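(* Let $\mu>\pi/2$, let $c_0>-1$, and let $\nu=\pi/(2\mu)$. For $\ell,j\in\mathbb{Z}$, $\ell\ge 0$, let $$H_{\ell,j}(z_1,z_2)=E_{c_0+\nu\ell+i(j+1)/2}(z_1,z_2)\,z_2^j .$$ Then $\{H_{\ell,j}\}_{\ell,j\in\mathbb{Z},\,\ell\ge 0}$ is a complete set in $A^2(\mathcal{W}'_\mu)$.
   Context: For $\mu>0$, the truncated worm domain is $$\mathcal{W}'_\mu=\big\{(z_1,z_2)\in\mathbb{C}^2:\ z_2\neq 0,\ \big|z_1-e^{i\log|z_2|^2}\big|^2<1,\ \big|\log|z_2|^2\big|<\mu\big\}.$$ $A^2(\mathcal{W}'_\mu)$ is the Bergman space of holomorphic functions on $\mathcal{W}'_\mu$ that are square integrable with respect to Lebesgue measure, with the $L^2$ inner product. For $\eta\in\mathbb{C}$, $E_\eta$ is the holomorphic function on $\mathcal{W}'_\mu$ given by $$E_\eta(z)=e^{\eta L(z)},\qquad L(z)=\log\big(z_1e^{-i\log|z_2|^2}\big)+i\log|z_2|^2,$$ where $\log$ of a complex number denotes the principal branch (on $\mathcal{W}'_\mu$ the number $z_1e^{-i\log|z_2|^2}$ lies in the disk $\{|\zeta-1|<1\}$). A subset of a Hilbert space is complete if its linear span is dense; equivalently, if $0$ is the only vector orthogonal to all its elements. *)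

(* Defs.v *)
From HB Require Import structures.
From mathcomp Require Import all_boot all_order all_algebra complex.
From mathcomp Require Import all_classical all_reals all_analysis.

Set Implicit Arguments.
Unset Strict Implicit.
Unset Printing Implicit Defensive.

Import Order.TTheory GRing.Theory Num.Theory numFieldNormedType.Exports.
Import ComplexField.Normc.

Local Open Scope classical_set_scope.
Local Open Scope ring_scope.
Local Open Scope complex_scope.

Section complex_exp_log.
Context {R : realType}.
Implicit Type z : R[i].

Definition cexp z : R[i] :=
  (expR (complex.Re z) * cos (complex.Im z)) +i*
  (expR (complex.Re z) * sin (complex.Im z)).

(* For z != 0 this is the argument in ]-pi, pi]; the value at 0 is irrelevant. *)
Definition carg z : R :=
  let theta := acos (complex.Re z / normc z) in
  if 0 <= complex.Im z then theta else - theta.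

Definition clog z : R[i] := ln (normc z) +i* carg z.

End complex_exp_log.

Section lebesgue_measure_C2.
Context {R : realType}.

Definition lebesgue2 : set (measurableTypeR R * measurableTypeR R) -> \bar R :=
  (@lebesgue_measure R \x @lebesgue_measure R)%E.

HB.instance Definition _ := Measure.on lebesgue2.

(* Needed to form the product lebesgue2 \x lebesgue2: the library's
   sigma-finiteness instance for products is shadowed by its instance for
   products of subprobabilities. *)
Let lebesgue2_sigma_finite : sigma_finite setT lebesgue2.
Proof.
have /sigma_finiteP[F [TF ndF Foo]] := sigma_finiteT (@lebesgue_measure R).
exists (fun n => F n `*` F n) => [|k].
  rewrite -setXTT {1}TF {1}TF predeqE => -[x y].
  split => [[/= [n _ Fnx] [k _ Fky]]|].
    exists (maxn n k) => //; split.
    - by move: x Fnx; exact/subsetPset/ndF/leq_maxl.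
    - by move: y Fky; exact/subsetPset/ndF/leq_maxr.
  by move=> [n _ [/= ? ?]]; split; exists n.
have [? ?] := Foo k; split; first exact: measurableX.
rewrite /lebesgue2 product_measure1E//.
by rewrite lte_mul_pinfty// ge0_fin_numE.
Qed.

HB.instance Definition _ :=
  Measure_isSigmaFinite.Build _ _ _ lebesgue2 lebesgue2_sigma_finite.

(* Lebesgue measure on C^2, in the real coordinates ((x1, y1), (x2, y2)). *)
Definition lebesgueC2 :
    {measure set ((measurableTypeR R * measurableTypeR R) *
                  (measurableTypeR R * measurableTypeR R)) -> \bar R} :=
  (lebesgue2 \x lebesgue2)%E.

Definition toC2 (p : (R * R) * (R * R)) : R[i]^o * R[i]^o :=
  (p.1.1 +i* p.1.2, p.2.1 +i* p.2.2).

End lebesgue_measure_C2.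

Section linear_span.
Context {K : pzRingType} {V : lmodType K}.

Definition lin_span (S : set V) : set V :=
  [set v | exists (n : nat) (c : 'I_n -> K) (s : 'I_n -> V),
     (forall k, S (s k)) /\ v = \sum_(k < n) c k *: s k].

End linear_span.

(* Elements of A^2(D) are represented by functions defined on all of C^2, of
   which only the values on D matter. *)
Section bergman_space.
Context {R : realType}.
Implicit Types (D : set (R[i]^o * R[i]^o)) (f g : R[i]^o * R[i]^o -> R[i]^o).

(* The scalars of the normed modules are R[i], so [differentiable] is Frechet
   differentiability with a C-linear differential. *)
Definition holomorphic_on D f : Prop :=
  forall z, D z -> differentiable f z.

Definition square_integrable_on D f : Prop :=
  lebesgueC2.-integrable (toC2 @^-1` D)
    (fun p => (normc (f (toC2 p)) ^+ 2)%:E).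

Definition bergman D : set (R[i]^o * R[i]^o -> R[i]^o) :=
  [set f | holomorphic_on D f /\ square_integrable_on D f].

Definition L2inner D f g : R[i] :=
  let h p := f (toC2 p) * conjc (g (toC2 p)) in
  (\int[lebesgueC2]_(p in toC2 @^-1` D) complex.Re (h p)) +i*
  (\int[lebesgueC2]_(p in toC2 @^-1` D) complex.Im (h p)).

Definition L2norm D f : R := Num.sqrt (complex.Re (L2inner D f f)).

Definition complete_in_bergman D (S : set (R[i]^o * R[i]^o -> R[i]^o)) : Prop :=
  S `<=` bergman D /\
  forall f, bergman D f -> forall eps : R, 0 < eps ->
    exists2 g, lin_span S g & L2norm D (f - g) < eps.

End bergman_space.

Section worm.
Context {R : realType}.
Implicit Types (z : R[i]^o * R[i]^o).

Definition log_sqnorm (w : R[i]) : R := ln (normc w ^+ 2).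

Definition truncated_worm (mu : R) : set (R[i]^o * R[i]^o) :=
  [set z | [/\ z.2 != 0,
    normc (z.1 - cexp (0 +i* log_sqnorm z.2)) ^+ 2 < 1 &
    `|log_sqnorm z.2| < mu]].

Definition worm_L z : R[i] :=
  clog (z.1 * cexp (0 -i* log_sqnorm z.2)) + (0 +i* log_sqnorm z.2).

Definition worm_E (eta : R[i]) z : R[i]^o := cexp (eta * worm_L z).

Definition worm_H (c0 nu : R) (l : nat) (j : int) z : R[i]^o :=
  worm_E ((c0 + nu * l%:R) +i* ((j + 1)%:~R / 2)) z * z.2 ^ j.

End worm.

(* Main.v *)
(* With w = L(z) one has z_1 = e^w, and L maps the domain onto a convex set Om;
   H_{l,j} becomes e^{(c + nu l) w} z_2^j with c = c0 + i (j + 1) / 2.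

   Contracting z_1, damping f as Re w -> -oo and averaging over rotations of
   z_2 against a positive trigonometric kernel approximates f in L^2 by finite
   sums of functions F(w) z_2^j, where F is holomorphic on a neighbourhood of Om
   and decays exponentially as Re w -> -oo.

   Such an F is recovered by Cauchy's formula with the kernel
   nu e^{c (w - u)} / (1 - q), q = e^{nu (w - u)}, integrated over a contour
   around Om. The kernel has period 4 i mu in w, while Om has height at most
   2 mu + pi; as mu > pi / 2, its only pole in Om is u itself. For u on the
   contour q stays away from [1, +oo[, so pushing the pole 1 to infinity
   approximates 1 / (1 - q) uniformly by polynomials in q, and the integral by
   linear combinations of the e^{(c + nu l) w}. *)
Require Import Defs.
From HB Require Import structures.
From mathcomp Require Import all_boot all_order all_algebra complex.
From mathcomp Require Import all_classical all_reals all_analysis.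
From mathcomp Require Import measurable_realfun ring lra.

Set Implicit Arguments.
Unset Strict Implicit.
Unset Printing Implicit Defensive.

Import Order.TTheory GRing.Theory Num.Theory numFieldNormedType.Exports.
Import ComplexField.Normc.

Local Open Scope classical_set_scope.
Local Open Scope ring_scope.
Local Open Scope complex_scope.

(** * Complex numbers *)

(* [lra] spends most of its time on hypotheses that it cannot use. *)
Ltac is_real x :=
  match goal with R : Real.type |- _ => let A := type of x in unify A (Real.sort R) end.

Ltac keep_real :=
  repeat match goal with
  | H : ?T |- _ => lazymatch type of T with
    | Prop => lazymatch T with
      | is_true (@Order.le _ _ ?x _) => tryif is_real x then fail else clear H
      | is_true (@Order.lt _ _ ?x _) => tryif is_real x then fail else clear H
      | is_true (andb _ _) => fail
      | @eq _ ?x _ => tryif is_real x then fail else clear H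
      | _ => clear H
      end
    end
  end; repeat match goal with x := _ |- _ => clearbody x end.

Ltac rlra := keep_real; lra.
Ltac rnra := keep_real; nra.

(** The left end Re w -> -oo shapes the proof. At a point u of the contour the distance to Om is of
    order e^{Re u}, so the kernel may grow like e^{- Re u}, and so does the speed of the boundary
    parametrization. A bound |F| <= C e^{p Re w} with p >= Re c + 2 absorbs both factors, uniformly
    up to the left end. What remains is the majorant |e^{c w}|, square integrable because c0 > -1,
    and dominated convergence takes pointwise limits of exponential sums to L^2 limits. A Bergman
    function is only bounded there by a power of e^{- Re w}, by Cauchy's formula on squares adapted
    to the distance to the boundary. Hence the damping, by a high power of a bounded function that
    vanishes at the left end, and the contraction, which leaves a margin around the points where the
    Fourier coefficients are evaluated. Contractions and averages converge in L^2 because they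
    converge pointwise and increase norms by factors tending to 1. Convexity of Om yields Cauchy's
    formula on the curved contour: the contour is shrunk to the pole by homotheties. *)

Section complex_norm.
Context {R : realType}.
Implicit Types (u v z : R[i]) (x y : R).

Lemma normc_ge0 z : 0 <= normc z.
Proof. by case: z => a b; exact: sqrtr_ge0. Qed.

Lemma normc_eq0 z : (normc z == 0) = (z == 0).
Proof. by apply/eqP/eqP => [/eq0_normc//|->]; rewrite normc0. Qed.

Lemma normc_gt0 z : (0 < normc z) = (z != 0).
Proof. by rewrite lt_neqAle normc_ge0 andbT eq_sym normc_eq0. Qed.

Lemma normcE z : normc z ^+ 2 = complex.Re z ^+ 2 + complex.Im z ^+ 2.
Proof. by case: z => a b /=; rewrite sqr_sqrtr// addr_ge0 ?sqr_ge0. Qed.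

Lemma normc_real x : normc x%:C = `|x|.
Proof. by rewrite /= expr0n/= addr0 sqrtr_sqr. Qed.

Lemma normc_realB x y : normc (x%:C - y%:C) = `|x - y|.
Proof. by rewrite -rmorphB normc_real. Qed.

Lemma normcB_sym u v : normc (u - v) = normc (v - u).
Proof. by rewrite -normcN opprB. Qed.

Lemma le_normcB u v : normc (u - v) <= normc u + normc v.
Proof. by rewrite (le_trans (le_normcD _ _))// normcN. Qed.

Lemma le_normc_sub u v : normc u - normc v <= normc (u - v).
Proof. by rewrite lerBlDr (le_trans _ (le_normcD _ _))// subrK. Qed.

Lemma le_dist_normc u v : `|normc u - normc v| <= normc (u - v).
Proof.
by rewrite ler_norml le_normc_sub andbT lerNl opprB normcB_sym le_normc_sub.
Qed.

Lemma normc_distD u v w : normc (u - w) <= normc (u - v) + normc (v - w).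
Proof. by rewrite (le_trans _ (le_normcD _ _))// addrA subrK. Qed.

Lemma le_Re_normc z : `|complex.Re z| <= normc z.
Proof.
by case: z => a b /=; rewrite -sqrtr_sqr ler_wsqrtr// lerDl sqr_ge0.
Qed.

Lemma le_Im_normc z : `|complex.Im z| <= normc z.
Proof.
by case: z => a b /=; rewrite -sqrtr_sqr ler_wsqrtr// lerDr sqr_ge0.
Qed.

Lemma normc_le_ReIm z : normc z <= `|complex.Re z| + `|complex.Im z|.
Proof.
rewrite -(@ler_pXn2r _ 2) ?nnegrE ?normc_ge0 ?addr_ge0// normcE sqrrD.
by rewrite !real_normK ?num_real// lerD2r lerDl mulrn_wge0// mulr_ge0.
Qed.

Lemma normcX z n : normc (z ^+ n) = normc z ^+ n.
Proof. by elim: n => [|n ih]; rewrite ?expr0 ?normc1// !exprS normcM ih. Qed.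

Lemma normcJ z : normc (conjc z) = normc z.
Proof. by case: z => a b /=; rewrite sqrrN. Qed.

Lemma cReD u v : complex.Re (u + v) = complex.Re u + complex.Re v.
Proof. by case: u v => ? ? []. Qed.
Lemma cImD u v : complex.Im (u + v) = complex.Im u + complex.Im v.
Proof. by case: u v => ? ? []. Qed.
Lemma cReN u : complex.Re (- u) = - complex.Re u.
Proof. by case: u. Qed.
Lemma cImN u : complex.Im (- u) = - complex.Im u.
Proof. by case: u. Qed.
Lemma cReB u v : complex.Re (u - v) = complex.Re u - complex.Re v.
Proof. by rewrite cReD cReN. Qed.
Lemma cImB u v : complex.Im (u - v) = complex.Im u - complex.Im v.
Proof. by rewrite cImD cImN. Qed.
Lemma cReM u v : complex.Re (u * v) =
  complex.Re u * complex.Re v - complex.Im u * complex.Im v.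
Proof. by case: u v => ? ? []. Qed.
Lemma cImM u v : complex.Im (u * v) =
  complex.Re u * complex.Im v + complex.Im u * complex.Re v.
Proof. by case: u v => ? ? []. Qed.
Definition ReImE := (cReD, cImD, cReN, cImN, cReM, cImM).

Lemma complex_eqP u v :
  complex.Re u = complex.Re v -> complex.Im u = complex.Im v -> u = v.
Proof. by case: u v => ? ? [? ?] /= -> ->. Qed.

Lemma complexRI z : z = complex.Re z +i* complex.Im z.
Proof. by case: z. Qed.

Lemma normc_lt_sqr z x : 0 <= x -> (normc z < x) = (normc z ^+ 2 < x ^+ 2).
Proof. by move=> x0; rewrite ltr_pXn2r// ?nnegrE ?normc_ge0. Qed.

Lemma conjcM_normc z : z * conjc z = (normc z ^+ 2)%:C.
Proof.
rewrite normcE; apply: complex_eqP; rewrite ?ReImE; case: z => a b /=; ring.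
Qed.

End complex_norm.

(** * The complex exponential and its first-order Taylor bound *)

Section complex_exp.
Context {R : realType}.
Implicit Types (u v z : R[i]) (x y : R).

Lemma cexpD u v : cexp (u + v) = cexp u * cexp v.
Proof.
case: u v => a b [c d]; apply: complex_eqP => /=.
  by rewrite expRD cosD; ring.
by rewrite expRD sinD; ring.
Qed.

Lemma cexp0 : cexp 0 = 1 :> R[i].
Proof. by apply: complex_eqP => /=; rewrite ?expR0 ?cos0 ?sin0 ?mul1r. Qed.

Lemma normc_cexp z : normc (cexp z) = expR (complex.Re z).
Proof.
rewrite /cexp/= !exprMn -mulrDr cos2Dsin2 mulr1 sqrtr_sqr ger0_norm//.
Qed.

Lemma cexp_neq0 z : cexp z != 0.
Proof. by rewrite -normc_gt0 normc_cexp expR_gt0. Qed.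

Lemma cexpN z : cexp (- z) = (cexp z)^-1.
Proof.
by apply: (mulIf (cexp_neq0 z)); rewrite mulVf ?cexp_neq0// -cexpD addNr cexp0.
Qed.

Lemma cexpB u v : cexp (u - v) = cexp u / cexp v.
Proof. by rewrite cexpD cexpN. Qed.

Lemma cexpMn n z : cexp (n%:R * z) = cexp z ^+ n.
Proof.
elim: n => [|n ih]; first by rewrite mul0r cexp0 expr0.
by rewrite -addn1 natrD mulrDl mul1r cexpD ih addn1 exprSr.
Qed.

Lemma cexpMz (j : int) z : cexp (j%:~R * z) = cexp z ^ j.
Proof.
case: j => n; first exact: cexpMn.
by rewrite NegzE mulrNz mulNr cexpN; congr (_ ^-1); exact: cexpMn.
Qed.

(** Everything follows from 1 + y <= e^y: y = x gives the sign, and y = - x gives e^x <= 1 / (1 -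
    x), where 1 / (1 - x) - 1 - x = x^2 / (1 - x). *)
Lemma expR_taylor1 x : x <= 2^-1 -> `|expR x - 1 - x| <= 2 * x ^+ 2.
Proof.
move=> x2; have h1 := expR_ge1Dx x; have h2 := expR_ge1Dx (- x).
rewrite expRN in h2.
have e0 := expR_gt0 x.
have h3 : (1 - x) * expR x <= 1.
  by rewrite -ler_pdivlMr// mul1r.
rewrite ger0_norm; last by lra.
nra.
Qed.

Lemma sin_le x : `|sin x| <= `|x|.
Proof.
suff h y : 0 < y -> `|sin y| <= y.
  have [->|x0] := eqVneq x 0; first by rewrite sin0.
  have := h `|x|; rewrite normr_gt0 => /(_ x0).
  by case: (ger0P x) => // _; rewrite sinN normrN.
move=> y0.
have [|c _] := @MVT R sin cos 0 y y0.
  by apply: continuous_subspaceT => z; exact: continuous_sin.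
rewrite sin0 !subr0 => ->.
by rewrite normrM (gtr0_norm y0) ler_piMl ?cos_max// ltW.
Qed.

Lemma cos_taylor1 x : `|cos x - 1| <= x ^+ 2 / 2.
Proof.
have -> : cos x - 1 = - (2 * sin (x / 2) ^+ 2).
  have {1}-> : x = (x / 2) *+ 2 by rewrite -mulr_natr; lra.
  rewrite cos_mulr2n cos2sin2 -mulr_natr; lra.
rewrite normrN ger0_norm; last by have := sqr_ge0 (sin (x / 2)); lra.
have := sin_le (x / 2); rewrite -(@ler_pXn2r _ 2)// ?nnegrE//.
rewrite !real_normK ?num_real//; nra.
Qed.

Lemma sin_taylor1 x : `|x| <= 1 -> `|sin x - x| <= x ^+ 2.
Proof.
suff h y : 0 < y -> y <= 1 -> `|sin y - y| <= y ^+ 2.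
  move=> x1; have [->|x0] := eqVneq x 0; first by rewrite sin0 subr0 normr0 expr0n.
  have := h `|x|; rewrite normr_gt0 => /(_ x0 x1).
  by case: (ger0P x) => // _; rewrite sinN sqrrN -opprD normrN.
move=> y0 y1.
have [|c cy] := @MVT R sin cos 0 y y0.
  by apply: continuous_subspaceT => z; exact: continuous_sin.
rewrite sin0 !subr0 => ->.
rewrite -[X in _ - X]mul1r -mulrBl normrM (gtr0_norm y0).
have := cos_taylor1 c; move: cy; rewrite in_itv/= => /andP[c0 cy] h.
rewrite expr2 ler_pM2r//; nra.
Qed.

Lemma cexp_taylor1 z : normc z <= 2^-1 -> normc (cexp z - 1 - z) <= 9 * normc z ^+ 2.
Proof.
move=> z2; rewrite normcE.
have := le_trans (le_Re_normc z) z2; have := le_trans (le_Im_normc z) z2.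
case: z z2 => x y z2; rewrite !ler_norml /= => /andP[y1 y2] /andP[x1 x2].
rewrite -[Num.sqrt _]/(normc ((expR x * cos y - 1 - x) +i* (expR x * sin y - 0 - y))).
apply: (le_trans (normc_le_ReIm _)); rewrite /cexp /=.
have hx := expR_taylor1 x2.
have hc := cos_taylor1 y.
have hs : `|sin y - y| <= y ^+ 2 by apply: sin_taylor1; rewrite ler_norml; lra.
have hsy := sin_le y.
have e2 : expR x <= 2.
  move: hx; rewrite ler_norml => /andP[_]; nra.
have e0 := expR_gt0 x.
have -> : expR x * cos y - 1 - x = expR x * (cos y - 1) + (expR x - 1 - x) by ring.
have -> : expR x * sin y - 0 - y = (expR x - 1 - x) * sin y + x * sin y + (sin y - y) by ring.
have a1 : `|expR x * (cos y - 1)| <= y ^+ 2.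
  rewrite normrM (gtr0_norm e0); have := normr_ge0 (cos y - 1); nra.
have a2 : `|(expR x - 1 - x) * sin y| <= 2 * x ^+ 2.
  rewrite normrM; have := sin_max y; have := normr_ge0 (sin y).
  have := normr_ge0 (expR x - 1 - x); rnra.
have a3 : `|x * sin y| <= x ^+ 2 + y ^+ 2.
  rewrite normrM; apply: (@le_trans _ _ (`|x| * `|y|)); first by rewrite ler_wpM2l.
  have := real_normK (num_real x); have := real_normK (num_real y) => <- <-.
  have := sqr_ge0 (`|x| - `|y|); have := normr_ge0 x; have := normr_ge0 y; rnra.
have b1 := ler_normD (expR x * (cos y - 1)) (expR x - 1 - x).
have b2 := ler_normD ((expR x - 1 - x) * sin y + x * sin y) (sin y - y).
have b3 := ler_normD ((expR x - 1 - x) * sin y) (x * sin y).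
have := sqr_ge0 x; have := sqr_ge0 y; rlra.
Qed.

End complex_exp.

Lemma le_quarter (R : realType) (n a b c d : R) : 4 * a < n -> 4 * b < n -> 4 * c < n ->
  n <= a + b + (c + d) -> n <= 4 * d.
Proof. lra. Qed.

Lemma itv_sub (R : realType) (a b c d x : R) : a <= c -> d <= b -> c <= x <= d -> a <= x <= b.
Proof. by move=> ac db /andP[cx xd]; rewrite (le_trans ac)//= (le_trans xd). Qed.

Lemma dist_itv (R : realType) (a b x y : R) : a <= x <= b -> a <= y <= b -> `|x - y| <= b - a.
Proof. by move=> /andP[? ?] /andP[? ?]; rewrite ler_norml; apply/andP; split; lra. Qed.

Lemma normc_contour_le (R : realType) (u v w z : R[i]) (a b c d : R) :
  normc u <= a -> normc v <= b -> normc w <= c -> normc z <= d ->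
  normc (u + w - z - v) <= a + c + d + b.
Proof.
move=> hu hv hw hz; apply: (le_trans (le_normcB _ _)); apply: lerD => //.
apply: (le_trans (le_normcB _ _)); apply: lerD => //.
by apply: (le_trans (le_normcD _ _)); exact: lerD.
Qed.

(** * Real and complex differentiation *)

Section eps_continuity.
Context {R : realType} {T : Type}.
Variable ds : T -> T -> R.
Implicit Types (D : set T) (g h : T -> R[i]) (x : T).

(** Continuity of the restriction of [g] to [D]. The same rules serve curves, functions of a complex
    variable and functions on C^2, so [ds] is an arbitrary function and the facts about it are asked
    for where they are used. *)
Definition cnt D g x := forall e : R, 0 < e -> exists2 d : R, 0 < d &
  forall y, D y -> ds y x < d -> normc (g y - g x) < e.

Lemma cnt_cst D (a : R[i]) x : cnt D (fun=> a) x.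
Proof. by move=> e e0; exists 1 => // y _ _; rewrite subrr normc0. Qed.

Lemma cntD D g h x : cnt D g x -> cnt D h x -> cnt D (fun y => g y + h y) x.
Proof.
move=> cg ch e e0; have e2 : 0 < e / 2 by rewrite divr_gt0.
have [d1 d10 H1] := cg _ e2; have [d2 d20 H2] := ch _ e2.
exists (Num.min d1 d2) => [|y Dy]; first by rewrite lt_min d10.
rewrite lt_min => /andP[y1 y2].
rewrite opprD addrACA (le_lt_trans (le_normcD _ _))// [e]splitr ltrD//.
  exact: H1.
exact: H2.
Qed.

Lemma cntN D g x : cnt D g x -> cnt D (fun y => - g y) x.
Proof.
move=> cg e /cg[d d0 H]; exists d => // y Dy yd.
by rewrite -opprD normcN; exact: H.
Qed.

Lemma cntB D g h x : cnt D g x -> cnt D h x -> cnt D (fun y => g y - h y) x.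
Proof. by move=> cg ch; apply: cntD => //; exact: cntN. Qed.

Lemma cntM D g h x : cnt D g x -> cnt D h x -> cnt D (fun y => g y * h y) x.
Proof.
move=> cg ch e e0.
have hx0 : 0 < 2 * (normc (h x) + 1) by have := normc_ge0 (h x); lra.
have gx0 : 0 < 2 * (normc (g x) + 1) by have := normc_ge0 (g x); lra.
have [d1 d10 H1] := cg _ (divr_gt0 e0 hx0).
have [d2 d20 H2] := ch _ (divr_gt0 e0 gx0).
have [d3 d30 H3] := ch _ ltr01.
exists (Num.min d1 (Num.min d2 d3)) => [|y Dy]; first by rewrite !lt_min d10 d20.
rewrite !lt_min => /and3P[y1 y2 y3].
have -> : g y * h y - g x * h x = (g y - g x) * h y + g x * (h y - h x) by ring.
rewrite (le_lt_trans (le_normcD _ _))// !normcM [e]splitr ltr_leD//.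
  have h1 := H1 _ Dy y1; have h3 := H3 _ Dy y3.
  have hy : normc (h y) < normc (h x) + 1.
    by have := le_normc_sub (h y) (h x); lra.
  rewrite ltr_pdivlMr// in h1.
  have := normc_ge0 (h y); have := normc_ge0 (g y - g x); nra.
have /ltW h2 := H2 _ Dy y2; rewrite ler_pdivlMr// in h2.
by have := normc_ge0 (g x); have := normc_ge0 (h y - h x); nra.
Qed.

Lemma cntV D g x : g x != 0 -> cnt D g x -> cnt D (fun y => (g y)^-1) x.
Proof.
move=> gx0 cg e e0; have n0 : 0 < normc (g x) by rewrite normc_gt0.
have [d1 d10 H1] := cg _ (divr_gt0 n0 (ltr0n _ 2)).
have [|d2 d20 H2] := cg (e * normc (g x) ^+ 2 / 2).
  by rewrite divr_gt0// mulr_gt0// exprn_gt0.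
exists (Num.min d1 d2) => [|y Dy]; first by rewrite lt_min d10.
rewrite lt_min => /andP[y1 y2].
have h1 := H1 _ Dy y1; have h2 := H2 _ Dy y2.
have hy : normc (g x) / 2 < normc (g y).
  have := le_normc_sub (g x) (g y); rewrite normcB_sym in h1; lra.
have gy0 : g y != 0 by rewrite -normc_gt0; lra.
have -> : (g y)^-1 - (g x)^-1 = (g x - g y) / (g y * g x) by field; apply/andP.
rewrite normcM normcV normcM normcB_sym ltr_pdivrMr; last by rewrite mulr_gt0; rlra.
apply: (lt_le_trans h2); rewrite -!mulrA ler_pM2l//; nra.
Qed.

Lemma cntX D g n x : cnt D g x -> cnt D (fun y => g y ^+ n) x.
Proof.
move=> cg; elim: n => [|n ih].
  by rewrite (_ : (fun _ => _) = cst 1); [exact: cnt_cst|apply/funext => y; rewrite expr0].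
rewrite (_ : (fun _ => _) = (fun y => g y * g y ^+ n)); first exact: cntM.
by apply/funext => y; rewrite exprS.
Qed.

Lemma cnt_sub D D' g x : D' `<=` D -> cnt D g x -> cnt D' g x.
Proof. by move=> DD cg e /cg[d d0 H]; exists d => // y /DD Dy; exact: H. Qed.

Lemma cnt_near D g h x : D x -> ds x x = 0 -> cnt D g x ->
  (exists2 d : R, 0 < d & forall y, D y -> ds y x < d -> g y = h y) -> cnt D h x.
Proof.
move=> Dx dxx cg [d d0 H] e /cg[d' d'0 H'].
exists (Num.min d d') => [|y Dy]; first by rewrite lt_min d0.
rewrite lt_min => /andP[y1 y2]; rewrite -(H _ Dy y1) -(H x)// ?dxx//; exact: H'.
Qed.

End eps_continuity.

Lemma cnt_comp {R : realType} {S T : Type} (dS : S -> S -> R) (dT : T -> T -> R)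
    (D : set S) (E : set T) (g : T -> R[i]) (h : S -> T) x :
  (forall y, D y -> E (h y)) ->
  (forall e : R, 0 < e -> exists2 d : R, 0 < d &
     forall y, D y -> dS y x < d -> dT (h y) (h x) < e) ->
  cnt dT E g (h x) -> cnt dS D (fun y => g (h y)) x.
Proof.
move=> DE ch cg e /cg[d d0 H]; have [d' d'0 H'] := ch _ d0.
by exists d' => // y Dy yd; apply: H; [exact: DE|exact: H'].
Qed.

Definition dC {R : realType} (u v : R[i]) : R := normc (u - v).
Definition dR {R : realType} (x y : R) : R := `|x - y|.

Section derivative.
Context {R : realType} {T : Type}.
Variable io : T -> R[i].
Implicit Types (g h : T -> R[i]) (x : T).

Definition dio (x y : T) : R := normc (io x - io y).

(* With [io] the identity of [R[i]] this is complex differentiability, with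
   [io] the embedding of [R] differentiability of a curve. *)
Definition der g x (a : R[i]) := forall e : R, 0 < e -> exists2 d : R, 0 < d &
  forall y, normc (io y - io x) < d ->
    normc (g y - g x - a * (io y - io x)) <= e * normc (io y - io x).

(* Caratheodory's criterion: the rules for derivatives become algebra. *)
Lemma derP g x a : der g x a <-> exists q : T -> R[i],
  [/\ forall y, g y = g x + q y * (io y - io x), cnt dio setT q x & q x = a].
Proof.
split=> [dg|[q [gq cq qx]] e e0].
  exists (fun y => if io y == io x then a else (g y - g x) / (io y - io x)); split.
  - move=> y; case: eqVneq => [yx|yx].
      have [d d0 /(_ y)] := dg 1 ltr01.
      rewrite yx subrr normc0 => /(_ d0); rewrite !mulr0 subr0 => h.
      have /eqP : normc (g y - g x) = 0 by apply/eqP; rewrite eq_le h normc_ge0.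
      by rewrite normc_eq0 subr_eq0 => /eqP ->; rewrite addr0.
    by rewrite divfK ?subr_eq0// addrC subrK.
  - move=> e e0; have e2 : 0 < e / 2 by rewrite divr_gt0.
    have [d d0 H] := dg _ e2; exists d => // y _ yd; rewrite eqxx.
    case: eqVneq => [yx|yx]; first by rewrite subrr normc0.
    have n0 : io y - io x != 0 by rewrite subr_eq0.
    have p0 : 0 < normc (io y - io x) by rewrite normc_gt0.
    have -> : (g y - g x) / (io y - io x) - a = (g y - g x - a * (io y - io x)) / (io y - io x).
      by field.
    rewrite normcM normcV ltr_pdivrMr//; have := H _ yd; nra.
  - by rewrite eqxx.
have [d d0 H] := cq _ e0; exists d => // y yd.
rewrite gq (addrC (g x)) addrK -qx -mulrBl normcM ler_wpM2r ?normc_ge0//.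
exact/ltW/H.
Qed.

Lemma der_cnt g x a : der g x a -> cnt dio setT g x.
Proof.
move=> /derP[q [gq cq _]]; rewrite (funext gq).
apply: cntD; first exact: cnt_cst.
by apply: cntM => // e e0; exists e => // y _; rewrite opprB addrA subrK.
Qed.

Lemma der_cst (a : R[i]) x : der (fun=> a) x 0.
Proof. by move=> e e0; exists 1 => // y _; rewrite subrr mul0r subrr normc0 mulr_ge0 ?normc_ge0// ltW. Qed.

Lemma der_io x : der io x 1.
Proof. by move=> e e0; exists 1 => // y _; rewrite mul1r subrr normc0 mulr_ge0 ?normc_ge0// ltW. Qed.

Lemma derD g h x a b : der g x a -> der h x b -> der (fun y => g y + h y) x (a + b).
Proof.
move=> /derP[q [gq cq <-]] /derP[r [hr cr <-]]; apply/derP.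
exists (fun y => q y + r y); split => // [y|]; last exact: cntD.
by rewrite gq hr; ring.
Qed.

Lemma derM g h x a b : der g x a -> der h x b ->
  der (fun y => g y * h y) x (a * h x + g x * b).
Proof.
move=> dg dh; have cg := der_cnt dg; have ch := der_cnt dh.
move: dg dh => /derP[q [gq cq <-]] /derP[r [hr cr <-]]; apply/derP.
exists (fun y => q y * h y + g x * r y); split => // [y|].
  by rewrite gq hr; ring.
by apply: cntD; apply: cntM => //; exact: cnt_cst.
Qed.

Lemma derZ g x a c : der g x a -> der (fun y => c * g y) x (c * a).
Proof. by move=> /(derM (der_cst c x)); rewrite mul0r add0r. Qed.

Lemma derN g x a : der g x a -> der (fun y => - g y) x (- a).
Proof.
move=> /(derZ (-1)); rewrite mulN1r; congr der.
by apply/funext => y; rewrite mulN1r.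
Qed.

Lemma derB g h x a b : der g x a -> der h x b -> der (fun y => g y - h y) x (a - b).
Proof. by move=> dg /derN; exact: derD. Qed.

Lemma derV g x a : g x != 0 -> der g x a -> der (fun y => (g y)^-1) x (- a / g x ^+ 2).
Proof.
move=> gx0 dg; have cg := der_cnt dg.
have ci := cntV gx0 cg.
move: dg => /derP[q [gq cq <-]].
(* Where [g] vanishes the inverse is 0 by convention and the explicit slope below breaks down. The
   values there are replaced by those of the tangent line, which changes nothing near [x]. *)
suff : der (fun y => if g y == 0 then (g x)^-1 - q x * (io y - io x) / g x ^+ 2 else (g y)^-1) x (- q x / g x ^+ 2).
  move=> H e e0; have [d d0 {}H] := H _ e0.
  have [|d' d'0 H'] := cg (normc (g x)); first by rewrite normc_gt0.
  exists (Num.min d d') => [|y]; first by rewrite lt_min d0.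
  rewrite lt_min => /andP[y1 y2]; have := H _ y1; rewrite (negbTE gx0).
  case: eqP => // gy0; have := H' _ I y2; by rewrite gy0 sub0r normcN ltxx.
apply/derP; exists (fun y => if g y == 0 then - q x / g x ^+ 2 else - q y * (g y)^-1 / g x); split.
- move=> y; rewrite (negbTE gx0); case: eqVneq => [gy|gy]; first by field.
  have gE := gq y.
  have -> : - q y / g y / g x * (io y - io x) = - (g y - g x) / g y / g x.
    have -> : g y - g x = q y * (io y - io x) by rewrite {1}gE addrC addKr.
    by field; apply/andP.
  by field; apply/andP.
- have : cnt dio setT (fun y => - q y * (g y)^-1 / g x) x.
    by apply: cntM; [apply: cntM => //; exact: cntN|exact: cnt_cst].
  move=> H; apply: (cnt_near _ _ H) => //; first by rewrite /dio subrr normc0.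
  have [|d' d'0 H'] := cg (normc (g x)); first by rewrite normc_gt0.
  exists d' => // y _ yd; case: eqP => // gy0; have := H' _ I yd.
  by rewrite gy0 sub0r normcN ltxx.
- by rewrite (negbTE gx0); field.
Qed.

Lemma derX g x a n : der g x a -> exists b, der (fun y => g y ^+ n) x b.
Proof.
move=> dg; elim: n => [|n [b ih]].
  by exists 0; rewrite (_ : (fun _ => _) = cst 1); [exact: der_cst|apply/funext => y; rewrite expr0].
exists (a * g x ^+ n + g x * b).
rewrite (_ : (fun _ => _) = (fun y => g y * g y ^+ n)); first exact: derM.
by apply/funext => y; rewrite exprS.
Qed.

Lemma der_near g h x a : der g x a ->
  (exists2 d : R, 0 < d & forall y, dio y x < d -> g y = h y) -> der h x a.
Proof.
move=> dg [d d0 H] e /dg[d' d'0 H'].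
exists (Num.min d d') => [|y]; first by rewrite lt_min d0.
rewrite lt_min => /andP[y1 y2]; rewrite -(H _ y1) -(H x); first exact: H'.
by rewrite /dio subrr normc0.
Qed.

End derivative.

Notation cder := (der id).
Notation rder := (der (real_complex _)).

Lemma dio_real {R : realType} : dio (real_complex R) = dR.
Proof. by apply/funext => x; apply/funext => y; rewrite /dio -rmorphB normc_real. Qed.

Lemma der_comp {R : realType} {T : Type} (io : T -> R[i]) (g : R[i] -> R[i])
    (h : T -> R[i]) x a b : der io h x a -> cder g (h x) b ->
  der io (fun y => g (h y)) x (b * a).
Proof.
move=> dh; have ch := der_cnt dh.
move: dh => /derP[q [hq cq <-]] /derP[r [gr cr <-]]; apply/derP.
exists (fun y => r (h y) * q y); split => // [y|].
  by rewrite (gr (h y)) -mulrA -[q y * _](addrK (h x)) (addrC (q y * _)) -hq.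
apply: cntM => //.
by apply: (@cnt_comp _ _ _ _ (dio id) _ setT) => // e /ch[d d0 H]; exists d.
Qed.

Lemma cder_cexp {R : realType} (z : R[i]) : cder cexp z (cexp z).
Proof.
move=> e e0; have n0 : 0 < normc (cexp z) by rewrite normc_gt0 cexp_neq0.
exists (Num.min 2^-1 (e / (9 * normc (cexp z)))) => [|y].
  by rewrite lt_min invr_gt0 ltr0n/= divr_gt0// mulr_gt0.
rewrite lt_min => /andP[/ltW y1 y2].
have -> : cexp y - cexp z - cexp z * (y - z) = cexp z * (cexp (y - z) - 1 - (y - z)).
  by rewrite cexpB; field; exact: cexp_neq0.
rewrite normcM.
apply: (@le_trans _ _ (normc (cexp z) * (9 * normc (y - z) ^+ 2))).
  by rewrite ler_wpM2l ?normc_ge0// cexp_taylor1.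
rewrite ltr_pdivlMr ?mulr_gt0// in y2.
have := normc_ge0 (y - z); rewrite expr2; nra.
Qed.

Section curves.
Context {R : realType}.
Implicit Types (h k : R -> R) (x : R).

Lemma rder_is_derive (g : R -> R[i]) x a : rder g x a ->
  is_derive x 1 (fun t => complex.Re (g t)) (complex.Re a) /\
  is_derive x 1 (fun t => complex.Im (g t)) (complex.Im a).
Proof.
move=> dg.
suff H (P : R[i] -> R) : (forall z, `|P z| <= normc z) ->
    (forall u v, P (u - v) = P u - P v) -> (forall (u : R[i]) (y : R), P (u * y%:C) = P u * y) ->
    is_derive x 1 (fun t => P (g t)) (P a).
  split; apply: H => [z|u v|u y].
  - exact: le_Re_normc.
  - exact: cReB.
  - by rewrite cReM /= mulr0 subr0.
  - exact: le_Im_normc.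
  - exact: cImB.
  - by rewrite cImM /= mulr0 add0r.
move=> Ple PB PM.
have H : (fun h : R => h^-1 *: (P (g (h *: 1 + x)) - P (g x))) @ 0^' --> P a.
  apply/cvgrPdist_le => e e0; have [d d0 Hd] := dg _ e0.
  near=> t; have t0 : t != 0 by near: t; exact: nbhs_dnbhs_neq.
  have td : `|t| < d.
    near: t; apply: dnbhs0_lt => //.
  rewrite [_ *: 1]mulr1 -[_ *: _]/(t^-1 * _).
  have := Hd (t + x); rewrite normc_realB addrK => /(_ td).
  rewrite -rmorphB addrK => Ht.
  have -> : P a - t^-1 * (P (g (t + x)) - P (g x)) = - (P (g (t + x) - g x - a * t%:C) / t).
    by rewrite !PB PM; field.
  rewrite normrN normrM normfV ler_pdivrMr ?normr_gt0//.
  exact: (le_trans (Ple _)).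
split; first by apply/cvg_ex; exists (P a).
exact/cvg_lim.
Unshelve. all: by end_near.
Qed.

Lemma is_derive_rder h x d : is_derive x 1 h d -> rder (fun t => (h t)%:C) x d%:C.
Proof.
move=> [dh hd] e e0.
have H : (fun t : R => t^-1 *: (h (t *: 1 + x) - h x)) @ 0^' --> d.
  by rewrite -hd; exact: dh.
move/cvgrPdist_le : H => /(_ _ e0) /nbhs_ballP[dd dd0 H].
exists dd; first exact: dd0.
move=> y; rewrite normc_realB -!rmorphB -rmorphM -rmorphB normc_real => yx.
have [->|yx0] := eqVneq y x; first by rewrite !subrr mulr0 subrr normr0 mulr0.
have n0 : y - x != 0 by rewrite subr_eq0.
have := H (y - x); rewrite /ball/= sub0r normrN => /(_ yx n0).
rewrite [_ *: 1]mulr1 subrK -[_ *: _]/((y - x)^-1 * _).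
have -> : h y - h x - d * (y - x) = - ((d - (y - x)^-1 * (h y - h x)) * (y - x)) by field.
by rewrite normrN normrM => hh; rewrite ler_wpM2r.
Qed.

Lemma rder_pair h k x d d' : is_derive x 1 h d -> is_derive x 1 k d' ->
  rder (fun t => h t +i* k t) x (d +i* d').
Proof.
move=> /is_derive_rder dh /is_derive_rder /(derZ 'i) dk.
have := derD dh dk; rewrite (_ : d%:C + _ = d +i* d'); last first.
  by apply: complex_eqP; rewrite ?ReImE /=; ring.
congr der; apply/funext => t; apply: complex_eqP; rewrite ?ReImE /=; ring.
Qed.

Lemma rder_id x : rder (fun t => t%:C) x 1.
Proof. exact: der_io. Qed.

End curves.

(** * Integrals of complex-valued functions *)

Section complex_integral.
Context {R : realType}.
Implicit Types (a b m x : R) (g h : R -> R[i]).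
Local Notation mu := (@lebesgue_measure R).

Definition cint a b g : R[i] :=
  (\int[mu]_(x in `[a, b]) complex.Re (g x)) +i*
  (\int[mu]_(x in `[a, b]) complex.Im (g x)).

Definition ccon a b g := forall x, a <= x <= b -> cnt dR [set y | a <= y <= b] g x.

Lemma cnt_ccon a b g : (forall x, a <= x <= b -> cnt dR setT g x) -> ccon a b g.
Proof. by move=> H x /H; exact: cnt_sub. Qed.

Lemma ccon_sub a b a' b' g : a <= a' -> b' <= b -> ccon a b g -> ccon a' b' g.
Proof.
move=> aa bb H x /andP[ax xb].
apply: (@cnt_sub _ _ _ [set y | a <= y <= b]) => [y /= /andP[h1 h2]|].
  by apply/andP; split; lra.
by apply: H; apply/andP; split; lra.
Qed.

Lemma cconD a b g h : ccon a b g -> ccon a b h -> ccon a b (fun x => g x + h x).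
Proof. by move=> cg ch x xab; apply: cntD; [exact: cg|exact: ch]. Qed.
Lemma cconB a b g h : ccon a b g -> ccon a b h -> ccon a b (fun x => g x - h x).
Proof. by move=> cg ch x xab; apply: cntB; [exact: cg|exact: ch]. Qed.
Lemma cconM a b g h : ccon a b g -> ccon a b h -> ccon a b (fun x => g x * h x).
Proof. by move=> cg ch x xab; apply: cntM; [exact: cg|exact: ch]. Qed.
Lemma cconZ a b c g : ccon a b g -> ccon a b (fun x => c * g x).
Proof. by move=> cg; apply: cconM => // x _; exact: cnt_cst. Qed.

Lemma within_contP (D : set R) (f : R -> R) :
  (forall x, D x -> forall e, 0 < e -> exists2 d, 0 < d &
    forall y, D y -> `|y - x| < d -> `|f y - f x| < e) ->
  {within D, continuous f}.
Proof.
move=> H; apply/subspace_continuousP => x Dx; apply/cvgrPdist_lt => e e0.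
have [d d0 Hd] := H _ Dx _ e0.
rewrite near_withinE; apply/nbhs_ballP; exists d => //= y xy Dy.
by rewrite distrC; apply: Hd => //; rewrite distrC.
Qed.

Lemma ccon_Re a b g : ccon a b g -> {within `[a, b], continuous (fun x => complex.Re (g x))}.
Proof.
move=> cg; apply: within_contP => x /=; rewrite in_itv/= => xab e /(cg _ xab)[d d0 H].
exists d => // y /=; rewrite in_itv/= => yab yd.
by rewrite -cReB (le_lt_trans (le_Re_normc _))// H.
Qed.

Lemma ccon_Im a b g : ccon a b g -> {within `[a, b], continuous (fun x => complex.Im (g x))}.
Proof.
move=> cg; apply: within_contP => x /=; rewrite in_itv/= => xab e /(cg _ xab)[d d0 H].
exists d => // y /=; rewrite in_itv/= => yab yd.
by rewrite -cImB (le_lt_trans (le_Im_normc _))// H.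
Qed.

Lemma ccon_normc a b g : ccon a b g -> {within `[a, b], continuous (fun x => normc (g x))}.
Proof.
move=> cg; apply: within_contP => x /=; rewrite in_itv/= => xab e /(cg _ xab)[d d0 H].
exists d => // y /=; rewrite in_itv/= => yab yd.
by rewrite (le_lt_trans (le_dist_normc _ _))// H.
Qed.

Lemma within_integrable a b (f : R -> R) : {within `[a, b], continuous f} ->
  mu.-integrable `[a, b] (EFin \o f).
Proof. by apply: continuous_compact_integrable; exact: segment_compact. Qed.

Lemma ccon_integrable a b g : ccon a b g ->
  mu.-integrable `[a, b] (EFin \o (fun x => complex.Re (g x))) /\
  mu.-integrable `[a, b] (EFin \o (fun x => complex.Im (g x))).
Proof. by move=> cg; split; apply: within_integrable; [exact: ccon_Re|exact: ccon_Im]. Qed.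

Lemma eq_cint a b g h : (forall x, a <= x <= b -> g x = h x) -> cint a b g = cint a b h.
Proof.
move=> gh; rewrite /cint; congr (_ +i* _); apply: eq_Rintegral => x;
by rewrite inE/= in_itv/= => /gh ->.
Qed.

Lemma cintD a b g h : ccon a b g -> ccon a b h ->
  cint a b (fun x => g x + h x) = cint a b g + cint a b h.
Proof.
move=> /ccon_integrable[g1 g2] /ccon_integrable[h1 h2].
rewrite /cint; apply: complex_eqP; rewrite ?ReImE /= -RintegralD//;
apply: eq_Rintegral => x _; by rewrite ?cReD ?cImD.
Qed.

Lemma integrableZl_EFin a b (k : R) (f : R -> R) :
  mu.-integrable `[a, b] (EFin \o f) -> mu.-integrable `[a, b] (EFin \o (fun x => k * f x)).
Proof. by move=> H; apply: eq_integrable (integrableZl _ k H). Qed.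

Lemma cintZ a b c g : ccon a b g -> cint a b (fun x => c * g x) = c * cint a b g.
Proof.
move=> /ccon_integrable[g1 g2].
rewrite /cint; apply: complex_eqP; rewrite ?ReImE /=.
- rewrite -!RintegralZl// -RintegralB//; [|exact: integrableZl_EFin..].
  by apply: eq_Rintegral => x _; rewrite cReM.
- rewrite -!RintegralZl// -RintegralD//; [|exact: integrableZl_EFin..].
  by apply: eq_Rintegral => x _; rewrite cImM.
Qed.

Lemma cintB a b g h : ccon a b g -> ccon a b h ->
  cint a b (fun x => g x - h x) = cint a b g - cint a b h.
Proof.
move=> cg ch; rewrite -[- cint a b h]mulN1r -cintZ// -cintD//; last exact: cconZ.
by apply: eq_cint => x _; rewrite mulN1r.
Qed.

Lemma cint_cat a m b g : a <= m <= b -> ccon a b g ->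
  cint a b g = cint a m g + cint m b g.
Proof.
move=> /andP[am mb] /ccon_integrable[g1 g2].
have H (f : R -> R) : mu.-integrable `[a, b] (EFin \o f) ->
    \int[mu]_(x in `[a, b]) f x = \int[mu]_(x in `[a, m]) f x + \int[mu]_(x in `[m, b]) f x.
  move=> fi; have := @Rintegral_itvB R f (BLeft a) (BRight b) m fi.
  rewrite !bnd_simp => /(_ am mb); rewrite Rintegral_itv_obnd_cbnd; last first.
    apply: integrableS fi => //; apply: subset_itv; by rewrite bnd_simp.
  by move=> /eqP; rewrite subr_eq addrC => /eqP.
by rewrite /cint (H _ g1) (H _ g2); apply: complex_eqP; rewrite ?ReImE.
Qed.

Lemma Rintegral_le_sup a b (f : R -> R) K : a <= b -> {within `[a, b], continuous f} ->
  (forall x, a <= x <= b -> `|f x| <= K) ->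
  `|\int[mu]_(x in `[a, b]) f x| <= K * (b - a).
Proof.
move=> ab cf fK; have fi := within_integrable cf.
apply: (le_trans (le_normr_Rintegral _ fi)) => //.
have E : fine (mu `[a, b]) = b - a.
  rewrite lebesgue_measure_itv/= lte_fin; case: ltP => // ba.
  have -> : b = a by apply/eqP; rewrite eq_le ab ba.
  by rewrite subrr.
rewrite -E -Rintegral_cst//; apply: le_Rintegral => //.
- exact: integrable_norm fi.
- apply: within_integrable; apply: continuous_subspaceT => x; exact: cvg_cst.
Qed.

(** The factor 2 is the cost of bounding the real and the imaginary part separately; it propagates
    to the constants of the contour estimates. *)
Lemma cint_le a b g K : a <= b -> ccon a b g ->
  (forall x, a <= x <= b -> normc (g x) <= K) -> normc (cint a b g) <= 2 * K * (b - a).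
Proof.
move=> ab cg gK; apply: (le_trans (normc_le_ReIm _)) => /=.
have h1 : `|\int[mu]_(x in `[a, b]) complex.Re (g x)| <= K * (b - a).
  apply: Rintegral_le_sup => //; first exact: ccon_Re.
  by move=> x /gK; apply: le_trans; exact: le_Re_normc.
have h2 : `|\int[mu]_(x in `[a, b]) complex.Im (g x)| <= K * (b - a).
  apply: Rintegral_le_sup => //; first exact: ccon_Im.
  by move=> x /gK; apply: le_trans; exact: le_Im_normc.
by lra.
Qed.

Lemma cint_le_norm a b g : ccon a b g ->
  normc (cint a b g) <= 2 * \int[mu]_(x in `[a, b]) normc (g x).
Proof.
move=> cg; apply: (le_trans (normc_le_ReIm _)) => /=.
have [g1 g2] := ccon_integrable cg; have gn := within_integrable (ccon_normc cg).
rewrite [2]/(1 + 1) mulrDl mul1r; apply: lerD.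
  apply: (le_trans (le_normr_Rintegral _ g1)) => //.
  apply: le_Rintegral => //; first exact: integrable_norm g1.
  by move=> x _; exact: le_Re_normc.
apply: (le_trans (le_normr_Rintegral _ g2)) => //.
apply: le_Rintegral => //; first exact: integrable_norm g2.
by move=> x _; exact: le_Im_normc.
Qed.

Lemma cint0 a g : cint a a g = 0.
Proof. by rewrite /cint set_itv1 !Rintegral_set1. Qed.

Lemma cint_cst a b c : a <= b -> cint a b (fun=> c) = c * (b - a)%:C.
Proof.
move=> ab; have E : fine (mu `[a, b]) = b - a.
  rewrite lebesgue_measure_itv/= lte_fin; case: ltP => // ba.
  have -> : b = a by apply/eqP; rewrite eq_le ab ba.
  by rewrite subrr.
by rewrite /cint !Rintegral_cst// E; apply: complex_eqP; rewrite ?ReImE/=; ring.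
Qed.

Lemma cint_FTC a b g g' : a <= b -> (forall x, a <= x <= b -> rder g x (g' x)) ->
  ccon a b g' -> cint a b g' = g b - g a.
Proof.
rewrite le_eqVlt => /predU1P[-> _ _|ab dg cg']; first by rewrite cint0 subrr.
have H (f f' : R -> R) : (forall x, a <= x <= b -> is_derive x 1 f (f' x)) ->
    {within `[a, b], continuous f'} -> \int[mu]_(x in `[a, b]) f' x = f b - f a.
  move=> df cf'.
  have cf x : a <= x <= b -> {for x, continuous f}.
    move=> /df[df1 _]; apply: differentiable_continuous.
    by apply/derivable1_diffP.
  rewrite /Rintegral (@continuous_FTC2 _ _ f)//; last first.
    move=> x; rewrite in_itv/= => /andP[ax xb].
    have dfx : is_derive x 1 f (f' x) by apply: df; rewrite !ltW.
    by rewrite derive1E derive_val.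
  split.
  - move=> x; rewrite in_itv/= => /andP[ax xb].
    by have dfx : is_derive x 1 f (f' x) by apply: df; rewrite !ltW.
  - by apply/cvg_at_right_filter/cf; rewrite lexx ltW.
  - by apply/cvg_at_left_filter/cf; rewrite lexx ltW.
have dg' x (xab : a <= x <= b) := rder_is_derive (dg x xab).
have H1 := H _ (fun t => complex.Re (g' t)) (fun x xab => (dg' x xab).1) (ccon_Re cg').
have H2 := H _ (fun t => complex.Im (g' t)) (fun x xab => (dg' x xab).2) (ccon_Im cg').
rewrite /cint H1 H2.
by apply: complex_eqP; rewrite ?ReImE.
Qed.

Lemma rder_lipschitz a b g g' K : (forall x, a <= x <= b -> rder g x (g' x)) ->
  ccon a b g' -> (forall x, a <= x <= b -> normc (g' x) <= K) ->
  forall x y, a <= x <= b -> a <= y <= b -> normc (g x - g y) <= 2 * K * `|x - y|.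
Proof.
move=> dg cg' gK.
suff H x y : a <= y -> y <= x -> x <= b -> normc (g x - g y) <= 2 * K * `|x - y|.
  move=> x y /andP[ax xb] /andP[ay yb]; have [yx|xy] := leP y x; first exact: H.
  by rewrite normcB_sym distrC; apply: H => //; exact: ltW.
move=> ay yx xb; rewrite -(@cint_FTC y x g g')//; last 2 first.
  by move=> z /andP[z1 z2]; apply: dg; apply/andP; split; lra.
  exact: ccon_sub cg'.
rewrite ger0_norm ?subr_ge0//; apply: cint_le => //; first exact: ccon_sub cg'.
by move=> z /andP[z1 z2]; apply: gK; apply/andP; split; lra.
Qed.

End complex_integral.

(** * Goursat's theorem for curvilinear rectangles *)

Lemma ccon_ex {R : realType} (a b : R) (g : R -> R[i]) :
  (forall x, a <= x <= b -> exists A, rder g x A) -> ccon a b g.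
Proof.
by move=> H; apply: cnt_ccon => x /H[A dA]; have := der_cnt dA; rewrite dio_real.
Qed.

Section goursat.
Context {R : realType}.
Variables (G : R[i] -> R[i]) (phi px py : R -> R -> R[i]) (a b c d L : R).
Hypothesis dpx : forall x y, a <= x <= b -> c <= y <= d -> rder (phi ^~ y) x (px x y).
Hypothesis dpy : forall x y, a <= x <= b -> c <= y <= d -> rder (phi x) y (py x y).
Hypothesis cpx : forall y, c <= y <= d -> ccon a b (px ^~ y).
Hypothesis cpy : forall x, a <= x <= b -> ccon c d (py x).
Hypothesis Lpx : forall x y, a <= x <= b -> c <= y <= d -> normc (px x y) <= L.
Hypothesis Lpy : forall x y, a <= x <= b -> c <= y <= d -> normc (py x y) <= L.
Hypothesis dG : forall x y, a <= x <= b -> c <= y <= d -> exists A, cder G (phi x y) A.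

Let horiz x1 x2 y := cint x1 x2 (fun x => G (phi x y) * px x y).
Let vert x y1 y2 := cint y1 y2 (fun y => G (phi x y) * py x y).
Let bd x1 x2 y1 y2 := horiz x1 x2 y1 + vert x2 y1 y2 - horiz x1 x2 y2 - vert x1 y1 y2.

Let chor y : c <= y <= d -> ccon a b (fun x => G (phi x y) * px x y).
Proof.
move=> yab; apply: cconM; last exact: cpx.
apply: ccon_ex => x xab; have [A dA] := dG xab yab.
by exists (A * px x y); apply: (der_comp (dpx xab yab)).
Qed.

Let cver x : a <= x <= b -> ccon c d (fun y => G (phi x y) * py x y).
Proof.
move=> xab; apply: cconM; last exact: cpy.
apply: ccon_ex => y ycd; have [A dA] := dG xab ycd.
by exists (A * py x y); apply: (der_comp (dpy xab ycd)).
Qed.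

Let bd_splitx x1 m x2 y1 y2 : a <= x1 -> x1 <= m -> m <= x2 -> x2 <= b ->
  c <= y1 -> y1 <= y2 -> y2 <= d ->
  bd x1 x2 y1 y2 = bd x1 m y1 y2 + bd m x2 y1 y2.
Proof.
move=> ? ? ? ? ? ? ?; rewrite /bd.
have H y : c <= y <= d -> horiz x1 x2 y = horiz x1 m y + horiz m x2 y.
  move=> ycd; apply: cint_cat; first by apply/andP.
  by apply: ccon_sub (chor ycd).
rewrite (H y1) ?(H y2); last 2 first.
  by apply/andP; split; lra.
  by apply/andP; split; lra.
by ring.
Qed.

Let bd_splity x1 x2 y1 m y2 : a <= x1 -> x1 <= x2 -> x2 <= b ->
  c <= y1 -> y1 <= m -> m <= y2 -> y2 <= d ->
  bd x1 x2 y1 y2 = bd x1 x2 y1 m + bd x1 x2 m y2.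
Proof.
move=> ? ? ? ? ? ? ?; rewrite /bd.
have H x : a <= x <= b -> vert x y1 y2 = vert x y1 m + vert x m y2.
  move=> xab; apply: cint_cat; first by apply/andP.
  by apply: ccon_sub (cver xab).
rewrite (H x1) ?(H x2); last 2 first.
  by apply/andP; split; lra.
  by apply/andP; split; lra.
by ring.
Qed.

Let L0 : a <= b -> c <= d -> 0 <= L.
Proof.
move=> ab cd; apply: (le_trans _ (@Lpx a c _ _)); first exact: normc_ge0.
  by rewrite lexx ab.
by rewrite lexx cd.
Qed.

Let phi_lip x y x' y' : a <= x <= b -> c <= y <= d -> a <= x' <= b -> c <= y' <= d ->
  normc (phi x y - phi x' y') <= 2 * L * (`|x - x'| + `|y - y'|).
Proof.
move=> xab ycd xab' ycd'.
apply: (le_trans (normc_distD _ (phi x' y) _)); rewrite mulrDr; apply: lerD.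
  apply: (@rder_lipschitz _ a b (phi ^~ y) (px ^~ y)) => // [z zab||z zab].
  - exact: dpx.
  - exact: cpx.
  - exact: Lpx.
apply: (@rder_lipschitz _ c d (phi x') (py x')) => // [z zab||z zab].
- exact: dpy.
- exact: cpy.
- exact: Lpy.
Qed.

(** With [P] a primitive of the affine Taylor polynomial of [G] at [p], the fundamental theorem
    along each edge makes the contribution of [P] telescope around the four corners. The remainder
    is o(1) times the size of the rectangle, on edges whose length is of that size: the bound is
    quadratic. *)
Let bd_local x0 y0 e : a <= x0 <= b -> c <= y0 <= d -> 0 < e -> exists2 r, 0 < r &
  forall x1 x2 y1 y2, a <= x1 -> x1 <= x0 <= x2 -> x2 <= b ->
   c <= y1 -> y1 <= y0 <= y2 -> y2 <= d -> (x2 - x1) + (y2 - y1) < r ->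
   normc (bd x1 x2 y1 y2) <= e * ((x2 - x1) + (y2 - y1)) ^+ 2.
Proof.
move=> xab ycd e0.
have LL0 : 0 <= L by apply: L0; lra.
have LL1 : L <= 1 * (2 * L + 1) by lra.
have [A dA] := dG xab ycd; pose p := phi x0 y0.
have k0 : 0 < 2 * L + 1 by lra.
have k20 : 0 < (2 * L + 1) ^+ 2 *+ 4 by rewrite pmulrn_lgt0// exprn_gt0.
(* The factor 4 is that of [cint_le] times the half-perimeter counted twice; the Lipschitz constant
   of [phi] and its speed cost at most 2L + 1 each. *)
have [r0 r00 Hr] := dA _ (divr_gt0 e0 k20).
exists (r0 / (2 * L + 1)); first exact: divr_gt0.
move=> x1 x2 y1 y2 ax1 hx0 x2b cy1 hy0 y2d.
have x12 : x1 <= x2 by case/andP: hx0; exact: le_trans.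
have y12 : y1 <= y2 by case/andP: hy0; exact: le_trans.
rewrite ltr_pdivlMr// => small.
pose s := (x2 - x1) + (y2 - y1); rewrite -/s in small *.
have s0 : 0 <= s by rewrite addr_ge0// subr_ge0.
pose P u := G p * u + A * ((u - p) ^+ 2 / 2).
pose rm u := G u - (G p + A * (u - p)).
have rmP x y : x1 <= x <= x2 -> y1 <= y <= y2 ->
    normc (rm (phi x y)) <= e / ((2 * L + 1) ^+ 2 *+ 4) * ((2 * L + 1) * s).
  move=> hx hy.
  have B : normc (phi x y - p) <= (2 * L + 1) * s.
    have ha := itv_sub ax1 x2b hx.
    have hb := itv_sub cy1 y2d hy.
    apply: (le_trans (phi_lip ha hb xab ycd)).
    have t3 : `|x - x0| + `|y - y0| <= s by rewrite lerD// dist_itv.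
    by apply: (@le_trans _ _ (2 * L * s)); [rewrite ler_wpM2l// mulr_ge0|rewrite ler_wpM2r// lerDl].
  have := Hr (phi x y) _; rewrite -/p mulrC in small *.
  rewrite [_ * s]mulrC in small; rewrite -/p in B *.
  move=> /(_ (le_lt_trans B _)) /= H.
  have -> : rm (phi x y) = G (phi x y) - G p - A * (phi x y - p) by rewrite /rm; ring.
  apply: (le_trans (H _)); first by rewrite mulrC.
  by rewrite ler_wpM2l// divr_ge0// ltW.
have dP u : cder P u (G p + A * (u - p)).
  have d1 : cder (fun u => u - p) u 1.
    by have := derB (der_io id u) (der_cst id p u); rewrite subr0.
  have := derD (derZ (G p) (der_io id u)) (derZ (A / 2) (derM d1 d1)).
  rewrite (_ : _ * 1 + _ = G p + A * (u - p)); last by field.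
  by congr der; apply/funext => v; rewrite /P; field.
have EH y : y1 <= y <= y2 -> horiz x1 x2 y =
    cint x1 x2 (fun x => rm (phi x y) * px x y) + (P (phi x2 y) - P (phi x1 y)).
  move=> /(itv_sub cy1 y2d) ycd'; have lxb x := @itv_sub _ _ _ _ _ x ax1 x2b.
  have cc : ccon x1 x2 (px ^~ y) by apply: ccon_sub (cpx ycd').
  have cphi : ccon x1 x2 (phi ^~ y) by apply: ccon_ex => x /lxb xx; exists (px x y); exact: dpx.
  have cA : ccon x1 x2 (fun x => (G p + A * (phi x y - p)) * px x y).
    apply: cconM => //; apply: cconD; first by move=> x _; exact: cnt_cst.
    by apply: cconZ; apply: cconB => // x _; exact: cnt_cst.
  rewrite -(@cint_FTC _ x1 x2 (fun x => P (phi x y)) (fun x => (G p + A * (phi x y - p)) * px x y)); first last.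
  - exact: cA.
  - by move=> x xx; apply: (der_comp (dpx (lxb _ xx) ycd') (dP _)).
  - by [].
  rewrite -cintD//; first by apply: eq_cint => x xx; rewrite /rm; ring.
  rewrite (_ : (fun _ => _) = (fun x => G (phi x y) * px x y - (G p + A * (phi x y - p)) * px x y)).
    by apply: cconB => //; apply: ccon_sub (chor ycd').
  by apply/funext => x; rewrite /rm; ring.
have EV x : x1 <= x <= x2 -> vert x y1 y2 =
    cint y1 y2 (fun y => rm (phi x y) * py x y) + (P (phi x y2) - P (phi x y1)).
  move=> /(itv_sub ax1 x2b) xab'; have lyd y := @itv_sub _ _ _ _ _ y cy1 y2d.
  have cc : ccon y1 y2 (py x) by apply: ccon_sub (cpy xab').
  have cphi : ccon y1 y2 (phi x) by apply: ccon_ex => y /lyd yy; exists (py x y); exact: dpy.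
  have cA : ccon y1 y2 (fun y => (G p + A * (phi x y - p)) * py x y).
    apply: cconM => //; apply: cconD; first by move=> y _; exact: cnt_cst.
    by apply: cconZ; apply: cconB => // y _; exact: cnt_cst.
  rewrite -(@cint_FTC _ y1 y2 (fun y => P (phi x y)) (fun y => (G p + A * (phi x y - p)) * py x y)); first last.
  - exact: cA.
  - by move=> y yy; apply: (der_comp (dpy xab' (lyd _ yy)) (dP _)).
  - by [].
  rewrite -cintD//; first by apply: eq_cint => y yy; rewrite /rm; ring.
  rewrite (_ : (fun _ => _) = (fun y => G (phi x y) * py x y - (G p + A * (phi x y - p)) * py x y)).
    by apply: cconB => //; apply: ccon_sub (cver xab').
  by apply/funext => y; rewrite /rm; ring.
pose K := e / ((2 * L + 1) ^+ 2 *+ 4) * ((2 * L + 1) * s) * L.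
have crm (x1' x2' : R) (g g' : R -> R[i]) : ccon x1' x2' (fun t => G (g t) * g' t) ->
    ccon x1' x2' g -> ccon x1' x2' g' -> ccon x1' x2' (fun t => rm (g t) * g' t).
  move=> c1 c2 c3.
  rewrite (_ : (fun _ => _) = (fun t => G (g t) * g' t - (G p + A * (g t - p)) * g' t)).
    apply: cconB => //; apply: cconM => //; apply: cconD; first by move=> y _; exact: cnt_cst.
    by apply: cconZ; apply: cconB => // y _; exact: cnt_cst.
  by apply/funext => t; rewrite /rm; ring.
have BH y : y1 <= y <= y2 -> normc (cint x1 x2 (fun x => rm (phi x y) * px x y)) <= 2 * K * (x2 - x1).
  move=> yy; have ycd' := itv_sub cy1 y2d yy.
  apply: cint_le => //.
    apply: crm; first by apply: ccon_sub (chor ycd').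
      by apply: ccon_ex => x /(itv_sub ax1 x2b) ?; exists (px x y); exact: dpx.
    by apply: ccon_sub (cpx ycd').
  move=> x xx; rewrite normcM ler_pM ?normc_ge0//; first exact: rmP.
  by apply: Lpx => //; exact: itv_sub xx.
have BV x : x1 <= x <= x2 -> normc (cint y1 y2 (fun y => rm (phi x y) * py x y)) <= 2 * K * (y2 - y1).
  move=> xx; have xab' := itv_sub ax1 x2b xx.
  apply: cint_le => //.
    apply: crm; first by apply: ccon_sub (cver xab').
      by apply: ccon_ex => y /(itv_sub cy1 y2d) ?; exists (py x y); exact: dpy.
    by apply: ccon_sub (cpy xab').
  move=> y yy; rewrite normcM ler_pM ?normc_ge0//; first exact: rmP.
  by apply: Lpy => //; exact: itv_sub yy.
have yy1 : y1 <= y1 <= y2 by rewrite lexx.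
have yy2 : y1 <= y2 <= y2 by rewrite lexx andbT.
have xx1 : x1 <= x1 <= x2 by rewrite lexx.
have xx2 : x1 <= x2 <= x2 by rewrite lexx andbT.
have -> : bd x1 x2 y1 y2 = cint x1 x2 (fun x => rm (phi x y1) * px x y1)
   + cint y1 y2 (fun y => rm (phi x2 y) * py x2 y)
   - cint x1 x2 (fun x => rm (phi x y2) * px x y2)
   - cint y1 y2 (fun y => rm (phi x1 y) * py x1 y).
  rewrite /bd (EH y1)// (EH y2)// (EV x1)// (EV x2)//.
  move: (P _) (P _) (P _) (P _) (cint _ _ _) (cint _ _ _) (cint _ _ _) (cint _ _ _) => *; ring.
have b1 := BH _ yy1; have b2 := BH _ yy2; have b3 := BV _ xx1; have b4 := BV _ xx2.
apply: (@le_trans _ _ (4 * K * s)).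
  apply: (le_trans (normc_contour_le b1 b3 b4 b2)).
  by rewrite le_eqVlt; apply/orP; left; apply/eqP; rewrite /s; ring.
have -> : 4 * K * s = e * s ^+ 2 * (L / (2 * L + 1)).
  by rewrite /K -mulr_natr; field; apply: lt0r_neq0.
rewrite ler_piMr ?mulr_ge0 ?sqr_ge0 ?(ltW e0)// ler_pdivrMr//.
Qed.

Let bd_halve x1 y1 w h : a <= x1 -> x1 + w <= b -> c <= y1 -> y1 + h <= d ->
  0 <= w -> 0 <= h -> exists p : R * R,
  [/\ x1 <= p.1, p.1 + w / 2 <= x1 + w, y1 <= p.2, p.2 + h / 2 <= y1 + h &
   normc (bd x1 (x1 + w) y1 (y1 + h)) <=
     4 * normc (bd p.1 (p.1 + w / 2) p.2 (p.2 + h / 2))].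
Proof.
move=> ax xb cy yd w0 h0.
pose q i j := bd (x1 + i) (x1 + i + w / 2) (y1 + j) (y1 + j + h / 2).
suff [i [j [i0 iw j0 jh H]]] : exists i j, [/\ 0 <= i, i <= w / 2, 0 <= j, j <= h / 2 &
    normc (bd x1 (x1 + w) y1 (y1 + h)) <= 4 * normc (q i j)].
  by exists (x1 + i, y1 + j); split => //=; lra.
have w2 : 0 <= w / 2 by rewrite divr_ge0.
have h2 : 0 <= h / 2 by rewrite divr_ge0.
have ww : w / 2 <= w by rewrite {2}[w]splitr lerDl.
have hh : h / 2 <= h by rewrite {2}[h]splitr lerDl.
have xm : x1 + w / 2 <= b by rewrite (le_trans _ xb)// lerD2l.
have xm' : a <= x1 + w / 2 by rewrite (le_trans ax)// lerDl.
have E : bd x1 (x1 + w) y1 (y1 + h) = q 0 0 + q 0 (h / 2) + (q (w / 2) 0 + q (w / 2) (h / 2)).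
  rewrite (@bd_splitx _ (x1 + w / 2)); [|by rewrite ?lerDl ?lerD2l..].
  rewrite (@bd_splity x1 (x1 + w / 2) _ (y1 + h / 2)); [|by rewrite ?lerDl ?lerD2l..].
  rewrite (@bd_splity (x1 + w / 2) _ _ (y1 + h / 2)); [|by rewrite ?lerDl ?lerD2l..].
  rewrite /q !addr0 -[y1 + h / 2 + h / 2]addrA -[x1 + w / 2 + w / 2]addrA.
  by rewrite -!splitr.
have T := le_trans (le_normcD (q 0 0 + q 0 (h / 2)) (q (w / 2) 0 + q (w / 2) (h / 2)))
  (lerD (le_normcD _ _) (le_normcD _ _)); rewrite -E in T.
have [h3|h3] := leP (normc (bd x1 (x1 + w) y1 (y1 + h))) (4 * normc (q 0 0)).
  by exists 0, 0.
have [h4|h4] := leP (normc (bd x1 (x1 + w) y1 (y1 + h))) (4 * normc (q 0 (h / 2))).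
  by exists 0, (h / 2).
have [h5|h5] := leP (normc (bd x1 (x1 + w) y1 (y1 + h))) (4 * normc (q (w / 2) 0)).
  by exists (w / 2), 0.
by exists (w / 2), (h / 2); split=> //; exact: le_quarter h3 h4 h5 T.
Qed.

(** Repeated bisection traps a point in nested rectangles, each carrying at least a quarter of the
    previous boundary integral; the quadratic local estimate compensates 4^n. The curvilinear form
    is meant for regions swept by homotheties and for parallelograms in a logarithmic coordinate. *)
Lemma goursat : a <= b -> c <= d ->
  cint a b (fun x => G (phi x c) * px x c) + cint c d (fun y => G (phi b y) * py b y) =
  cint a b (fun x => G (phi x d) * px x d) + cint c d (fun y => G (phi a y) * py a y).
Proof.
move=> ab cd; apply/eqP; rewrite -subr_eq0 opprD addrA -normc_eq0; apply/eqP.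
rewrite -[LHS]/(normc (bd a b c d)).
pose w n := (b - a) / 2 ^+ n; pose h n := (d - c) / 2 ^+ n.
have w0 n : 0 <= w n by rewrite divr_ge0 ?subr_ge0.
have h0 n : 0 <= h n by rewrite divr_ge0 ?subr_ge0.
have wS n : w n.+1 = w n / 2 by rewrite /w exprSr invfM mulrA.
have hS n : h n.+1 = h n / 2 by rewrite /h exprSr invfM mulrA.
pose good n (p : R * R) := [/\ a <= p.1, p.1 + w n <= b, c <= p.2 & p.2 + h n <= d].
pose B n (p : R * R) := normc (bd p.1 (p.1 + w n) p.2 (p.2 + h n)).
have step (np : nat * (R * R)) : exists p' : R * R, good np.1 np.2 ->
    [/\ good np.1.+1 p', np.2.1 <= p'.1, np.2.2 <= p'.2,
      (p'.1 + w np.1.+1 <= np.2.1 + w np.1) /\ (p'.2 + h np.1.+1 <= np.2.2 + h np.1) &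
      B np.1 np.2 <= 4 * B np.1.+1 p'].
  case: np => n p /=.
  have [[g1 g2 g3 g4]|ng] := pselect (good n p); last by exists p.
  have [p' [q1 q2 q3 q4 q5]] := bd_halve g1 g2 g3 g4 (w0 n) (h0 n).
  exists p' => _; rewrite /B wS hS; split => //; split; rewrite ?wS ?hS; lra.
have {step}[f Hf] := choice step.
pose s := fix s n := if n is k.+1 then f (k, s k) else (a, c).
have gs n : good n (s n).
  elim: n => [|n ih]; last by have [] := Hf (n, s n) ih.
  by rewrite /good /= /w /h !expr0 !divr1; split; lra.
have mono n k : (s n).1 <= (s (n + k)%N).1 /\ (s n).2 <= (s (n + k)%N).2 /\
   (s (n + k)%N).1 + w (n + k)%N <= (s n).1 + w n /\ (s (n + k)%N).2 + h (n + k)%N <= (s n).2 + h n.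
  elim: k => [|k [i1 [i2 [i3 i4]]]]; first by rewrite addn0.
  by rewrite addnS; have [_ j1 j2 [j3 j4] _] := Hf (_, _) (gs (n + k)%N); rewrite /= in j1 j2 j3 j4 *; lra.
have Bs n : B 0%N (s 0%N) <= 4 ^+ n * B n (s n).
  elim: n => [|n ih]; first by rewrite expr0 mul1r.
  apply: (le_trans ih); rewrite exprSr -mulrA ler_wpM2l ?exprn_ge0//.
  by have [_ _ _ _] := Hf (_, _) (gs n).
have cross (u v : nat -> R) (k : nat -> R) : (forall n, 0 <= k n) ->
   (forall n m, u n <= u (n + m)%N) -> (forall n m, u (n + m)%N + k (n + m)%N <= u n + k n) ->
   exists l, forall n, u n <= l <= u n + k n.
  move=> k0 m1 m2.
  have ubd n : ubound (range u) (u n + k n).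
    move=> _ [m _ <-]; have [nm|mn] := leqP n m.
      by have := m2 n (m - n)%N; rewrite subnKC//; have := k0 m; lra.
    by have := m1 m (n - m)%N; rewrite subnKC ?(ltnW mn)//; have := k0 n; lra.
  have hs : has_sup (range u) by split; [exists (u 0%N), 0%N|exists (u 0%N + k 0%N); exact: ubd].
  exists (sup (range u)) => n; apply/andP; split.
    by apply: ub_le_sup; [exact: hs.2|exists n].
  by apply: ge_sup; [exact: hs.1|exact: ubd].
have [x0 Hx0] := cross (fun n => (s n).1) (fun n => (s n).1) w w0
  (fun n k => (mono n k).1) (fun n k => (mono n k).2.2.1).
have [y0 Hy0] := cross (fun n => (s n).2) (fun n => (s n).2) h h0
  (fun n k => (mono n k).2.1) (fun n k => (mono n k).2.2.2).
have xab : a <= x0 <= b by have := Hx0 0%N; rewrite /= /w expr0 divr1; lra.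
have ycd : c <= y0 <= d by have := Hy0 0%N; rewrite /= /h expr0 divr1; lra.
have key e : 0 < e -> normc (bd a b c d) <= e * ((b - a) + (d - c)) ^+ 2.
  move=> e0; have [r r0 Hr] := bd_local xab ycd e0.
  have [n Hn] : exists n, (w n + h n) < r.
    pose n := Num.bound ((b - a + (d - c)) / r).
    have Hn : (b - a + (d - c)) / r < n%:R.
      by apply: archi_boundP; apply: divr_ge0; [lra|exact: ltW].
    exists n; rewrite /w /h -mulrDl ltr_pdivrMr ?exprn_gt0// mulrC -ltr_pdivrMr//.
    apply: (lt_le_trans Hn); rewrite -natrX ler_nat; exact/ltnW/ltn_expl.
  have [g1 g2 g3 g4] := gs n.
  have := Hr (s n).1 ((s n).1 + w n) (s n).2 ((s n).2 + h n) g1 (Hx0 n) g2 g3 (Hy0 n) g4.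
  rewrite ![_ + w n - _]addrC ![_ + h n - _]addrC !addKr => /(_ Hn) {}Hn.
  have E0 : bd a b c d = bd (s 0%N).1 ((s 0%N).1 + w 0%N) (s 0%N).2 ((s 0%N).2 + h 0%N).
    by rewrite /= /w /h !expr0 !divr1 ![_ + (_ - _)]addrC !subrK.
  rewrite E0; apply: (le_trans (Bs n)).
  apply: (@le_trans _ _ (4 ^+ n * (e * (w n + h n) ^+ 2))); first by rewrite ler_wpM2l ?exprn_ge0.
  rewrite /w /h -mulrDl expr_div_n -exprM mulnC exprM (_ : 2 ^+ 2 = 4); last by rewrite -natrX.
  by rewrite mulrCA [4 ^+ n * _]mulrC divfK ?expf_neq0// pnatr_eq0.
apply/eqP; rewrite eq_le normc_ge0 andbT; apply/ler_addgt0Pl => e e0; rewrite addr0.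
have K0 : 0 < ((b - a) + (d - c)) ^+ 2 + 1 by have := sqr_ge0 ((b - a) + (d - c)); lra.
apply: (le_trans (key _ (divr_gt0 e0 K0))).
rewrite -mulrA ler_piMr ?(ltW e0)// mulrC ler_pdivrMr//; lra.
Qed.

End goursat.

(** * The principal logarithm *)

Section complex_log.
Context {R : realType}.
Implicit Types (z u v w : R[i]) (x t : R).

Lemma sin_ge_mul_cos t : 0 <= t <= pi / 2 -> t * cos t <= sin t.
Proof.
move=> /andP[]; rewrite le_eqVlt => /predU1P[<- _|t0 t2]; first by rewrite mul0r sin0.
have [|c] := @MVT R sin cos 0 t t0.
  by apply: continuous_subspaceT => z; exact: continuous_sin.
rewrite sin0 !subr0 in_itv/= => /andP[c0 ct] ->.
rewrite mulrC ler_pM2r// leNgt ltr_cos; first by rewrite -leNgt ltW.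
- by rewrite in_itv/=; have := pi_ge0 R; lra.
- by rewrite in_itv/=; have := pi_ge0 R; lra.
Qed.

Lemma cos_eq1 t : cos t = 1 -> `|t| < 2 * pi -> t = 0.
Proof.
move=> c1; wlog t0 : t c1 / 0 <= t.
  move=> H ht; have [t0|t0] := leP 0 t; first exact: H.
  apply/eqP; rewrite -oppr_eq0; apply/eqP; apply: H; rewrite ?cosN ?normrN//.
  by rewrite oppr_ge0 ltW.
rewrite ger0_norm// => t2; apply/eqP; apply/negPn/negP => tn.
have tp : 0 < t by rewrite lt_neqAle eq_sym tn.
have : 0 < sin (t / 2) by apply: sin_gt0_pi; apply/andP; split; lra.
have e2 : (t / 2) *+ 2 = t by rewrite -mulr_natr; lra.
have := cos_mulr2n (t / 2); rewrite e2 c1 cos2sin2 -mulr_natr => h.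
have : sin (t / 2) ^+ 2 = 0 by lra.
by move=> /eqP; rewrite sqrf_eq0 => /eqP ->; rewrite ltxx.
Qed.

Lemma cexp_eq1 z : cexp z = 1 -> `|complex.Im z| < 2 * pi -> z = 0.
Proof.
move=> z1; have := normc_cexp z; rewrite z1 normc1 => /esym e1.
have x0 : complex.Re z = 0 by apply: (@expR_inj R); rewrite e1 expR0.
move: z1; rewrite /cexp x0 expR0 !mul1r => -[c1 _] h.
by apply: complex_eqP => //; exact: cos_eq1.
Qed.

Lemma cexp_inj u v : cexp u = cexp v -> `|complex.Im u - complex.Im v| < 2 * pi -> u = v.
Proof.
move=> uv h; apply/eqP; rewrite -subr_eq0; apply/eqP; apply: cexp_eq1; rewrite ?cImB//.
by rewrite cexpB uv divff ?cexp_neq0.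
Qed.

Lemma Re_div_normc z : z != 0 -> -1 <= complex.Re z / normc z <= 1.
Proof.
move=> z0; rewrite -ler_norml normrM normfV (ger0_norm (normc_ge0 _)).
by rewrite ler_pdivrMr ?normc_gt0// mul1r le_Re_normc.
Qed.

Lemma cos_carg z : z != 0 -> cos (carg z) = complex.Re z / normc z.
Proof.
move=> z0; have h := Re_div_normc z0.
by rewrite /carg; case: ifP => _; rewrite ?cosN acosK.
Qed.

Lemma sin_carg z : z != 0 -> sin (carg z) = complex.Im z / normc z.
Proof.
move=> z0; have h := Re_div_normc z0.
have n0 : 0 < normc z by rewrite normc_gt0.
have E : sin (acos (complex.Re z / normc z)) = `|complex.Im z| / normc z.
  rewrite sin_acos//.
  have -> : 1 - (complex.Re z / normc z) ^+ 2 = (complex.Im z / normc z) ^+ 2.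
    have := normcE z => hn; rewrite !expr_div_n; apply: (@mulIf _ (normc z ^+ 2)).
      by rewrite sqrf_eq0 gt_eqF.
    by rewrite mulrBl !divfK ?sqrf_eq0 ?gt_eqF// hn; ring.
  by rewrite sqrtr_sqr normrM normfV (gtr0_norm n0).
rewrite /carg; case: ifPn => [i0|]; first by rewrite E ger0_norm.
by rewrite -ltNge => i0; rewrite sinN E ltr0_norm// mulNr opprK.
Qed.

Lemma cexp_clog z : z != 0 -> cexp (clog z) = z.
Proof.
move=> z0; have n0 : 0 < normc z by rewrite normc_gt0.
rewrite /cexp /clog/= lnK ?posrE// cos_carg// sin_carg//.
by rewrite !(mulrC (normc z)) !divfK ?gt_eqF//; case: z {z0 n0}.
Qed.

Lemma carg_itv z : z != 0 -> - pi < carg z <= pi.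
Proof.
move=> z0; have h := Re_div_normc z0; have p0 := pi_gt0 R.
have h1 := acos_ge0 h; have h2 := acos_lepi h.
rewrite /carg; case: ifPn => [_|]; first by apply/andP; split; lra.
rewrite -ltNge => i0.
suff : acos (complex.Re z / normc z) < pi by move=> ?; apply/andP; split; lra.
have := sin_carg z0; rewrite /carg leNgt i0/= sinN => hs.
rewrite lt_neqAle h2 andbT; apply/eqP => e; move: hs; rewrite e sinpi oppr0.
move=> /esym/eqP; rewrite mulf_eq0 invr_eq0 normc_eq0 (negbTE z0) orbF.
by rewrite lt_eqF.
Qed.

Lemma clog_uniq z w : cexp w = z -> - pi < complex.Im w <= pi -> clog z = w.
Proof.
move=> wz hw; have z0 : z != 0 by rewrite -wz cexp_neq0.
have hz := carg_itv z0.
apply: cexp_inj; rewrite ?cexp_clog//=.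
by rewrite ltr_norml; apply/andP; split; lra.
Qed.

Definition slit : set (R[i]) := [set z | 0 < complex.Re z \/ complex.Im z != 0].

Lemma slit_neq0 z : slit z -> z != 0.
Proof. by case=> h; apply/eqP => z0; move: h; rewrite z0 /= ?ltxx ?eqxx. Qed.

Lemma carg_slit z : slit z -> `|carg z| < pi.
Proof.
move=> sz; have z0 := slit_neq0 sz; have n0 : 0 < normc z by rewrite normc_gt0.
have /andP[h1 h2] := carg_itv z0; rewrite ltr_norml h1/= lt_neqAle h2 andbT.
apply/eqP => e; have := cos_carg z0; have := sin_carg z0; rewrite e cospi sinpi.
move=> /esym/eqP; rewrite mulf_eq0 invr_eq0 (gt_eqF n0) orbF => /eqP i0 hc.
case: sz; last by rewrite i0 eqxx.
move=> r0; have : 0 < complex.Re z / normc z by rewrite divr_gt0.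
by rewrite -hc; lra.
Qed.

Lemma carg_Re_gt0 z : 0 < complex.Re z -> `|carg z| < pi / 2.
Proof.
move=> r0; have sz : slit z by left.
have z0 := slit_neq0 sz; have n0 : 0 < normc z by rewrite normc_gt0.
have h := carg_slit sz.
have c0 : 0 < cos (carg z) by rewrite cos_carg// divr_gt0.
rewrite ltNge; apply/negP => h2.
have : cos `|carg z| <= cos (pi / 2).
  move: h2; rewrite le_eqVlt => /predU1P[->//|h2].
  apply: ltW; rewrite ltr_cos//.
  - by rewrite in_itv/=; have := pi_ge0 R; lra.
  - by rewrite in_itv/= normr_ge0 ltW.
by rewrite cos_norm cos_pihalf; lra.
Qed.

(** The modulus contributes 2 |z|, by ln x <= x - 1 at |1 + z| and at its inverse. The argument
    theta contributes 4 |z|, since cos theta >= 1/2, theta cos theta <= sin theta for theta >= 0,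
    and sin theta = Im z / |1 + z|. *)
Lemma clog1D z : normc z <= 4^-1 -> normc (clog (1 + z)) <= 6 * normc z.
Proof.
move=> z4; have hr := le_Re_normc z; have hi := le_Im_normc z.
have re : complex.Re (1 + z) = 1 + complex.Re z by rewrite cReD.
have im : complex.Im (1 + z) = complex.Im z by rewrite cImD add0r.
have r0 : 0 < complex.Re (1 + z) by move: hr; rewrite re ler_norml; lra.
have z0 : 1 + z != 0 by apply: slit_neq0; left.
have n1 : normc (1 + z) <= 1 + normc z by have := le_normcD 1 z; rewrite normc1.
have n2 : 1 - normc z <= normc (1 + z).
  by have := le_normc_sub 1 (- z); rewrite opprK normcN normc1.
have np := normc_ge0 z.
have n0 : 0 < normc (1 + z) by lra.
apply: (le_trans (normc_le_ReIm _)) => /=.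
have L : `|ln (normc (1 + z))| <= 2 * normc z.
  rewrite ler_norml; apply/andP; split.
    have := @le_ln1Dx R ((normc (1 + z))^-1 - 1).
    rewrite [X in ln X]addrC subrK lnV ?posrE// => H.
    have v1 : (normc (1 + z))^-1 <= 1 + 2 * normc z.
      rewrite -div1r ler_pdivrMr//; rnra.
    have v0 : 0 < (normc (1 + z))^-1 by rewrite invr_gt0.
    have := H _; rlra.
  have := @le_ln1Dx R (normc (1 + z) - 1); rewrite [X in ln X]addrC subrK; lra.
have h := carg_Re_gt0 r0.
have c2 : 2^-1 <= cos (carg (1 + z)).
  rewrite cos_carg// ler_pdivlMr// re; move: hr; rewrite ler_norml; clear -z4 n1; rlra.
have S : `|carg (1 + z)| * 2^-1 <= `|sin (carg (1 + z))|.
  have p : 0 <= `|carg (1 + z)| <= pi / 2 by rewrite normr_ge0 ltW.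
  have := sin_ge_mul_cos p; rewrite cos_norm => H.
  apply: (@le_trans _ _ (sin `|carg (1 + z)|)).
    by apply: le_trans H; rewrite ler_wpM2l.
  by case: (ger0P (carg (1 + z))) => _; [exact: ler_norm|rewrite sinN -normrN; exact: ler_norm].
have S2 : `|sin (carg (1 + z))| <= 2 * normc z.
  rewrite sin_carg// normrM normfV (gtr0_norm n0) ler_pdivrMr// im; rnra.
clear -L S S2; rlra.
Qed.

Lemma cder_clog z : slit z -> cder clog z z^-1.
Proof.
move=> sz e e0; have z0 := slit_neq0 sz; have n0 : 0 < normc z by rewrite normc_gt0.
have h := carg_slit sz.
(* 1/12 brings [k] below 1/2, as [cexp_taylor1] requires; the second bound keeps the sum of the
   arguments inside ]-pi, pi[; 9 * 36 is the constant of [cexp_taylor1] times the square of that of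
   [clog1D]. *)
pose dl := Num.min 12^-1 (Num.min ((pi - `|carg z|) / 6) (e * normc z / (9 * 36))).
have dl0 : 0 < dl.
  rewrite !lt_min invr_gt0 ltr0n/= !divr_gt0 ?subr_gt0//= ?mulr_gt0//.
exists (dl * normc z); first exact: mulr_gt0.
move=> y; rewrite -ltr_pdivrMr// => hy.
pose q := (y - z) / z.
have nq : normc q = normc (y - z) / normc z by rewrite normcM normcV.
rewrite -nq in hy; move: hy; rewrite !lt_min => /and3P[q1 q2 q3].
have q0 := normc_ge0 q.
have yE : y = z * (1 + q) by rewrite /q; field.
have q4 : normc q <= 4^-1 by rlra.
have k6 := clog1D q4; set k := clog (1 + q) in k6 *.
have z1 : 1 + q != 0.
  have := le_normc_sub 1 (- q); rewrite opprK normcN normc1 -normc_gt0; rlra.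
have ek : cexp k = 1 + q by exact: cexp_clog.
have ly : clog y = clog z + k.
  apply: clog_uniq; first by rewrite cexpD ek cexp_clog.
  have := le_Im_normc k; rewrite cImD [complex.Im (clog z)]/=.
  have : `|complex.Im k| < pi - `|carg z|.
    by apply: (le_lt_trans (le_Im_normc k)); rlra.
  have hc1 := ler_norm (carg z).
  have hc2 : - `|carg z| <= carg z by rewrite lerNl -normrN ler_norm.
  by rewrite ltr_norml => /andP[b1 b2] _; apply/andP; split; clear -hc2 b1 hc1 b2; rlra.
have -> : clog y - clog z - z^-1 * (y - z) = - (cexp k - 1 - k).
  by rewrite ly ek /q; ring.
rewrite normcN; have k2 : normc k <= 2^-1 by rlra.
apply: (le_trans (cexp_taylor1 k2)).
have E : normc (y - z) = normc q * normc z by rewrite nq divfK// gt_eqF.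
have k0 := normc_ge0 k.
apply: (@le_trans _ _ ((9 * 36) * normc q * normc q)); first by rewrite expr2; rnra.
rewrite E mulrCA mulrC ler_wpM2l//.
by move: q3; rewrite ltr_pdivlMr//; clear; lra.
Qed.

Lemma clogN z : 0 < complex.Im z -> clog (- z) = clog z - (0 +i* pi).
Proof.
move=> i0; have sz : slit z by right; rewrite gt_eqF.
have z0 := slit_neq0 sz; have n0 : 0 < normc z by rewrite normc_gt0.
have h := carg_slit sz; rewrite ltr_norml in h; have p0 := pi_gt0 R.
apply: clog_uniq.
  rewrite cexpB cexp_clog// (_ : cexp (0 +i* pi) = -1); first by rewrite invrN1 mulrN1.
  by apply: complex_eqP => /=; rewrite expR0 ?cospi ?sinpi mul1r ?oppr0.
rewrite cImB/=.
suff : 0 < carg z by move=> ?; apply/andP; split; lra.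
rewrite ltNge; apply/negP => hz.
have : 0 < sin (carg z) by rewrite sin_carg// divr_gt0.
rewrite -[carg z]opprK sinN oppr_gt0 ltNge => /negP; apply.
by apply: sin_ge0_pi; apply/andP; split; lra.
Qed.

End complex_log.

(** * Residues by homothety *)

Section arcs.
Context {R : realType}.
Implicit Types (g : R -> R[i]) (a b : R) (w z : R[i]).

Lemma ccon_bounded a b g : a <= b -> ccon a b g ->
  exists2 K, 0 < K & forall x, a <= x <= b -> normc (g x) <= K.
Proof.
move=> ab /ccon_normc cg; have [m _ Hm] := EVT_max ab cg.
exists (normc (g m) + 1) => [|x xab]; first by have := normc_ge0 (g m); lra.
by have := Hm x; rewrite in_itv/= => /(_ xab); lra.
Qed.

Record arc := Arc { apt : R -> R[i]; avel : R -> R[i]; alo : R; ahi : R }.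

Implicit Types (c : arc) (G : R[i] -> R[i]).

Definition aon c : set R := [set x | alo c <= x <= ahi c].
Definition arc_ok c := [/\ alo c <= ahi c,
  forall x, aon c x -> rder (apt c) x (avel c x) & ccon (alo c) (ahi c) (avel c)].

Definition aint c G := cint (alo c) (ahi c) (fun x => G (apt c x) * avel c x).

Lemma arc_ok_ccon c : arc_ok c -> ccon (alo c) (ahi c) (apt c).
Proof. by case=> _ dc _; apply: ccon_ex => x /dc; exists (avel c x). Qed.

Lemma ccon_arc c G : arc_ok c -> (forall x, aon c x -> exists A, cder G (apt c x) A) ->
  ccon (alo c) (ahi c) (fun x => G (apt c x)).
Proof.
move=> [_ dc _] dG; apply: ccon_ex => x xc; have [A dA] := dG _ xc.
by exists (A * avel c x); apply: (der_comp (dc _ xc)).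
Qed.

Definition rad G w e p := cint e 1 (fun r => G (w + r%:C * (p - w)) * (p - w)).

(** Goursat's theorem on the region that the arc sweeps when contracted towards [w]. The two radial
    edges depend on the endpoints only and cancel around a closed contour. *)
Lemma aint_homothety c G w e : 0 < e -> e <= 1 -> arc_ok c ->
  (forall x, aon c x -> forall r, 0 < r <= 1 -> exists A, cder G (w + r%:C * (apt c x - w)) A) ->
  aint c G = rad G w e (apt c (ahi c)) - rad G w e (apt c (alo c)) +
    cint (alo c) (ahi c) (fun x => G (w + e%:C * (apt c x - w)) * (e%:C * avel c x)).
Proof.
move=> e0 e1 ok dG; have [ab dc cc] := ok.
have cp := arc_ok_ccon ok.
have [K1 K10 HK1] : exists2 K, 0 < K & forall x, aon c x -> normc (apt c x - w) <= K.
  by apply: (ccon_bounded ab); apply: cconB => // x _; exact: cnt_cst.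
have [K2 K20 HK2] := ccon_bounded ab cc.
have := @goursat R G (fun r x => w + r%:C * (apt c x - w)) (fun r x => apt c x - w)
  (fun r x => r%:C * avel c x) e 1 (alo c) (ahi c) (K1 + K2) _ _ _ _ _ _ _ e1 ab.
rewrite /=; move=> H.
have {}H := H _ _ _ _ _ _ _.
have E1 : aint c G = cint (alo c) (ahi c)
   (fun x => G (w + 1%:C * (apt c x - w)) * (1%:C * avel c x)).
  by apply: eq_cint => x _; rewrite !mul1r addrC subrK.
rewrite E1 /rad; apply/eqP; rewrite eq_sym addrAC subr_eq eq_sym; apply/eqP.
rewrite -H; first by rewrite addrC.
- move=> r x /andP[r0 r1] xc.
  have := derD (der_cst (real_complex R) w r) (derM (rder_id r) (der_cst _ (apt c x - w) r)).
  by rewrite mulr0 addr0 add0r mul1r.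
- move=> r x /andP[r0 r1] xc.
  have := derD (der_cst (real_complex R) w x) (derZ r%:C (derB (dc x xc) (der_cst _ w x))).
  by rewrite subr0 add0r.
- by move=> x xc r _; exact: cnt_cst.
- by move=> r _; apply: cconZ.
- by move=> r x _ xc; apply: (le_trans (HK1 _ xc)); rlra.
- move=> r x /andP[r0 r1] xc; rewrite normcM normc_real ger0_norm; last lra.
  have := HK2 _ xc; have := normc_ge0 (avel c x); rnra.
- by move=> r x /andP[r0 r1] xc; apply: dG => //; apply/andP; split; clear -e0 r0 r1; rlra.
Qed.

(** The form du / (u - w) is invariant under homotheties centred at [w]. On the contracted arc the
    integrand therefore differs from alpha du / (u - w) by the factor (u - w) G u - alpha, which is
    uniformly small. *)
Lemma aint_residue_limit c G w alpha : arc_ok c ->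
  (forall x, aon c x -> apt c x != w) ->
  (forall x, aon c x -> forall r, 0 < r <= 1 -> exists A, cder G (w + r%:C * (apt c x - w)) A) ->
  (forall e, 0 < e -> exists2 d, 0 < d & forall u, u != w -> normc (u - w) < d ->
     normc ((u - w) * G u - alpha) < e) ->
  forall e, 0 < e -> exists2 d, 0 < d & forall r, 0 < r -> r < d -> r <= 1 ->
   normc (cint (alo c) (ahi c) (fun x => G (w + r%:C * (apt c x - w)) * (r%:C * avel c x)) -
      alpha * aint c (fun u => (u - w)^-1)) <= e.
Proof.
move=> ok nw dG res e e0; have [ab dc cc] := ok; have cp := arc_ok_ccon ok.
have cpw : ccon (alo c) (ahi c) (fun x => apt c x - w).
  by apply: cconB => // x _; exact: cnt_cst.
have civ : ccon (alo c) (ahi c) (fun x => (apt c x - w)^-1 * avel c x).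
  apply: cconM => // x xc; apply: cntV; last exact: cpw.
  by rewrite subr_eq0; exact: nw.
have [K1 K10 HK1] := ccon_bounded ab cpw.
have [K2 K20 HK2] := ccon_bounded ab civ.
have l0 : 0 <= ahi c - alo c by lra.
have [|d d0 Hd] := res (e / (2 * K2 * (ahi c - alo c) + 1)).
  by rewrite divr_gt0//; nra.
exists (d / K1); first exact: divr_gt0.
move=> r r0 rd r1; rewrite ltr_pdivlMr// in rd.
have cG : ccon (alo c) (ahi c) (fun x => G (w + r%:C * (apt c x - w))).
  apply: ccon_ex => x xc; have [|A dA] := dG _ xc r; first by rewrite r0.
  exists (A * (0 + r%:C * (avel c x - 0))).
  apply: (@der_comp _ _ _ G (fun x => w + r%:C * (apt c x - w)) x _ A _ dA).
  by apply: derD; [exact: der_cst|apply: derZ; apply: derB; [exact: dc|exact: der_cst]].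
have crG : ccon (alo c) (ahi c) (fun x => G (w + r%:C * (apt c x - w)) * (r%:C * avel c x)).
  by apply: cconM => //; exact: cconZ.
rewrite /aint -cintZ// -cintB//; last exact: cconZ.
apply: (@le_trans _ _ (2 * (e / (2 * K2 * (ahi c - alo c) + 1) * K2) * (ahi c - alo c))).
  apply: cint_le => //; first by apply: cconB => //; exact: cconZ.
  move=> x xc; have pn : apt c x - w != 0 by rewrite subr_eq0; exact: nw.
  have rn : r%:C != 0 by rewrite -normc_eq0 normc_real normr_eq0 gt_eqF.
  set u := w + r%:C * (apt c x - w).
  have uw : u - w = r%:C * (apt c x - w) by rewrite /u addrC addKr.
  have -> : G u * (r%:C * avel c x) - alpha * ((apt c x - w)^-1 * avel c x) =
      ((u - w) * G u - alpha) * ((apt c x - w)^-1 * avel c x).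
    by rewrite uw; field.
  rewrite normcM ler_pM ?normc_ge0//; last exact: HK2.
  apply/ltW/Hd; first by rewrite -subr_eq0 uw mulf_neq0.
  rewrite uw normcM normc_real gtr0_norm//; have := HK1 _ xc.
  by have := normc_ge0 (apt c x - w); rnra.
have kl : 0 <= K2 * (ahi c - alo c) by rewrite mulr_ge0// ltW.
have -> : 2 * (e / (2 * K2 * (ahi c - alo c) + 1) * K2) * (ahi c - alo c) =
  e * ((2 * (K2 * (ahi c - alo c))) / (2 * (K2 * (ahi c - alo c)) + 1)).
  by field; rewrite gt_eqF//; rlra.
rewrite ler_piMr ?(ltW e0)// ler_pdivrMr; clear -kl; rlra.
Qed.

End arcs.

(** * Closed contours made of four arcs: residue and winding number *)

Section quad.
Context {R : realType}.
Variables (cb cr ct cl : @arc R).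
Hypotheses (okb : arc_ok cb) (okr : arc_ok cr) (okt : arc_ok ct) (okl : arc_ok cl).
Hypotheses (bl : apt cb (alo cb) = apt cl (alo cl)) (br : apt cb (ahi cb) = apt cr (alo cr))
  (tr : apt ct (ahi ct) = apt cr (ahi cr)) (tl : apt ct (alo ct) = apt cl (ahi cl)).

Definition qint (G : R[i] -> R[i]) := aint cb G + aint cr G - aint ct G - aint cl G.

Definition qon : set (R[i]) := [set z | exists c x,
  (c = cb \/ c = cr \/ c = ct \/ c = cl) /\ aon c x /\ z = apt c x].

(** All four arcs are contracted to [w] by the same ratio and the radial integrals cancel at the
    shared corners. Holomorphy is only asked for on the half-open segments from the contour to [w],
    and the winding integral is left to be computed separately. *)
Lemma qint_residue (G : R[i] -> R[i]) (w alpha : R[i]) :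
  (forall z, qon z -> z != w) ->
  (forall z, qon z -> forall r, 0 < r <= 1 -> exists A, cder G (w + r%:C * (z - w)) A) ->
  (forall e, 0 < e -> exists2 d, 0 < d & forall u, u != w -> normc (u - w) < d ->
     normc ((u - w) * G u - alpha) < e) ->
  qint G = alpha * qint (fun u => (u - w)^-1).
Proof.
move=> nw dG res.
have qb x : aon cb x -> qon (apt cb x) by move=> ?; exists cb, x; tauto.
have qr x : aon cr x -> qon (apt cr x) by move=> ?; exists cr, x; tauto.
have qt x : aon ct x -> qon (apt ct x) by move=> ?; exists ct, x; tauto.
have ql x : aon cl x -> qon (apt cl x) by move=> ?; exists cl, x; tauto.
apply/eqP; rewrite -subr_eq0 -normc_eq0 eq_le normc_ge0 andbT.
apply/ler_addgt0Pl => e e0; rewrite addr0.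
have e4 : 0 < e / 4 by rewrite divr_gt0.
have [d1 d10 H1] := aint_residue_limit okb (fun x xc => nw _ (qb x xc)) (fun x xc => dG _ (qb x xc)) res e4.
have [d2 d20 H2] := aint_residue_limit okr (fun x xc => nw _ (qr x xc)) (fun x xc => dG _ (qr x xc)) res e4.
have [d3 d30 H3] := aint_residue_limit okt (fun x xc => nw _ (qt x xc)) (fun x xc => dG _ (qt x xc)) res e4.
have [d4 d40 H4] := aint_residue_limit okl (fun x xc => nw _ (ql x xc)) (fun x xc => dG _ (ql x xc)) res e4.
pose r := Num.min (Num.min d1 d2) (Num.min (Num.min d3 d4) 1) / 2.
have m0 : 0 < Num.min (Num.min d1 d2) (Num.min (Num.min d3 d4) 1).
  by rewrite !lt_min d10 d20 d30 d40 ltr01.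
have r0 : 0 < r by rewrite divr_gt0.
have rm : r < Num.min (Num.min d1 d2) (Num.min (Num.min d3 d4) 1) by rewrite /r; rlra.
move: rm; rewrite !lt_min => /andP[/andP[r1 r2] /andP[/andP[r3 r4] /ltW r5]].
have {}H1 := H1 _ r0 r1 r5; have {}H2 := H2 _ r0 r2 r5.
have {}H3 := H3 _ r0 r3 r5; have {}H4 := H4 _ r0 r4 r5.
rewrite /qint (aint_homothety r0 r5 okb (fun x xc => dG _ (qb x xc))).
rewrite (aint_homothety r0 r5 okr (fun x xc => dG _ (qr x xc))).
rewrite (aint_homothety r0 r5 okt (fun x xc => dG _ (qt x xc))).
rewrite (aint_homothety r0 r5 okl (fun x xc => dG _ (ql x xc))).
rewrite bl br tr tl.
set I1 := cint (alo cb) _ _ in H1 *; set I2 := cint (alo cr) _ _ in H2 *.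
set I3 := cint (alo ct) _ _ in H3 *; set I4 := cint (alo cl) _ _ in H4 *.
set J1 := aint cb _ in H1 *; set J2 := aint cr _ in H2 *.
set J3 := aint ct _ in H3 *; set J4 := aint cl _ in H4 *.
set X1 := rad _ _ _ _; set X2 := rad _ _ _ _; set X3 := rad _ _ _ _; set X4 := rad _ _ _ _.
rewrite (_ : _ - _ = (I1 - alpha * J1) + (I2 - alpha * J2) - (I3 - alpha * J3) - (I4 - alpha * J4)); last by ring.
have t1 := le_normcB ((I1 - alpha * J1) + (I2 - alpha * J2) - (I3 - alpha * J3)) (I4 - alpha * J4).
have t2 := le_normcB ((I1 - alpha * J1) + (I2 - alpha * J2)) (I3 - alpha * J3).
have t3 := le_normcD (I1 - alpha * J1) (I2 - alpha * J2).
clear -H1 H2 H3 H4 t1 t2 t3; rlra.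
Qed.

(** The factor [s] turns the cut of the logarithm away from the arc; it drops out of the
    derivative. *)
Lemma aint_log c (w : R[i]) (s : R[i]) : arc_ok c ->
  (forall x, aon c x -> slit (s * (apt c x - w))) ->
  aint c (fun u => (u - w)^-1) = clog (s * (apt c (ahi c) - w)) - clog (s * (apt c (alo c) - w)).
Proof.
move=> ok sl; have [ab dc cc] := ok.
have nz x : aon c x -> s * (apt c x - w) != 0 by move=> /sl /slit_neq0.
apply: (@cint_FTC _ _ _ (fun x => clog (s * (apt c x - w))) _ ab) => [x xc|].
  have := der_comp (derZ s (derB (dc x xc) (der_cst _ w x))) (cder_clog (sl x xc)).
  congr der; have := nz x xc; rewrite mulf_eq0 negb_or => /andP[s0 a0].
  by field; apply/andP.
apply: cconM => //; apply: ccon_ex => x xc.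
have d : rder (fun x => apt c x - w) x (avel c x - 0) by apply: derB; [exact: dc|exact: der_cst].
eexists; apply: (derV _ d); apply/eqP => z0; have := nz x xc.
by rewrite z0 mulr0 eqxx.
Qed.

(** Only the left arc meets the cut of log (u - w); there log (w - u) is a primitive. The change of
    branch at each of its two ends contributes i pi, and the other terms cancel at the corners. *)
Lemma qint_winding (w : R[i]) :
  (forall x, aon cb x -> slit (apt cb x - w)) ->
  (forall x, aon cr x -> slit (apt cr x - w)) ->
  (forall x, aon ct x -> slit (apt ct x - w)) ->
  (forall x, aon cl x -> complex.Re (apt cl x - w) < 0) ->
  complex.Im (apt cl (alo cl) - w) < 0 -> 0 < complex.Im (apt cl (ahi cl) - w) ->
  qint (fun u => (u - w)^-1) = 0 +i* (2 * pi).
Proof.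
move=> sb sr st sl i0 i1.
have nb x : aon cb x -> slit (1 * (apt cb x - w)) by rewrite mul1r; exact: sb.
have nr x : aon cr x -> slit (1 * (apt cr x - w)) by rewrite mul1r; exact: sr.
have nt x : aon ct x -> slit (1 * (apt ct x - w)) by rewrite mul1r; exact: st.
have nl x : aon cl x -> slit (-1 * (apt cl x - w)).
  by rewrite mulN1r => /sl h; left; rewrite cReN oppr_gt0.
rewrite /qint (aint_log okb nb) (aint_log okr nr) (aint_log okt nt) (aint_log okl nl).
rewrite !mul1r bl br tr tl !mulN1r.
rewrite (clogN i1).
have i0' : 0 < complex.Im (- (apt cl (alo cl) - w)) by rewrite cImN oppr_gt0.
have := clogN i0'; rewrite opprK => ->.
by apply: complex_eqP; rewrite ?ReImE /=; ring.
Qed.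

End quad.

(** * Cauchy's formula and holomorphic parameter integrals *)

Section cauchy_rectangle.
Context {R : realType}.
Implicit Types (G g : R[i] -> R[i]) (w z u h : R[i]) (x y r K : R).

Definition harc x1 x2 y : @arc R := Arc (fun x => x +i* y) (fun=> 1) x1 x2.
Definition varc x y1 y2 : @arc R := Arc (fun y => x +i* y) (fun=> 'i) y1 y2.

Lemma harc_ok x1 x2 y : x1 <= x2 -> arc_ok (harc x1 x2 y).
Proof.
move=> xx; split => //= [x _|x _]; last exact: cnt_cst.
exact: rder_pair (is_derive_id _ _) (is_derive_cst _ _ _).
Qed.

Lemma varc_ok x y1 y2 : y1 <= y2 -> arc_ok (varc x y1 y2).
Proof.
move=> yy; split => //= [y _|y _]; last exact: cnt_cst.
exact: rder_pair (is_derive_cst _ _ _) (is_derive_id _ _).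
Qed.

Definition rect_int x1 x2 y1 y2 : (R[i] -> R[i]) -> R[i] :=
  qint (harc x1 x2 y1) (varc x2 y1 y2) (harc x1 x2 y2) (varc x1 y1 y2).

Definition crect x1 x2 y1 y2 : set (R[i]) :=
  [set z | x1 <= complex.Re z <= x2 /\ y1 <= complex.Im z <= y2].

Lemma cauchy_rect x1 x2 y1 y2 g w :
  x1 < complex.Re w < x2 -> y1 < complex.Im w < y2 ->
  (forall z, crect x1 x2 y1 y2 z -> exists A, cder g z A) ->
  rect_int x1 x2 y1 y2 (fun u => g u * (u - w)^-1) = g w * (0 +i* (2 * pi)).
Proof.
case: w => a b /= /andP[xa ax] /andP[yb by2] dg; set w := a +i* b.
have xx : x1 <= x2 by lra.
have yy : y1 <= y2 by lra.
have okb := harc_ok y1 xx; have okt := harc_ok y2 xx.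
have okr := varc_ok x2 yy; have okl := varc_ok x1 yy.
rewrite /rect_int (@qint_residue _ _ _ _ _ okb okr okt okl _ _ _ _ _ w (g w))//.
- rewrite (@qint_winding _ _ _ _ _ okb okr okt okl)//=.
  + by move=> x _; right; rewrite /= lt_eqF//; lra.
  + by move=> x _; left; rewrite /=; lra.
  + by move=> x _; right; rewrite /= gt_eqF//; lra.
  + by move=> x _; lra.
  + lra.
  + lra.
- move=> z [c [x [[->|[->|[->|->]]] [xc ->]]]]; apply/eqP => -[e1 e2]; rlra.
- move=> z hz r /andP[r0 r1].
  have nz : z != w.
    by move: hz => [c [x [[->|[->|[->|->]]] [xc ->]]]]; apply/eqP => -[e1 e2]; clear -yb e2 ax e1 by2 xa; rlra.
  have hz' : crect x1 x2 y1 y2 z.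
    move: hz => [c [x [hc [xc ->]]]]; move: hc xc; rewrite /aon.
    by case=> [->|[->|[->|->]]] /= /andP[? ?]; split => /=; apply/andP; split; rlra.
  have [A dA] : exists A, cder g (w + r%:C * (z - w)) A.
    apply: dg; move: hz' => []; case: z {hz nz} => p q /= /andP[p1 p2] /andP[q1 q2].
    by split; rewrite /= !mul0r ?subr0 ?addr0; apply/andP; split; rnra.
  have rz : r%:C * (z - w) != 0.
    by rewrite mulf_neq0 ?subr_eq0// -normc_eq0 normc_real normr_eq0 gt_eqF.
  eexists; apply: (derM dA); apply: derV; last first.
    by apply: derB; [exact: der_io|exact: der_cst].
  by rewrite addrC addKr.
- have [A dA] : exists A, cder g w A.
    by apply: dg; split => /=; apply/andP; split; lra.
  move=> e e0; have [d d0 H] := der_cnt dA e0; exists d => // u uw ud.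
  by rewrite mulrCA divff ?subr_eq0// mulr1; apply: H.
Qed.

(** For the real and imaginary parts along the positive reals, the limit is the supremum of t -> P
    (E t) - K t, which no value P (E t) + K t can undercut. In the constant 4, one 2 comes from the
    two parts, the other from passing from h to |h|. *)
Lemma lip_limit (E : R[i] -> R[i]) K r : 0 < r -> 0 <= K ->
  (forall h h', h != 0 -> h' != 0 -> normc h < r -> normc h' < r ->
     normc (E h - E h') <= K * normc (h - h')) ->
  exists a, forall h, h != 0 -> normc h < r -> normc (E h - a) <= 4 * K * normc h.
Proof.
move=> r0 K0 H.
have key (P : R[i] -> R) : (forall u v, `|P u - P v| <= normc (u - v)) ->
    exists a, forall t, 0 < t < r -> `|P (E t%:C) - a| <= K * t.
  move=> HP; pose e t := P (E t%:C).
  have He s t : 0 < s < r -> 0 < t < r -> e s - K * s <= e t + K * t.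
    move=> /andP[s0 sr] /andP[t0 tr].
    have := H s%:C t%:C; rewrite -!normc_eq0 normc_realB !normc_real !normr_eq0.
    rewrite (gt_eqF s0) (gt_eqF t0) (gtr0_norm s0) (gtr0_norm t0) => /(_ isT isT sr tr) h.
    have := le_trans (HP (E s%:C) (E t%:C)) h; rewrite -/(e s) -/(e t) ler_norml => /andP[_ h2].
    have : `|s - t| <= s + t by rewrite ler_norml; apply/andP; split; rlra.
    nra.
  have r2 : 0 < r / 2 < r by apply/andP; split; lra.
  pose S := [set e s - K * s | s in [set s | 0 < s < r]].
  have hS : has_sup S.
    split; first by exists (e (r / 2) - K * (r / 2)), (r / 2).
    by exists (e (r / 2) + K * (r / 2)) => _ [s hs <-]; exact: He.
  exists (sup S) => t ht; rewrite -/(e t) ler_norml.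
  have h1 : e t - K * t <= sup S by apply: ub_le_sup; [exact: hS.2|exists t].
  have h2 : sup S <= e t + K * t.
    by apply: ge_sup; [exact: hS.1|move=> _ [s hs <-]; exact: He].
  by apply/andP; split; rlra.
have [|a1 Ha1] := key (@complex.Re R).
  by move=> u v; rewrite -cReB le_Re_normc.
have [|a2 Ha2] := key (@complex.Im R).
  by move=> u v; rewrite -cImB le_Im_normc.
exists (a1 +i* a2) => h h0 hr.
have n0 : 0 < normc h by rewrite normc_gt0.
have hi : 0 < normc h < r by rewrite n0.
have b1 := Ha1 _ hi; have b2 := Ha2 _ hi.
have b3 : normc (E (normc h)%:C - (a1 +i* a2)) <= 2 * K * normc h.
  apply: (le_trans (normc_le_ReIm _)); rewrite cReB cImB /=; rlra.
have b4 : normc (E h - E (normc h)%:C) <= K * (2 * normc h).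
  apply: (le_trans (H _ _ h0 _ hr _)).
  - by rewrite -normc_eq0 normc_real normr_eq0 gt_eqF.
  - by rewrite normc_real gtr0_norm.
  - rewrite ler_wpM2l//; apply: (le_trans (le_normcB _ _)).
    by rewrite normc_real gtr0_norm//; rlra.
apply: (le_trans (normc_distD _ (E (normc h)%:C) _)); rlra.
Qed.

Lemma rect_int_le x1 x2 y1 y2 G K : x1 <= x2 -> y1 <= y2 ->
  (forall z, qon (harc x1 x2 y1) (varc x2 y1 y2) (harc x1 x2 y2) (varc x1 y1 y2) z ->
     (exists A, cder G z A) /\ normc (G z) <= K) ->
  normc (rect_int x1 x2 y1 y2 G) <= 4 * K * ((x2 - x1) + (y2 - y1)).
Proof.
move=> xx yy H.
have okb := harc_ok y1 xx; have okt := harc_ok y2 xx.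
have okr := varc_ok x2 yy; have okl := varc_ok x1 yy.
have B (c : arc) : arc_ok c ->
    (forall x, aon c x -> (exists A, cder G (apt c x) A) /\ normc (G (apt c x)) <= K) ->
    (forall x, normc (avel c x) = 1) -> normc (aint c G) <= 2 * K * (ahi c - alo c).
  move=> ok Hc v1; have [ab _ cc] := ok; apply: cint_le => //.
    by apply: cconM => //; apply: ccon_arc => // x /Hc[].
  by move=> x /Hc[_]; rewrite normcM v1 mulr1.
have n1 : normc (1 : R[i]) = 1 by rewrite normc1.
have ni : normc ('i : R[i]) = 1 by rewrite /= expr0n/= add0r expr1n sqrtr1.
have b1 : normc (aint (harc x1 x2 y1) G) <= 2 * K * (x2 - x1).
  by apply: B => // x xc; apply: H; do 2 eexists; split; [left|split; [exact: xc|]].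
have b2 : normc (aint (varc x2 y1 y2) G) <= 2 * K * (y2 - y1).
  by apply: B => // x xc; apply: H; do 2 eexists; split; [right; left|split; [exact: xc|]].
have b3 : normc (aint (harc x1 x2 y2) G) <= 2 * K * (x2 - x1).
  by apply: B => // x xc; apply: H; do 2 eexists; split; [right; right; left|split; [exact: xc|]].
have b4 : normc (aint (varc x1 y1 y2) G) <= 2 * K * (y2 - y1).
  by apply: B => // x xc; apply: H; do 2 eexists; split; [right; right; right|split; [exact: xc|]].
rewrite /rect_int /qint.
set I1 := aint _ _ in b1 *; set I2 := aint _ _ in b2 *.
set I3 := aint _ _ in b3 *; set I4 := aint _ _ in b4 *.
have t1 := le_normcB (I1 + I2 - I3) I4; have t2 := le_normcB (I1 + I2) I3.
have t3 := le_normcD I1 I2; rlra.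
Qed.

Lemma rect_int_lin x1 x2 y1 y2 G1 G2 (a b : R[i]) : x1 <= x2 -> y1 <= y2 ->
  (forall z, qon (harc x1 x2 y1) (varc x2 y1 y2) (harc x1 x2 y2) (varc x1 y1 y2) z ->
     (exists A, cder G1 z A) /\ (exists A, cder G2 z A)) ->
  rect_int x1 x2 y1 y2 (fun u => a * G1 u + b * G2 u) =
  a * rect_int x1 x2 y1 y2 G1 + b * rect_int x1 x2 y1 y2 G2.
Proof.
move=> xx yy H.
have okb := harc_ok y1 xx; have okt := harc_ok y2 xx.
have okr := varc_ok x2 yy; have okl := varc_ok x1 yy.
have L (c : arc) : arc_ok c ->
    (forall x, aon c x -> (exists A, cder G1 (apt c x) A) /\ (exists A, cder G2 (apt c x) A)) ->
    aint c (fun u => a * G1 u + b * G2 u) = a * aint c G1 + b * aint c G2.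
  move=> ok Hc; have [ab _ cc] := ok.
  have c1 : ccon (alo c) (ahi c) (fun x => G1 (apt c x) * avel c x).
    by apply: cconM => //; apply: ccon_arc => // x /Hc[].
  have c2 : ccon (alo c) (ahi c) (fun x => G2 (apt c x) * avel c x).
    by apply: cconM => //; apply: ccon_arc => // x /Hc[].
  rewrite /aint -!cintZ// -cintD//; [|exact: cconZ..].
  by apply: eq_cint => x _; ring.
rewrite /rect_int /qint.
rewrite (L _ okb); last by move=> x xc; apply: H; do 2 eexists; split; [left|split; [exact: xc|]].
rewrite (L _ okr); last by move=> x xc; apply: H; do 2 eexists; split; [right; left|split; [exact: xc|]].
rewrite (L _ okt); last by move=> x xc; apply: H; do 2 eexists; split; [right; right; left|split; [exact: xc|]].
rewrite (L _ okl); last by move=> x xc; apply: H; do 2 eexists; split; [right; right; right|split; [exact: xc|]].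
by move: (aint _ _) (aint _ _) (aint _ _) (aint _ _) (aint _ _) (aint _ _) (aint _ _) (aint _ _) => *; ring.
Qed.

Definition csquare w r := crect (complex.Re w - r) (complex.Re w + r)
  (complex.Im w - r) (complex.Im w + r).

Lemma csquareP w r h : normc h <= r -> csquare w r (w + h).
Proof.
move=> hr; have := le_Re_normc h; have := le_Im_normc h.
by rewrite !ler_norml => /andP[? ?] /andP[? ?]; split; rewrite ?cReD ?cImD; apply/andP; split; lra.
Qed.

(** Up to 2 pi i, Cauchy's formula writes the difference of the two quotients as the integral around
    the square of g(u) (h - h') / ((u - w) (u - w - h) (u - w - h')). The bound involves [g] only
    through its supremum, so it is uniform over families. *)
Lemma quotient_lipschitz g w r B : 0 < r ->
  (forall z, csquare w r z -> (exists A, cder g z A) /\ normc (g z) <= B) ->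
  forall h h', h != 0 -> h' != 0 -> normc h < r / 2 -> normc h' < r / 2 ->
  normc ((g (w + h) - g w) / h - (g (w + h') - g w) / h') <= 64 * B / r ^+ 2 * normc (h - h').
Proof.
move=> r0 Hg h h' h0 h0' hr hr'.
have B0 : 0 <= B.
  have [|_] := Hg (w + 0); first by apply: csquareP; rewrite normc0 ltW.
  by apply: le_trans; exact: normc_ge0.
pose x1 := complex.Re w - r; pose x2 := complex.Re w + r.
pose y1 := complex.Im w - r; pose y2 := complex.Im w + r.
have xx : x1 <= x2 by rewrite /x1 /x2; lra.
have yy : y1 <= y2 by rewrite /y1 /y2; lra.
pose tpi : R[i] := 0 +i* (2 * pi).
pose J k := rect_int x1 x2 y1 y2 (fun u => g u * (u - (w + k))^-1).
have HJ k : normc k < r / 2 -> J k = g (w + k) * tpi.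
  move=> kr; have := le_Re_normc k; have := le_Im_normc k.
  rewrite !ler_norml => /andP[? ?] /andP[? ?].
  apply: cauchy_rect; rewrite ?cReD ?cImD ?/x1 ?/x2 ?/y1 ?/y2; try (by apply/andP; split; rlra).
  by move=> z /Hg[].
have qfar z : qon (harc x1 x2 y1) (varc x2 y1 y2) (harc x1 x2 y2) (varc x1 y1 y2) z ->
   csquare w r z /\ r <= normc (z - w).
  case=> c [x [hc [xc ->]]].
  have HR v : r <= `|complex.Re v| -> r <= normc v by move=> /le_trans; apply; exact: le_Re_normc.
  have HI v : r <= `|complex.Im v| -> r <= normc v by move=> /le_trans; apply; exact: le_Im_normc.
  move: hc xc; rewrite /aon; case=> [->|[->|[->|->]]] /= /andP[p1 p2].
  - split; first by split => /=; apply/andP; split; rewrite /y1 /x1 /x2 in p1 p2 *; rlra.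
    apply: HI; rewrite cImB /= /y1 distrC (_ : _ - _ = r); last by ring.
    exact: ler_norm.
  - split; first by split => /=; apply/andP; split; rewrite /x2 /y1 /y2 in p1 p2 *; rlra.
    apply: HR; rewrite cReB /= /x2 (_ : _ - _ = r); last by ring.
    exact: ler_norm.
  - split; first by split => /=; apply/andP; split; rewrite /y2 /x1 /x2 in p1 p2 *; rlra.
    apply: HI; rewrite cImB /= /y2 (_ : _ - _ = r); last by ring.
    exact: ler_norm.
  - split; first by split => /=; apply/andP; split; rewrite /x1 /y1 /y2 in p1 p2 *; clear -r0 p1 p2; rlra.
    apply: HR; rewrite cReB /= /x1 distrC (_ : _ - _ = r); last by ring.
    exact: ler_norm.
have far k z : normc k < r / 2 -> r <= normc (z - w) -> r / 2 <= normc (z - (w + k)).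
  by move=> kr zr; have := le_normc_sub (z - w) k; rewrite (_ : z - w - k = z - (w + k)); [rlra|ring].
have nzk k z : normc k < r / 2 -> r <= normc (z - w) -> z - (w + k) != 0.
  by move=> kr zr; rewrite -normc_gt0; have := far _ _ kr zr; rlra.
have dJ k z : normc k < r / 2 ->
    qon (harc x1 x2 y1) (varc x2 y1 y2) (harc x1 x2 y2) (varc x1 y1 y2) z ->
    exists A, cder (fun u => g u * (u - (w + k))^-1) z A.
  move=> kr /qfar[zq zr]; have [[A dA] _] := Hg _ zq.
  eexists; apply: (derM dA); apply: derV; first exact: nzk.
  by apply: derB; [exact: der_io|exact: der_cst].
have k00 : normc (0 : R[i]) < r / 2 by rewrite normc0 divr_gt0.
pose G u := g u * (h - h') / ((u - w) * (u - (w + h)) * (u - (w + h'))).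
have EG u : r <= normc (u - w) -> G u =
   1 * (h^-1 * (g u * (u - (w + h))^-1) + (- h'^-1) * (g u * (u - (w + h'))^-1)) +
    (h'^-1 - h^-1) * (g u * (u - (w + 0))^-1).
  move=> ur; rewrite /G addr0; have a1 := nzk _ _ hr ur; have a2 := nzk _ _ hr' ur.
  have a3 := nzk _ _ k00 ur; rewrite addr0 in a3.
  by field; rewrite a1 a2 a3 h0 h0'.
have tpn : normc tpi = 2 * pi.
  by rewrite /tpi /= expr0n/= add0r sqrtr_sqr ger0_norm// mulr_ge0// pi_ge0.
have tp0 : tpi != 0 by rewrite -normc_gt0 tpn mulr_gt0// pi_gt0.
have ED : ((g (w + h) - g w) / h - (g (w + h') - g w) / h') * tpi =
   rect_int x1 x2 y1 y2 (fun u => 1 * (h^-1 * (g u * (u - (w + h))^-1) + (- h'^-1) * (g u * (u - (w + h'))^-1)) +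
    (h'^-1 - h^-1) * (g u * (u - (w + 0))^-1)).
  rewrite rect_int_lin//; last first.
    move=> z zq; split; last exact: dJ.
    have [A dA] := dJ _ _ hr zq; have [A' dA'] := dJ _ _ hr' zq.
    by eexists; apply: derD; apply: derZ; eassumption.
  rewrite rect_int_lin//; last by move=> z zq; split; exact: dJ.
  rewrite -/(J h) -/(J h') -/(J 0) !HJ// addr0; field.
  by rewrite h0 h0'.
have p2 := pi_ge2 R.
have NB : normc (((g (w + h) - g w) / h - (g (w + h') - g w) / h') * tpi) <=
    4 * (B * normc (h - h') / (r * (r / 2) * (r / 2))) * ((x2 - x1) + (y2 - y1)).
  rewrite ED; apply: rect_int_le => // z zq; have [zs zr] := qfar _ zq; split.
    have [A dA] := dJ _ _ hr zq; have [A' dA'] := dJ _ _ hr' zq; have [A2 dA2] := dJ _ _ k00 zq.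
    by eexists; apply: derD; apply: derZ; last eassumption; apply: derD; apply: derZ; eassumption.
  rewrite -EG// /G normcM normcV !normcM.
  have [_ gB] := Hg _ zs; have f1 := far _ _ hr zr; have f2 := far _ _ hr' zr.
  have r2 : 0 < r / 2 by rewrite divr_gt0.
  apply: ler_pM; rewrite ?mulr_ge0 ?invr_ge0 ?mulr_ge0 ?normc_ge0//.
    by rewrite ler_wpM2r ?normc_ge0.
  rewrite lef_pV2 ?posrE ?mulr_gt0//; try (clear -r0 zr f1 f2; rlra).
  by rewrite !ler_pM ?mulr_ge0 ?(ltW r2) ?(ltW r0).
rewrite normcM tpn in NB.
have E : 4 * (B * normc (h - h') / (r * (r / 2) * (r / 2))) * ((x2 - x1) + (y2 - y1)) =
   64 * B / r ^+ 2 * normc (h - h').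
  by rewrite /x1 /x2 /y1 /y2; field; rewrite gt_eqF.
rewrite E in NB; apply: le_trans NB.
by rewrite ler_peMr ?normc_ge0//; rlra.
Qed.

(** By [quotient_lipschitz] the difference quotients of the integral are Lipschitz in the increment,
    hence converge. The integrand has to be continuous in the parameter, but not its derivative in
    z. *)
Lemma param_holo (al be : R) (g : R -> R[i] -> R[i]) w r B : al <= be -> 0 < r ->
  (forall t z, al <= t <= be -> csquare w r z -> (exists A, cder (g t) z A) /\ normc (g t z) <= B) ->
  (forall z, csquare w r z -> ccon al be (g ^~ z)) ->
  exists A, cder (fun u => cint al be (g ^~ u)) w A.
Proof.
move=> ab r0 Hg cg.
have B0 : 0 <= B.
  have [||_] := Hg al (w + 0); first by rewrite lexx.
    by apply: csquareP; rewrite normc0 ltW.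
  by apply: le_trans; exact: normc_ge0.
have r2 : 0 < r / 2 by rewrite divr_gt0.
have K0 : 0 <= 64 * B / r ^+ 2 by rewrite divr_ge0 ?sqr_ge0// mulr_ge0.
pose Phi u := cint al be (g ^~ u).
have cgh h : normc h < r / 2 -> ccon al be (g ^~ (w + h)).
  by move=> hr; apply: cg; apply: csquareP; lra.
have cg0 : ccon al be (g ^~ w) by have := @cgh 0; rewrite addr0 normc0; apply.
have EP h : normc h < r / 2 -> (Phi (w + h) - Phi w) / h =
    cint al be (fun t => h^-1 * (g t (w + h) - g t w)).
  by move=> hr; rewrite mulrC cintZ ?cintB//; [exact: cgh|apply: cconB => //; exact: cgh].
have [||a Ha] := @lip_limit (fun h => (Phi (w + h) - Phi w) / h) (2 * (64 * B / r ^+ 2) * (be - al)) (r / 2) r2.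
  by rewrite mulr_ge0 ?subr_ge0// mulr_ge0.
  move=> h h' h0 h0' hr hr'; rewrite !EP//.
  have c1 : ccon al be (fun t => h^-1 * (g t (w + h) - g t w)).
    by apply: cconZ; apply: cconB => //; exact: cgh.
  have c2 : ccon al be (fun t => h'^-1 * (g t (w + h') - g t w)).
    by apply: cconZ; apply: cconB => //; exact: cgh.
  rewrite -cintB//.
  rewrite [leRHS](_ : _ = 2 * (64 * B / r ^+ 2 * normc (h - h')) * (be - al)); last by ring.
  apply: cint_le => //; first exact: cconB.
  move=> t tab; rewrite mulrC [h'^-1 * _]mulrC.
  by apply: quotient_lipschitz => // z; exact: Hg.
exists a => e e0; set K := 2 * _ * _ in Ha.
have KK : 0 <= K by rewrite /K mulr_ge0 ?subr_ge0// mulr_ge0.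
exists (Num.min (r / 2) (e / (4 * K + 1))) => [|y].
  by rewrite lt_min r2 divr_gt0//; lra.
rewrite lt_min => /andP[y1]; rewrite ltr_pdivlMr => [y2|]; last lra.
have [->|yw] := eqVneq y w.
  by rewrite !subrr mulr0 subrr normc0 mulr0.
have h0 : y - w != 0 by rewrite subr_eq0.
have := Ha _ h0 y1; rewrite [w + _]addrC subrK => H.
have -> : cint al be (g ^~ y) - cint al be (g ^~ w) - a * (y - w) =
    ((Phi y - Phi w) / (y - w) - a) * (y - w) by rewrite /Phi; field.
rewrite normcM ler_wpM2r ?normc_ge0//; apply: (le_trans H).
have := normc_ge0 (y - w); rlra.
Qed.

End cauchy_rectangle.

(** * Changes of variables in Lebesgue measure *)

Section affine_change.
Context {R : realType}.
Local Notation mR := (measurableTypeR R).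
Local Notation mu := (@lebesgue_measure R).
Local Open Scope ereal_scope.

Lemma measurable_affine (k b : R) : measurable_fun [set: mR] (fun x : mR => (k * x + b)%R : mR).
Proof.
apply: (@measurable_funD _ mR R setT (fun x : R => k * x)%R (cst b)) => //.
by apply: (@measurable_funM _ mR R setT (cst k) id).
Qed.

(** Lebesgue measure is determined by its values on half-open intervals, and the image measure under
    x -> k x + b, multiplied by k, has the same ones. *)
Lemma ge0_integral_affine (k b : R) (h : mR -> \bar R) : (0 < k)%R ->
  measurable_fun setT h -> (forall x, 0 <= h x) ->
  \int[mu]_x h x = k%:E * \int[mu]_x h (k * x + b)%R.
Proof.
move=> k0 mh h0; pose phi : mR -> mR := fun x => (k * x + b)%R.
have mphi : measurable_fun setT phi by exact: measurable_affine.
pose kn : {nonneg R} := NngNum (ltW k0).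
pose pm : {measure set mR -> \bar R} :=
  measure_function_pushforward__canonical__measure_function_Measure mu mphi.
pose m : {measure set mR -> \bar R} := mscale kn pm.
have E A : measurable A -> mu A = m A.
  apply: lebesgue_measure_unique => X [[x y] /= xy <-].
  rewrite /m /=/mscale/= /pushforward.
  have -> : phi @^-1` [set` `]x, y]%R] = [set` `](x - b) / k, (y - b) / k]%R].
    apply/seteqP; split => t /=; rewrite !in_itv/= /phi ltr_pdivrMr// ler_pdivlMr//;
      by rewrite ltrBlDr lerBrDr (mulrC t).
  rewrite !lebesgue_measure_itv/= !lte_fin ltr_pM2r ?invr_gt0// ltrD2r.
  case: ifP => _; last by rewrite mule0.
  by rewrite -!EFinB -EFinM; congr EFin; field; rewrite gt_eqF.
have {1}-> : \int[mu]_x h x = \int[m]_x h x by apply: eq_measure_integral => A mA _; exact: E.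
rewrite (@ge0_integral_mscale _ _ _ pm setT measurableT kn h)//.
by rewrite ge0_integral_pushforward.
Qed.

Lemma ge0_integral_translate (b : R) (h : mR -> \bar R) :
  measurable_fun setT h -> (forall x, 0 <= h x) ->
  \int[mu]_x h (x + b)%R = \int[mu]_x h x.
Proof.
move=> mh h0; rewrite [RHS](@ge0_integral_affine 1 b)// mul1e.
by apply: eq_integral => x _; rewrite mul1r.
Qed.

Local Notation mR2 := (mR * mR)%type.

Lemma measurable_shear1 (t : R) : measurable_fun [set: mR2] (fun p : mR2 => (p.1 + t * p.2, p.2)%R : mR2).
Proof.
apply: measurable_fun_pair => //; apply: (@measurable_funD _ _ R setT fst (fun p : mR2 => t * p.2)%R) => //.
by apply: (@measurable_funM _ _ R setT (cst t) snd).
Qed.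

Lemma measurable_shear2 (t : R) : measurable_fun [set: mR2] (fun p : mR2 => (p.1, p.2 + t * p.1)%R : mR2).
Proof.
apply: measurable_fun_pair => //; apply: (@measurable_funD _ _ R setT snd (fun p : mR2 => t * p.1)%R) => //.
by apply: (@measurable_funM _ _ R setT (cst t) fst).
Qed.

Lemma ge0_integral_shear1 (t : R) (h : mR2 -> \bar R) :
  measurable_fun setT h -> (forall x, 0 <= h x) ->
  \int[lebesgue2]_p h (p.1 + t * p.2, p.2)%R = \int[lebesgue2]_p h p.
Proof.
move=> mh h0.
rewrite (@fubini_tonelli2 _ _ _ _ _ mu mu _ _ _)//; last first.
  by apply: measurableT_comp => //; exact: measurable_shear1.
rewrite (@fubini_tonelli2 _ _ _ _ _ mu mu h mh h0).
apply: eq_integral => y _; rewrite /fubini_G/=.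
by apply: (@ge0_integral_translate _ (fun x => h (x, y))) => //; exact: measurable_fun_pair1.
Qed.

Lemma ge0_integral_shear2 (t : R) (h : mR2 -> \bar R) :
  measurable_fun setT h -> (forall x, 0 <= h x) ->
  \int[lebesgue2]_p h (p.1, p.2 + t * p.1)%R = \int[lebesgue2]_p h p.
Proof.
move=> mh h0.
rewrite (@fubini_tonelli1 _ _ _ _ _ mu mu _ _ _)//; last first.
  by apply: measurableT_comp => //; exact: measurable_shear2.
rewrite (@fubini_tonelli1 _ _ _ _ _ mu mu h mh h0).
apply: eq_integral => x _; rewrite /fubini_F/=.
by apply: (@ge0_integral_translate _ (fun y => h (x, y))) => //; exact: measurable_fun_pair2.
Qed.

Definition rot2 (c s : R) (p : mR2) : mR2 := (c * p.1 - s * p.2, s * p.1 + c * p.2)%R.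

Lemma measurable_rot2 c s : measurable_fun setT (rot2 c s).
Proof.
apply: measurable_fun_pair.
  apply: (@measurable_funB _ _ R setT (fun p : mR2 => c * p.1)%R (fun p : mR2 => s * p.2)%R).
    by apply: (@measurable_funM _ _ R setT (cst c) fst).
  by apply: (@measurable_funM _ _ R setT (cst s) snd).
apply: (@measurable_funD _ _ R setT (fun p : mR2 => s * p.1)%R (fun p : mR2 => c * p.2)%R).
  by apply: (@measurable_funM _ _ R setT (cst s) fst).
by apply: (@measurable_funM _ _ R setT (cst c) snd).
Qed.

(* A plane rotation other than the half turn is a product of three shears. *)
Lemma ge0_integral_rot2 c s (h : mR2 -> \bar R) : (c ^+ 2 + s ^+ 2 = 1)%R ->
  measurable_fun setT h -> (forall x, 0 <= h x) ->
  \int[lebesgue2]_p h (rot2 c s p) = \int[lebesgue2]_p h p.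
Proof.
suff H c' s' (h' : mR2 -> \bar R) : (c' ^+ 2 + s' ^+ 2 = 1)%R -> c' != (-1)%R ->
    measurable_fun setT h' -> (forall x, 0 <= h' x) ->
    \int[lebesgue2]_p h' (rot2 c' s' p) = \int[lebesgue2]_p h' p.
  move=> cs mh h0; have [c1|c1] := eqVneq c (-1)%R; last exact: H.
  have s0 : s = 0%R.
    by apply/eqP; rewrite -sqrf_eq0; apply/eqP; move: cs; rewrite c1; lra.
  (* The half turn is the square of the quarter turn, which the other case covers. *)
  have e : (0 ^+ 2 + 1 ^+ 2 = 1 :> R)%R by rewrite expr0n/= add0r expr1n.
  have n1 : (0 != -1 :> R)%R by rewrite eq_sym oppr_eq0 oner_eq0.
  rewrite -(H 0%R 1%R h e n1 mh h0) -(H 0%R 1%R (h \o rot2 0 1) e n1)//.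
    apply: eq_integral => p _ /=; congr h; rewrite /rot2/= c1 s0.
    by congr pair; ring.
    by apply: measurableT_comp => //; exact: measurable_rot2.
  by move=> x /=.
move=> cs c1 mh h0 {c s h}; have c10 : (1 + c' != 0)%R by rewrite addrC addr_eq0.
(* The tangent of half the angle: horizontal shears by -t around a vertical shear by the sine
   compose to the rotation. *)
pose t := (s' / (1 + c'))%R.
pose h1 := fun p : mR2 => h' (p.1 + (- t) * p.2, p.2)%R.
have mh1 : measurable_fun setT h1 by apply: measurableT_comp => //; exact: measurable_shear1.
pose h2 := fun p : mR2 => h1 (p.1, p.2 + s' * p.1)%R.
have mh2 : measurable_fun setT h2 by apply: (measurableT_comp mh1); exact: measurable_shear2.
have h10 x : 0 <= h1 x by exact: h0.
have h20 x : 0 <= h2 x by exact: h0.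
rewrite -(@ge0_integral_shear1 (- t) h')// -/(h1 _).
rewrite -(@ge0_integral_shear2 s' h1)//.
rewrite -(@ge0_integral_shear1 (- t) h2)//.
apply: eq_integral => p _; rewrite /h2 /h1 /rot2 /=; congr h'.
have e : (t * s' = 1 - c')%R.
  rewrite /t mulrAC -expr2 (_ : s' ^+ 2 = (1 - c') * (1 + c'))%R; last by move: cs; lra.
  by rewrite mulfK.
have e2 : (t * c' = s' - t)%R.
  by rewrite /t; field.
have e3 : (s' = t * c' + t)%R by rewrite e2 subrK.
clearbody t; congr pair.
  transitivity (p.1 - (t + t) * p.2 - (t * s') * p.1 + t * (t * s') * p.2)%R; last by ring.
  by rewrite e e3; ring.
transitivity (p.2 + s' * p.1 - (t * s') * p.2)%R; last by ring.
by rewrite e; ring.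
Qed.

End affine_change.

Section C2_measure.
Context {R : realType}.
Local Notation mR := (measurableTypeR R).
Local Notation mu := (@lebesgue_measure R).
Local Open Scope ereal_scope.
Definition mR4 : measurableType _ := ((mR * mR) * (mR * mR))%type.

Lemma ge0_integral_scale2 (k : R) (h : (mR * mR)%type -> \bar R) : (0 < k)%R ->
  measurable_fun setT h -> (forall x, 0 <= h x) ->
  \int[lebesgue2]_p h p = (k ^+ 2)%:E * \int[lebesgue2]_p h (k * p.1, k * p.2)%R.
Proof.
move=> k0 mh h0.
have m1 : measurable_fun [set: (mR * mR)%type] (fun p : (mR * mR)%type => (k * p.1, k * p.2)%R : (mR * mR)%type).
  apply: measurable_fun_pair.
    by apply: (@measurable_funM _ _ R setT (cst k) fst).
  by apply: (@measurable_funM _ _ R setT (cst k) snd).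
rewrite (@fubini_tonelli1 _ _ _ _ _ mu mu h mh h0).
rewrite (@fubini_tonelli1 _ _ _ _ _ mu mu _ _ _)//; last exact: measurableT_comp.
rewrite (@ge0_integral_affine _ k 0 _ k0); last 2 first.
- exact: measurable_fun_fubini_tonelli_F.
- by move=> x; exact: integral_ge0.
rewrite expr2 EFinM -muleA; congr (_ * _).
rewrite -ge0_integralZl//; last 3 first.
- apply: measurable_fun_fubini_tonelli_F => //; exact: measurableT_comp.
- by move=> x _; exact: integral_ge0.
- by rewrite lee_fin ltW.
apply: eq_integral => x _; rewrite /fubini_F/= addr0.
rewrite (@ge0_integral_affine _ k 0 (fun y => h ((k * x)%R, y)))//; last exact: measurable_fun_pair2.
by congr (_ * _); apply: eq_integral => y _; rewrite addr0.
Qed.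

Lemma ge0_integral_C2_scale (k : R) (h : mR4 -> \bar R) : (0 < k)%R ->
  measurable_fun setT h -> (forall x, 0 <= h x) ->
  \int[lebesgueC2]_p h p =
  (k ^+ 2)%:E * \int[lebesgueC2]_p h ((k * p.1.1, k * p.1.2)%R, p.2).
Proof.
move=> k0 mh h0.
have m1 : measurable_fun [set: mR4] (fun p : mR4 => ((k * p.1.1, k * p.1.2)%R, p.2) : mR4).
  apply: measurable_fun_pair; last exact: measurable_snd.
  apply: measurable_fun_pair.
    apply: (@measurable_funM _ mR4 R setT (cst k) (fun p => p.1.1)) => //.
    by apply: (measurableT_comp measurable_fst); exact: measurable_fst.
  apply: (@measurable_funM _ mR4 R setT (cst k) (fun p => p.1.2)) => //.
  by apply: (measurableT_comp measurable_snd); exact: measurable_fst.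
pose h' : mR4 -> \bar R := fun p => h ((k * p.1.1, k * p.1.2)%R, p.2).
have mh' : measurable_fun setT h' by exact: (measurableT_comp mh m1).
have h'0 x : 0 <= h' x by exact: h0.
rewrite -[X in _ * X]/(\int[lebesgueC2]_p h' p).
rewrite (@fubini_tonelli2 _ _ _ _ _ lebesgue2 lebesgue2 h)//.
rewrite (@fubini_tonelli2 _ _ _ _ _ lebesgue2 lebesgue2 h')//.
rewrite -ge0_integralZl//; last 3 first.
- exact: measurable_fun_fubini_tonelli_G.
- by move=> x _; exact: integral_ge0.
- by rewrite lee_fin exprn_ge0// ltW.
apply: eq_integral => y _; rewrite /fubini_G.
rewrite (@ge0_integral_scale2 k (fun x => h (x, y)))//; exact: measurable_fun_pair1.
Qed.

Definition dR4 (p q : (R * R) * (R * R)) : R :=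
  (Num.max (Num.max `|p.1.1 - q.1.1| `|p.1.2 - q.1.2|)
    (Num.max `|p.2.1 - q.2.1| `|p.2.2 - q.2.2|))%R.

Lemma dR4_lt p q e : (dR4 p q < e)%R <->
  [/\ (`|p.1.1 - q.1.1| < e)%R, (`|p.1.2 - q.1.2| < e)%R,
      (`|p.2.1 - q.2.1| < e)%R & (`|p.2.2 - q.2.2| < e)%R].
Proof.
rewrite /dR4 !gt_max; split; first by move=> /andP[/andP[? ?] /andP[? ?]].
by case=> -> -> -> ->.
Qed.

Lemma measurable_box (q : mR4) (e : R) : measurable ([set p | (dR4 p q < e)%R] : set mR4).
Proof.
have H (g : mR4 -> mR) (a : R) : measurable_fun setT g -> measurable [set p | (`|g p - a| < e)%R].
  move=> mg; rewrite -[X in measurable X]setTI.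
  have -> : [set p | (`|g p - a| < e)%R] = g @^-1` [set` `]a - e, a + e[%R].
    apply/seteqP; split => p /=; rewrite in_itv/= ltr_norml; first by move=> /andP[? ?]; apply/andP; split; lra.
    by move=> /andP[? ?]; apply/andP; split; lra.
  exact: mg.
have m11 : measurable_fun setT (fun p : mR4 => p.1.1) by apply: (measurableT_comp measurable_fst); exact: measurable_fst.
have m12 : measurable_fun setT (fun p : mR4 => p.1.2) by apply: (measurableT_comp measurable_snd); exact: measurable_fst.
have m21 : measurable_fun setT (fun p : mR4 => p.2.1) by apply: (measurableT_comp measurable_fst); exact: measurable_snd.
have m22 : measurable_fun setT (fun p : mR4 => p.2.2) by apply: (measurableT_comp measurable_snd); exact: measurable_snd.
rewrite (_ : [set p | _] = [set p | (`|p.1.1 - q.1.1| < e)%R] `&` [set p | (`|p.1.2 - q.1.2| < e)%R] `&`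
   ([set p | (`|p.2.1 - q.2.1| < e)%R] `&` [set p | (`|p.2.2 - q.2.2| < e)%R])).
  by do !apply: measurableI; exact: H.
by apply/seteqP; split => p; [move/dR4_lt => []|move=> /= [[? ?] [? ?]]; apply/dR4_lt].
Qed.

(** The product sigma-algebra is generated by rectangles, not by open sets; an open set belongs to
    it as a countable union of boxes with rational centres and radii 1 / (n + 1). *)
Lemma box_open_measurable (U : set mR4) :
  (forall p, U p -> exists2 e : R, (0 < e)%R & forall q, (dR4 q p < e)%R -> U q) ->
  measurable U.
Proof.
move=> oU.
pose C := (((rat * rat) * (rat * rat)) * nat)%type.
pose ctr (c : C) : mR4 := ((ratr c.1.1.1, ratr c.1.1.2), (ratr c.1.2.1, ratr c.1.2.2)).
pose B (c : C) : set mR4 := [set p | (dR4 p (ctr c) < c.2.+1%:R^-1)%R].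
rewrite (_ : U = \bigcup_(c in [set: C]) (if `[< B c `<=` U >] then B c else set0)).
  apply: countable_bigcupT_measurable; first exact: countableP.
  move=> c; case: ifP => _ //; exact: measurable_box.
apply/seteqP; split=> [p Up|p [c _]]; last by case: ifPn => [/asboolP + ?|//]; apply.
have [e e0 He] := oU _ Up.
have [n Hn] : exists n, (n.+1%:R^-1 < e / 2 :> R)%R.
  exists (Num.bound (e / 2)^-1); rewrite invf_plt ?posrE ?divr_gt0//.
  apply: (lt_trans (archi_boundP _)); first by rewrite invr_ge0 ltW// divr_gt0.
  by rewrite ltr_nat.
have n0 : (0 < n.+1%:R^-1 :> R)%R by rewrite invr_gt0.
have app0 (i x : R) : (0 < i)%R -> exists r : rat, (`|x - ratr r| < i)%R.
  move=> i0; have xx : (x - i < x + i)%R by lra.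
  have [r] := rat_in_itvoo xx; rewrite in_itv/= => /andP[r1 r2].
  by exists r; rewrite ltr_norml; apply/andP; split; rlra.
have app x := app0 _ x n0.
have [r1 h1] := app p.1.1; have [r2 h2] := app p.1.2.
have [r3 h3] := app p.2.1; have [r4 h4] := app p.2.2.
have Bp : B (((r1, r2), (r3, r4)), n) p by apply/dR4_lt.
exists (((r1, r2), (r3, r4)), n) => //; case: ifPn => // /asboolP; case => q.
move=> /dR4_lt[/= q1 q2 q3 q4]; apply: He; apply/dR4_lt.
have tri0 (i x y z : R) : (i < e / 2 -> `|x - z| < i -> `|y - z| < i -> `|x - y| < e)%R.
  move=> ie xz yz; have := ler_distD z x y; rewrite [(`|z - y|)%R]distrC; clear -ie xz yz; rlra.
have tri x y z := @tri0 _ x y z Hn.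
by split; [exact: tri q1 h1|exact: tri q2 h2|exact: tri q3 h3|exact: tri q4 h4].
Qed.

Lemma box_continuous_measurable (U : set mR4) (f : mR4 -> R) :
  (forall p, U p -> exists2 e : R, (0 < e)%R & forall q, (dR4 q p < e)%R -> U q) ->
  (forall p, U p -> forall e : R, (0 < e)%R -> exists2 d : R, (0 < d)%R &
     forall q, U q -> (dR4 q p < d)%R -> (`|f q - f p| < e)%R) ->
  measurable_fun U f.
Proof.
move=> oU cf mU; apply: (measurability _ (RGenOInfty.measurableE R)) => //.
move=> _ [_ [a ->] <-]; apply: box_open_measurable => p [Up].
rewrite /= in_itv/= andbT => ap.
have [e e0 He] := oU _ Up.
have [|d d0 Hd] := cf _ Up (f p - a)%R; first by rewrite subr_gt0.
exists (Num.min e d) => [|q]; first by rewrite lt_min e0.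
rewrite lt_min => /andP[qe qd]; have Uq := He _ qe; split => //=.
by rewrite in_itv/= andbT; have := Hd _ Uq qd; rewrite ltr_norml; lra.
Qed.

End C2_measure.

(** * Square-integrable functions on open sets *)

Section frechet.
Context {R : realType}.
Local Notation C2 := (R[i]^o * R[i]^o)%type.

Definition dC2 (z w : R[i] * R[i]) : R := Num.max (normc (z.1 - w.1)) (normc (z.2 - w.2)).

Lemma dC2_lt z w e : dC2 z w < e <-> normc (z.1 - w.1) < e /\ normc (z.2 - w.2) < e.
Proof. by rewrite /dC2 gt_max; split=> [/andP[]|[-> ->]]. Qed.

Lemma normCE (z : R[i]) : `|z| = (normc z)%:C.
Proof. by case: z => a b; rewrite normc_def. Qed.

(** A C-linear form on C^2 is given by two complex coefficients. This turns Frechet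
    differentiability over the field [R[i]] into an epsilon-delta statement with real radii. *)
Lemma differentiable_partial (f : C2 -> R[i]^o) (z : C2) : differentiable f z ->
  exists a b : R[i], forall e : R, 0 < e -> exists2 d : R, 0 < d &
    forall h1 h2 : R[i], normc h1 < d -> normc h2 < d ->
      normc (f (z.1 + h1, z.2 + h2) - f z - (a * h1 + b * h2)) <= e * Num.max (normc h1) (normc h2).
Proof.
move=> df; exists ('d f z (1, 0)), ('d f z (0, 1)) => e e0.
have eC : 0 < e%:C :> R[i] by rewrite ltcR.
have /eqaddoP/(_ _ eC) := diff_locally df.
move=> /nbhs_ballP[r /= r0 Hr].
have [rr rr0 rE] : exists2 rr : R, 0 < rr & r = rr%:C.
  by move: r0; rewrite ltcE /= => /andP[/eqP i0 r0]; exists (complex.Re r) => //; rewrite [LHS]complexRI i0.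
exists rr => // h1 h2 d1 d2.
have := Hr (h1, h2); rewrite -ball_normE /= => H.
have lin : 'd f z (h1, h2) = 'd f z (1, 0) * h1 + 'd f z (0, 1) * h2.
  have -> : (h1, h2) = h1 *: ((1, 0) : C2) + h2 *: ((0, 1) : C2).
    by congr pair; rewrite /= ?scaler0 ?addr0 ?add0r -[_ *: _]/(_ * _) ?mulr1 ?mulr0 ?addr0 ?add0r.
  rewrite linearD !linearZ /=; rewrite -[_ *: 'd f z _]/(h1 * _) -[h2 *: _]/(h2 * _).
  by rewrite mulrC [X in _ + X]mulrC.
have nE (u v : R[i]) : `|((u, v) : C2)| = (Num.max (normc u) (normc v))%:C.
  rewrite prod_normE /= !normCE; case: (leP (normc u) (normc v)) => uv.
    by rewrite max_r ?lecR.
  by rewrite max_l ?lecR// ltW.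
have {}H := H _.
rewrite sub0r normrN nE rE ltcR gt_max d1 d2 in H.
have E : (f \o +%R^~ z - (cst (f z) + 'd f z)) (h1, h2) =
    f (z.1 + h1, z.2 + h2) - f z - ('d f z (1, 0) * h1 + 'd f z (0, 1) * h2).
  rewrite -lin -[LHS]/(f ((h1, h2) + z) - (f z + 'd f z (h1, h2))) opprD addrA.
  congr (f _ - _ - _); case: z {df lin H Hr} => z1 z2; congr pair; exact: addrC.
by have := H isT; rewrite E normCE -rmorphM lecR.
Qed.

Lemma cder_differentiable (g : R[i]^o -> R[i]^o) (u : R[i]^o) (a : R[i]) : cder g u a -> differentiable g u.
Proof.
move=> dg; apply/derivable1_diffP.
apply/cvg_ex; exists a; apply/cvgrPdist_le => e e0.
have [ee ee0 eE] : exists2 ee : R, 0 < ee & e = ee%:C.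
  by move: e0; rewrite ltcE /= => /andP[/eqP i0 r0]; exists (complex.Re e) => //; rewrite [LHS]complexRI i0.
have [d d0 Hd] := dg _ ee0.
near=> h; have h0 : h != 0 by near: h; exact: nbhs_dnbhs_neq.
have hd : `|h| < d%:C.
  by near: h; apply: dnbhs0_lt; rewrite ltcR.
rewrite normCE ltcR in hd.
rewrite [h *: 1]mulr1 -[h^-1 *: _]/(h^-1 * _) eE normCE lecR.
have := Hd (h + u); rewrite addrK => /(_ hd) H.
have -> : a - h^-1 * (g (h + u) - g u) = - ((g (h + u) - g u - a * h) / h) by field.
by rewrite normcN normcM normcV ler_pdivrMr ?normc_gt0.
Unshelve. all: by end_near.
Qed.

Lemma differentiable_cnt (f : C2 -> R[i]^o) (z : C2) : differentiable f z -> cnt dC2 setT f z.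
Proof.
move=> /differentiable_partial[a [b H]] e e0.
have [d d0 Hd] := H 1 ltr01.
pose K := normc a + normc b + 1.
have K0 : 0 < K by rewrite /K; have := normc_ge0 a; have := normc_ge0 b; lra.
exists (Num.min d (e / K)) => [|y _]; first by rewrite lt_min d0 divr_gt0.
rewrite lt_min => /andP[/dC2_lt[y1 y2]]; rewrite ltr_pdivlMr// => yK.
have := Hd (y.1 - z.1) (y.2 - z.2) y1 y2.
rewrite ![_ + (_ - _)]addrC !subrK -surjective_pairing mul1r -/(dC2 y z) => h.
have t := le_normcD (f y - f z - (a * (y.1 - z.1) + b * (y.2 - z.2))) (a * (y.1 - z.1) + b * (y.2 - z.2)).
rewrite subrK in t.
have t2 := le_normcD (a * (y.1 - z.1)) (b * (y.2 - z.2)); rewrite !normcM in t2.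
have m1 : normc (y.1 - z.1) <= dC2 y z by rewrite /dC2 le_max lexx.
have m2 : normc (y.2 - z.2) <= dC2 y z by rewrite /dC2 le_max lexx orbT.
have a0 := normc_ge0 a; have b0 := normc_ge0 b.
have h1 : normc a * normc (y.1 - z.1) <= normc a * dC2 y z by rewrite ler_wpM2l.
have h2 : normc b * normc (y.2 - z.2) <= normc b * dC2 y z by rewrite ler_wpM2l.
by rewrite /K in yK; rlra.
Qed.

Lemma differentiable_cder1 (f : C2 -> R[i]^o) (z1 z2 : R[i]^o) : differentiable f (z1, z2) ->
  exists a, cder (fun u => f (u, z2)) z1 a.
Proof.
move=> /differentiable_partial[a [b H]]; exists a => e /H[d d0 Hd]; exists d => // y yd.
have := Hd (y - z1) 0 yd; rewrite normc0 => /(_ d0).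
by rewrite /= addr0 mulr0 addr0 [z1 + _]addrC subrK max_l ?normc_ge0.
Qed.

Lemma differentiable_cder2 (f : C2 -> R[i]^o) (z1 z2 : R[i]^o) : differentiable f (z1, z2) ->
  exists a, cder (fun u => f (z1, u)) z2 a.
Proof.
move=> /differentiable_partial[a [b H]]; exists b => e /H[d d0 Hd]; exists d => // y yd.
have := Hd 0 (y - z2); rewrite normc0 => /(_ d0 yd).
by rewrite /= addr0 mulr0 add0r [z2 + _]addrC subrK max_r ?normc_ge0.
Qed.

Definition dopen (D : set (R[i] * R[i])) := forall z, D z ->
  exists2 e : R, 0 < e & forall w, dC2 w z < e -> D w.

Lemma dC2_toC2 p q (e : R) : dR4 p q < e / 2 -> dC2 (toC2 p) (toC2 q) < e.
Proof.
move=> /dR4_lt[h1 h2 h3 h4]; apply/dC2_lt; split;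
  apply: (le_lt_trans (normc_le_ReIm _)); rewrite cReB cImB /=; lra.
Qed.

Lemma dopen_box (D : set (R[i] * R[i])) : dopen D ->
  forall p, D (toC2 p) -> exists2 e : R, 0 < e & forall q, dR4 q p < e -> D (toC2 q).
Proof.
move=> oD p /oD[e e0 He]; exists (e / 2); first by rewrite divr_gt0.
by move=> q qp; apply: He; exact: dC2_toC2.
Qed.

End frechet.

(** * The squared L^2 norm and the closure of a linear span *)

Section L2.
Context {R : realType}.
Local Notation C2 := (R[i]^o * R[i]^o)%type.
Local Notation V := (C2 -> R[i]^o).
Local Notation mR4 := (@mR4 R).
Variable D : set C2.
Hypothesis oD : dopen D.
Let E : set mR4 := toC2 @^-1` D.
Implicit Types (f g h : V).

Lemma measurable_toC2 : measurable E.
Proof. by apply: box_open_measurable => p; exact: dopen_box. Qed.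
Let mE := measurable_toC2.

Definition cmeas f := measurable_fun E (fun p : mR4 => complex.Re (f (toC2 p))) /\
  measurable_fun E (fun p : mR4 => complex.Im (f (toC2 p))).

Lemma cnt_cmeas f : (forall z, D z -> cnt dC2 D f z) -> cmeas f.
Proof.
move=> cf; split; apply: box_continuous_measurable; try (by move=> p; exact: dopen_box);
  move=> p Dp e /(cf _ Dp)[d d0 H]; exists (d / 2); rewrite ?divr_gt0// => q Dq qp.
  by rewrite -cReB (le_lt_trans (le_Re_normc _))// H//; exact: dC2_toC2.
by rewrite -cImB (le_lt_trans (le_Im_normc _))// H//; exact: dC2_toC2.
Qed.

Lemma holomorphic_cmeas f : holomorphic_on D f -> cmeas f.
Proof.
move=> hf; apply: cnt_cmeas => z /hf /differentiable_cnt; exact: cnt_sub.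
Qed.

Lemma cmeasD f g : cmeas f -> cmeas g -> cmeas (f + g).
Proof.
move=> [f1 f2] [g1 g2]; split.
  rewrite (_ : (fun _ => _) = (fun p => complex.Re (f (toC2 p)) + complex.Re (g (toC2 p)))).
    exact: measurable_funD.
  by apply/funext => p; rewrite -cReD.
rewrite (_ : (fun _ => _) = (fun p => complex.Im (f (toC2 p)) + complex.Im (g (toC2 p)))).
  exact: measurable_funD.
by apply/funext => p; rewrite -cImD.
Qed.

Lemma cmeasM f g : cmeas f -> cmeas g -> cmeas (fun z => f z * g z).
Proof.
move=> [f1 f2] [g1 g2]; split.
  rewrite (_ : (fun _ => _) = (fun p => complex.Re (f (toC2 p)) * complex.Re (g (toC2 p)) -
     complex.Im (f (toC2 p)) * complex.Im (g (toC2 p)))).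
    by apply: measurable_funB; exact: measurable_funM.
  by apply/funext => p; rewrite -cReM.
rewrite (_ : (fun _ => _) = (fun p => complex.Re (f (toC2 p)) * complex.Im (g (toC2 p)) +
     complex.Im (f (toC2 p)) * complex.Re (g (toC2 p)))).
  by apply: measurable_funD; exact: measurable_funM.
by apply/funext => p; rewrite -cImM.
Qed.

Lemma cmeas_cst c : cmeas (cst c).
Proof. by split; exact: measurable_cst. Qed.

Lemma cmeasZ c f : cmeas f -> cmeas (c *: f).
Proof. by move=> mf; exact: (cmeasM (cmeas_cst c) mf). Qed.

Lemma cmeasN f : cmeas f -> cmeas (- f).
Proof. by move=> /(cmeasZ (-1)); rewrite scaleN1r. Qed.

Lemma cmeasB f g : cmeas f -> cmeas g -> cmeas (f - g).
Proof. by move=> mf mg; exact: (cmeasD mf (cmeasN mg)). Qed.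

Lemma cmeas_sum n (f : 'I_n -> V) : (forall k, cmeas (f k)) -> cmeas (\sum_(k < n) f k).
Proof.
by move=> mf; apply: (big_ind cmeas (cmeas_cst 0) cmeasD).
Qed.

Lemma cmeas_normc2 f : cmeas f ->
  measurable_fun E (fun p : mR4 => (normc (f (toC2 p)) ^+ 2)%:E).
Proof.
move=> [f1 f2]; apply/measurable_EFinP.
rewrite (_ : (fun _ => _) = (fun p => complex.Re (f (toC2 p)) ^+ 2 + complex.Im (f (toC2 p)) ^+ 2)).
  by apply: measurable_funD; exact: measurable_funX.
by apply/funext => p; rewrite normcE.
Qed.

Lemma eq_cmeas f g : (forall z, D z -> f z = g z) -> cmeas f -> cmeas g.
Proof.
move=> fg [f1 f2]; split.
  by apply: eq_measurable_fun f1 => p; rewrite inE => Ep; rewrite fg.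
by apply: eq_measurable_fun f2 => p; rewrite inE => Ep; rewrite fg.
Qed.

(** The squared norm takes extended values, so that estimates can be written before finiteness is
    known. *)
Definition N2 f : \bar R := (\int[lebesgueC2]_(p in E) (normc (f (toC2 p)) ^+ 2)%:E)%E.

Lemma N2_ge0 f : (0 <= N2 f)%E.
Proof. by apply: integral_ge0 => p _; rewrite lee_fin sqr_ge0. Qed.

Lemma eq_N2 f g : (forall z, D z -> f z = g z) -> N2 f = N2 g.
Proof. by move=> fg; apply: eq_integral => p; rewrite inE => Ep; rewrite fg. Qed.

Lemma N2_le f (G : mR4 -> \bar R) : cmeas f -> measurable_fun E G ->
  (forall p, E p -> ((normc (f (toC2 p)) ^+ 2)%:E <= G p)%E) ->
  (N2 f <= \int[lebesgueC2]_(p in E) G p)%E.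
Proof.
move=> mf mG H; apply: (@ge0_le_integral _ _ _ lebesgueC2 E mE) => //.
  by move=> p _; rewrite lee_fin sqr_ge0.
exact: cmeas_normc2.
Qed.

Lemma normcD_sqr (u v : R[i]) : (normc (u + v) ^+ 2 <= 2 * normc u ^+ 2 + 2 * normc v ^+ 2)%R.
Proof.
have h := le_normcD u v; have := normc_ge0 (u + v); have := sqr_ge0 (normc u - normc v).
by move=> a b; rewrite -subr_ge0; nra.
Qed.

(** The pointwise inequality |u + v|^2 <= 2 |u|^2 + 2 |v|^2 gives a triangle inequality up to
    constants, which is enough for passing to limits. *)
Lemma N2D f g : cmeas f -> cmeas g -> (N2 (f + g)%R <= 2%:E * N2 f + 2%:E * N2 g)%E.
Proof.
move=> mf mg.
have m1 := cmeas_normc2 mf; have m2 := cmeas_normc2 mg.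
have p1 p : E p -> (0 <= (normc (f (toC2 p)) ^+ 2)%:E)%E by rewrite lee_fin sqr_ge0.
have p2 p : E p -> (0 <= (normc (g (toC2 p)) ^+ 2)%:E)%E by rewrite lee_fin sqr_ge0.
rewrite /N2 -!ge0_integralZl// -ge0_integralD//; last 4 first.
- by move=> p Ep; rewrite mule_ge0// p1.
- exact: measurable_funeM.
- by move=> p Ep; rewrite mule_ge0// p2.
- exact: measurable_funeM.
apply: N2_le; first exact: cmeasD.
  by apply: emeasurable_funD; exact: measurable_funeM.
by move=> p Ep; rewrite -!EFinM -EFinD lee_fin; exact: normcD_sqr.
Qed.

Lemma N2_tri f g h : cmeas f -> cmeas g -> cmeas h ->
  (N2 (f - h)%R <= 2%:E * N2 (f - g)%R + 2%:E * N2 (g - h)%R)%E.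
Proof.
move=> mf mg mh; have := N2D (cmeasB mf mg) (cmeasB mg mh).
by rewrite addrA subrK.
Qed.

Lemma N2Z c f : cmeas f -> N2 (c *: f)%R = ((normc c ^+ 2)%:E * N2 f)%E.
Proof.
move=> mf; have m1 := cmeas_normc2 mf.
have p1 p : E p -> (0 <= (normc (f (toC2 p)) ^+ 2)%:E)%E by rewrite lee_fin sqr_ge0.
have k0 : (0 <= (normc c ^+ 2)%:E)%E by rewrite lee_fin sqr_ge0.
rewrite /N2 -ge0_integralZl//.
by apply: eq_integral => p _; rewrite -EFinM -exprMn -normcM.
Qed.

Section approximable.
Variable S : set V.
Hypothesis mS : forall s, S s -> cmeas s.

Lemma lin_span0 : lin_span S 0%R.
Proof. by exists 0%N, (fun=> 0%R), (fun=> 0%R); split => [[]//|]; rewrite big_ord0. Qed.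

Lemma lin_spanD g h : lin_span S g -> lin_span S h -> lin_span S (g + h)%R.
Proof.
move=> [n [c [s [Ss ->]]]] [m [d [t [St ->]]]].
exists (n + m)%N, (fun k : 'I_(n + m)%N => match fintype.split k return R[i] with inl i => c i | inr j => d j end),
  (fun k : 'I_(n + m)%N => match fintype.split k return V with inl i => s i | inr j => t j end).
split; first by move=> k; case: (fintype.split k).
rewrite big_split_ord /=; congr (_ + _)%R; apply: eq_bigr => k _.
  by rewrite -[lshift m k]/(unsplit (inl k)) unsplitK.
by rewrite -[rshift n k]/(unsplit (inr k)) unsplitK.
Qed.

Lemma lin_spanZ c g : lin_span S g -> lin_span S (c *: g)%R.
Proof.
move=> [n [d [s [Ss ->]]]]; exists n, (fun k => c * d k)%R, s; split => //.
by rewrite scaler_sumr; apply: eq_bigr => k _; rewrite scalerA.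
Qed.

Lemma lin_span_cmeas g : lin_span S g -> cmeas g.
Proof.
by move=> [n [c [s [Ss ->]]]]; apply: cmeas_sum => k; apply: cmeasZ; exact: mS.
Qed.

(** Membership in the L^2 closure of the span. Measurability is part of it because every comparison
    of integrals requires it, while the intermediate functions are not tracked as elements of the
    Bergman space. *)
Definition approximable f := cmeas f /\ forall e : R, (0 < e)%R ->
  exists2 g, lin_span S g & (N2 (f - g)%R < e%:E)%E.

Lemma approximable_span g : lin_span S g -> approximable g.
Proof.
move=> Sg; split; first exact: lin_span_cmeas.
move=> e e0; exists g => //; rewrite subrr /N2 (eq_integral (fun=> 0%E)).
  by rewrite integral0 lte_fin.
by move=> p _; rewrite -[X in normc X]/(0 : R[i]) normc0 expr0n.
Qed.

Lemma approximable_lim f : cmeas f ->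
  (forall e : R, (0 < e)%R -> exists2 g, approximable g & (N2 (f - g)%R < e%:E)%E) ->
  approximable f.
Proof.
move=> mf H; split => // e e0; have e4 : (0 < e / 4)%R by rewrite divr_gt0.
have [g [mg ag] fg] := H _ e4; have [h Sh gh] := ag _ e4; exists h => //.
apply: (le_lt_trans (N2_tri mf mg (lin_span_cmeas Sh))).
apply: (@lt_le_trans _ _ (2%:E * (e / 4)%:E + 2%:E * (e / 4)%:E)%E).
  by apply: lteD; rewrite lte_pmul2l.
by rewrite -!EFinM -EFinD lee_fin; lra.
Qed.

Lemma eq_approximable f g : (forall z, D z -> f z = g z) -> approximable f -> approximable g.
Proof.
move=> fg [mf af]; split; first exact: eq_cmeas mf.
move=> e /af[h Sh fh]; exists h => //.
by rewrite -(@eq_N2 (f - h)%R)// => z Dz; rewrite /= -[LHS]/(f z - h z)%R -[RHS]/(g z - h z)%R fg.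
Qed.

Lemma approximableD f g : approximable f -> approximable g -> approximable (f + g)%R.
Proof.
move=> [mf af] [mg ag]; split; first exact: cmeasD.
move=> e e0; have e4 : (0 < e / 4)%R by rewrite divr_gt0.
have [f' Sf ff] := af _ e4; have [g' Sg gg] := ag _ e4.
exists (f' + g')%R; first exact: lin_spanD.
rewrite opprD addrACA.
apply: (le_lt_trans (N2D (cmeasB mf (lin_span_cmeas Sf)) (cmeasB mg (lin_span_cmeas Sg)))).
apply: (@lt_le_trans _ _ (2%:E * (e / 4)%:E + 2%:E * (e / 4)%:E)%E).
  by apply: lteD; rewrite lte_pmul2l.
by rewrite -!EFinM -EFinD lee_fin; lra.
Qed.

Lemma approximableZ c f : approximable f -> approximable (c *: f)%R.
Proof.
move=> [mf af]; split; first exact: cmeasZ.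
move=> e e0; have K0 : (0 < normc c ^+ 2 + 1)%R by have := sqr_ge0 (normc c); lra.
have [g Sg fg] := af _ (divr_gt0 e0 K0); exists (c *: g)%R; first exact: lin_spanZ.
rewrite -scalerBr N2Z; last by apply: cmeasB => //; exact: lin_span_cmeas.
apply: (@le_lt_trans _ _ ((normc c ^+ 2)%:E * (e / (normc c ^+ 2 + 1))%:E)%E).
  by apply: lee_wpmul2l; [rewrite lee_fin sqr_ge0|exact: ltW].
rewrite -EFinM lte_fin mulrCA -[X in (_ < X)%R]mulr1 ltr_pM2l//.
by rewrite ltr_pdivrMr//; lra.
Qed.

Lemma approximable_sum n (f : 'I_n -> V) : (forall k, approximable (f k)) ->
  approximable (\sum_(k < n) f k)%R.
Proof.
by move=> af; apply: (big_ind approximable (approximable_span lin_span0) approximableD).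
Qed.

End approximable.

(** The limit inherits the majorant [G], so |f_n - f|^2 <= 4 G and the dominated convergence theorem
    applies to these differences. *)
Lemma L2_dominated (f_ : nat -> V) f (G : mR4 -> R) :
  (forall n, cmeas (f_ n)) -> cmeas f ->
  (forall z, D z -> forall e : R, (0 < e)%R -> exists N, forall n, (N <= n)%N -> (normc (f_ n z - f z) < e)%R) ->
  lebesgueC2.-integrable E (EFin \o G) ->
  (forall n p, E p -> (normc (f_ n (toC2 p)) ^+ 2 <= G p)%R) ->
  forall e : R, (0 < e)%R -> exists n, (N2 (f - f_ n)%R < e%:E)%E.
Proof.
move=> mf_ mf cv iG domG e e0.
have cv0 z : D z -> (fun n => normc (f_ n z - f z) ^+ 2) @ \oo --> (0 : R)%R.
  move=> Dz; apply/cvgrPdist_lt => d d0.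
  have [|N HN] := cv _ Dz (Num.min d 1); first by rewrite lt_min d0 ltr01.
  exists N => // n /= Nn; have := HN _ Nn; rewrite lt_min => /andP[h1 h2].
  rewrite sub0r normrN ger0_norm ?sqr_ge0//.
  by apply: le_lt_trans h1; rewrite expr2; have := normc_ge0 (f_ n z - f z); nra.
have fG p : E p -> (normc (f (toC2 p)) ^+ 2 <= G p)%R.
  move=> Ep; apply/ler_addgt0Pl => d d0.
  pose K := (normc (f (toC2 p)) * 2 + 3)%R.
  have K0 : (0 < K)%R by rewrite /K; have := normc_ge0 (f (toC2 p)); lra.
  have [|N HN] := cv _ Ep (Num.min 1 (d / K))%R; first by rewrite lt_min ltr01 divr_gt0.
  have := HN N (leqnn _); rewrite lt_min ltr_pdivlMr// => /andP[h1 h2].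
  have := domG N p Ep; have := le_normc_sub (f (toC2 p)) (f_ N (toC2 p)).
  have := le_normc_sub (f_ N (toC2 p)) (f (toC2 p)); rewrite [normc (f _ - f_ _ _)]normcB_sym.
  rewrite /K in h2; move: h1 h2; set a := normc (_ - _).
  have := normc_ge0 (f (toC2 p)); have := normc_ge0 (f_ N (toC2 p)).
  have : 0 <= a by exact: normc_ge0.
  move: (normc (f (toC2 p))) (normc (f_ N (toC2 p))) => u v a0 v0 u0 a1 aK vu uv vG; rnra.
have [|||||_ + _] := @dominated_convergence _ _ _ lebesgueC2 E mE
  (fun n p => (normc (f_ n (toC2 p) - f (toC2 p)) ^+ 2)%:E) (fun=> 0%E) (fun p => (4 * G p)%:E).
- by move=> n; exact: (cmeas_normc2 (cmeasB (mf_ n) mf)).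
- exact: measurable_cst.
- by apply: aeW => p Ep; apply: cvg_EFin; [exact: nearW|exact: cv0].
- rewrite (_ : (fun _ => _) = (fun p => 4%:E * (EFin \o G) p)%E); first exact: integrableZl.
  by apply/funext => p; rewrite EFinM.
- apply: aeW => p n Ep; rewrite gee0_abs ?lee_fin ?sqr_ge0//.
  have := normcD_sqr (f_ n (toC2 p)) (- f (toC2 p)); rewrite normcN.
  by have := fG _ Ep; have := domG n _ Ep; lra.
move=> /fine_cvgP[F /cvgrPdist_lt /(_ _ e0) C].
have [N _ HN] := filterI F C.
have [/= f1 f2] := HN N (leqnn _); exists N.
have E1 : (\int[lebesgueC2]_(p in E) `|(normc (f_ N (toC2 p) - f (toC2 p))%R ^+ 2)%:E - 0|)%E = N2 (f - f_ N)%R.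
  apply: eq_integral => p _; rewrite sube0 gee0_abs ?lee_fin ?sqr_ge0//.
  by rewrite normcB_sym.
rewrite E1 in f1 f2; rewrite sub0r normrN ger0_norm ?fine_ge0 ?N2_ge0// in f2.
by rewrite -(fineK f1) lte_fin.
Qed.

(* Fatou's lemma for the nonnegative functions [2|f_n|^2 + 2|f|^2 - |f - f_n|^2]. *)
Lemma L2_fatou (f_ : nat -> V) f (c : nat -> R) :
  (forall n, cmeas (f_ n)) -> cmeas f ->
  (forall z, D z -> forall e : R, 0 < e -> exists N, forall n, (N <= n)%N -> normc (f_ n z - f z) < e) ->
  (N2 f < +oo)%E -> (forall n, 0 <= c n) -> c n @[n --> \oo] --> (1 : R) ->
  (forall n, N2 (f_ n) <= (c n)%:E * N2 f)%E ->
  forall e : R, 0 < e -> exists n, (N2 (f - f_ n)%R < e%:E)%E.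
Proof.
move=> mf_ mf cv foo c0 c1 fc e e0; apply: contrapT => /forallNP H.
have {}H n : (e%:E <= N2 (f - f_ n)%R)%E by rewrite leNgt; apply/negP/H.
pose a := fine (N2 f).
have aE : N2 f = a%:E by rewrite fineK// ge0_fin_numE// N2_ge0.
have a0 : 0 <= a by apply: fine_ge0; exact: N2_ge0.
pose phi n (p : mR4) : R := 2 * normc (f_ n (toC2 p)) ^+ 2 + 2 * normc (f (toC2 p)) ^+ 2 - normc (f (toC2 p) - f_ n (toC2 p)) ^+ 2.
have phi0 n p : 0 <= phi n p.
  by have := normcD_sqr (f (toC2 p)) (- f_ n (toC2 p)); rewrite normcN /phi; lra.
have mr g : cmeas g -> measurable_fun E (fun p : mR4 => normc (g (toC2 p)) ^+ 2).
  by move=> /cmeas_normc2/measurable_EFinP.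
have mphi n : measurable_fun E (phi n).
  apply: measurable_funB; last by exact: (mr _ (cmeasB mf (mf_ n))).
  apply: measurable_funD.
    by apply: measurable_funM; [exact: measurable_cst|exact: (mr _ (mf_ n))].
  by apply: measurable_funM; [exact: measurable_cst|exact: (mr _ mf)].
have mphiE n : measurable_fun E (fun p => (phi n p)%:E) by apply/measurable_EFinP.
(* If all squared distances were at least e, these integrals would be at most a sequence tending to
   4 a - e, whereas their integrands converge pointwise to 4 |f|^2, of integral 4 a. *)
have Iphi n : (\int[lebesgueC2]_(p in E) (phi n p)%:E <= (2 * (c n * a) + 2 * a - e)%:E)%E.
  have S : (\int[lebesgueC2]_(p in E) (phi n p)%:E + N2 (f - f_ n)%R = 2%:E * N2 (f_ n) + 2%:E * N2 f)%E.
    have m1 := cmeas_normc2 (mf_ n); have m2 := cmeas_normc2 mf.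
    have m3 := cmeas_normc2 (cmeasB mf (mf_ n)).
    have p1 p : E p -> (0 <= (normc (f_ n (toC2 p)) ^+ 2)%:E)%E by rewrite lee_fin sqr_ge0.
    have p2 p : E p -> (0 <= (normc (f (toC2 p)) ^+ 2)%:E)%E by rewrite lee_fin sqr_ge0.
    have p3 p : E p -> (0 <= (normc ((f - f_ n)%R (toC2 p)) ^+ 2)%:E)%E by rewrite lee_fin sqr_ge0.
    have p4 p : E p -> (0 <= (phi n p)%:E)%E by rewrite lee_fin.
    rewrite /N2 -ge0_integralD// -!ge0_integralZl// -ge0_integralD//; last 4 first.
    - by move=> p Ep; rewrite mule_ge0// p1.
    - exact: measurable_funeM.
    - by move=> p Ep; rewrite mule_ge0// p2.
    - exact: measurable_funeM.
    apply: eq_integral => p _; rewrite -EFinD -!EFinM -EFinD; congr EFin.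
    by rewrite /phi -[(f - f_ n) (toC2 p)]/(f (toC2 p) - f_ n (toC2 p)); ring.
  have fn : (N2 (f_ n) <= (c n * a)%:E)%E by rewrite EFinM -aE.
  have S2 : (\int[lebesgueC2]_(p in E) (phi n p)%:E + e%:E <= (2 * (c n * a) + 2 * a)%:E)%E.
    apply: (@le_trans _ _ (\int[lebesgueC2]_(p in E) (phi n p)%:E + N2 (f - f_ n)%R)%E).
      exact: leeD2l.
    rewrite S aE (EFinD (2 * (c n * a))) (EFinM 2 (c n * a)) (EFinM 2 a).
    by apply: leeD2r; apply: lee_wpmul2l; rewrite ?lee_fin.
  by rewrite EFinB leeBrDr.
have := @fatou _ _ _ lebesgueC2 E mE (fun n p => (phi n p)%:E) mphiE (fun n p _ => phi0 n p).
apply/negP; rewrite -ltNge.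
have L1 : (\int[lebesgueC2]_(p in E) limn_einf (fun n => (phi n p)%:E) = (4 * a)%:E)%E.
  rewrite EFinM -aE /N2 -ge0_integralZl//; last 2 first.
  - exact: cmeas_normc2.
  - by move=> p _; rewrite lee_fin sqr_ge0.
  apply: eq_integral => p; rewrite inE => Ep.
  have C : phi n p @[n --> \oo] --> 4 * normc (f (toC2 p)) ^+ 2.
    apply/cvgrPdist_lt => d d0; pose A := normc (f (toC2 p)).
    have A0 : 0 <= A by exact: normc_ge0.
    have K0 : 0 < 4 * A + 5 by rlra.
    have [|N HN] := cv _ Ep (Num.min 1 (d / (4 * A + 5))); first by rewrite lt_min ltr01 divr_gt0.
    exists N => // n /= Nn; have := HN _ Nn; rewrite lt_min ltr_pdivlMr// => /andP[h1 h2].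
    have := le_dist_normc (f_ n (toC2 p)) (f (toC2 p)).
    rewrite /phi [normc (f _ - f_ _ _)]normcB_sym -/A.
    move: h1 h2; set b := normc (_ - _); set B := normc (f_ n _) => b1 bK.
    have b0 : 0 <= b by exact: normc_ge0.
    rewrite !ler_norml => /andP[u1 u2]; rewrite ltr_norml; apply/andP; split; rnra.
  have /cvg_limn_einf_sup[-> _] : (fun n => (phi n p)%:E) @ \oo --> (4 * normc (f (toC2 p)) ^+ 2)%:E.
    by apply: cvg_EFin; [exact: nearW|exact: C].
  by rewrite EFinM.
rewrite L1.
have C2' : (fun n => (2 * (c n * a) + 2 * a - e)%:E) @ \oo --> (4 * a - e)%:E.
  apply: cvg_EFin; first exact: nearW.
  rewrite (_ : 4 * a - e = 2 * (1 * a) + 2 * a - e); last by ring.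
  apply: cvgB; last exact: cvg_cst.
  apply: cvgD; last exact: cvg_cst.
  apply: cvgM; first exact: cvg_cst.
  by apply: cvgM => //; exact: cvg_cst.
apply: (@le_lt_trans _ _ (4 * a - e)%:E); last by rewrite lte_fin; rlra.
rewrite limn_einf_lim -(cvg_lim _ C2')//.
apply: lee_lim; first exact: is_cvg_einfs.
  by apply/cvg_ex; exists (4 * a - e)%:E.
apply: nearW => n; apply: le_trans (Iphi n).
by apply: ereal_inf_lbound; exists n => //=.
Qed.

End L2.

(** * Pointwise bounds for Bergman functions *)

Section mean_value.
Context {R : realType}.
Local Notation mR := (measurableTypeR R).
Local Notation mu := (@lebesgue_measure R).
Local Notation mR2 := (mR * mR)%type.

(** Otherwise the integral over the interval would reach I + d; the slack [d] makes the
    contradiction strict. *)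
Lemma exists_below_mean (V : mR -> \bar R) (a b I d : R) : a < b -> 0 < d ->
  measurable_fun setT V -> (forall x, 0 <= V x)%E ->
  (\int[mu]_x V x <= I%:E)%E -> exists2 x, a <= x <= b & (V x <= ((I + d) / (b - a))%:E)%E.
Proof.
move=> ab d0 mV V0 VI; apply: contrapT => H.
have {}H x : a <= x <= b -> (((I + d) / (b - a))%:E <= V x)%E.
  by move=> xab; rewrite leNgt; apply/negP => /ltW h; apply: H; exists x.
have : (\int[mu]_(x in [set` `[a, b]]) ((I + d) / (b - a))%:E <= \int[mu]_x V x)%E.
  apply: (@le_trans _ _ (\int[mu]_(x in [set` `[a, b]]) V x)%E).
    have I0 : 0 <= I by rewrite -lee_fin; apply: le_trans VI; exact: integral_ge0.
    apply: ge0_le_integral => //.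
    - by move=> x _; rewrite lee_fin divr_ge0//; lra.
    - exact: measurable_funTS.
  by apply: ge0_subset_integral.
rewrite integral_cst//= lebesgue_measure_itv/= lte_fin ab -EFinB -EFinM divfK; last first.
  by rewrite subr_eq0 gt_eqF.
move=> h; have := le_trans h VI; rewrite lee_fin; lra.
Qed.

Lemma cint_kernel_le (a b r B : R) (g k v : R -> R[i]) : a <= b -> 0 < r ->
  ccon a b g -> ccon a b (fun x => g x * k x * v x) ->
  (forall x, a <= x <= b -> normc (k x) <= 2 / r) ->
  (forall x, a <= x <= b -> normc (v x) = 1) ->
  (\int[mu]_(x in [set` `[a, b]]) (normc (g x))%:E <= B%:E)%E ->
  normc (cint a b (fun x => g x * k x * v x)) <= 4 / r * B.
Proof.
move=> ab r0 cg cgk kr v1 gB.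
have ig := within_integrable (ccon_normc cg).
apply: (le_trans (cint_le_norm cgk)).
have -> : 4 / r * B = 2 * (2 / r * B) by ring.
rewrite ler_pM2l//; apply: (@le_trans _ _ (2 / r * \int[mu]_(x in `[a, b]) normc (g x))).
  rewrite -RintegralZl//; apply: le_Rintegral => //.
  - exact: within_integrable (ccon_normc cgk).
  - exact: integrableZl_EFin.
  - move=> x /=; rewrite in_itv/= => xab; rewrite !normcM v1// mulr1 mulrC.
    by rewrite ler_wpM2r ?normc_ge0// kr.
rewrite ler_wpM2l ?divr_ge0 ?(ltW r0)//.
rewrite -lee_fin /Rintegral fineK//; apply: integrable_fin_num => //.
Qed.

(** Cauchy's formula is applied on a single rectangle: each side is picked, in an outer strip of
    width r / 2, so that the integral of |g| along it does not exceed its mean over the strip, up to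
    [d]. The function [h] extends |g| measurably off the square, so that Tonelli's theorem can be
    used on the whole plane. *)
Lemma square_mean (g : R[i] -> R[i]) (w : R[i]) (r : R) (h : mR2 -> \bar R) : 0 < r ->
  (forall z, csquare w r z -> exists A, cder g z A) ->
  measurable_fun setT h -> (forall p, 0 <= h p)%E ->
  (forall p, csquare w r (p.1 +i* p.2) -> h p = (normc (g (p.1 +i* p.2)))%:E) ->
  ((r ^+ 2 * normc (g w))%:E <= 16%:E * \int[lebesgue2]_p h p)%E.
Proof.
move=> r0 dg mh h0 hg.
have [Ioo|Ifin] := eqVneq (\int[lebesgue2]_p h p)%E +oo%E.
  by rewrite Ioo gt0_muley ?leey// lte_fin.
have Ige : (0 <= \int[lebesgue2]_p h p)%E by exact: integral_ge0.
have [I IE] : exists I : R, (\int[lebesgue2]_p h p = I%:E)%E.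
  by exists (fine (\int[lebesgue2]_p h p)%E); rewrite fineK// ge0_fin_numE// ltey.
rewrite IE -EFinM lee_fin; apply/ler_addgt0Pl => e e0.
pose d := e / 16; have d0 : 0 < d by rewrite divr_gt0.
pose V := fubini_F mu h; pose H := fubini_G mu h.
have mV : measurable_fun setT V by exact: measurable_fun_fubini_tonelli_F.
have mH : measurable_fun setT H by exact: measurable_fun_fubini_tonelli_G.
have V0 x : (0 <= V x)%E by exact: integral_ge0.
have H0 y : (0 <= H y)%E by exact: integral_ge0.
have VI : (\int[mu]_x V x <= I%:E)%E.
  by rewrite -IE (@fubini_tonelli1 _ _ _ _ _ mu mu h mh h0).
have HI : (\int[mu]_y H y <= I%:E)%E.
  by rewrite -IE (@fubini_tonelli2 _ _ _ _ _ mu mu h mh h0).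
set a := complex.Re w in dg hg; set b := complex.Im w in dg hg.
have l1 : a - r < a - r / 2 by rlra.
have l2 : a + r / 2 < a + r by rlra.
have l3 : b - r < b - r / 2 by rlra.
have l4 : b + r / 2 < b + r by rlra.
have [x1 /andP[x11 x12] Vx1] := exists_below_mean l1 d0 mV V0 VI.
have [x2 /andP[x21 x22] Vx2] := exists_below_mean l2 d0 mV V0 VI.
have [y1 /andP[y11 y12] Hy1] := exists_below_mean l3 d0 mH H0 HI.
have [y2 /andP[y21 y22] Hy2] := exists_below_mean l4 d0 mH H0 HI.
have E1 : a - r / 2 - (a - r) = r / 2 by rlra.
have E2 : a + r - (a + r / 2) = r / 2 by rlra.
have E3 : b - r / 2 - (b - r) = r / 2 by (clear; lra).
have E4 : b + r - (b + r / 2) = r / 2 by (clear; lra).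
rewrite E1 in Vx1; rewrite E2 in Vx2; rewrite E3 in Hy1; rewrite E4 in Hy2.
pose B := (I + d) / (r / 2).
have r2 : 0 < r / 2 by rewrite divr_gt0.
have mid (x x' s : R) : x <= s - r / 2 -> s + r / 2 <= x' -> x < s < x'.
  by move=> h1 h2; rewrite (le_lt_trans h1) ?ltrBlDr ?ltrDl//= (lt_le_trans _ h2)// ltrDl.
have xm := mid _ _ _ x12 x21; have ym := mid _ _ _ y12 y21.
have xx : x1 <= x2 by case/andP: xm => /lt_trans k /k /ltW.
have yy : y1 <= y2 by case/andP: ym => /lt_trans k /k /ltW.
have insq x y : x1 <= x <= x2 -> y1 <= y <= y2 -> csquare w r (x +i* y).
  by move=> hx hy; split; [exact: itv_sub x11 x22 hx|exact: itv_sub y11 y22 hy].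
have := @cauchy_rect R x1 x2 y1 y2 g w.
rewrite -/a -/b => CR.
have {CR} : rect_int x1 x2 y1 y2 (fun u => g u * (u - w)^-1) = g w * (0 +i* (2 * pi)).
  apply: CR => //.
  case=> x y [/= xh yh]; exact/dg/insq.
have HR v : r / 2 <= `|complex.Re v| -> normc v^-1 <= 2 / r.
  move=> hv; have := le_trans hv (le_Re_normc v) => h2.
  by rewrite normcV -[2 / r]invrK invf_div lef_pV2// posrE ?divr_gt0// (lt_le_trans r2).
have HIm v : r / 2 <= `|complex.Im v| -> normc v^-1 <= 2 / r.
  move=> hv; have := le_trans hv (le_Im_normc v) => h2.
  by rewrite normcV -[2 / r]invrK invf_div lef_pV2// posrE ?divr_gt0// (lt_le_trans r2).
have nz v : normc v^-1 <= 2 / r -> r / 2 <= normc v -> v != 0.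
  by move=> _ hv; rewrite -normc_gt0; clear -r0 hv; rlra.
have abs1 (x s : R) : s + r / 2 <= x -> r / 2 <= `|x - s|.
  by rewrite addrC -lerBrDr => k; exact: le_trans k (ler_norm _).
have abs2 (x s : R) : x <= s - r / 2 -> r / 2 <= `|x - s|.
  by rewrite lerBrDr -lerBrDl distrC => k; exact: le_trans k (ler_norm _).
have vsideC x : x1 <= x <= x2 -> r / 2 <= `|x - a| ->
    (V x <= B%:E)%E -> normc (aint (varc x y1 y2) (fun u => g u * (u - w)^-1)) <= 4 / r * B.
  move=> xh xa VB; have okv := varc_ok x yy.
  have cg : ccon y1 y2 (fun y => g (x +i* y)).
    by apply: (ccon_arc (c := varc x y1 y2) okv) => y yh; apply/dg/insq.
  apply: (@cint_kernel_le y1 y2 r B (fun y => g (x +i* y)) (fun y => ((x +i* y) - w)^-1) (fun=> 'i)) => //.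
  - apply: cconM; last by move=> y _; exact: cnt_cst.
    apply: (@ccon_arc _ (varc x y1 y2) (fun u => g u * (u - w)^-1) okv) => y yh.
    have [A dA] := dg _ (insq _ _ xh yh).
    eexists; apply: (derM dA); apply: derV; last by apply: derB; [exact: der_io|exact: der_cst].
    by apply: (nz _ (HR _ _)); rewrite ?cReB//= (le_trans _ (le_Re_normc _))// cReB.
  - by move=> y yh; apply: HR; rewrite cReB.
  - by move=> y _; rewrite /= expr0n/= add0r expr1n sqrtr1.
  - apply: le_trans VB; rewrite /V /fubini_F.
    apply: (@le_trans _ _ (\int[mu]_(y in [set` `[y1, y2]]) h (x, y))%E).
      rewrite le_eqVlt; apply/orP; left; apply/eqP.
      by apply: eq_integral => y; rewrite inE/= in_itv/= => yh; rewrite hg//; exact: insq.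
    by apply: ge0_subset_integral => //; exact: measurable_fun_pair2.
have hsideC y : y1 <= y <= y2 -> r / 2 <= `|y - b| ->
    (H y <= B%:E)%E -> normc (aint (harc x1 x2 y) (fun u => g u * (u - w)^-1)) <= 4 / r * B.
  move=> yh yb HB; have okv := harc_ok y xx.
  have cg : ccon x1 x2 (fun x => g (x +i* y)).
    by apply: (ccon_arc (c := harc x1 x2 y) okv) => x xh; apply/dg/insq.
  apply: (@cint_kernel_le x1 x2 r B (fun x => g (x +i* y)) (fun x => ((x +i* y) - w)^-1) (fun=> 1)) => //.
  - apply: cconM; last by move=> x _; exact: cnt_cst.
    apply: (@ccon_arc _ (harc x1 x2 y) (fun u => g u * (u - w)^-1) okv) => x xh.
    have [A dA] := dg _ (insq _ _ xh yh).
    eexists; apply: (derM dA); apply: derV; last by apply: derB; [exact: der_io|exact: der_cst].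
    by apply: (nz _ (HIm _ _)); rewrite ?cImB//= (le_trans _ (le_Im_normc _))// cImB.
  - by move=> x xh; apply: HIm; rewrite cImB.
  - by move=> x _; rewrite normc1.
  - apply: le_trans HB; rewrite /H /fubini_G.
    apply: (@le_trans _ _ (\int[mu]_(x in [set` `[x1, x2]]) h (x, y))%E).
      rewrite le_eqVlt; apply/orP; left; apply/eqP.
      by apply: eq_integral => x; rewrite inE/= in_itv/= => xh; rewrite hg//; exact: insq.
    by apply: ge0_subset_integral => //; exact: measurable_fun_pair1.
have b1 : normc (aint (harc x1 x2 y1) (fun u => g u * (u - w)^-1)) <= 4 / r * B.
  by apply: (hsideC _ _ (abs2 _ _ y12) Hy1); rewrite lexx.
have b2 : normc (aint (varc x2 y1 y2) (fun u => g u * (u - w)^-1)) <= 4 / r * B.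
  by apply: (vsideC _ _ (abs1 _ _ x21) Vx2); rewrite lexx andbT.
have b3 : normc (aint (harc x1 x2 y2) (fun u => g u * (u - w)^-1)) <= 4 / r * B.
  by apply: (hsideC _ _ (abs1 _ _ y21) Hy2); rewrite lexx andbT.
have b4 : normc (aint (varc x1 y1 y2) (fun u => g u * (u - w)^-1)) <= 4 / r * B.
  by apply: (vsideC _ _ (abs2 _ _ x12) Vx1); rewrite lexx.
move=> EQ; have := normc_contour_le b1 b4 b2 b3; rewrite -[X in normc X]/(rect_int _ _ _ _ _) EQ.
have p2 := pi_ge2 R.
have n2 : normc ((0 : R) +i* (2 * pi)) = 2 * pi.
  by rewrite /= expr0n/= add0r sqrtr_sqr ger0_norm// mulr_ge0// pi_ge0.
rewrite normcM n2.
have -> : 4 / r * B + 4 / r * B + 4 / r * B + 4 / r * B = 2 * (16 * (I + d)) / r ^+ 2 by rewrite /B; field; rewrite gt_eqF.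
rewrite ler_pdivlMr ?exprn_gt0//.
have -> : e + 16 * I = 16 * (I + d) by rewrite /d; field.
have g0 := normc_ge0 (g w).
have := sqr_ge0 r; move: (normc (g w)) g0 (r ^+ 2) => G G0 r2' r20 K; clear -G0 r20 K p2.
have : G * r2' <= G * r2' * pi by rewrite ler_peMr ?mulr_ge0//; lra.
lra.
Qed.

Definition polysquare (z : R[i]^o * R[i]^o) (r : R) : set (R[i]^o * R[i]^o) :=
  [set w | csquare z.1 r w.1 /\ csquare z.2 r w.2].

Lemma polysquare_mean (f : R[i]^o * R[i]^o -> R[i]^o) (z : R[i]^o * R[i]^o) (r : R)
    (h : mR4 -> \bar R) : 0 < r ->
  (forall w : R[i]^o * R[i]^o, polysquare z r w -> differentiable f w) ->
  measurable_fun setT h -> (forall p, 0 <= h p)%E ->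
  (forall p, polysquare z r (toC2 p) -> h p = (normc (f (toC2 p)))%:E) ->
  ((r ^+ 4 * normc (f z))%:E <= 256%:E * \int[lebesgueC2]_p h p)%E.
Proof.
move=> r0 df mh h0 hf.
have r20 : 0 < r ^+ 2 by rewrite exprn_gt0.
case: z df hf => z1 z2 df hf.
pose F := fubini_F (@lebesgue2 R) h.
have mF : measurable_fun setT F by exact: measurable_fun_fubini_tonelli_F.
have F0 p : (0 <= F p)%E by exact: integral_ge0.
pose q2 : mR2 := (complex.Re z2, complex.Im z2).
have z2s : csquare z2 r (q2.1 +i* q2.2).
  by split; rewrite /=; apply/andP; split; rlra.
have z2E : q2.1 +i* q2.2 = z2 by rewrite /q2 /= -complexRI.
have step p1 : csquare z1 r (p1.1 +i* p1.2) ->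
    ((r ^+ 2 * normc (f (p1.1 +i* p1.2, z2)))%:E <= 16%:E * F p1)%E.
  move=> p1s; apply: (@square_mean (fun u => f (p1.1 +i* p1.2, u)) z2 r (fun p2 => h (p1, p2))) => //.
  - move=> u us; apply: differentiable_cder2; exact: df.
  - exact: measurable_fun_pair2.
  - by move=> p2 p2s; apply: hf.
(* Over the square the first term is the smaller one, by [step], so [h1] is r^2 |f| there; taking
   the minimum keeps it below 16 F on the whole plane, which bounds its integral. *)
pose h1 p1 := mine ((r ^+ 2)%:E * h (p1, q2))%E (16%:E * F p1)%E.
have mh1 : measurable_fun setT h1.
  apply: measurable_mine; apply: measurable_funeM => //.
  exact: measurable_fun_pair1.
have h10 p1 : (0 <= h1 p1)%E by rewrite /h1 le_min !mule_ge0// lee_fin ltW.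
have h1E p1 : csquare z1 r (p1.1 +i* p1.2) ->
    h1 p1 = (normc ((r ^+ 2)%:C * f (p1.1 +i* p1.2, z2)))%:E.
  move=> p1s; have st := step _ p1s.
  have E : h (p1, q2) = (normc (f (p1.1 +i* p1.2, z2)))%:E.
    by rewrite hf /toC2 /= ?z2E//; split => //=; rewrite -z2E.
  rewrite /h1 E -EFinM min_l// normcM normc_real ger0_norm//; exact: ltW.
have := @square_mean (fun u => (r ^+ 2)%:C * f (u, z2)) z1 r h1 r0 _ mh1 h10 h1E.
move=> H; have {}H := H _.
rewrite normcM normc_real (gtr0_norm r20) mulrA -exprD in H.
apply: le_trans (H _) _.
  move=> u us; have [A dA] : exists A, cder (fun u => f (u, z2)) u A.
    by apply: differentiable_cder1; apply: df; split => //=; rewrite -z2E.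
  by exists ((r ^+ 2)%:C * A); exact: derZ.
rewrite (_ : 256%:E = 16%:E * 16%:E :> \bar R)%E; last by rewrite -EFinM; congr EFin; rlra.
rewrite -muleA; apply: lee_wpmul2l; first by rewrite lee_fin.
have -> : (\int[lebesgueC2]_p h p = \int[lebesgue2]_p F p)%E.
  exact: (@fubini_tonelli1 _ _ _ _ _ lebesgue2 lebesgue2 h mh h0).
rewrite -ge0_integralZl//; apply: ge0_le_integral => //.
- exact: measurable_funeM.
- by move=> p _; rewrite /h1 ge_min lexx orbT.
Qed.

(** On a set of finite measure |f| <= 1 + |f|^2 is integrable, so the L^1 mean bound holds with one
    constant for all polysquares. *)
Lemma bergman_polysquare_bound (D : set (R[i]^o * R[i]^o)) (f : R[i]^o * R[i]^o -> R[i]^o) :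
  dopen D -> (lebesgueC2 (toC2 @^-1` D) < +oo)%E -> bergman D f ->
  exists2 K : R, 0 <= K & forall z r, 0 < r -> polysquare z r `<=` D -> normc (f z) <= K / r ^+ 4.
Proof.
move=> oD Dfin [hf f2].
have mE := measurable_toC2 oD; set E := toC2 @^-1` D in mE f2 Dfin.
have cf := holomorphic_cmeas oD hf.
have m2 := cmeas_normc2 cf.
have mn : measurable_fun E (fun p : mR4 => (normc (f (toC2 p)))%:E).
  apply/measurable_EFinP.
  rewrite (_ : (fun _ => _) = (fun p : mR4 => Num.sqrt (normc (f (toC2 p)) ^+ 2))).
    by apply: (measurableT_comp (continuous_measurable_fun (@sqrt_continuous R))); exact/measurable_EFinP.
  by apply/funext => p; rewrite sqrtr_sqr ger0_norm// normc_ge0.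
pose h : mR4 -> \bar R := (fun p : mR4 => (normc (f (toC2 p)))%:E) \_ E.
have mh : measurable_fun setT h by apply/(measurable_restrictT _ mE).
have h0 p : (0 <= h p)%E by rewrite /h patchE; case: ifP => // _; rewrite lee_fin normc_ge0.
have I2 : (\int[lebesgueC2]_(p in E) (normc (f (toC2 p)) ^+ 2)%:E < +oo)%E.
  move/integrableP : f2 => [_]; apply: le_lt_trans; rewrite le_eqVlt; apply/orP; left; apply/eqP.
  by apply: eq_integral => p _; rewrite gee0_abs// lee_fin sqr_ge0.
have Ih : (\int[lebesgueC2]_p h p < +oo)%E.
  rewrite -integral_mkcond; apply: (@le_lt_trans _ _ (\int[lebesgueC2]_(p in E) (1%:E + (normc (f (toC2 p)) ^+ 2)%:E))%E).
    apply: ge0_le_integral => //.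
    - by move=> p _; rewrite lee_fin normc_ge0.
    - by apply: emeasurable_funD => //; exact: measurable_cst.
    - move=> p _; rewrite -EFinD lee_fin; have := sqr_ge0 (normc (f (toC2 p)) - 1); rnra.
  have -> : (\int[lebesgueC2]_(p in E) (1%:E + (normc (f (toC2 p)) ^+ 2)%:E) = \int[lebesgueC2]_(p in E) (cst 1%:E) p + \int[lebesgueC2]_(p in E) (normc (f (toC2 p)) ^+ 2)%:E)%E.
    apply: (@ge0_integralD _ _ _ lebesgueC2 E mE (cst 1%:E)).
    - by move=> p _; rewrite lee_fin ler01.
    - exact: measurable_cst.
    - by move=> p _; rewrite lee_fin sqr_ge0.
    - exact: m2.
  rewrite integral_cst; last exact: mE.
  rewrite mul1e; exact: lte_add_pinfty.
have Ih0 : (0 <= \int[lebesgueC2]_p h p)%E by exact: integral_ge0.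
have PM := fun z (r : R) => @polysquare_mean f z r h.
have c0 : 0 <= 256 :> R by exact: ler0n.
move: (256 : R) c0 PM => c c0 PM.
exists (c * fine (\int[lebesgueC2]_p h p)%E); first exact: (mulr_ge0 c0 (fine_ge0 Ih0)).
move=> z r r0 zD; rewrite ler_pdivlMr ?exprn_gt0// mulrC -lee_fin (EFinM c) fineK; last first.
  by rewrite ge0_fin_numE.
apply: PM => // [w /zD /hf//|p /zD pD].
by rewrite /h patchE ifT// inE.
Qed.

End mean_value.

(** * Logarithmic coordinates on the worm domain *)

Lemma near_differentiable {K : numFieldType} {V W : normedModType K} (f g : V -> W) (x : V) :
  (\forall y \near x, f y = g y) -> differentiable f x -> differentiable g x.
Proof.
move=> fg df.
have h0 : \forall y \near x, (g - f) y = cst 0 y.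
  by near=> y; rewrite /= -[LHS]/(g y - f y); have -> : f y = g y; [near: y; exact: fg|rewrite subrr].
have hx : (g - f) x = 0 by exact: (nbhs_singleton h0).
suff dh : differentiable (g - f) x.
  by have := differentiableD df dh; rewrite addrC subrK.
have dc : continuous ('d (cst (0 : W) : V -> W) x) by apply: diff_continuous.
have E : (g - f) \o shift x = cst ((g - f) x) + 'd (cst (0 : W) : V -> W) x +o_ 0 id.
  apply/eqaddoP => e e0; rewrite diff_cst hx.
  have : \forall k \near (0 : V), (g - f) (k + x) = 0.
    by have := h0; rewrite (near_shift 0 x); apply: filterS => k; rewrite /= subr0.
  apply: filterS => k hk.
  rewrite -[X in `|X|]/((g - f) (k + x) - (0 + 0)) hk addr0 subr0 normr0.
  by rewrite mulr_ge0// ltW.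
apply/diff_locallyP; rewrite (diff_unique dc E); split; [exact: dc|exact: E].
Unshelve. all: by end_near. Qed.

#[global] Arguments log_sqnorm {R} w : simpl never.
#[global] Arguments worm_L {R} z : simpl never.

Section worm_geometry.
Context {R : realType}.
Implicit Types (w u : R[i]) (s x y : R) (z : R[i]^o * R[i]^o).

Lemma cos_lipschitz x y : `|cos x - cos y| <= `|x - y|.
Proof.
have -> : cos x - cos y = - (2 * sin ((x + y) / 2) * sin ((x - y) / 2)).
  set u := _ / 2; set v := _ / 2.
  have -> : x = u + v by rewrite /u /v; field.
  have -> : y = u - v by rewrite /u /v; field.
  by rewrite cosD cosB; ring.
rewrite normrN !normrM (ger0_norm (ler0n _ 2)).
have h1 := sin_le ((x - y) / 2); rewrite normrM (@ger0_norm _ (2^-1)) in h1; last by rewrite invr_ge0.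
have h2 : `|sin ((x + y) / 2)| <= 1 by rewrite ler_norml sin_geN1 sin_le1.
have h3 : `|sin ((x + y) / 2)| * `|sin ((x - y) / 2)| <= `|sin ((x - y) / 2)|.
  by rewrite ler_piMl.
lra.
Qed.

(** Thus |e^w - e^{i s}| < 1 reads e^{Re w} < 2 cos (Im w - s), the inequality of [adm]. *)
Lemma normc_cexp_circle w s :
  normc (cexp w - cexp (0 +i* s)) ^+ 2 =
  1 + expR (complex.Re w) * (expR (complex.Re w) - 2 * cos (complex.Im w - s)).
Proof.
rewrite normcE cReB cImB /cexp /= expR0 !mul1r cosB.
have c1 := cos2Dsin2 (complex.Im w); have c2 := cos2Dsin2 s.
set c := cos (complex.Im w) in c1 *; set d := sin (complex.Im w) in c1 *.
set a := cos s in c2 *; set b := sin s in c2 *; set E := expR _.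
have -> : (E * c - a) ^+ 2 + (E * d - b) ^+ 2 = E ^+ 2 * (c ^+ 2 + d ^+ 2) + (a ^+ 2 + b ^+ 2) - 2 * E * (a * c + b * d) by ring.
by rewrite c1 c2; ring.
Qed.

Lemma log_sqnorm_cexp w : log_sqnorm (cexp w) = 2 * complex.Re w.
Proof. by rewrite /log_sqnorm normc_cexp -expRM_natl expRK -mulr_natl. Qed.

Lemma expR_log_sqnorm u : u != 0 -> expR (log_sqnorm u) = normc u ^+ 2.
Proof. by move=> u0; rewrite /log_sqnorm lnK// posrE exprn_gt0// normc_gt0. Qed.

Lemma log_sqnormM u w : u != 0 -> w != 0 -> log_sqnorm (u * w) = log_sqnorm u + log_sqnorm w.
Proof.
by move=> u0 w0; rewrite /log_sqnorm normcM exprMn lnM// posrE exprn_gt0// normc_gt0.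
Qed.

Lemma log_sqnorm_clog u : u != 0 -> log_sqnorm u = 2 * complex.Re (clog u).
Proof. by move=> u0; rewrite -log_sqnorm_cexp cexp_clog. Qed.

(* [s] plays the role of [log |z_2|^2]: [Om mu 0] is the image of the domain
   under [worm_L], and [Om mu tau] is its translate by [tau]. *)
Definition adm (tau : R) w s :=
  `|complex.Im w - s| < pi / 2 /\ expR (complex.Re w - tau) < 2 * cos (complex.Im w - s).

Definition Om (mu tau : R) : set R[i] := [set w | exists2 s, `|s| < mu & adm tau w s].

Lemma worm_cexp mu w u : u != 0 ->
  truncated_worm mu (cexp w, u) <->
  `|log_sqnorm u| < mu /\ expR (complex.Re w) < 2 * cos (complex.Im w - log_sqnorm u).
Proof.
move=> u0; have -> : truncated_worm mu (cexp w, u) = [/\ u != 0,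
  normc (cexp w - cexp (0 +i* log_sqnorm u)) ^+ 2 < 1 & `|log_sqnorm u| < mu] by [].
rewrite normc_cexp_circle.
have e0 := expR_gt0 (complex.Re w).
split=> [[_ h1 h2]|[h1 h2]]; split => //.
  by rewrite -subr_lt0 -(pmulr_rlt0 _ e0); lra.
by rewrite -subr_lt0 -(pmulr_rlt0 _ e0) in h2; lra.
Qed.

(** The number z_1 e^{- i s} lies in the disc |zeta - 1| < 1, hence in the right half-plane, where
    the principal argument is less than pi / 2 in modulus. So [worm_L z] is the logarithm of z_1
    whose imaginary part is within pi / 2 of s. *)
Lemma worm_LP mu z : truncated_worm mu z ->
  cexp (worm_L z) = z.1 /\ adm 0 (worm_L z) (log_sqnorm z.2).
Proof.
case: z => z1 z2 /= zD; have [/= z20 h1 h2] := zD; set s := log_sqnorm z2 in h1 h2 *.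
pose u := z1 * cexp (0 -i* s).
have cN : cexp (0 -i* s) = (cexp (0 +i* s))^-1.
  by rewrite -cexpN; congr cexp; apply: complex_eqP; rewrite ?cReN ?cImN /= ?oppr0.
have n1 : normc (cexp (0 -i* s)) = 1 by rewrite normc_cexp expR0.
have u1 : normc (u - 1) < 1.
  have -> : u - 1 = (z1 - cexp (0 +i* s)) * cexp (0 -i* s).
    by rewrite mulrBl cN divff ?cexp_neq0// -cN.
  by rewrite normcM n1 mulr1 normc_lt_sqr// expr1n.
have ur : 0 < complex.Re u.
  have := le_lt_trans (le_Re_normc _) u1; rewrite cReB /= ltr_norml; lra.
have us : slit u by left.
have u0 := slit_neq0 us.
have cu := cexp_clog u0.
have E : cexp (worm_L (z1, z2)) = z1.
  by rewrite /worm_L /= -/s cexpD -/u cu /u cN divfK// cexp_neq0.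
have ImE : complex.Im (worm_L (z1, z2)) - s = carg u.
  by rewrite /worm_L /= -/s -/u addrK.
have := (worm_cexp mu (worm_L (z1, z2)) z20); rewrite E => -[/(_ zD)[_ h3] _].
split => //; split; last by rewrite subr0.
by rewrite ImE; exact: carg_Re_gt0.
Qed.

Lemma worm_L_uniq w u : `|complex.Im w - log_sqnorm u| < pi / 2 -> worm_L (cexp w, u) = w.
Proof.
move=> h; rewrite /worm_L /=; set s := log_sqnorm u in h *.
rewrite -cexpD; rewrite (@clog_uniq _ _ (w + (0 -i* s)))//.
  by case: w h => a b _; apply: complex_eqP; rewrite ?cReD ?cImD /=; ring.
rewrite cImD /=; have p0 := pi_gt0 R; move: h; rewrite ltr_norml; lra.
Qed.

Lemma Om_worm_L mu z : truncated_worm mu z -> Om mu 0 (worm_L z).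
Proof. by move=> zD; have [_ a] := worm_LP zD; have [_ _ h] := zD; exists (log_sqnorm z.2). Qed.

Lemma adm_worm mu w u : u != 0 -> `|log_sqnorm u| < mu -> adm 0 w (log_sqnorm u) ->
  truncated_worm mu (cexp w, u).
Proof. by move=> u0 h [_]; rewrite subr0 => h2; apply/worm_cexp. Qed.

Lemma adm_open mu tau w s : `|s| < mu -> adm tau w s -> exists2 e : R, 0 < e &
  forall w' s', `|complex.Re w' - complex.Re w| < e -> `|complex.Im w' - complex.Im w| < e ->
    `|s' - s| < e -> `|s'| < mu /\ adm tau w' s'.
Proof.
move=> smu [h1 h2]; set x := complex.Re w in h2 *; set y := complex.Im w in h1 h2 *.
pose g := 2 * cos (y - s) - expR (x - tau); have g0 : 0 < g by rewrite subr_gt0.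
have [d d0 Hd] : exists2 d : R, 0 < d & forall x', `|x' - x| < d -> `|expR (x' - tau) - expR (x - tau)| < g / 2.
  have : (fun t : R => expR (t - tau)) @ x --> expR (x - tau).
    apply: continuous_comp; last exact: continuous_expR.
    by apply: cvgB; [exact: cvg_id|exact: cvg_cst].
  move=> /cvgrPdist_lt/(_ (g / 2)); rewrite divr_gt0// => /(_ isT).
  move=> /nbhs_ballP[d /= d0 H]; exists d => // x' hx'; rewrite distrC; apply: H.
  by rewrite /ball /= distrC.
(* Half of the gap [g] pays for the exponential. The argument of the cosine moves by less than g /
   4, so twice the cosine moves by less than the other half. *)
pose e := Num.min d (Num.min (g / 8) (Num.min ((pi / 2 - `|y - s|) / 2) (mu - `|s|))).
exists e; first by rewrite !lt_min d0 !divr_gt0 ?subr_gt0.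
move=> w' s'; rewrite !lt_min => /and4P[hx1 _ _ _] /and4P[_ hy2 hy3 _] /and4P[_ hs2 hs3 hs4].
set x' := complex.Re w' in hx1 *; set y' := complex.Im w' in hy2 hy3 *.
have hx := Hd _ hx1; have hc := cos_lipschitz (y' - s') (y - s).
have hd : `|(y' - s') - (y - s)| <= `|y' - y| + `|s' - s|.
  by rewrite (_ : _ - _ = (y' - y) - (s' - s)); [exact: ler_normB|ring].
split; [|split].
- by have := ler_distD s s' 0; rewrite !subr0; clear -hs4; rlra.
- rewrite -/y'; have := ler_distD (y - s) (y' - s') 0; rewrite !subr0; clear -hs3 hy3 hd; rlra.
- rewrite -/x' -/y'; move: (ler_norm (expR (x' - tau) - expR (x - tau))) => h3.
  have h4 : cos (y - s) - cos (y' - s') <= `|cos (y' - s') - cos (y - s)| by rewrite distrC ler_norm.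
  by rewrite /g in hx hy2 hs2; clear -hc hd h3 h4 hx hy2 hs2; rlra.
Qed.

Lemma clog_ratio_near u (e : R) : u != 0 -> 0 < e -> exists2 d : R, 0 < d &
  forall v, normc (v - u) < d -> [/\ v != 0, slit (v / u) & normc (clog (v / u)) < e].
Proof.
move=> u0 e0; have n0 : 0 < normc u by rewrite normc_gt0.
exists (normc u * Num.min 4^-1 (e / 7)); first by rewrite mulr_gt0// lt_min invr_gt0 ltr0n/= divr_gt0.
move=> v hv; pose h := v / u - 1.
have hh : normc h < Num.min 4^-1 (e / 7).
  have -> : h = (v - u) / u by rewrite /h mulrBl divff.
  by rewrite normcM normcV ltr_pdivrMr// mulrC.
move: hh; rewrite lt_min => /andP[h4 h7].
have vE : v / u = 1 + h by rewrite /h addrC subrK.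
have sl : slit (v / u).
  left; rewrite vE cReD /=; have := le_Re_normc h; rewrite ler_norml; lra.
split => //.
  by have := slit_neq0 sl; rewrite mulf_eq0 negb_or => /andP[].
rewrite vE; apply: (le_lt_trans (clog1D (ltW h4))); lra.
Qed.

(** Although its formula involves |z_2|, [worm_L] is locally a branch of log z_1, which makes it
    holomorphic. Both sides have exponential z_1', and [adm], being an open condition, settles the
    branch. *)
Lemma worm_L_near mu z : truncated_worm mu z -> exists2 d : R, 0 < d &
  forall z', dC2 z' z < d -> [/\ truncated_worm mu z', slit (z'.1 / z.1) &
    worm_L z' = clog (z'.1 / z.1) + worm_L z].
Proof.
move=> zD; have [E ad] := worm_LP zD; have [z20 _ hmu] := zD.
have [e e0 He] := adm_open hmu ad.
have z10 : z.1 != 0 by rewrite -E cexp_neq0.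
have [d1 d10 H1] := clog_ratio_near z10 e0.
have e20 : 0 < e / 2 by rewrite divr_gt0.
have [d2 d20 H2] := clog_ratio_near z20 e20.
exists (Num.min d1 d2) => [|z']; first by rewrite lt_min d10.
rewrite lt_min => /andP[/dC2_lt[/H1[z1' s1 c1] _] /dC2_lt[_ /H2[z2' s2 c2]]].
pose v := clog (z'.1 / z.1) + worm_L z.
have Ev : cexp v = z'.1 by rewrite /v cexpD cexp_clog ?slit_neq0// E divfK.
have ls : log_sqnorm z'.2 - log_sqnorm z.2 = 2 * complex.Re (clog (z'.2 / z.2)).
  rewrite -log_sqnorm_clog ?slit_neq0//.
  by have := log_sqnormM (slit_neq0 s2) z20; rewrite divfK// => ->; rewrite addrK.
have [||| m ad'] := He v (log_sqnorm z'.2).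
- by rewrite /v cReD addrK (le_lt_trans (le_Re_normc _)).
- by rewrite /v cImD addrK (le_lt_trans (le_Im_normc _)).
- rewrite ls normrM (ger0_norm (ler0n _ 2)); have := le_Re_normc (clog (z'.2 / z.2)); rlra.
have z'E : z' = (cexp v, z'.2) by rewrite Ev -surjective_pairing.
split => //.
  by rewrite z'E; apply: adm_worm.
by rewrite {1}z'E; apply: worm_L_uniq; case: ad'.
Qed.

Lemma dopen_worm mu : dopen (truncated_worm mu : set (R[i] * R[i])).
Proof. by move=> z /worm_L_near[d d0 H]; exists d => // w /H[]. Qed.

Lemma cder_expz (j : int) u : u != 0 -> exists a, cder (fun v => v ^ j) u a.
Proof.
move=> u0; case: j => n; first exact: (derX n (der_io id u)).
have [a da] := derX n.+1 (der_io id u).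
eexists; apply: derV da; exact: expf_neq0.
Qed.

Lemma worm_holomorphic mu (F : R[i] -> R[i]) (j : int) :
  (forall w, Om mu 0 w -> exists a, cder F w a) ->
  holomorphic_on (truncated_worm mu) (fun z => F (worm_L z) * z.2 ^ j : R[i]^o).
Proof.
move=> dF z zD; have [z20 _ _] := zD.
have [E _] := worm_LP zD; have z10 : z.1 != 0 by rewrite -E cexp_neq0.
have [d d0 Hd] := worm_L_near zD.
pose g (u : R[i]^o) : R[i]^o := F (clog (u / z.1) + worm_L z).
have s1 : slit (z.1 / z.1) by left; rewrite divff//= ltr01.
have [a da] := dF _ (Om_worm_L zD).
have c1 : clog (z.1 / z.1) = 0 by rewrite divff// (@clog_uniq _ _ 0) ?cexp0//= pi_ge0 oppr_lt0 pi_gt0.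
have dg : differentiable g z.1.
  apply: (@cder_differentiable _ _ _ (a * (1 * (z.1 / z.1)^-1 * (1 / z.1) ))).
  apply: (@der_comp _ _ id F (fun u => clog (u / z.1) + worm_L z)); last by rewrite c1 add0r.
  rewrite -[X in der _ _ _ X]addr0; apply: derD; last exact: der_cst.
  rewrite mul1r; apply: (@der_comp _ _ id clog (fun u => u / z.1)); last exact: cder_clog.
  have := derM (der_io id (z.1 : R[i])) (der_cst id (z.1 : R[i])^-1 (z.1 : R[i])); rewrite mulr0 addr0; exact.
have dgf : differentiable (fun z' : R[i]^o * R[i]^o => g z'.1) z.
  apply: (@differentiable_comp _ _ _ _ (fst : R[i]^o * R[i]^o -> R[i]^o) g) => //.
  by apply: linear_differentiable => x; exact: cvg_fst.
have [b db] := cder_expz j z20.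
pose pw (u : R[i]^o) : R[i]^o := (u : R[i]) ^ j.
have dp : differentiable pw z.2 by exact: cder_differentiable db.
have ds : differentiable (snd : R[i]^o * R[i]^o -> R[i]^o) z.
  by apply: linear_differentiable => x; exact: cvg_snd.
have dj : differentiable (pw \o snd) z by exact: differentiable_comp.
have dm := differentiableM dgf dj; apply: near_differentiable dm.
have dC : 0 < d%:C by rewrite ltcR.
apply/nbhs_ballP; exists d%:C => // z' [/= h1 h2].
have [|_ _ EL] := Hd z'.
  apply/dC2_lt; rewrite -!(ltcR (R:=R)) -!normCE.
  by rewrite -ball_normE /= in h1; rewrite -ball_normE /= in h2; rewrite !(distrC _ z.1) !(distrC _ z.2).
by rewrite EL.
Qed.

End worm_geometry.

(** * Integrability of powers on the worm domain *)

Section radial_powers.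
Context {R : realType}.
Local Notation mR2 := (measurableTypeR R * measurableTypeR R)%type.
Implicit Types (r c q C : R).

Lemma nneseries_geometric_lty q C : 0 <= q < 1 -> 0 <= C ->
  (\sum_(0 <= k <oo) (C * q ^+ k)%:E < +oo)%E.
Proof.
move=> /andP[q0 q1] C0; apply: (@le_lt_trans _ _ (C / (1 - q))%:E); last exact: ltry.
apply: lime_le; first by apply: is_cvg_nneseries => n _ _; rewrite lee_fin mulr_ge0// exprn_ge0.
near=> n; rewrite sumEFin lee_fin.
have := congr1 (fun f => f n) (@geometric_seriesE R C q (negbT (lt_eqF q1))).
rewrite /series /= => ->.
rewrite ler_wpM2r ?invr_ge0 ?subr_ge0 ?(ltW q1)//.
by rewrite ler_piMr// lerBlDr lerDl exprn_ge0.
Unshelve. all: by end_near. Qed.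

Lemma dyadic_shell r : 0 < r < 2 -> exists k, 2^-1 ^+ k <= r < 2 * 2^-1 ^+ k.
Proof.
move=> /andP[r0 r2].
have H : exists k, (2^-1 : R) ^+ k <= r.
  exists (Num.bound r^-1); rewrite exprVn -[X in _ <= X]invrK lef_pV2 ?posrE ?exprn_gt0 ?invr_gt0//.
  apply: (le_trans (ltW (archi_boundP _))); first by rewrite invr_ge0 ltW.
  by rewrite -natrX ler_nat ltnW// ltn_expl.
have [k Hk mk] := ex_minnP H; exists k; rewrite Hk /=.
case: k Hk mk => [|k] Hk mk; first by rewrite expr0 mulr1.
rewrite exprS mulrA divff// mul1r ltNge; apply/negP => /mk.
by rewrite ltnn.
Qed.

Definition cube2 r : set mR2 := [set` `]- r, r[] `*` [set` `]- r, r[].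

Lemma measurable_cube2 r : measurable (cube2 r).
Proof. by apply: measurableX; exact: measurable_itv. Qed.

Lemma lebesgue2_cube2 r : 0 < r -> lebesgue2 (cube2 r) = (4 * r ^+ 2)%:E.
Proof.
move=> r0; rewrite /cube2 /lebesgue2 product_measure1E; try exact: measurable_itv.
have E : lebesgue_measure [set` `]- r, r[] = (2 * r)%:E.
  rewrite lebesgue_measure_itv /= lte_fin (_ : - r < r) //=; last lra.
  by rewrite -EFinB; congr EFin; ring.
apply: (@eq_trans _ _ ((2 * r)%:E * (2 * r)%:E)%E); first by congr (_ * _)%E; exact: E.
by rewrite -EFinM; congr EFin; ring.
Qed.

Lemma integral_cube2 r : 0 < r ->
  (\int[lebesgue2]_p (\1_(cube2 r) p)%:E = (4 * r ^+ 2)%:E)%E.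
Proof.
move=> r0; rewrite integral_indic//; last exact: measurable_cube2.
by apply: (eq_trans _ (lebesgue2_cube2 r0)); congr lebesgue2; rewrite setIT.
Qed.

(** On the shell 2^-k <= |z| < 2 * 2^-k the power |z|^{2c} is at most b^k with b = 2^{-2c}, and the
    shell lies in a square of area 16 / 4^k. The condition c > -1 is b < 4, which makes the series
    of integrals geometric. *)
Lemma radial_power_majorant c : -1 < c <= 0 -> exists g : mR2 -> \bar R,
  [/\ measurable_fun setT g, (forall p, 0 <= g p)%E, (\int[lebesgue2]_p g p < +oo)%E &
   forall p, p.1 +i* p.2 != 0 -> normc (p.1 +i* p.2) < 2 ->
     ((expR (2 * c * ln (normc (p.1 +i* p.2))))%:E <= g p)%E].
Proof.
move=> /andP[c1 c0]; pose b := expR (- (2 * c) * ln 2).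
have l2 : 0 < ln 2 :> R by rewrite ln_gt0// ltr1n.
have b0 : 0 < b by exact: expR_gt0.
have b4 : b < 4.
  have -> : 4 = expR (2 * ln 2) :> R by rewrite expRM_natl lnK ?posrE//; ring.
  by rewrite ltr_expR ltr_pM2r//; lra.
pose B k := cube2 (2 * 2^-1 ^+ k).
pose f k (p : mR2) := ((b ^+ k)%:E * (\1_(B k) p)%:E)%E.
have f0 k p : (0 <= f k p)%E by rewrite /f -EFinM lee_fin mulr_ge0// exprn_ge0// ltW.
have mf k : measurable_fun setT (f k).
  apply: measurable_funeM; apply/measurable_EFinP; exact: measurable_indic (measurable_cube2 _).
exists (fun p => \sum_(0 <= k <oo) f k p)%E; split.
- by apply: ge0_emeasurable_sum => // k x _ _; exact: f0.
- by move=> p; apply: nneseries_ge0.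
- rewrite integral_nneseries//.
  rewrite (eq_eseriesr (g := fun k => (16 * (b / 4) ^+ k)%:E)).
    by apply: nneseries_geometric_lty; rewrite ?ler0n// divr_ge0 ?(ltW b0)//= ltr_pdivrMr// mul1r.
  have mB k : measurable_fun setT (fun p => (\1_(B k) p)%:E : \bar R).
    by apply/measurable_EFinP; exact: measurable_indic (measurable_cube2 _).
  have B0 k p : setT p -> (0 <= (\1_(B k) p)%:E :> \bar R)%E by rewrite lee_fin.
  move=> k _; rewrite (ge0_integralZl lebesgue2 measurableT (mB k) (B0 k)) ?lee_fin ?exprn_ge0 ?(ltW b0)//.
  apply: (@eq_trans _ _ ((b ^+ k)%:E * (4 * (2 * 2^-1 ^+ k) ^+ 2)%:E)%E).
    by congr (_ * _)%E; apply: integral_cube2; rewrite ?mulr_gt0 ?exprn_gt0 ?invr_gt0.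
  rewrite -EFinM; congr EFin; rewrite exprMn -exprM mulnC exprM expr2.
  by rewrite (_ : 2^-1 ^+ 2 = 4^-1 :> R); [rewrite exprMn; ring|field].
- move=> p p0 p2; set r := normc _ in p2 *.
  have r0 : 0 < r by rewrite normc_gt0.
  have [|k /andP[k1 k2]] := @dyadic_shell r; first by rewrite r0.
  apply: (le_trans _ (nneseries_lim_ge k.+1 _)) => //.
  rewrite big_nat_recr//=; apply: (@le_trans _ _ (f k p)); last first.
    by rewrite leeDr// sume_ge0.
  rewrite /f indicE mem_set; last first.
    have := le_Re_normc (p.1 +i* p.2); have := le_Im_normc (p.1 +i* p.2); rewrite -/r /= => h1 h2.
    by split; rewrite /= in_itv/= -ltr_norml (le_lt_trans _ k2).
  rewrite mule1 lee_fin /b -expRM_natl ler_expR.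
  have hl : - (k%:R * ln 2) <= ln r.
    rewrite -mulrN -lnV ?posrE// mulr_natl -lnXn ?invr_gt0// ler_ln ?posrE// ?exprn_gt0 ?invr_gt0//.
  by have := ler_wpM2l (_ : 0 <= - (2 * c)) hl; rewrite oppr_ge0 => /(_ ltac:(rlra)); rlra.
Qed.

End radial_powers.

Section worm_integrability.
Context {R : realType}.
Local Notation mR4 := (@mR4 R).
Variable mu : R.
Hypothesis mu0 : 0 < mu.
Local Notation W := (@truncated_worm R mu).
Local Notation C2 := (R[i]^o * R[i]^o)%type.

Lemma worm_normc1 (z : C2) : W z -> 0 < normc z.1 < 2.
Proof.
move=> zD; have [E [_ h]] := worm_LP zD.
rewrite -E normc_cexp expR_gt0 /=; have := cos_le1 (complex.Im (worm_L z) - log_sqnorm z.2).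
rewrite subr0 in h; lra.
Qed.

Lemma worm_Re_L (z : C2) : W z -> complex.Re (worm_L z) = ln (normc z.1).
Proof. by move=> /worm_LP[<- _]; rewrite normc_cexp expRK. Qed.

Lemma worm_Re_L_lt (z : C2) : W z -> complex.Re (worm_L z) < ln 2.
Proof. by move=> zD; have /andP[h0 h2] := worm_normc1 zD; rewrite worm_Re_L// ltr_ln ?posrE. Qed.

Lemma worm_Im_L (z : C2) : W z -> `|complex.Im (worm_L z)| < mu + pi / 2.
Proof.
move=> zD; have [_ [h _]] := worm_LP zD; have [_ _ hs] := zD.
have := ler_normD (complex.Im (worm_L z) - log_sqnorm z.2) (log_sqnorm z.2); rewrite subrK; lra.
Qed.

Lemma worm_normc2 (z : C2) : W z -> expR (- mu) < normc z.2 ^+ 2 < expR mu.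
Proof.
by move=> zD; have [h _ hs] := zD; rewrite -expR_log_sqnorm// !ltr_expR -ltr_norml.
Qed.

(** On the domain its modulus is |z_1|^c, the reference majorant for the exponential sums. The
    factor [z.2 ^ 0] gives it the shape treated by [worm_holomorphic]. *)
Definition worm_pow (c : R) : C2 -> R[i]^o := fun z => cexp (c%:C * worm_L z) * z.2 ^ 0.

Lemma normc_worm_pow c z : normc (worm_pow c z) ^+ 2 = expR (2 * c * complex.Re (worm_L z)).
Proof.
by rewrite /worm_pow mulr1 normc_cexp cReM /= mul0r subr0 -expRM_natl mulrA.
Qed.

Lemma worm_pow_holomorphic c : holomorphic_on W (worm_pow c).
Proof.
apply: (@worm_holomorphic _ _ (fun w => cexp (c%:C * w)) 0) => w _.
by eexists; apply: der_comp (cder_cexp _); apply: derZ (der_io _ _).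
Qed.

Lemma worm_pow_cmeas c : cmeas W (worm_pow c).
Proof. exact: (holomorphic_cmeas (@dopen_worm _ _) (@worm_pow_holomorphic c)). Qed.

(** The integrand is majorized by a function of z_1 alone and z_2 stays in a bounded square, so
    Tonelli's theorem factors the integral. *)
Lemma N2_worm_pow_nonpos c : -1 < c <= 0 -> (N2 W (worm_pow c) < +oo)%E.
Proof.
move=> hc; have [g [mg g0 gI gle]] := radial_power_majorant hc.
have mE := measurable_toC2 (@dopen_worm R mu); have mc := worm_pow_cmeas c.
pose Q := @cube2 R (expR mu).
pose G (p : mR4) := (g p.1 * (\1_Q p.2)%:E)%E.
have mQ : measurable_fun setT (fun p => (\1_Q p : R)%:E).
  by apply/measurable_EFinP; exact: measurable_indic (measurable_cube2 _).
have mG : measurable_fun setT G.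
  apply: emeasurable_funM; first exact: measurableT_comp mg measurable_fst.
  exact: (measurableT_comp mQ measurable_snd).
have G0 p : (0 <= G p)%E by rewrite mule_ge0// lee_fin.
apply: (@le_lt_trans _ _ (\int[lebesgueC2]_p G p)%E).
  apply: (@le_trans _ _ (\int[lebesgueC2]_(p in toC2 @^-1` W) G p)%E); last first.
    by apply: ge0_subset_integral.
  apply: (N2_le (@dopen_worm R mu) mc) => [|p Ep]; first exact: measurable_funS mG.
  have /andP[n1 n2] := worm_normc1 Ep; have /andP[_ n3] := worm_normc2 Ep.
  have h := gle p.1; rewrite normc_worm_pow worm_Re_L//.
  have {h} := h _ n2; rewrite -normc_gt0 => /(_ n1) h.
  apply: (le_trans h); rewrite /G indicE mem_set ?mule1//.
  have m1 : 1 <= expR mu by rewrite -expR0 ler_expR ltW.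
  have n4 : normc (toC2 p).2 < expR mu.
    rewrite -(@ltr_pXn2r _ 2)// ?nnegrE ?normc_ge0 ?expR_ge0//.
    by apply: (lt_le_trans n3); rewrite expr2 ler_peMl ?expR_ge0.
  have := le_Re_normc (toC2 p).2; have := le_Im_normc (toC2 p).2; rewrite /= => k1 k2.
  by split; rewrite /= in_itv/= -ltr_norml; [exact: (le_lt_trans k2)|exact: (le_lt_trans k1)].
have -> : (\int[lebesgueC2]_p G p = \int[lebesgue2]_p \int[lebesgue2]_q G (p, q))%E.
  exact: (@fubini_tonelli1 _ _ _ _ _ lebesgue2 lebesgue2 G mG G0).
under eq_integral => p _.
  have -> : (\int[lebesgue2]_q G (p, q) = g p * (4 * expR mu ^+ 2)%:E)%E.
    rewrite /G /= ge0_integralZl//.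
    by congr (_ * _)%E; apply: integral_cube2; exact: expR_gt0.
  over.
have Z0 : (0%:E <= (4 * expR mu ^+ 2)%:E)%E by rewrite lee_fin mulr_ge0// exprn_ge0// expR_ge0.
rewrite (ge0_integralZr lebesgue2 measurableT mg (fun p _ => g0 p) Z0).
by rewrite muleC lte_mul_pinfty.
Qed.

Lemma N2_bound (f g : C2 -> R[i]^o) (K : R) : 0 <= K -> cmeas W f -> cmeas W g ->
  (forall z, W z -> normc (f z) <= K * normc (g z)) -> (N2 W f <= (K ^+ 2)%:E * N2 W g)%E.
Proof.
move=> K0 mf mg H; have mG := cmeas_normc2 mg.
have mE := measurable_toC2 (@dopen_worm R mu).
rewrite -ge0_integralZl//; last 2 first.
- by move=> p _; rewrite lee_fin sqr_ge0.
- by rewrite lee_fin sqr_ge0.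
apply: (N2_le (@dopen_worm R mu)) => //; first exact: measurable_funeM.
move=> p Ep; rewrite -EFinM lee_fin -exprMn ler_pXn2r ?nnegrE ?mulr_ge0 ?normc_ge0//.
exact: H.
Qed.

Lemma N2_worm_pow c : -1 < c -> (N2 W (worm_pow c) < +oo)%E.
Proof.
move=> c1; have [c0|/ltW c0] := leP c 0; first by apply: N2_worm_pow_nonpos; rewrite c1.
apply: (@le_lt_trans _ _ ((expR (c * ln 2) ^+ 2)%:E * N2 W (worm_pow 0))%E).
  apply: N2_bound; rewrite ?expR_ge0//; try exact: worm_pow_cmeas.
  move=> z zW; rewrite /worm_pow !mulr1 !normc_cexp !cReM /= !mul0r !subr0 expR0 mulr1 ler_expR.
  by rewrite ler_wpM2l// ltW// worm_Re_L_lt.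
rewrite lte_mul_pinfty// ?lee_fin ?sqr_ge0//.
by apply: N2_worm_pow_nonpos; rewrite lexx andbT ltrN10.
Qed.

Lemma worm_finite : (lebesgueC2 (toC2 @^-1` W : set mR4) < +oo)%E.
Proof.
have mE := measurable_toC2 (@dopen_worm R mu).
have : (N2 W (worm_pow 0) < +oo)%E by apply: N2_worm_pow; rewrite ltrN10.
rewrite (_ : N2 _ _ = \int[lebesgueC2]_(p in toC2 @^-1` W) cst 1%:E p)%E.
  by rewrite integral_cst// mul1e.
by apply: eq_integral => p _; rewrite normc_worm_pow mulr0 mul0r expR0.
Qed.

Lemma N2_square_integrable (f : C2 -> R[i]^o) : cmeas W f -> (N2 W f < +oo)%E ->
  square_integrable_on W f.
Proof.
move=> mf f2; apply/integrableP; split; first exact: cmeas_normc2.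
apply: le_lt_trans f2; rewrite le_eqVlt; apply/orP; left; apply/eqP.
by apply: eq_integral => p _; rewrite gee0_abs// lee_fin sqr_ge0.
Qed.

Lemma normc_expz (u : R[i]) (j : int) : normc (u ^ j) = normc u ^ j.
Proof. by case: j => n; rewrite ?NegzE -?exprnN ?normcV ?normcX. Qed.

Lemma worm_expz_bound (j : int) : exists2 K : R, 0 <= K &
  forall z, W z -> normc (z.2 ^ j) <= K.
Proof.
have b : exists2 K : R, 1 <= K & forall z, W z -> normc z.2 <= K /\ (normc z.2)^-1 <= K.
  have m1 : 1 <= expR mu by rewrite -expR0 ler_expR ltW.
  exists (expR mu) => // z zW; have /andP[h1 h2] := worm_normc2 zW; have [z0 _ _] := zW.
  have n0 : 0 < normc z.2 by rewrite normc_gt0.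
  have e2 : expR mu <= expR mu ^+ 2 by rewrite expr2 ler_peMl ?expR_ge0.
  split; rewrite -(@ler_pXn2r _ 2)// ?nnegrE ?invr_ge0 ?normc_ge0 ?expR_ge0//.
    by rewrite (le_trans (ltW h2)).
  rewrite exprVn (le_trans _ e2)// -[expR mu]invrK lef_pV2 ?posrE ?invr_gt0 ?exprn_gt0 ?expR_gt0//.
  by rewrite -expRN ltW.
have [K K1 HK] := b; exists (K ^+ `|j|%N) => [|z /HK[k1 k2]]; first by rewrite exprn_ge0// (le_trans ler01).
have K0 : 0 <= K by rewrite (le_trans ler01).
rewrite normc_expz; case: j => n.
  by rewrite -exprnP absz_nat lerXn2r ?nnegrE ?normc_ge0.
by rewrite NegzE -exprnN -exprVn ler_pXn2r ?nnegrE ?invr_ge0 ?normc_ge0.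
Qed.

(** Compared with |z_1|^{c0}, each extra factor is bounded: e^{nu l L} because Re L < ln 2, the one
    from the imaginary exponent because Im L is bounded, and z_2^j because |z_2| and its inverse
    are. *)
Lemma worm_H_bergman c0 nu l j : -1 < c0 -> 0 <= nu -> bergman W (worm_H c0 nu l j).
Proof.
move=> hc hnu; set eta := (c0 + nu * l%:R) +i* ((j + 1)%:~R / 2).
have hol : holomorphic_on W (worm_H c0 nu l j).
  apply: (@worm_holomorphic _ _ (fun w => cexp (eta * w)) j) => w _.
  by eexists; apply: der_comp (cder_cexp _); apply: derZ (der_io _ _).
have cm := holomorphic_cmeas (@dopen_worm R mu) hol.
split=> //; apply: N2_square_integrable => //.
have [K K0 HK] := worm_expz_bound j.
pose K' := expR (nu * l%:R * ln 2 + `|(j + 1)%:~R / 2| * (mu + pi / 2)) * K.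
have K'0 : 0 <= K' by rewrite mulr_ge0// expR_ge0.
apply: (@le_lt_trans _ _ ((K' ^+ 2)%:E * N2 W (worm_pow c0))%E).
  apply: N2_bound => //; first exact: worm_pow_cmeas.
  move=> z zW; rewrite /worm_H /worm_E -/eta /worm_pow mulr1 normcM !normc_cexp.
  have hx := worm_Re_L_lt zW; have hy := worm_Im_L zW; move: (worm_L z) hx hy => L hx hy.
  rewrite !cReM /= mul0r subr0.
  rewrite /K' [X in _ <= X]mulrAC -expRD ler_pM ?expR_ge0 ?normc_ge0 ?HK// ler_expR.
  set x := complex.Re _ in hx *; set y := complex.Im _ in hy *.
  set d := _ / 2 in |- *.
  have h1 : nu * l%:R * x <= nu * l%:R * ln 2 by rewrite ler_wpM2l ?mulr_ge0// ltW.
  have h2 : - (d * y) <= `|d| * (mu + pi / 2).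
    by rewrite (le_trans (ler_norm _))// normrN normrM ler_wpM2l// ltW.
  rlra.
rewrite lte_mul_pinfty// ?lee_fin ?sqr_ge0//.
exact: N2_worm_pow.
Qed.

End worm_integrability.

(** * Pole pushing and the kernel *)

Section pole_pushing.
Context {R : realType}.
Variable (S : set R[i]).
Implicit Types (h u v : R[i] -> R[i]) (p : {poly R[i]}).

Definition poly_approximable h := forall e : R, 0 < e -> exists p,
  forall q, S q -> normc (h q - p.[q]) <= e.

Definition bounded_by (B : R) h := forall q, S q -> normc (h q) <= B.

Lemma poly_approximable_horner p : poly_approximable (horner p).
Proof. by move=> e e0; exists p => q _; rewrite subrr normc0 ltW. Qed.

Lemma poly_approximable_cst a : poly_approximable (fun=> a).
Proof. by move=> e e0; exists a%:P => q _; rewrite hornerC subrr normc0 ltW. Qed.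

Lemma eq_poly_approximable h u : (forall q, S q -> h q = u q) ->
  poly_approximable h -> poly_approximable u.
Proof. by move=> hu ah e /ah[p Hp]; exists p => q Sq; rewrite -hu//; exact: Hp. Qed.

Lemma poly_approximableD h u : poly_approximable h -> poly_approximable u ->
  poly_approximable (fun q => h q + u q).
Proof.
move=> ah au e e0; have e2 : 0 < e / 2 by rewrite divr_gt0.
have [p Hp] := ah _ e2; have [p' Hp'] := au _ e2; exists (p + p') => q Sq.
rewrite hornerD opprD addrACA (le_trans (le_normcD _ _))//.
have := Hp _ Sq; have := Hp' _ Sq; lra.
Qed.

Lemma poly_approximableM B B' h u : bounded_by B h -> bounded_by B' u ->
  poly_approximable h -> poly_approximable u -> poly_approximable (fun q => h q * u q).
Proof.
move=> bh bu ah au e e0.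
pose K := `|B| + `|B'| + 1.
have B0 := normr_ge0 B; have B'0 := normr_ge0 B'.
have K0 : 0 < K by rewrite /K; lra.
pose d := Num.min 1 (e / (2 * K)).
have d0 : 0 < d by rewrite lt_min ltr01/= divr_gt0// mulr_gt0.
have [p Hp] := ah _ d0; have [p' Hp'] := au _ d0; exists (p * p') => q Sq.
have hp := Hp _ Sq; have hp' := Hp' _ Sq.
have d1 : d <= 1 by rewrite ge_min lexx.
have dK : d * (2 * K) <= e.
  by rewrite -ler_pdivlMr ?mulr_gt0// ge_min lexx orbT.
rewrite hornerM.
have -> : h q * u q - p.[q] * p'.[q] = (h q - p.[q]) * u q + p.[q] * (u q - p'.[q]) by ring.
rewrite (le_trans (le_normcD _ _))// !normcM.
have uK : normc (u q) <= K.
  by rewrite (le_trans (bu _ Sq))// (le_trans (ler_norm _))// /K; lra.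
have pK : normc p.[q] <= K.
  have := le_normc_sub p.[q] (h q); rewrite normcB_sym => h1.
  have := bh _ Sq; have := ler_norm B; rewrite /K; rlra.
have h1 : normc (h q - p.[q]) * normc (u q) <= d * K by rewrite ler_pM ?normc_ge0.
have h2 : normc p.[q] * normc (u q - p'.[q]) <= K * d by rewrite ler_pM ?normc_ge0.
rlra.
Qed.

Lemma poly_approximableX B h n : bounded_by B h -> poly_approximable h ->
  poly_approximable (fun q => h q ^+ n).
Proof.
move=> bh ah; elim: n => [|n ih].
  by apply: eq_poly_approximable (poly_approximable_cst 1) => q _; rewrite expr0.
apply: (@eq_poly_approximable (fun q => h q * h q ^+ n)) => [q _|]; first by rewrite exprS.
apply: (poly_approximableM (B' := B ^+ n) bh _ ah ih) => q Sq; rewrite normcX.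
by rewrite lerXn2r ?nnegrE ?normc_ge0 ?(le_trans (normc_ge0 _) (bh _ Sq))//; exact: bh.
Qed.

Lemma poly_approximable_sum (F : nat -> R[i] -> R[i]) n :
  (forall k, poly_approximable (F k)) -> poly_approximable (fun q => \sum_(k < n) F k q).
Proof.
move=> aF; elim: n => [|n ih].
  by apply: eq_poly_approximable (poly_approximable_cst 0) => q _; rewrite big_ord0.
apply: (@eq_poly_approximable (fun q => \sum_(k < n) F k q + F n q)) => [q _|].
  by rewrite big_ord_recr.
exact: poly_approximableD.
Qed.

Lemma dyadic_shell_exists (r : R) : 0 < r -> exists k, (2^-1 : R) ^+ k <= r.
Proof.
move=> r0; exists (Num.bound r^-1); rewrite exprVn -[X in _ <= X]invrK lef_pV2 ?posrE ?exprn_gt0 ?invr_gt0//.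
apply: (le_trans (ltW (archi_boundP _))); first by rewrite invr_ge0 ltW.
by rewrite -natrX ler_nat ltnW// ltn_expl.
Qed.

Lemma poly_approximable_geometric B u v : 0 <= B -> bounded_by B u -> bounded_by 2^-1 v ->
  poly_approximable u -> poly_approximable v -> poly_approximable (fun q => u q / (1 - v q)).
Proof.
move=> B0 bu bv au av e e0.
have [n Hn] : exists n, 2 * B * 2^-1 ^+ n <= e / 2.
  have [|k Hk] := @dyadic_shell_exists (e / 2 / (2 * B + 1)); first by rewrite !divr_gt0//; lra.
  exists k; have k0 : 0 < (2^-1 : R) ^+ k by rewrite exprn_gt0// invr_gt0.
  by move: Hk; rewrite ler_pdivlMr; [lra|lra].
have e2 : 0 < e / 2 by rewrite divr_gt0.
have : poly_approximable (fun q => \sum_(k < n) u q * v q ^+ k).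
  apply: (@poly_approximable_sum (fun k q => u q * v q ^+ k)) => k; have ak := poly_approximableX k bv av.
  apply: (poly_approximableM bu _ au ak) => q Sq; rewrite normcX.
  by apply: (lerXn2r k _ _ (bv _ Sq)); rewrite nnegrE ?normc_ge0 ?invr_ge0.
move=> /(_ _ e2)[p Hp]; exists p => q Sq.
have v1 : normc (v q) <= 2^-1 := bv _ Sq.
have n1 : 2^-1 <= normc (1 - v q).
  by have := le_normc_sub 1 (v q); rewrite normc1; lra.
have nz : 1 - v q != 0 by rewrite -normc_gt0; lra.
have E : u q / (1 - v q) - \sum_(k < n) u q * v q ^+ k = u q * v q ^+ n / (1 - v q).
  rewrite -mulr_sumr; have := subrX1 (v q) n => X.
  have -> : \sum_(k < n) v q ^+ k = (1 - v q ^+ n) / (1 - v q).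
    by apply: (mulIf nz); rewrite divfK// -[1 - v q]opprB -[1 - v q ^+ n]opprB X; ring.
  by field.
have h1 : normc (u q / (1 - v q) - \sum_(k < n) u q * v q ^+ k) <= e / 2.
  rewrite E !normcM normcV normcX; apply: le_trans Hn.
  have i1 : (normc (1 - v q))^-1 <= 2.
    by rewrite -[X in _ <= X]invrK lef_pV2 ?posrE ?invr_gt0//; lra.
  have x1 : normc (v q) ^+ n <= 2^-1 ^+ n by rewrite lerXn2r ?nnegrE ?normc_ge0 ?invr_ge0.
  have -> : 2 * B * 2^-1 ^+ n = B * 2^-1 ^+ n * 2 by ring.
  apply: ler_pM => //; rewrite ?invr_ge0 ?mulr_ge0 ?exprn_ge0 ?normc_ge0//.
  by apply: ler_pM => //; rewrite ?exprn_ge0 ?normc_ge0//; exact: bu.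
have := normc_distD (u q / (1 - v q)) (\sum_(k < n) u q * v q ^+ k) p.[q].
have := Hp _ Sq; lra.
Qed.

(** The pole travels down the real axis from beyond 2 |Q| + 1, where 1 / (b - q) is a geometric
    series in q / b, to 1 in steps d = c / 2. With s = 1 / (b + d - q) one has 1 / (b - q) = s / (1
    - d s), and |d s| <= 1/2, so each step is again a geometric series. *)
Lemma pole_pushing (Q c : R) : 0 < c -> bounded_by Q id ->
  (forall q, S q -> forall b : R, 1 <= b -> c <= normc (b%:C - q)) ->
  poly_approximable (fun q => (1 - q)^-1).
Proof.
move=> c0 bQ Hc.
pose d := c / 2; have d0 : 0 < d by rewrite divr_gt0.
pose B := 2 * `|Q| + 1; have B0 : 0 < B by rewrite /B; have := normr_ge0 Q; lra.
have inv_bound b : 1 <= b -> bounded_by c^-1 (fun q => (b%:C - q)^-1).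
  move=> b1 q Sq; rewrite normcV lef_pV2 ?posrE//; first exact: Hc.
  exact: lt_le_trans (Hc _ Sq _ b1).
have step n : forall b : R, 1 <= b -> B <= b + n%:R * d -> poly_approximable (fun q => (b%:C - q)^-1).
  elim: n => [b b1|n ih b b1].
    rewrite mul0r addr0 => Bb; have b0 : 0 < b by lra.
    have bn : b%:C != 0 by rewrite -normc_eq0 normc_real normr_eq0 gt_eqF.
    apply: (@eq_poly_approximable (fun q => b%:C^-1 / (1 - b%:C^-1 * q))).
      move=> q Sq; have := Hc _ Sq _ b1 => h.
      have nz : b%:C - q != 0 by rewrite -normc_gt0; lra.
      have nz' : 1 - b%:C^-1 * q != 0.
        by rewrite -[1](mulVf bn) -mulrBr mulf_neq0 ?invr_neq0.
      by field; rewrite bn nz.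
    have bi : normc b%:C^-1 = b^-1 by rewrite normcV normc_real gtr0_norm.
    apply: (@poly_approximable_geometric (b^-1)).
    - by rewrite invr_ge0 ltW.
    - by move=> q _; rewrite bi.
    - move=> q Sq; rewrite normcM bi mulrC ler_pdivrMr//.
      by have := bQ _ Sq; have := ler_norm Q; rewrite /B in Bb; rlra.
    - exact: poly_approximable_cst.
    - apply: (@eq_poly_approximable (horner (b%:C^-1 *: 'X))) => [q _|]; last exact: poly_approximable_horner.
      by rewrite hornerZ hornerX.
  move=> Bb; have bd1 : 1 <= b + d by lra.
  have ag := ih _ bd1 _; have {}ag := ag ltac:(by move: Bb; rewrite -natr1; rlra).
  have bg := inv_bound _ bd1.
  have dc : normc d%:C = d by rewrite normc_real gtr0_norm.
  apply: (@eq_poly_approximable (fun q => ((b + d)%:C - q)^-1 / (1 - d%:C * ((b + d)%:C - q)^-1))).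
    move=> q Sq; have h1 := Hc _ Sq _ b1; have h2 := Hc _ Sq _ bd1.
    have n1 : b%:C - q != 0 by rewrite -normc_gt0; lra.
    have n2 : (b + d)%:C - q != 0 by rewrite -normc_gt0; lra.
    have E : (b + d)%:C - q - d%:C = b%:C - q by rewrite rmorphD/=; ring.
    have -> : 1 - d%:C * ((b + d)%:C - q)^-1 = (b%:C - q) / ((b + d)%:C - q).
      by rewrite -E mulrBl divff.
    by rewrite invf_div mulrA mulVf// mul1r.
  apply: (@poly_approximable_geometric c^-1) => //.
  - by rewrite invr_ge0 ltW.
  - move=> q Sq; rewrite normcM dc (_ : 2^-1 = d * c^-1); last by rewrite /d; field; rewrite gt_eqF.
    by rewrite ler_wpM2l ?(ltW d0)//; exact: bg.
  - apply: (poly_approximableM (B := d) _ bg) => //; last exact: poly_approximable_cst.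
    by move=> q _; rewrite dc.
have := step (Num.bound (B / d)) 1 (lexx _); apply.
have := archi_boundP (ltW (divr_gt0 B0 d0)); rewrite ltr_pdivrMr//; lra.
Qed.

End pole_pushing.

(** * Convexity of Om and lower bounds for the kernel *)

Section gaps.
Context {R : realType}.
Implicit Types (w u : R[i]) (x y t tau : R).

Lemma cos_norm x : cos `|x| = cos x.
Proof. by case: (ger0P x) => // _; rewrite cosN. Qed.

(** The left side has derivative -(1 + k^2) e^{k d} sin d in d, so its maximum on [-pi, pi] is at d
    = 0. For k = tan m it says cos (m + d) <= cos m * e^{- k d}: the graph of ln cos lies below its
    tangent at m. *)
Lemma cos_exp_tangent (k d : R) : `|d| <= pi -> expR (k * d) * (cos d - k * sin d) <= 1.
Proof.
move=> dpi.
pose g (x : R) := expR (k * x) * (cos x - k * sin x).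
pose g' (x : R) := - ((1 + k ^+ 2) * expR (k * x) * sin x).
have dg x : is_derive x 1 g (g' x).
  rewrite /g /g'; apply: is_derive_eq; rewrite -![_ *: _]/(_ * _); ring.
have g0 : g 0 = 1 by rewrite /g mulr0 expR0 cos0 sin0; ring.
have cg a b : {within `[a, b], continuous g}.
  apply: continuous_subspaceT => x; apply: differentiable_continuous.
  by apply/derivable1_diffP; case: (dg x).
suff : g d <= g 0 by rewrite g0.
have [d0|d0] := leP 0 d.
  have [|c] := @MVT_segment _ g g' 0 d d0 (fun x _ => dg x); first exact: cg.
  rewrite in_itv/= => /andP[c0 cd] E; rewrite -subr_le0 E subr0 /g' mulNr oppr_le0.
  rewrite !mulr_ge0 ?expR_ge0 ?addr_ge0 ?sqr_ge0// sin_ge0_pi//.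
  by rewrite c0 (le_trans cd)// (le_trans (ler_norm _)).
have [|c] := @MVT_segment _ g g' d 0 (ltW d0) (fun x _ => dg x); first exact: cg.
rewrite in_itv/= => /andP[dc c0] E; rewrite -subr_ge0 E sub0r /g' mulrNN.
have -> : (1 + k ^+ 2) * expR (k * c) * sin c * d = (1 + k ^+ 2) * expR (k * c) * (sin c * d) by ring.
apply: mulr_ge0; first by apply: mulr_ge0; [exact: addr_ge0 ler01 (sqr_ge0 k)|exact: expR_ge0].
apply: mulr_le0; last exact: ltW.
rewrite -oppr_ge0 -sinN sin_ge0_pi// oppr_ge0 c0/=.
rewrite (@le_trans _ _ (- d)) ?lerN2//; apply: le_trans dpi; rewrite -normrN; exact: ler_norm.
Qed.

Lemma ltr_norm_convex (a b l r : R) : 0 <= l <= 1 -> `|a| < r -> `|b| < r ->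
  `|(1 - l) * a + l * b| < r.
Proof.
move=> /andP[l0 l1] ha hb; pose M := Num.max `|a| `|b|.
have M1 : M < r by rewrite gt_max ha.
have l2 : 0 <= 1 - l by rewrite subr_ge0.
apply: le_lt_trans M1; apply: (le_trans (ler_normD _ _)); rewrite !normrM (ger0_norm l0) (ger0_norm l2).
have h1 : (1 - l) * `|a| <= (1 - l) * M by rewrite ler_wpM2l// le_max lexx.
have h2 : l * `|b| <= l * M by rewrite ler_wpM2l// le_max lexx orbT.
lra.
Qed.

(* The tangent line of the concave function [ln \o cos] at the convex
   combination [m], read after exponentiation. *)
Lemma exp_lt_cos_convex (x1 x2 y1 y2 l : R) : 0 <= l <= 1 ->
  `|y1| < pi / 2 -> `|y2| < pi / 2 -> expR x1 < 2 * cos y1 -> expR x2 < 2 * cos y2 ->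
  expR ((1 - l) * x1 + l * x2) < 2 * cos ((1 - l) * y1 + l * y2).
Proof.
move=> /andP[l0 l1] h1 h2 e1 e2; set m := _ + l * y2.
have mb : `|m| < pi / 2 by apply: ltr_norm_convex; rewrite ?l0.
have cm : 0 < cos m by apply: cos_gt0_pihalf; rewrite -ltr_norml.
pose k := tan m; have kE : sin m = k * cos m by rewrite /k /tan divfK// gt_eqF.
have tg x y : `|y| < pi / 2 -> expR x < 2 * cos y -> x < ln (2 * cos m) - k * (y - m).
  move=> hy ex; rewrite -ltr_expR expRD lnK ?posrE ?mulr_gt0// expRN.
  have d1 : `|y - m| <= pi by have := ler_normB y m; rlra.
  have := cos_exp_tangent k d1; set E := expR _ => T.
  have E0 : 0 < E by exact: expR_gt0.
  apply: (lt_le_trans ex); rewrite ler_pdivlMr//.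
  have -> : cos y = cos m * (cos (y - m) - k * sin (y - m)).
    by rewrite -[in LHS](subrK m y) (cosD (y - m) m) kE; ring.
  have := ler_wpM2l (ltW cm) T; clear; lra.
have t1 := tg _ _ h1 e1; have t2 := tg _ _ h2 e2.
rewrite -[X in _ < X]lnK ?posrE ?mulr_gt0// ltr_expR.
have E : k * (m - m) = 0 by rewrite subrr mulr0.
have : (1 - l) * (k * (y1 - m)) + l * (k * (y2 - m)) = 0 by rewrite /m; ring.
move: (k * (y1 - m)) (k * (y2 - m)) (ln _) t1 t2 => A B C t1 t2 H.
have [l00|l00] := eqVneq l 0; first by rewrite l00 in H *; rlra.
have lp : 0 < l by rewrite lt_neqAle eq_sym l00.
have : (1 - l) * x1 <= (1 - l) * (C - A) by rewrite ler_wpM2l ?subr_ge0// ltW.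
have : l * x2 < l * (C - B) by rewrite ltr_pM2l.
rlra.
Qed.

(** The conditions on the pair (w, s) are jointly convex, because ln cos is concave, and [Om] is the
    projection of this convex set. *)
Lemma Om_convex (mu tau : R) w u (l : R) : 0 <= l <= 1 -> Om mu tau w -> Om mu tau u ->
  Om mu tau (w + l%:C * (u - w)).
Proof.
move=> l01 [s hs [h1 h2]] [s' hs' [h1' h2']]; have /andP[l0 l1] := l01.
exists ((1 - l) * s + l * s'); first exact: ltr_norm_convex.
have -> : w + l%:C * (u - w) = (1 - l)%:C * w + l%:C * u by rewrite rmorphB rmorph1; ring.
rewrite /adm !cReD !cImD !cReM !cImM /= !mul0r !subr0 !addr0.
set y := (1 - l) * complex.Im w + l * complex.Im u - _.
have yE : y = (1 - l) * (complex.Im w - s) + l * (complex.Im u - s') by rewrite /y; ring.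
split.
  by rewrite yE; exact: ltr_norm_convex.
rewrite yE (_ : _ - tau = (1 - l) * (complex.Re w - tau) + l * (complex.Re u - tau)); last by ring.
exact: exp_lt_cos_convex.
Qed.

(** As [adm] is an open condition in [s], a height with |s| = mu can be replaced by (1 - k) s for
    small [k]. *)
Lemma Om_closed (mu tau : R) w s : 0 < mu -> `|s| <= mu -> adm tau w s -> Om mu tau w.
Proof.
move=> mu0 hs ha; have s1 : `|s| < mu + 1 by lra.
have [e e0 He] := adm_open s1 ha.
pose k := Num.min 2^-1 (e / (2 * mu)).
have k0 : 0 < k by rewrite lt_min invr_gt0 ltr0n/= divr_gt0// mulr_gt0.
have k1 : k <= 2^-1 by rewrite ge_min lexx.
have ke : k * (2 * mu) <= e by rewrite -ler_pdivlMr ?mulr_gt0// ge_min lexx orbT.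
exists ((1 - k) * s).
  rewrite normrM gtr0_norm; last lra.
  by have := normr_ge0 s; nra.
apply (He w ((1 - k) * s)); rewrite ?subrr ?normr0//.
rewrite (_ : _ - s = - (k * s)); last by ring.
rewrite normrN normrM gtr0_norm//; have := normr_ge0 s; nra.
Qed.

(* Top, bottom and right edges of the integration contours: arcs of the
   boundary of [Om mu t] and a vertical segment. *)
Definition contour_edge (mu t : R) : set R[i] := [set u |
  (exists2 psi : R, 0 <= psi < pi / 2 &
     expR (complex.Re u - t) = 2 * cos psi /\ `|complex.Im u| = mu + psi) \/
  complex.Re u = ln 2 + t /\ `|complex.Im u| <= mu].

Lemma contour_edge_Re mu t u : contour_edge mu t u -> complex.Re u <= ln 2 + t.
Proof.
case=> [[psi _ [h _]]|[-> //]].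
rewrite -lerBlDr -ler_expR h lnK ?posrE// ler_piMr// cos_le1.
Qed.

Lemma adm_shrink (t tau : R) w s psi : `|psi| < pi / 2 -> 0 < t ->
  expR (complex.Re w - tau) <= 2 * cos psi -> `|complex.Im w - s| <= `|psi| ->
  adm (tau + t) w s.
Proof.
move=> hp t0 h1 h2; have p0 := pi_gt0 R; split; first lra.
have c0 : 0 < cos psi by apply: cos_gt0_pihalf; rewrite -ltr_norml.
have cE : cos psi <= cos (complex.Im w - s).
  rewrite -(cos_norm psi) -(cos_norm (_ - s)) leNgt ltr_cos ?in_itv/= ?normr_ge0/=; first by rewrite -leNgt.
  - lra.
  - lra.
rewrite opprD addrA expRD; apply: (@lt_le_trans _ _ (2 * cos psi)); last by rewrite ler_pM2l.
apply: (le_lt_trans (y := 2 * cos psi * expR (- t))); first by rewrite ler_wpM2r ?expR_ge0.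
by rewrite gtr_pMr ?mulr_gt0// expR_lt1 oppr_lt0.
Qed.

(** The height to use is the point of [-mu, mu] nearest to Im w, at distance at most psi; the shift
    by t turns the weak inequality into a strict one. *)
Lemma Om_of_gap (mu t tau : R) w psi : 0 < mu -> 0 < t -> 0 <= psi < pi / 2 ->
  expR (complex.Re w - tau) <= 2 * cos psi -> `|complex.Im w| <= mu + psi -> Om mu (tau + t) w.
Proof.
move=> mu0 t0 /andP[p0 p1] h1 h2; set y := complex.Im w in h2 *.
have pn : `|psi| = psi by rewrite ger0_norm.
have H s : `|s| <= mu -> `|y - s| <= psi -> Om mu (tau + t) w.
  move=> hs hy; apply: (Om_closed mu0 hs); apply: adm_shrink h1 _; rewrite ?pn//.
have [y1|y1] := leP `|y| mu; first by apply: (H y y1); rewrite subrr normr0.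
have [y0|y0] := leP 0 y.
  rewrite ger0_norm// in h2 y1.
  by apply: (H mu); rewrite ?gtr0_norm// ?subr_gt0//; lra.
rewrite ltr0_norm// in h2 y1.
apply: (H (- mu)); first by rewrite normrN gtr0_norm.
by rewrite opprK -normrN gtr0_norm; rlra.
Qed.

Lemma contour_edge_Om mu t u : 0 < mu -> 0 < t -> contour_edge mu t u -> Om mu (t + t / 2) u.
Proof.
move=> mu0 t0; have t2 : 0 < t / 2 by rewrite divr_gt0.
have p0 := pi_gt0 R.
case=> [[psi hpsi [h1 h2]]|[h1 h2]].
  by apply: (Om_of_gap mu0 t2 hpsi); rewrite ?h1 ?h2.
apply: (@Om_of_gap mu _ _ _ 0 mu0 t2); rewrite ?addr0//; first by rewrite lexx divr_gt0.
by rewrite h1 addrK lnK ?posrE// cos0 mulr1.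
Qed.

(** The distance from b to the ray of angle theta is b |sin theta| or b. The half angle bounds both
    from below and does not vanish at theta = pi. *)
Lemma normc_real_sub_cexp (b : R) v : 0 <= b -> b * `|sin (complex.Im v / 2)| <= normc (b%:C - cexp v).
Proof.
move=> b0; rewrite -(@ler_pXn2r _ 2)// ?nnegrE ?normc_ge0 ?mulr_ge0//.
rewrite normcE cReB cImB /= sub0r exprMn real_normK ?num_real//.
set r := expR _; set th := complex.Im v.
have r0 : 0 < r by exact: expR_gt0.
have e2 : th = (th / 2) *+ 2 by rewrite -mulr_natr; field.
have c := cos_mulr2n (th / 2); have s2 := cos2Dsin2 (th / 2); have s1 := cos2Dsin2 th.
rewrite -e2 in c; rewrite -mulr_natr in c.
have -> : (b - r * cos th) ^+ 2 + (- (r * sin th)) ^+ 2 =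
    b ^+ 2 + r ^+ 2 * (cos th ^+ 2 + sin th ^+ 2) - 2 * b * r * cos th by ring.
rewrite s1 c; have -> : cos (th / 2) ^+ 2 = 1 - sin (th / 2) ^+ 2 by lra.
set S := sin _ ^+ 2; have S0 : 0 <= S by exact: sqr_ge0.
have S1 : S <= 1 by have := sqr_ge0 (cos (th / 2)); rewrite /S; lra.
have := sqr_ge0 (b - r).
have h1 : b ^+ 2 * S <= b ^+ 2 by rewrite ler_piMr ?sqr_ge0.
have h2 : 0 <= b * r * S by exact: mulr_ge0 (mulr_ge0 b0 (ltW r0)) S0.
have h3 : (b - r) ^+ 2 * S <= (b - r) ^+ 2 by rewrite ler_piMr ?sqr_ge0.
have h4 : 0 <= r ^+ 2 * S by rewrite mulr_ge0 ?sqr_ge0.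
lra.
Qed.

Lemma normr_sin x : 0 <= sin `|x| -> `|sin x| = sin `|x|.
Proof.
case: (ger0P x) => x0 s0; first by rewrite ger0_norm.
by rewrite sinN in s0 *; rewrite ler0_norm// -oppr_ge0.
Qed.

Lemma sin_ge_mul_cos2 (A T : R) : 0 <= T -> T / 2 <= A -> A < pi / 2 -> T * cos A ^+ 2 <= sin T.
Proof.
move=> T0 TA A2; have p0 := pi_gt0 R.
have h : T / 2 * cos (T / 2) <= sin (T / 2) by apply: sin_ge_mul_cos; apply/andP; split; lra.
have cA : 0 <= cos A by apply: cos_ge0_pihalf; apply/andP; split; lra.
have cc : cos A <= cos (T / 2).
  by rewrite leNgt ltr_cos ?in_itv/=; [rewrite -leNgt|apply/andP; split; rlra|apply/andP; split; rlra].
have -> : sin T = 2 * sin (T / 2) * cos (T / 2).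
  have {1}-> : T = (T / 2) *+ 2 by rewrite -mulr_natr; field.
  by rewrite sin_mulr2n -mulr_natr; ring.
have c0 := le_trans cA cc.
have k1 : cos A ^+ 2 <= cos (T / 2) ^+ 2 by apply: lerXn2r.
have k2 := ler_wpM2l T0 k1.
have k3 := ler_wpM2r c0 h.
rlra.
Qed.

(** The difference cos phi - cos psi exceeds (a - 1) cos psi and, the cosine being 1-Lipschitz, is
    at most psi - |phi|. *)
Lemma cos_height_gap (a psi phi : R) : 0 <= psi < pi / 2 -> `|phi| < pi / 2 -> 1 < a ->
  a * cos psi < cos phi -> (a - 1) * cos psi <= psi - `|phi|.
Proof.
move=> /andP[psi0 psi1] hphi a1 h; have p0 := pi_gt0 R.
have cp : 0 < cos psi by apply: cos_gt0_pihalf; apply/andP; split; lra.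
have le : cos psi <= a * cos psi by rewrite ler_peMl ?(ltW cp)// ltW.
have ppsi : `|phi| < psi.
  rewrite -ltr_cos ?in_itv/= ?normr_ge0/=; [rewrite cos_norm; lra|lra|].
  by apply/andP; split; lra.
have := cos_lipschitz `|phi| psi; rewrite cos_norm.
have -> : `| `|phi| - psi| = psi - `|phi| by rewrite distrC gtr0_norm// subr_gt0.
have := ler_norm (cos phi - cos psi); lra.
Qed.

(* For [w] in [Om mu 0] not far to the left of [u], the height of [u] exceeds
   that of [w] by a multiple of [expR (Re u)]. *)
Lemma kernel_gap (mu t : R) : pi / 2 < mu -> 0 < t ->
  exists2 c : R, 0 < c & forall w u (b : R), Om mu 0 w -> contour_edge mu t u -> 1 <= b ->
    c * expR (complex.Re u) <= normc (b%:C - cexp ((pi / (2 * mu))%:C * (w - u))).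
Proof.
move=> hmu t0; have p0 := pi_gt0 R; set nu := pi / (2 * mu).
have mu0 : 0 < mu by rlra.
have nu0 : 0 < nu by rewrite divr_gt0// mulr_gt0.
(* This is where mu > pi / 2 enters: the argument nu (Im w - Im u) of the exponential stays below 2
   pi in modulus, so the sine of its half vanishes only at 0. *)
have nuM : nu * (mu + pi / 2) < pi.
  rewrite /nu mulrAC ltr_pdivrMr ?mulr_gt0// ltr_pM2l//; rlra.
pose A := nu * (mu + pi / 2) / 2.
have A0 : 0 < A by rewrite divr_gt0// mulr_gt0//; rlra.
have cA : 0 < cos A by apply: cos_gt0_pihalf; rewrite /A; apply/andP; split; rewrite /A in A0; rlra.
have A2 : A < pi / 2 by rewrite /A; rlra.
(* [c1] serves when Re w <= Re u - t / 2: the exponential is then at most e^{- nu t / 2} in modulus,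
   and 2 e^t bounds e^{Re u}. [c2] serves otherwise, through the difference of heights. *)
pose c1 := (1 - expR (- (nu * (t / 2)))) / (2 * expR t).
have et : expR (- (nu * (t / 2))) < 1 by rewrite expR_lt1 oppr_lt0 mulr_gt0// divr_gt0.
have c10 : 0 < c1 by rewrite divr_gt0 ?subr_gt0// mulr_gt0// expR_gt0.
have et2 : 1 < expR (t / 2) by rewrite expR_gt1 divr_gt0.
pose c2 := nu * (expR (t / 2) - 1) / 4 * expR (- t) * cos A ^+ 2.
have c20 : 0 < c2 by rewrite /c2 mulr_gt0 ?exprn_gt0// mulr_gt0 ?expR_gt0// divr_gt0// mulr_gt0// subr_gt0.
exists (Num.min c1 c2); first by rewrite lt_min c10.
move=> w u b ww uu b1; have b0 := le_trans ler01 b1; have e0 := expR_gt0 (complex.Re u).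
have ux := contour_edge_Re uu.
have eu : expR (complex.Re u) <= 2 * expR t.
  by rewrite -[X in X * _](@lnK R) ?posrE// -expRD ler_expR.
have far : complex.Re w <= complex.Re u - t / 2 ->
    Num.min c1 c2 * expR (complex.Re u) <= normc (b%:C - cexp (nu%:C * (w - u))).
  move=> h; have := le_normc_sub b%:C (cexp (nu%:C * (w - u))).
  rewrite normc_real ger0_norm; last rlra.
  rewrite normc_cexp cReM /= mul0r subr0 cReB => k1.
  have k2 : expR (nu * (complex.Re w - complex.Re u)) <= expR (- (nu * (t / 2))).
    by rewrite ler_expR -mulrN ler_pM2l//; clear -h; rlra.
  have k3 : Num.min c1 c2 * expR (complex.Re u) <= c1 * (2 * expR t).
    by rewrite ler_pM ?expR_ge0// ?ge_min ?lexx// le_min !ltW.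
  have k4 : c1 * (2 * expR t) = 1 - expR (- (nu * (t / 2))).
    by rewrite /c1 divfK// gt_eqF// mulr_gt0// expR_gt0.
  clear -b1 k1 k2 k3 k4; rlra.
case: (ww) => s hs [hy hw]; rewrite subr0 in hw.
have cw := cos_le1 (complex.Im w - s).
case: (uu) => [[psi /andP[psi0 psi1] [h1 h2]]|[h1 h2]]; last first.
  apply: far; rewrite h1; suff : complex.Re w < ln 2 by (clear -t0; rlra).
  by rewrite -ltr_expR lnK ?posrE//; clear -hw cw; rlra.
have [/far//|hf] := leP (complex.Re w) (complex.Re u - t / 2).
set phi := complex.Im w - s in hy hw cw.
(* Since Re w > Re u - t / 2, half of the translation by t is left over; it makes the cosine at [w]
   exceed that at [u] by a factor e^{t / 2} and so separates the heights. *)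
have cphi : expR (t / 2) * cos psi < cos phi.
  have : expR (complex.Re u - t / 2) < 2 * cos phi by apply: lt_trans hw; rewrite ltr_expR.
  rewrite (_ : _ - t / 2 = (complex.Re u - t) + t / 2); last by field.
  by rewrite expRD h1; clear; lra.
have gap : (expR (t / 2) - 1) * cos psi <= psi - `|phi|.
  by apply: cos_height_gap; rewrite ?psi0.
set d := nu * (complex.Im w - complex.Im u).
have ImE : complex.Im (nu%:C * (w - u)) = d by rewrite cImM /= mul0r addr0 cImB.
have yw : `|complex.Im w| <= `|phi| + `|s|.
  by have := ler_normD phi s; rewrite /phi subrK.
have dlo : psi - `|phi| <= `|complex.Im w - complex.Im u|.
  by have := lerB_dist (complex.Im u) (complex.Im w); rewrite distrC; clear -hs h2 yw; rlra.
have dhi : `|complex.Im w - complex.Im u| <= 2 * (mu + pi / 2).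
  by have := ler_normB (complex.Im w) (complex.Im u); clear -hs psi1 h2 hy yw; rlra.
set T := `|d| / 2.
have TE : T = nu * `|complex.Im w - complex.Im u| / 2.
  by rewrite /T /d normrM (gtr0_norm nu0).
have T0 : 0 <= T by rewrite divr_ge0.
have T1 : T / 2 <= A.
  rewrite TE /A; have : nu * `|complex.Im w - complex.Im u| <= nu * (2 * (mu + pi / 2)) by rewrite ler_pM2l.
  clear; lra.
have sT : T * cos A ^+ 2 <= sin T by exact: sin_ge_mul_cos2.
have := normc_real_sub_cexp (nu%:C * (w - u)) b0; rewrite ImE; apply: le_trans.
have sT0 : 0 <= sin T by apply: le_trans sT; rewrite mulr_ge0 ?sqr_ge0.
have TE2 : T = `|d / 2| by rewrite /T [RHS]normrM (@ger0_norm _ 2^-1) ?invr_ge0.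
rewrite TE2 in sT0; rewrite normr_sin// -TE2; rewrite -TE2 in sT0.
apply: (@le_trans _ _ (sin T)); last by rewrite ler_peMl.
apply: le_trans sT.
have k1 : Num.min c1 c2 * expR (complex.Re u) <= c2 * expR (complex.Re u).
  by rewrite ler_pM2r// ge_min lexx orbT.
apply: (le_trans k1).
have -> : expR (complex.Re u) = 2 * cos psi * expR t by rewrite -h1 -expRD subrK.
have -> : c2 * (2 * cos psi * expR t) = (nu / 2 * ((expR (t / 2) - 1) * cos psi)) * cos A ^+ 2.
  by rewrite /c2 expRN; field; rewrite gt_eqF ?expR_gt0.
rewrite ler_wpM2r ?sqr_ge0// TE.
have := ler_wpM2l (ltW nu0) (le_trans gap dlo); clear; lra.
Qed.

End gaps.

(** * Contours *)

Section contour.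
Context {R : realType}.
Implicit Types (w u : R[i]) (x t b : R).

(** With psi = - x this is Re u = ln (2 cos psi) + t, Im u = mu + psi, run from left to right and
    ending on the vertical edge at psi = 0. The parameter b < pi / 2 cuts off the end at -oo. *)
Definition top_arc (mu t b : R) : @arc R :=
  Arc (fun x => (ln (2 * cos x) + t) +i* (mu - x)) (fun x => (- (sin x / cos x)) +i* (-1)) (- b) 0.
Definition bottom_arc (mu t b : R) : @arc R :=
  Arc (fun x => (ln (2 * cos x) + t) +i* (x - mu)) (fun x => (- (sin x / cos x)) +i* 1) (- b) 0.
Definition right_arc (mu t : R) : @arc R := varc (ln 2 + t) (- mu) mu.
Definition left_arc (mu t b : R) : @arc R := varc (ln (2 * cos b) + t) (- (mu + b)) (mu + b).

Lemma cos_gt0_near b x : 0 <= b < pi / 2 -> - b <= x <= 0 -> 0 < cos x.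
Proof. by move=> hb hx; apply: cos_gt0_pihalf; apply/andP; split; lra. Qed.

Lemma is_derive_ln_cos t x : 0 < cos x ->
  is_derive x 1 (fun x => ln (2 * cos x) + t) (- (sin x / cos x)).
Proof.
move=> c0; have c20 : 0 < 2 * cos x by rewrite mulr_gt0.
have d : is_derive x 1 (@ln R \o (fun x => 2 * cos x)) ((2 * cos x)^-1 * (2 * - sin x)).
  by apply: is_derive1_comp; exact: is_derive1_ln.
apply: (@is_derive_eq _ _ _ (fun x => (@ln R \o (fun x => 2 * cos x)) x + t)).
by field; rewrite gt_eqF.
Qed.

Lemma is_derive_tanN x : 0 < cos x -> exists d, is_derive x 1 (fun x => - (sin x / cos x) : R) d.
Proof.
move=> c0; eexists; apply: is_deriveN; apply: is_deriveM.
by apply: is_deriveV; rewrite gt_eqF.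
Qed.

Lemma top_arc_ok mu t b : 0 <= b < pi / 2 -> arc_ok (top_arc mu t b).
Proof.
move=> hb; split => [|x hx|]; rewrite /=; first by rewrite oppr_le0; case/andP: hb.
  apply: rder_pair; first exact/is_derive_ln_cos/(cos_gt0_near hb).
  by rewrite -[-1]sub0r; apply: is_deriveB.
apply: ccon_ex => x hx; have [d dd] := is_derive_tanN (cos_gt0_near hb hx).
by exists (d +i* 0); apply: rder_pair.
Qed.

Lemma bottom_arc_ok mu t b : 0 <= b < pi / 2 -> arc_ok (bottom_arc mu t b).
Proof.
move=> hb; split => [|x hx|]; rewrite /=; first by rewrite oppr_le0; case/andP: hb.
  apply: rder_pair; first exact/is_derive_ln_cos/(cos_gt0_near hb).
  by apply: is_derive_eq; rewrite ?subr0 ?addr0.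
apply: ccon_ex => x hx; have [d dd] := is_derive_tanN (cos_gt0_near hb hx).
by exists (d +i* 0); apply: rder_pair.
Qed.

Lemma right_arc_ok mu t : 0 < mu -> arc_ok (right_arc mu t).
Proof. by move=> mu0; apply: varc_ok; lra. Qed.

Lemma left_arc_ok mu t b : 0 < mu -> 0 <= b < pi / 2 -> arc_ok (left_arc mu t b).
Proof. by move=> mu0 /andP[b0 _]; apply: varc_ok; lra. Qed.

(* The three edges on which the kernel is controlled, cut at [Re u = X]. *)
Definition cut_edge (mu t X : R) : set R[i] := [set u | contour_edge mu t u /\ X <= complex.Re u].

Lemma expR_ln2cos t x : 0 < cos x -> expR (ln (2 * cos x) + t - t) = 2 * cos x.
Proof. by move=> c0; rewrite addrK lnK// posrE mulr_gt0. Qed.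

Lemma ln2cos_mono b x : 0 <= b < pi / 2 -> - b <= x <= 0 -> ln (2 * cos b) <= ln (2 * cos x).
Proof.
move=> hb hx; have cx := cos_gt0_near hb hx; have p0 := pi_gt0 R.
have cb : 0 < cos b by apply: cos_gt0_pihalf; apply/andP; split; lra.
rewrite ler_ln ?posrE ?mulr_gt0// ler_pM2l//.
rewrite -(cos_norm x) leNgt ltr_cos ?in_itv/= ?normr_ge0/=; [rewrite -leNgt|lra|].
  by rewrite ler_norml; apply/andP; split; lra.
have : `|x| <= b by rewrite ler_norml; apply/andP; split; lra.
lra.
Qed.

Lemma top_arc_edge mu t b x : 0 < mu -> 0 <= b < pi / 2 -> aon (top_arc mu t b) x ->
  cut_edge mu t (ln (2 * cos b) + t) (apt (top_arc mu t b) x).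
Proof.
move=> mu0 hb hx; rewrite /aon/= in hx; have c0 := cos_gt0_near hb hx; split; last first.
  by rewrite /= lerD2r ln2cos_mono.
left; exists (- x); first by apply/andP; split; lra.
by rewrite /= cosN expR_ln2cos// ger0_norm//; lra.
Qed.

Lemma bottom_arc_edge mu t b x : 0 < mu -> 0 <= b < pi / 2 -> aon (bottom_arc mu t b) x ->
  cut_edge mu t (ln (2 * cos b) + t) (apt (bottom_arc mu t b) x).
Proof.
move=> mu0 hb hx; rewrite /aon/= in hx; have c0 := cos_gt0_near hb hx; split; last first.
  by rewrite /= lerD2r ln2cos_mono.
left; exists (- x); first by apply/andP; split; lra.
by rewrite /= cosN expR_ln2cos// ler0_norm//; [split=> //; lra|lra].
Qed.

Lemma right_arc_edge mu t b x : 0 < mu -> 0 <= b < pi / 2 -> aon (right_arc mu t) x ->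
  cut_edge mu t (ln (2 * cos b) + t) (apt (right_arc mu t) x).
Proof.
move=> mu0 hb hx; rewrite /aon/= in hx; split; last first.
  rewrite /= lerD2r; have -> : ln 2 = ln (2 * cos 0) :> R by rewrite cos0 mulr1.
  by rewrite ln2cos_mono// lexx andbT oppr_le0; case/andP: hb.
by right; rewrite /=; split=> //; rewrite ler_norml.
Qed.

Lemma left_arc_Om mu t b x : 0 < mu -> 0 < t -> 0 <= b < pi / 2 -> aon (left_arc mu t b) x ->
  Om mu (t + t / 2) (apt (left_arc mu t b) x).
Proof.
move=> mu0 t0 hb hx; rewrite /aon/= in hx; have p0 := pi_gt0 R.
have cb : 0 < cos b by apply: cos_gt0_pihalf; apply/andP; split; lra.
apply: (@Om_of_gap _ _ _ _ _ b mu0) => //=; first by rewrite divr_gt0.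
  by rewrite expR_ln2cos.
by rewrite ler_norml.
Qed.

(** The slope of ln cos is at most 1 / cos in modulus, and on the curved arcs 2 cos x = e^{Re u -
    t}. The speed may thus grow like e^{- Re u}, one of the two factors that the decay of F has to
    absorb. *)
Lemma edge_velocity mu t b c x : 0 < mu -> 0 < t -> 0 <= b < pi / 2 ->
  c = bottom_arc mu t b \/ c = top_arc mu t b \/ c = right_arc mu t -> aon c x ->
  normc (avel c x) <= 4 * expR t * expR (- complex.Re (apt c x)).
Proof.
move=> mu0 t0 hb.
have H y : - b <= y <= 0 -> normc ((- (sin y / cos y)) +i* (1 : R)) <= 4 * expR t * expR (- (ln (2 * cos y) + t)) /\
    normc ((- (sin y / cos y)) +i* (-1 : R)) <= 4 * expR t * expR (- (ln (2 * cos y) + t)).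
  move=> hy; have c0 := cos_gt0_near hb hy.
  have -> : 4 * expR t * expR (- (ln (2 * cos y) + t)) = 2 / cos y.
    by rewrite opprD expRD !expRN lnK ?posrE ?mulr_gt0//; field; rewrite !gt_eqF ?expR_gt0.
  have h1 : `|sin y / cos y| <= 1 / cos y.
    have s1 : `|sin y| <= 1 by rewrite ler_norml sin_geN1 sin_le1.
    by rewrite normrM normfV (gtr0_norm c0) ler_wpM2r// invr_ge0 ltW.
  have h2 : 1 <= 1 / cos y by rewrite ler_pdivlMr// mul1r cos_le1.
  have n1 := normc_le_ReIm ((- (sin y / cos y)) +i* (1 : R)).
  have n2 := normc_le_ReIm ((- (sin y / cos y)) +i* (-1 : R)).
  have E1 : `|(1 : R)| = 1 := normr1 _.
  have E2 : `|(-1 : R)| = 1 by rewrite normrN normr1.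
  split; [apply: (le_trans n1)|apply: (le_trans n2)]; rewrite [complex.Re _]/= [complex.Im _]/= ?E1 ?E2 normrN; clear -h1 h2; rlra.
case=> [->|[->|->]] hx; rewrite /aon/= in hx; first exact: (H x hx).1; first exact: (H x hx).2.
rewrite [complex.Re _]/= opprD expRD !expRN lnK ?posrE//.
have -> : normc (avel (right_arc mu t) x) = 1 by rewrite /= expr0n /= add0r expr1n sqrtr1.
have -> : 4 * expR t * (2^-1 / expR t) = 2 by field; rewrite gt_eqF ?expR_gt0.
lra.
Qed.

(** A point of the contour at the height of [w] lies to its right, because the height exceeds the
    admissible ones by psi and the cosine decreases. The principal logarithm of u - w is therefore
    available along the three edges. *)
Lemma edge_slit mu t w u : 0 < mu -> 0 < t -> Om mu 0 w -> contour_edge mu t u -> slit (u - w).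
Proof.
move=> mu0 t0 [s hs [hy hw]] eu; rewrite subr0 in hw; have p0 := pi_gt0 R.
have [E|E] := eqVneq (complex.Im u) (complex.Im w); last by right; rewrite cImB subr_eq0.
left; rewrite cReB subr_gt0; case: eu => [[psi /andP[q0 q1] [h1 h2]]|[-> _]]; last first.
  have : complex.Re w < ln 2.
    by rewrite -ltr_expR lnK ?posrE//; have := cos_le1 (complex.Im w - s); lra.
  lra.
set y := complex.Im w in E hy hw.
have hp : psi < `|y - s| by have := ler_normD (y - s) s; rewrite subrK -E h2; lra.
have cc : cos (y - s) < cos psi.
  rewrite -(cos_norm (y - s)) ltr_cos ?in_itv/= ?normr_ge0//=; clear -q0 q1 p0 hy; rlra.
have : expR (complex.Re w) < expR (complex.Re u - t) by rewrite h1; lra.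
rewrite ltr_expR; rlra.
Qed.

End contour.

(** * Approximation by exponentials *)

Ltac nonneg := solve [repeat first
  [ exact: expR_ge0 | exact: normc_ge0 | exact: normr_ge0 | exact: sqr_ge0 | exact: ler01
  | exact: ler0n | exact: pi_ge0 | assumption | (apply: ltW; assumption)
  | apply: mulr_ge0 | apply: divr_ge0 | apply: exprn_ge0 | apply: addr_ge0 | rewrite invr_ge0 ]].

Section arc_integrals.
Context {R : realType}.
Implicit Types (c : @arc R) (G H : R[i] -> R[i]).

Definition holomorphic_along c G := forall x, aon c x -> exists A, cder G (apt c x) A.

Lemma aint_ccon c G : arc_ok c -> holomorphic_along c G ->
  ccon (alo c) (ahi c) (fun x => G (apt c x) * avel c x).
Proof. by move=> ok dG; apply: cconM; [exact: ccon_arc|case: ok]. Qed.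

Lemma eq_aint c G H : (forall x, aon c x -> G (apt c x) = H (apt c x)) -> aint c G = aint c H.
Proof. by move=> GH; apply: eq_cint => x /GH ->. Qed.

Lemma aintD c G H : arc_ok c -> holomorphic_along c G -> holomorphic_along c H ->
  aint c (fun u => G u + H u) = aint c G + aint c H.
Proof.
move=> ok dG dH; rewrite /aint -cintD; try exact: aint_ccon.
by apply: eq_cint => x _; rewrite mulrDl.
Qed.

Lemma aintZ c G (a : R[i]) : arc_ok c -> holomorphic_along c G ->
  aint c (fun u => a * G u) = a * aint c G.
Proof.
move=> ok dG; rewrite /aint -cintZ; last exact: aint_ccon.
by apply: eq_cint => x _; rewrite mulrA.
Qed.

Lemma holomorphic_along_sum c n (G : 'I_n -> R[i] -> R[i]) (a : 'I_n -> R[i]) :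
  (forall k, holomorphic_along c (G k)) -> holomorphic_along c (fun u => \sum_(k < n) a k * G k u).
Proof.
elim: n G a => [|n ih] G a dG x cx.
  by exists 0; rewrite (_ : (fun u => \sum_(k < 0) a k * G k u) = (fun=> 0)); [exact: der_cst|apply/funext => u; rewrite big_ord0].
have [A dA] := dG ord0 x cx; have [B dB] := ih (fun k => G (lift ord0 k)) (fun k => a (lift ord0 k)) (fun k => dG _) x cx.
exists (a ord0 * A + B); rewrite (_ : (fun u => \sum_(k < n.+1) a k * G k u) = (fun u => a ord0 * G ord0 u + \sum_(k < n) a (lift ord0 k) * G (lift ord0 k) u)).
  by apply: derD dB; exact: derZ.
by apply/funext => u; rewrite big_ord_recl.
Qed.

Lemma aint_sum c n (G : 'I_n -> R[i] -> R[i]) (a : 'I_n -> R[i]) : arc_ok c ->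
  (forall k, holomorphic_along c (G k)) ->
  aint c (fun u => \sum_(k < n) a k * G k u) = \sum_(k < n) a k * aint c (G k).
Proof.
move=> ok; elim: n G a => [|n ih] G a dG.
  rewrite big_ord0 (@eq_aint _ _ (fun u => 0 * 0)) => [|x _]; last by rewrite big_ord0 mul0r.
  by rewrite aintZ// ?mul0r// => x _; exists 0; exact: der_cst.
rewrite big_ord_recl -ih// -aintZ// -aintD//; last 2 first.
- by move=> x cx; have [A dA] := dG ord0 x cx; exists (a ord0 * A); exact: derZ.
- exact: holomorphic_along_sum.
by apply: eq_aint => x _; rewrite big_ord_recl.
Qed.

Lemma aint_le c G B : arc_ok c -> holomorphic_along c G ->
  (forall x, aon c x -> normc (G (apt c x) * avel c x) <= B) ->
  normc (aint c G) <= 2 * B * (ahi c - alo c).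
Proof. by move=> ok dG H; apply: cint_le => //; [case: ok|exact: aint_ccon]. Qed.

End arc_integrals.

(** * Runge approximation on Om by the exponentials e^{(c + nu k) w} *)

Section runge.
Context {R : realType}.
Variables (mu t C p : R) (c : R[i]) (F : R[i] -> R[i]).
Hypotheses (hmu : pi / 2 < mu) (t0 : 0 < t) (C0 : 0 <= C).
Hypothesis dF : forall w, Om mu (t + t / 2) w -> exists A, cder F w A.
Hypothesis bF : forall w, Om mu (t + t / 2) w -> normc (F w) <= C * expR (p * complex.Re w).
Hypothesis hp : complex.Re c + 2 <= p.
Implicit Types (w u : R[i]) (b : R) (G : R[i] -> R[i]).

Let mu0 : 0 < mu. Proof. by have := pi_gt0 R; have := hmu; lra. Qed.
Let nu := pi / (2 * mu).
Let nu0 : 0 < nu. Proof. by rewrite divr_gt0 ?pi_gt0// mulr_gt0. Qed.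
Let M := mu + pi / 2.
Let M0 : 0 < M. Proof. by rewrite addr_gt0// divr_gt0// pi_gt0. Qed.
Let L := ln 2 + t.
Let X b := ln (2 * cos b) + t.
Let Y := expR (`|complex.Im c| * M).
Let Y0 : 0 < Y. Proof. exact: expR_gt0. Qed.
Let okb b := @bottom_arc_ok R mu t b.
Let okt b := @top_arc_ok R mu t b.
Let okr := @right_arc_ok R mu t mu0.
Let okl b := @left_arc_ok R mu t b mu0.

Lemma Om_Im tau w : Om mu tau w -> `|complex.Im w| < M.
Proof.
case=> s hs [h _]; have := ler_normD (complex.Im w - s) s; rewrite subrK /M; lra.
Qed.

Lemma Om0_Re w : Om mu 0 w -> complex.Re w < ln 2.
Proof.
case=> s _ [_ h]; rewrite subr0 in h; rewrite -ltr_expR lnK ?posrE//.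
by have := cos_le1 (complex.Im w - s); lra.
Qed.

Lemma Om_mono tau tau' w : tau <= tau' -> Om mu tau w -> Om mu tau' w.
Proof.
move=> h [s hs [h1 h2]]; exists s => //; split=> //; apply: le_lt_trans h2.
by rewrite ler_expR; lra.
Qed.

Definition on_edges (X : R) G := forall u, cut_edge mu t X u -> exists A, cder G u A.

(** The left edge is kept apart: the kernel is replaced by polynomials on the other three only, and
    the left integral tends to 0 as b -> pi / 2. The top arc runs from left to right, hence its
    sign. *)
Definition edge_int b G : R[i] :=
  (aint (bottom_arc mu t b) G + aint (right_arc mu t) G - aint (top_arc mu t b) G) / (0 +i* (2 * pi)).

Lemma two_pi_i_neq0 : (0 +i* (2 * pi) : R[i]) != 0.
Proof.
by rewrite eq_complex /= negb_and orbC mulf_neq0// ?gt_eqF ?pi_gt0.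
Qed.

Lemma on_edges_along b G : 0 <= b < pi / 2 -> on_edges (X b) G ->
  [/\ holomorphic_along (bottom_arc mu t b) G, holomorphic_along (right_arc mu t) G &
    holomorphic_along (top_arc mu t b) G].
Proof.
move=> hb dG; split=> x cx; apply: dG; [exact: bottom_arc_edge|exact: right_arc_edge|exact: top_arc_edge].
Qed.

Lemma edge_int_sum b n (G : 'I_n -> R[i] -> R[i]) (a : 'I_n -> R[i]) : 0 <= b < pi / 2 ->
  (forall k, on_edges (X b) (G k)) ->
  edge_int b (fun u => \sum_(k < n) a k * G k u) = \sum_(k < n) a k * edge_int b (G k).
Proof.
move=> hb dG; have H k := on_edges_along hb (dG k).
rewrite /edge_int !aint_sum//; try exact: okb; try exact: okt; try by move=> k; case: (H k).
rewrite -big_split /= -sumrB mulr_suml; apply: eq_bigr => k _; ring.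
Qed.

Lemma edge_intB b G H : 0 <= b < pi / 2 -> on_edges (X b) G -> on_edges (X b) H ->
  edge_int b (fun u => G u - H u) = edge_int b G - edge_int b H.
Proof.
move=> hb dG dH.
have := @edge_int_sum b 2 (fun k => if k == ord0 then G else H) (fun k => if k == ord0 then 1 else -1) hb.
rewrite !big_ord_recl !big_ord0 /= => E.
rewrite (_ : (fun u => G u - H u) = (fun u => \sum_(k < 2) (if k == ord0 then 1 else -1) * (if k == ord0 then G else H) u)).
  by rewrite E; [ring|move=> k; case: ifP].
by apply/funext => u; rewrite !big_ord_recl big_ord0 /=; ring.
Qed.

(** Three edges, each with the factor 2 of [cint_le], the speed constant 4 e^t and a parameter
    interval of length at most 2 mu, divided by |2 pi i|. *)
Definition edge_const : R := (3 * (2 * (4 * expR t) * (2 * mu))) / (2 * pi).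

Lemma edge_int_le b G (B : R) : 0 <= b < pi / 2 -> 0 <= B -> on_edges (X b) G ->
  (forall u, cut_edge mu t (X b) u -> normc (G u) <= B * expR (complex.Re u)) ->
  normc (edge_int b G) <= edge_const * B.
Proof.
move=> hb B0 dG H; have [db dr dt] := on_edges_along hb dG.
have p0 := pi_gt0 R; have /andP[b0 b1] := hb.
have K0 : 0 <= 4 * expR t by rewrite mulr_ge0// expR_ge0.
have one (a : arc) : a = bottom_arc mu t b \/ a = top_arc mu t b \/ a = right_arc mu t ->
    arc_ok a -> holomorphic_along a G -> (forall x, aon a x -> cut_edge mu t (X b) (apt a x)) ->
    ahi a - alo a <= 2 * mu -> normc (aint a G) <= 2 * (4 * expR t) * (2 * mu) * B.
  move=> ha ok da ea la; apply: (@le_trans _ _ (2 * (4 * expR t * B) * (ahi a - alo a))).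
    apply: aint_le => // x ax; rewrite normcM.
    have h1 := H _ (ea x ax); have h2 := edge_velocity mu0 t0 hb ha ax.
    apply: (le_trans (ler_pM (normc_ge0 _) (normc_ge0 _) h1 h2)).
    set e := complex.Re _; have E : expR e * expR (- e) = 1 by rewrite -expRD subrr expR0.
    have -> : B * expR e * (4 * expR t * expR (- e)) = 4 * expR t * B * (expR e * expR (- e)) by ring.
    by rewrite E mulr1.
  have := ler_wpM2l (mulr_ge0 (ler0n R 2) (mulr_ge0 K0 B0)) la; lra.
have h1 := one _ (or_introl erefl) (okb hb) db (fun x => @bottom_arc_edge _ mu t b x mu0 hb).
have h2 := one _ (or_intror (or_introl erefl)) (okt hb) dt (fun x => @top_arc_edge _ mu t b x mu0 hb).
have h3 := one _ (or_intror (or_intror erefl)) okr dr (fun x => @right_arc_edge _ mu t b x mu0 hb).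
have hm := hmu.
have {}h1 := h1 ltac:(rewrite /=; rlra); have {}h2 := h2 ltac:(rewrite /=; rlra).
have {}h3 := h3 ltac:(rewrite /=; rlra).
have n2 : normc ((0 : R) +i* (2 * pi)) = 2 * pi.
  by rewrite /= expr0n/= add0r sqrtr_sqr ger0_norm// mulr_ge0// pi_ge0.
rewrite /edge_int normcM normcV n2 /edge_const mulrAC; apply: ler_wpM2r; first by rewrite invr_ge0 mulr_ge0// ltW.
move: h1 h2 h3; set I1 := aint _ _; set I2 := aint _ _; set I3 := aint _ _ => h1 h2 h3.
have := le_normcB (I1 + I3) I2; have := le_normcD I1 I3; rlra.
Qed.

Lemma edge_Im u : contour_edge mu t u -> `|complex.Im u| <= M.
Proof. move=> h; have := pi_gt0 R; rewrite /M; case: h => [[psi /andP[h0 h1] [_ ->]]|[_ h]]; lra. Qed.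

Lemma normc_cexpN_mul w : `|complex.Im w| <= M ->
  normc (cexp (- (c * w))) <= Y * expR (- (complex.Re c * complex.Re w)).
Proof.
move=> h; rewrite normc_cexp cReN cReM -expRD ler_expR.
have : complex.Im c * complex.Im w <= `|complex.Im c| * M.
  by rewrite (le_trans (ler_norm _))// normrM ler_wpM2l.
lra.
Qed.

(* [F u * cexp (c (w - u))] is small enough on the edges to absorb the blow-up
   of the Cauchy kernel and of the velocity at the left end. *)
Lemma edge_weight w u : Om mu 0 w -> Om mu (t + t / 2) u -> complex.Re u <= L ->
  normc (F u * (nu%:C * cexp (c * (w - u)))) <=
  C * nu * Y * expR ((p - complex.Re c - 2) * L) * normc (cexp (c * w)) * expR (2 * complex.Re u).
Proof.
move=> ww uu uL; have iu := ltW (Om_Im uu).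
have h1 := bF uu; have h2 := normc_cexpN_mul iu.
rewrite mulrBr cexpD !normcM normc_real (gtr0_norm nu0).
set E := normc (cexp (c * w)); have E0 : 0 <= E by exact: normc_ge0.
have h3 : normc (F u) * normc (cexp (- (c * u))) <=
    (C * expR (p * complex.Re u)) * (Y * expR (- (complex.Re c * complex.Re u))).
  by rewrite ler_pM ?normc_ge0.
have h4 : expR (p * complex.Re u) * expR (- (complex.Re c * complex.Re u)) <=
    expR ((p - complex.Re c - 2) * L) * expR (2 * complex.Re u).
  rewrite -!expRD ler_expR; have : (p - complex.Re c - 2) * complex.Re u <= (p - complex.Re c - 2) * L.
    by rewrite ler_wpM2l//; move: hp; lra.
  lra.
have CY : 0 <= C * Y by rewrite mulr_ge0// ltW.
have h5 := ler_wpM2l CY h4.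
have nE : 0 <= nu * E by rewrite mulr_ge0// ltW.
have h6 := ler_wpM2l nE (le_trans h3 (_ : _ <= (C * Y) * (expR ((p - complex.Re c - 2) * L) * expR (2 * complex.Re u)))).
have {}h6 := h6 ltac:(by apply: le_trans h5; rewrite le_eqVlt; apply/orP; left; apply/eqP; ring).
have -> : normc (F u) * (nu * (E * normc (cexp (- (c * u))))) = nu * E * (normc (F u) * normc (cexp (- (c * u)))) by ring.
apply: (le_trans h6); rewrite le_eqVlt; apply/orP; left; apply/eqP; ring.
Qed.

Definition ckernel w u : R[i] := nu%:C * cexp (c * (w - u)) / (1 - cexp (nu%:C * (w - u))).

Lemma ckernel_pole w u : `|complex.Im w - complex.Im u| <= 2 * M ->
  1 - cexp (nu%:C * (w - u)) = 0 -> u = w.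
Proof.
move=> hM /eqP; rewrite subr_eq0 eq_sym => /eqP /cexp_eq1 H.
have : nu%:C * (w - u) = 0.
  apply: H; rewrite cImM /= mul0r addr0 cImB normrM (gtr0_norm nu0).
  apply: (@le_lt_trans _ _ (nu * (2 * M))); first by rewrite ler_wpM2l// ltW.
  have p0 := pi_gt0 R; rewrite /nu /M mulrAC ltr_pdivrMr ?mulr_gt0// mulrAC.
  have : pi * (pi / 2) < pi * mu by rewrite ltr_pM2l.
  lra.
move/eqP; rewrite mulf_eq0 subr_eq0 => /orP[|/eqP->//].
by rewrite -normc_eq0 normc_real normr_eq0 gt_eqF.
Qed.

Lemma cder_shift_exp (a w u : R[i]) : exists A, cder (fun v => cexp (a * (w - v))) u A.
Proof.
eexists; apply: der_comp (cder_cexp _); apply: derZ; apply: derB; [exact: der_cst|exact: der_io].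
Qed.

Lemma cder_ckernel w u : `|complex.Im w - complex.Im u| <= 2 * M -> u != w ->
  exists A, cder (ckernel w) u A.
Proof.
move=> hM uw; have nz : 1 - cexp (nu%:C * (w - u)) != 0.
  by apply/eqP => /(ckernel_pole hM) /eqP; exact/negP.
have [A dA] := cder_shift_exp c w u; have [B dB] := cder_shift_exp nu%:C w u.
eexists; apply: derM; first by apply: derZ; exact: dA.
by apply: derV => //; apply: derB dB; exact: der_cst.
Qed.

(** The factor nu of the kernel cancels the derivative nu of u -> 1 - e^{nu (w - u)} at [w].
    Caratheodory's slope [q] of this function removes the singularity: (u - w) F u times the kernel
    equals the continuous function [H]. *)
Lemma ckernel_residue w : (exists A, cder F w A) ->
  forall e, 0 < e -> exists2 d, 0 < d & forall u, u != w -> normc (u - w) < d ->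
    normc ((u - w) * (F u * ckernel w u) - F w) < e.
Proof.
move=> [A dA].
have dg : cder (fun v => 1 - cexp (nu%:C * (w - v))) w nu%:C.
  have : cder (fun v => 1 - cexp (nu%:C * (w - v))) w (0 - cexp (nu%:C * (w - w)) * (nu%:C * (0 - 1))).
    apply: derB; first exact: der_cst.
    apply: (@der_comp _ _ id cexp (fun v => nu%:C * (w - v)) w _ _ _ (cder_cexp _)).
    by apply: derZ; apply: derB; [exact: der_cst|exact: der_io].
  by rewrite subrr mulr0 cexp0 sub0r mul1r sub0r mulrN1 opprK.
have /derP[q [qE cq qw]] := dg.
have nuC : nu%:C != 0 by rewrite -normc_eq0 normc_real normr_eq0 gt_eqF.
pose H v := F v * (nu%:C * cexp (c * (w - v))) * (q v)^-1.
have cH : cnt (dio id) setT H w.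
  apply: cntM; last by apply: cntV => //; rewrite qw.
  have [B dB] := cder_shift_exp c w w.
  exact: der_cnt (derM dA (derZ nu%:C dB)).
have Hw : H w = F w by rewrite /H qw subrr mulr0 cexp0 mulr1 mulfK.
move=> e /cH[d d0 Hd]; exists d => // u uw ud.
have := Hd u I ud; rewrite Hw; congr (normc (_ - _) < _).
rewrite /H /ckernel qE subrr mulr0 cexp0 subrr add0r.
have uw0 : u - w != 0 by rewrite subr_eq0.
by rewrite [q u * _]mulrC invfM; move: (q u)^-1 => i; field.
Qed.

(** By convexity the segments from [w] to the contour stay in [Om mu (t + t / 2)], and the kernel
    has no pole there other than [w], so the residue formula by homothety applies. *)
Lemma edge_cauchy b w : 0 <= b < pi / 2 -> Om mu 0 w -> X b < complex.Re w ->
  F w = edge_int b (fun u => F u * ckernel w u) -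
    aint (left_arc mu t b) (fun u => F u * ckernel w u) / (0 +i* (2 * pi)).
Proof.
move=> hb ww Xw; have /andP[b0 b1] := hb; have p0 := pi_gt0 R.
have t20 : 0 < t / 2 by rewrite divr_gt0.
have wt : Om mu (t + t / 2) w by apply: Om_mono ww; lra.
pose cb := bottom_arc mu t b; pose ct := top_arc mu t b; pose cr := right_arc mu t; pose cl := left_arc mu t b.
have iw := ltW (Om_Im ww).
have qO z : qon cb cr ct cl z -> [/\ Om mu (t + t / 2) z, slit (z - w) \/ complex.Re (z - w) < 0 & `|complex.Im z| <= M].
  have edge u : cut_edge mu t (X b) u -> [/\ Om mu (t + t / 2) u, slit (u - w) \/ complex.Re (u - w) < 0 & `|complex.Im u| <= M].
    move=> [eu _]; split; [exact: (contour_edge_Om mu0 t0 eu)|by left; exact: (edge_slit mu0 t0 ww eu)|exact: edge_Im eu].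
  case=> a [x [ha [ax ->]]]; case: ha ax => [->|[->|[->|->]]] ax.
  - by apply/edge/bottom_arc_edge.
  - by apply/edge/right_arc_edge.
  - by apply/edge/top_arc_edge.
  - split; [exact: left_arc_Om|by right; rewrite cReB subr_lt0|].
    by rewrite /aon/= in ax; rewrite /= ler_norml /M; apply/andP; split; rlra.
have nw z : qon cb cr ct cl z -> z != w.
  move=> /qO[_ h _]; rewrite -subr_eq0; case: h; first exact: slit_neq0.
  by move=> h; apply/eqP => z0; move: h; rewrite z0 /= ltxx.
have dG z : qon cb cr ct cl z -> forall r, 0 < r <= 1 ->
    exists A, cder (fun u => F u * ckernel w u) (w + r%:C * (z - w)) A.
  move=> qz r /andP[r0 r1]; have [zO _ zM] := qO z qz; set v := w + _.
  have vO : Om mu (t + t / 2) v by apply: Om_convex => //; rewrite (ltW r0).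
  have [A dA] := dF vO.
  have vw : v != w.
    rewrite -subr_eq0 /v addrC addKr mulf_neq0 ?subr_eq0 ?nw//.
    by rewrite -normc_eq0 normc_real normr_eq0 gt_eqF.
  have [|B dB] := @cder_ckernel w v _ vw.
    by have := ltW (Om_Im vO); have := ler_normB (complex.Im w) (complex.Im v); rlra.
  by eexists; exact: derM dA dB.
have E := @qint_residue _ cb cr ct cl (okb hb) okr (okt hb) (okl hb) _ _ _ _ (fun u => F u * ckernel w u) w (F w) nw dG (ckernel_residue (dF wt)).
have {}E := E _ _ _ _.
have {}E := E ltac:(by rewrite /=; congr (_ +i* _); rewrite ?cosN; ring)
  ltac:(by rewrite /= cos0 mulr1; congr (_ +i* _); ring)
  ltac:(by rewrite /= cos0 mulr1; congr (_ +i* _); ring)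
  ltac:(by rewrite /=; congr (_ +i* _); rewrite ?cosN; ring).
(* The left edge must span the height of [w]. As [w] lies to its right, cos b < cos (Im w - s), so
   Im w is within b of an admissible s. *)
have iwb : `|complex.Im w| < mu + b.
  case: (ww) => s hs [hy hw]; rewrite subr0 in hw; set y := complex.Im w in hy hw *.
  have cosb : 0 < cos b by apply: cos_gt0_pihalf; apply/andP; split; rlra.
  have : 2 * cos b < expR (complex.Re w).
    rewrite -[X in X < _]lnK ?posrE ?mulr_gt0// ltr_expR; apply: lt_trans Xw.
    by rewrite /X ltrDl.
  move=> hb2; have : `|y - s| < b.
    rewrite -ltr_cos ?in_itv/= ?normr_ge0/= ?b0/=; [rewrite cos_norm; rlra|rlra|rlra].
  by have := ler_normD (y - s) s; rewrite subrK; rlra.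
have Wn := @qint_winding _ cb cr ct cl (okb hb) okr (okt hb) (okl hb) _ _ _ _ w.
have {}Wn := Wn ltac:(by rewrite /=; congr (_ +i* _); rewrite ?cosN; ring)
  ltac:(by rewrite /= cos0 mulr1; congr (_ +i* _); ring)
  ltac:(by rewrite /= cos0 mulr1; congr (_ +i* _); ring)
  ltac:(by rewrite /=; congr (_ +i* _); rewrite ?cosN; ring).
have {}Wn : qint cb cr ct cl (fun u => (u - w)^-1) = 0 +i* (2 * pi).
  apply: Wn.
  - by move=> x ax; have [ex _] := bottom_arc_edge mu0 hb ax; exact: (edge_slit mu0 t0 ww ex).
  - by move=> x ax; have [ex _] := right_arc_edge mu0 hb ax; exact: (edge_slit mu0 t0 ww ex).
  - by move=> x ax; have [ex _] := top_arc_edge mu0 hb ax; exact: (edge_slit mu0 t0 ww ex).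
  - by move=> x _; rewrite cReB subr_lt0.
  - by rewrite cImB /=; move: iwb; rewrite ltr_norml; lra.
  - by rewrite cImB /=; move: iwb; rewrite ltr_norml; rlra.
rewrite Wn /qint in E; rewrite /edge_int -mulrBl; apply: (canRL (mulfK two_pi_i_neq0)).
rewrite -E; move: (aint cb _) (aint cr _) (aint ct _) (aint cl _) => I1 I2 I3 I4; ring.
Qed.

Let W := C * nu * Y * expR ((p - complex.Re c - 2) * L).
Let W0 : 0 <= W.
Proof. rewrite /W; nonneg. Qed.

(** When the left edge is ln 2 / nu away from [w], the exponential in the denominator is at least 2
    in modulus, and 1 - q is at least 1. The weight e^{2 X} of [edge_weight] then makes the integral
    small; one factor e^X is kept. *)
Lemma left_int_le b w : 0 <= b < pi / 2 -> Om mu 0 w -> X b <= complex.Re w - ln 2 / nu ->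
  normc (aint (left_arc mu t b) (fun u => F u * ckernel w u)) <=
  4 * M * W * expR L * normc (cexp (c * w)) * expR (X b).
Proof.
move=> hb ww Xw; have /andP[b0 b1] := hb; have p0 := pi_gt0 R.
have l2 : 0 < ln 2 / nu by rewrite divr_gt0// ln_gt0// ltr1n.
have Xw' : X b < complex.Re w by lra.
set E := normc (cexp (c * w)); have E0 : 0 <= E by exact: normc_ge0.
have XL : X b <= L.
  rewrite /X /L lerD2r; have -> : ln 2 = ln (2 * cos 0) :> R by rewrite cos0 mulr1.
  by rewrite ln2cos_mono// lexx andbT oppr_le0.
have uO x : aon (left_arc mu t b) x -> Om mu (t + t / 2) (apt (left_arc mu t b) x).
  by move=> ax; exact: left_arc_Om.
have iw := ltW (Om_Im ww).
have hol : holomorphic_along (left_arc mu t b) (fun u => F u * ckernel w u).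
  move=> x ax; have [A dA] := dF (uO x ax); have iu := ltW (Om_Im (uO x ax)).
  have [||B dB] := @cder_ckernel w (apt (left_arc mu t b) x).
  - by have := ler_normB (complex.Im w) (complex.Im (apt (left_arc mu t b) x)); rlra.
  - apply/eqP => e; have : complex.Re (apt (left_arc mu t b) x) = X b by [].
    by rewrite e => h; move: Xw'; rewrite h ltxx.
  by eexists; exact: derM dA dB.
have len : ahi (left_arc mu t b) - alo (left_arc mu t b) <= 2 * M by rewrite /= /M; lra.
have B0 : 0 <= W * E * expR (2 * X b) by nonneg.
apply: (@le_trans _ _ (2 * (W * E * expR (2 * X b)) * (2 * M))); last first.
  have -> : 2 * X b = X b + X b by ring.
  rewrite expRD; have : expR (X b) <= expR L by rewrite ler_expR.
  have k0 : 0 <= W * E * expR (X b) * M by nonneg.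
  by move=> /(ler_wpM2l k0); rlra.
apply: (le_trans (aint_le (B := W * E * expR (2 * X b)) (okl hb) hol _)); last first.
  by rewrite ler_wpM2l// mulr_ge0.
move=> x ax; rewrite normcM; have -> : normc (avel (left_arc mu t b) x) = 1.
  by rewrite /= expr0n /= add0r expr1n sqrtr1.
rewrite mulr1 /ckernel mulrA normcM normcV.
have h1 := edge_weight ww (uO x ax) XL; set u := apt _ x in h1 *.
have uX : complex.Re u = X b by [].
rewrite uX in h1.
have qn : 1 <= normc (1 - cexp (nu%:C * (w - u))).
  rewrite normcB_sym; have := le_normc_sub (cexp (nu%:C * (w - u))) 1; rewrite normc1 normc_cexp cReM /= mul0r subr0 cReB uX.
  have : 2 <= expR (nu * (complex.Re w - X b)).
    rewrite -[2 in leLHS](@lnK R) ?posrE// ler_expR -ler_pdivrMl// mulrC; rlra.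
  rlra.
rewrite ler_pdivrMr ?(lt_le_trans _ qn)//; apply: (le_trans h1).
by rewrite -/E ler_peMr.
Qed.

Lemma on_edges_ckernel b w : Om mu 0 w -> on_edges (X b) (fun u => F u * ckernel w u).
Proof.
move=> ww u [eu _]; have [A dA] := dF (contour_edge_Om mu0 t0 eu).
have [||B dB] := @cder_ckernel w u.
- by have := ler_normB (complex.Im w) (complex.Im u); have := ltW (Om_Im ww); have := edge_Im eu; lra.
- by have := slit_neq0 (edge_slit mu0 t0 ww eu); rewrite subr_eq0.
- by eexists; exact: derM dA dB.
Qed.

(** Of the factor e^{2 Re u} in [edge_weight], one e^{Re u} pays for the smallness of 1 - q and the
    other for the speed. Uniformity in [b] and [w] is what makes the approximants dominated by |e^{c
    w}|. *)
Lemma edge_kernel_bound : exists2 k : R, 0 <= k & forall b w, 0 <= b < pi / 2 -> Om mu 0 w ->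
  normc (edge_int b (fun u => F u * ckernel w u)) <= k * normc (cexp (c * w)).
Proof.
have [c1 c10 Hc] := kernel_gap hmu t0.
have ec0 : 0 <= edge_const by rewrite /edge_const; nonneg.
exists (edge_const * (W / c1)); first nonneg.
move=> b w hb ww; set E := normc (cexp (c * w)); have E0 : 0 <= E by exact: normc_ge0.
rewrite -mulrA; apply: edge_int_le => //.
- nonneg.
- exact: on_edges_ckernel.
move=> u [eu _]; have h := edge_weight ww (contour_edge_Om mu0 t0 eu) (contour_edge_Re eu).
have g := Hc w u 1 ww eu (lexx _); rewrite rmorph1 -/nu in g.
have e0 := expR_gt0 (complex.Re u).
have d0 : 0 < c1 * expR (complex.Re u) by rewrite mulr_gt0.
rewrite /ckernel mulrA normcM normcV ler_pdivrMr ?(lt_le_trans d0)//.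
apply: (le_trans h); rewrite -/W -/E (_ : 2 * _ = complex.Re u + complex.Re u); last by ring.
rewrite expRD; have k0 : 0 <= W / c1 * E * expR (complex.Re u).
  nonneg.
have := ler_wpM2l k0 g; apply: le_trans.
rewrite le_eqVlt; apply/orP; left; apply/eqP; field; exact: lt0r_neq0.
Qed.

Definition poly_int b (P : {poly R[i]}) w :=
  edge_int b (fun u => F u * (nu%:C * cexp (c * (w - u))) * P.[cexp (nu%:C * (w - u))]).

Lemma on_edges_F b (G : R[i] -> R[i]) : (forall u, exists A, cder G u A) ->
  on_edges (X b) (fun u => F u * G u).
Proof.
move=> dG u [eu _]; have [A dA] := dF (contour_edge_Om mu0 t0 eu); have [B dB] := dG u.
by eexists; exact: derM dA dB.
Qed.

(** In e^{c (w - u)} q^k the variables separate: the factor in w is the exponential e^{(c + nu k)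
    w}, and the integral over u becomes its coefficient. *)
Lemma poly_intE b (P : {poly R[i]}) w : 0 <= b < pi / 2 ->
  poly_int b P w = \sum_(k < size P)
    (P`_k * edge_int b (fun u => F u * (nu%:C * cexp (- ((c + (nu * k%:R)%:C) * u))))) *
     cexp ((c + (nu * k%:R)%:C) * w).
Proof.
move=> hb; rewrite /poly_int.
pose G (k : 'I_(size P)) u := F u * (nu%:C * cexp (- ((c + (nu * k%:R)%:C) * u))).
rewrite (_ : (fun u => _) = (fun u => \sum_(k < size P) (P`_k * cexp ((c + (nu * k%:R)%:C) * w)) * G k u)).
  rewrite edge_int_sum//; first by apply: eq_bigr => k _; rewrite mulrAC.
  move=> k; apply: on_edges_F => u; eexists; apply: derZ.
  apply: (@der_comp _ _ id cexp (fun u => - ((c + (nu * k%:R)%:C) * u)) u _ _ _ (cder_cexp _)).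
  by apply: derN; apply: derZ; exact: der_io.
apply/funext => u; rewrite horner_coef mulr_sumr; apply: eq_bigr => k _.
rewrite /G -cexpMn.
have -> : cexp (c * (w - u)) = cexp (c * w) * cexp (- (c * u)) by rewrite -cexpD; congr cexp; ring.
have -> : cexp (k%:R * (nu%:C * (w - u))) = cexp ((nu * k%:R)%:C * w) * cexp (- ((nu * k%:R)%:C * u)).
  have -> : (nu * k%:R)%:C = nu%:C * k%:R :> R[i].
    by rewrite rmorphM; congr (_ * _); exact: (rmorph_nat (real_complex R) k).
  by rewrite -cexpD; congr cexp; ring.
have -> : cexp ((c + (nu * k%:R)%:C) * w) = cexp (c * w) * cexp ((nu * k%:R)%:C * w).
  by rewrite -cexpD; congr cexp; ring.
have -> : cexp (- ((c + (nu * k%:R)%:C) * u)) = cexp (- (c * u)) * cexp (- ((nu * k%:R)%:C * u)).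
  by rewrite -cexpD; congr cexp; ring.
by ring.
Qed.

Lemma on_edges_poly b (P : {poly R[i]}) w :
  on_edges (X b) (fun u => F u * (nu%:C * cexp (c * (w - u))) * P.[cexp (nu%:C * (w - u))]).
Proof.
have -> : (fun u => F u * (nu%:C * cexp (c * (w - u))) * P.[cexp (nu%:C * (w - u))]) =
  (fun u => F u * (nu%:C * cexp (c * (w - u)) * P.[cexp (nu%:C * (w - u))])).
  by apply/funext => u; ring.
apply: on_edges_F => u; have [A dA] := cder_shift_exp c w u; have [B dB] := cder_shift_exp nu%:C w u.
have [D dD] : exists D, cder (fun u => P.[cexp (nu%:C * (w - u))]) u D.
  elim/poly_ind: P => [|P a [D dD]].
    by exists 0; rewrite (_ : (fun u => (0 : {poly R[i]}).[cexp (nu%:C * (w - u))]) = (fun=> 0)); [exact: der_cst|apply/funext => v; rewrite horner0].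
  rewrite (_ : (fun u => (P * 'X + a%:P).[cexp (nu%:C * (w - u))]) = (fun u => P.[cexp (nu%:C * (w - u))] * cexp (nu%:C * (w - u)) + a)).
    by eexists; apply: derD; [exact: derM dD dB|exact: der_cst].
  by apply/funext => v; rewrite hornerMXaddC.
by eexists; apply: derM dD; apply: derZ; exact: dA.
Qed.

(** For fixed [b] the edges are cut at Re u = X b, so q is bounded and, by [kernel_gap], at distance
    at least c1 e^{X b} from [1, +oo[. Hence [pole_pushing] applies to the set of all values of q,
    simultaneously for all w. *)
Lemma poly_int_near b (e : R) : 0 <= b < pi / 2 -> 0 < e -> exists P : {poly R[i]},
  forall w, Om mu 0 w ->
    normc (poly_int b P w - edge_int b (fun u => F u * ckernel w u)) <= e * normc (cexp (c * w)).
Proof.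
move=> hb e0; have [c1 c10 Hc] := kernel_gap hmu t0.
pose S := [set q : R[i] | exists w u, [/\ Om mu 0 w, cut_edge mu t (X b) u & q = cexp (nu%:C * (w - u))]].
have ec0 : 0 <= edge_const by rewrite /edge_const; nonneg.
pose K := edge_const * W * expR L; have K0 : 0 <= K by nonneg.
have d0 : 0 < e / (K + 1) by rewrite divr_gt0// ltr_wpDl.
have bS : bounded_by S (expR (nu * (ln 2 - X b))) id.
  move=> q [w [u [ww [_ hu] ->]]]; rewrite normc_cexp cReM /= mul0r subr0 cReB ler_expR.
  by rewrite ler_pM2l//; have := Om0_Re ww; lra.
have gS q : S q -> forall a : R, 1 <= a -> c1 * expR (X b) <= normc (a%:C - q).
  move=> [w [u [ww [eu hu] ->]]] a a1; apply: le_trans (Hc w u a ww eu a1).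
  by rewrite ler_pM2l// ler_expR.
have [P HP] := pole_pushing (mulr_gt0 c10 (expR_gt0 _)) bS gS d0.
exists P => w ww; set E := normc (cexp (c * w)); have E0 : 0 <= E by exact: normc_ge0.
rewrite normcB_sym /poly_int -edge_intB//; [|exact: on_edges_ckernel|exact: on_edges_poly].
apply: (@le_trans _ _ (edge_const * (W * E * expR L * (e / (K + 1))))); last first.
  have -> : edge_const * (W * E * expR L * (e / (K + 1))) = e * E * (K / (K + 1)).
    by rewrite /K; field; rewrite gt_eqF// -/K ltr_wpDl.
  by rewrite ler_piMr ?mulr_ge0 ?(ltW e0)// ler_pdivrMr ?ltr_wpDl// mul1r lerDl.
apply: edge_int_le => //.
- nonneg.
- move=> u eu; have [A dA] := on_edges_ckernel ww eu; have [B dB] := on_edges_poly P w eu.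
  by eexists; exact: derB dA dB.
move=> u eu; have [eu1 eu2] := eu.
have h := edge_weight ww (contour_edge_Om mu0 t0 eu1) (contour_edge_Re eu1).
set q := cexp (nu%:C * (w - u)).
have Sq : S q by exists w, u.
have hq := HP q Sq.
have -> : F u * ckernel w u - F u * (nu%:C * cexp (c * (w - u))) * P.[q] =
   (F u * (nu%:C * cexp (c * (w - u)))) * ((1 - q)^-1 - P.[q]) by rewrite /ckernel -/q; ring.
rewrite normcM; apply: (le_trans (ler_pM (normc_ge0 _) (normc_ge0 _) h hq)).
rewrite -/W -/E (_ : 2 * _ = complex.Re u + complex.Re u); last by ring.
have le : expR (complex.Re u) <= expR L by rewrite ler_expR; exact: contour_edge_Re eu1.
have k0 : 0 <= W * E * (e / (K + 1)) * expR (complex.Re u).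
  nonneg.
by rewrite expRD; have := ler_wpM2l k0 le; rlra.
Qed.

(** A diagonal choice: at stage n the contour is cut at b = pi / 2 - 1 / (n + 1) and the polynomial
    has tolerance 1 / (n + 1). Convergence is only pointwise, since the left edge has to pass [w];
    the bound by A |e^{c w}| makes up for this in L^2. *)
Theorem exponential_approximation : exists (Q : nat -> R[i] -> R[i]) (A : R),
  [/\ 0 <= A,
    forall n, exists (N : nat) (a : 'I_N -> R[i]), forall w,
      Q n w = \sum_(k < N) a k * cexp ((c + (nu * k%:R)%:C) * w),
    forall n w, Om mu 0 w -> normc (Q n w) <= A * normc (cexp (c * w)) &
    forall w, Om mu 0 w -> forall e : R, 0 < e -> exists N, forall n, (N <= n)%N ->
      normc (Q n w - F w) < e].
Proof.
have p2 := pi_ge2 R; have p0 := pi_gt0 R.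
pose d n : R := n.+1%:R^-1.
have d0 n : 0 < d n by rewrite invr_gt0.
have d1 n : d n <= 1 by rewrite invf_le1// ler1n.
pose b n := pi / 2 - d n.
have hb n : 0 <= b n < pi / 2 by apply/andP; split; rewrite /b; have := d0 n; have := d1 n; lra.
(* As cos b_n = sin d_n <= d_n, the abscissa X b_n of the left edge tends to -oo. *)
have Xd n : expR (X (b n)) <= 2 * expR t * d n.
  have cb : 0 < cos (b n) by apply: cos_gt0_pihalf; have /andP[h1 h2] := hb n; apply/andP; split; lra.
  rewrite /X expRD lnK ?posrE ?mulr_gt0//.
  have -> : cos (b n) = sin (d n).
    by rewrite -cosBpihalf -cosN; congr cos; rewrite /b; ring.
  have s1 : sin (d n) <= d n.
    by have := sin_le (d n); rewrite (gtr0_norm (d0 n)) ler_norml => /andP[].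
  by have := ler_wpM2l (ltW (expR_gt0 t)) s1; lra.
have [P HP] := choice (fun n => poly_int_near (hb n) (d0 n)).
have [k k0 Hk] := edge_kernel_bound.
exists (fun n => poly_int (b n) (P n)), (k + 1); split.
- by rewrite addr_ge0.
- move=> n; exists (size (P n)); eexists => w; exact: (poly_intE (P n) w (hb n)).
- move=> n w ww; have h1 := HP n w ww; have h2 := Hk _ w (hb n) ww.
  have E0 := normc_ge0 (cexp (c * w)).
  have := le_normc_sub (poly_int (b n) (P n) w) (edge_int (b n) (fun u => F u * ckernel w u)).
  have := ler_wpM2r E0 (d1 n); rlra.
move=> w ww e e0; set E := normc (cexp (c * w)); have E0 : 0 < E by rewrite /E normc_gt0 cexp_neq0.
pose K1 := 4 * M * W * expR L / (2 * pi).
have K10 : 0 <= K1 by rewrite /K1; nonneg.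
pose K2 := E * (1 + K1 * (2 * expR t)).
have K20 : 0 < K2 by rewrite /K2 mulr_gt0// ltr_pwDl//; nonneg.
(* The first bound makes the two errors add up to less than e; the second puts the left edge ln 2 /
   nu to the left of [w], as [left_int_le] requires. *)
pose r := Num.min (e / K2) (expR (complex.Re w - ln 2 / nu) / (2 * expR t)).
have et : 0 < 2 * expR t by rewrite mulr_gt0// expR_gt0.
have r0 : 0 < r by rewrite /r lt_min (divr_gt0 e0 K20) (divr_gt0 (expR_gt0 _) et).
exists (Num.bound r^-1) => n Nn.
have dn : d n < r.
  rewrite /d invf_plt ?posrE//; apply: (lt_le_trans (archi_boundP _)); first by rewrite invr_ge0 ltW.
  by rewrite ler_nat (leq_trans Nn).
move: dn; rewrite /r lt_min (ltr_pdivlMr _ _ K20) (ltr_pdivlMr _ _ et) => /andP[dn1 dn2].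
have Xw : X (b n) <= complex.Re w - ln 2 / nu.
  by rewrite -ler_expR; apply: (le_trans (Xd n)); rewrite mulrC ltW.
have l2 : 0 < ln 2 / nu by rewrite divr_gt0// ln_gt0// ltr1n.
have Xw' : X (b n) < complex.Re w by rlra.
have FE := edge_cauchy (hb n) ww Xw'.
have h1 := HP n w ww; have h2 := left_int_le (hb n) ww Xw; rewrite -/E in h1 h2.
have n2 : normc ((0 : R) +i* (2 * pi)) = 2 * pi.
  by rewrite /= expr0n/= add0r sqrtr_sqr ger0_norm// mulr_ge0// pi_ge0.
move: h2 FE; set Lf := aint _ _; set Ed := edge_int _ _ => h2 FE.
have h3 : normc (Lf / (0 +i* (2 * pi))) <= K1 * E * (2 * expR t * d n).
  rewrite normcM normcV n2 ler_pdivrMr ?mulr_gt0//; apply: (le_trans h2).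
  have -> : K1 * E * (2 * expR t * d n) * (2 * pi) = 4 * M * W * expR L * E * (2 * expR t * d n).
    have K1E : K1 * (2 * pi) = 4 * M * W * expR L by rewrite /K1 divfK// gt_eqF// mulr_gt0.
    by rewrite -K1E; ring.
  by rewrite ler_wpM2l//; nonneg.
rewrite FE opprB addrCA addrC -[_ - Ed + _]/(_ + _).
apply: (le_lt_trans (le_normcD _ _)).
apply: le_lt_trans dn1; rewrite /K2.
have -> : d n * (E * (1 + K1 * (2 * expR t))) = d n * E + K1 * E * (2 * expR t * d n) by ring.
exact: lerD.
Qed.

End runge.

Section worm_functions.
Context {R : realType}.
Local Notation C2 := (R[i]^o * R[i]^o)%type.
Variables (mu c0 : R).
Hypotheses (hmu : pi / 2 < mu) (hc0 : -1 < c0).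
Local Notation W := (@truncated_worm R mu).
Let nu := pi / (2 * mu).
Let mu0 : 0 < mu. Proof. by have := pi_gt0 R; have := hmu; lra. Qed.
Let nu0 : 0 <= nu. Proof. by rewrite divr_ge0 ?pi_ge0// mulr_ge0// ltW. Qed.
Let oW := @dopen_worm R mu.

Definition worm_system : set (C2 -> R[i]^o) := [set f | exists (l : nat) (j : int), f = worm_H c0 nu l j].

Lemma worm_system_bergman : worm_system `<=` bergman W.
Proof. by move=> f [l [j ->]]; exact: worm_H_bergman. Qed.

Lemma worm_system_cmeas f : worm_system f -> cmeas W f.
Proof. by move=> /worm_system_bergman[hf _]; exact: holomorphic_cmeas. Qed.

(** On the domain |e^{c w}| is at most Y |z_1|^{c0}, where [Y] accounts for Im c on the bounded
    heights, and |z_2^j| <= K. The approximants are thus dominated by A Y K |z_1|^{c0}, which is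
    square integrable as c0 > -1. *)
Lemma approximable_worm_fun (t C p : R) (j : int) (F : R[i] -> R[i]) : 0 < t -> 0 <= C ->
  c0 + 2 <= p ->
  (forall w, Om mu (t + t / 2) w -> exists A, cder F w A) ->
  (forall w, Om mu (t + t / 2) w -> normc (F w) <= C * expR (p * complex.Re w)) ->
  approximable W worm_system (fun z => F (worm_L z) * z.2 ^ j : R[i]^o).
Proof.
move=> t0 C0 hp dF bF.
pose c : R[i] := c0 +i* ((j + 1)%:~R / 2).
have [Q [A [A0 QE QA QF]]] := @exponential_approximation R mu t C p c F hmu t0 C0 dF bF hp.
have [K K0 HK] := worm_expz_bound mu0 j.
pose Y := expR (`|complex.Im c| * (mu + pi / 2)).
have hf : holomorphic_on W (fun z => F (worm_L z) * z.2 ^ j : R[i]^o).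
  by apply: worm_holomorphic => w ww; apply: dF; apply: Om_mono ww; rewrite addr_ge0// ltW// divr_gt0.
have mf := holomorphic_cmeas oW hf.
have cY (v : R[i]) : `|complex.Im v| <= mu + pi / 2 ->
    normc (cexp (c * v)) <= Y * normc (cexp (c0%:C * v)).
  move=> iv; rewrite !normc_cexp -expRD ler_expR !cReM /= mul0r subr0.
  have : - ((j + 1)%:~R / 2 * complex.Im v) <= `|(j + 1)%:~R / 2| * (mu + pi / 2).
    by rewrite (le_trans (ler_norm _))// normrN normrM ler_wpM2l.
  lra.
pose f_ n : C2 -> R[i]^o := fun z => Q n (worm_L z) * z.2 ^ j.
have Ec k : (c0 + nu * k%:R) +i* ((j + 1)%:~R / 2) = c + (nu * k%:R)%:C :> R[i].
  by apply: complex_eqP; rewrite ?cReD ?cImD /= ?addr0.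
have Sf n : lin_span worm_system (f_ n).
  have [N [a E]] := QE n; exists N, a, (fun k => worm_H c0 nu k j); split; first by move=> k; exists k, j.
  apply/funext => z; rewrite /f_ E mulr_suml fct_sumE; apply: eq_bigr => k _.
  transitivity (a k * worm_H c0 nu k j z : R[i]); last by [].
  by rewrite /worm_H /worm_E Ec [RHS]mulrA.
have mf_ n : cmeas W (f_ n) by apply: (lin_span_cmeas worm_system_cmeas); exact: Sf.
split=> // e e0.
have [n Hn] : exists n, (N2 W ((fun z => F (worm_L z) * z.2 ^ j : R[i]^o) - f_ n)%R < e%:E)%E; last by exists (f_ n).
pose B := A * Y * K; have B0 : 0 <= B by rewrite !mulr_ge0// expR_ge0.
have mp := @worm_pow_cmeas _ mu c0.
apply: (@L2_dominated _ _ oW _ _ (fun p => B ^+ 2 * normc (worm_pow c0 (toC2 p)) ^+ 2)) => //.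
- move=> z zW d d0; have ww := Om_worm_L zW.
  have K10 : 0 < K + 1 by rewrite ltr_wpDl.
  have [N HN] := QF _ ww _ (divr_gt0 d0 K10); exists N => n Nn.
  have := HN n Nn; rewrite ltr_pdivlMr// => h.
  rewrite /f_ -mulrBl normcM; apply: le_lt_trans h.
  by rewrite ler_wpM2l ?normc_ge0// (le_trans (HK _ zW))// lerDl.
- rewrite (_ : EFin \o _ = (fun p => (B ^+ 2)%:E * (normc (worm_pow c0 (toC2 p)) ^+ 2)%:E)%E) => [|]; last by apply/funext => p'; rewrite /= EFinM.
  apply: integrableZl; first exact: measurable_toC2.
  by apply: N2_square_integrable => //; exact: N2_worm_pow.
move=> n p' pW; have ww := Om_worm_L pW.
rewrite -exprMn lerXn2r ?nnegrE ?(mulr_ge0 B0) ?normc_ge0//.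
rewrite /f_ normcM /B /worm_pow mulr1; set L := worm_L _ in ww *; set zj := _ ^ j.
have iL : `|complex.Im L| <= mu + pi / 2 by exact: ltW (worm_Im_L pW).
have h1 := QA n _ ww; have h2 : normc zj <= K by exact: HK.
have h3 := cY L iL.
have h4 := le_trans h1 (ler_wpM2l A0 h3).
have := ler_pM (normc_ge0 _) (normc_ge0 _) h4 h2.
by rewrite (_ : A * (Y * normc (cexp (c0%:C * L))) * K = A * Y * K * normc (cexp (c0%:C * L))); [|ring].
Qed.

End worm_functions.

(** * Fourier coefficients of Bergman functions *)

Section fourier_coefficients.
Context {R : realType}.
Local Notation C2 := (R[i]^o * R[i]^o)%type.
Variables (mu : R) (f : C2 -> R[i]^o).
Hypotheses (mu1 : 1 < mu) (hf : bergman (truncated_worm mu) f).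
Local Notation W := (@truncated_worm R mu).
Implicit Types (w a ze : R[i]) (j : int).

Let mu0 : 0 < mu. Proof. by apply: lt_trans mu1; exact: ltr01. Qed.

Definition log_section j w ze : R[i] := f (cexp w, cexp ze) * cexp (- (j%:~R * ze)).

(** 2 pi times the j-th Laurent coefficient of f(e^w, .) on the circle |z_2| = e^{Re a}, written in
    the coordinate log z_2 so that moving the circle becomes moving a vertical segment. *)
Definition fourier_coef j w a : R[i] :=
  cint (- pi) pi (fun th => log_section j w (a + (0 +i* th))).

Lemma worm_cexp2 w ze : W (cexp w, cexp ze) <->
  `|2 * complex.Re ze| < mu /\ expR (complex.Re w) < 2 * cos (complex.Im w - 2 * complex.Re ze).
Proof. by rewrite -log_sqnorm_cexp; apply: worm_cexp; exact: cexp_neq0. Qed.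

Lemma adm_worm_cexp w ze : `|2 * complex.Re ze| < mu -> adm 0 w (2 * complex.Re ze) ->
  W (cexp w, cexp ze).
Proof. by move=> h [_ h2]; apply/worm_cexp2; rewrite subr0 in h2. Qed.

Lemma cder_log_section2 j w ze : W (cexp w, cexp ze) -> exists A, cder (log_section j w) ze A.
Proof.
case: hf => hol _ /hol /differentiable_cder2[a da].
eexists; apply: derM; first exact: (@der_comp _ _ id (fun u => f (cexp w, u)) cexp ze _ _ (cder_cexp ze) da).
apply: (@der_comp _ _ id cexp (fun u => - (j%:~R * u)) ze _ _ _ (cder_cexp _)).
by apply: derN; apply: derZ; exact: der_io.
Qed.

Lemma cder_log_section1 j w ze : W (cexp w, cexp ze) ->
  exists A, cder (fun v => log_section j v ze) w A.
Proof.
case: hf => hol _ /hol /differentiable_cder1[a da].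
eexists; apply: derM; last exact: der_cst.
exact: (@der_comp _ _ id (fun u => f (u, cexp ze)) cexp w _ _ (cder_cexp w) da).
Qed.

Lemma cexp_period ze : cexp (ze + (0 +i* (- pi))) = cexp (ze + (0 +i* pi)).
Proof.
by rewrite !cexpD; congr (_ * _); rewrite /cexp /= cosN sinN sinpi oppr0.
Qed.

Lemma adm_between tau w s s' (l : R) : 0 <= l <= 1 -> adm tau w s -> adm tau w s' ->
  adm tau w ((1 - l) * s + l * s').
Proof.
move=> l01 [h1 h2] [h1' h2'].
have E : complex.Im w - ((1 - l) * s + l * s') =
  (1 - l) * (complex.Im w - s) + l * (complex.Im w - s') by ring.
split; rewrite E; first exact: ltr_norm_convex.
rewrite [X in expR X](_ : _ = (1 - l) * (complex.Re w - tau) + l * (complex.Re w - tau)); last by ring.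
exact: exp_lt_cos_convex.
Qed.

Lemma cint_vertical_der ze th : rder (fun y => ze + (0 +i* y)) th 'i.
Proof.
rewrite -[X in der _ _ _ X]add0r; apply: derD; first exact: der_cst.
exact: (rder_pair (is_derive_cst _ _ _) (is_derive_id _ _)).
Qed.

Lemma log_section_ccon j w a : W (cexp w, cexp a) ->
  ccon (- pi) pi (fun th => log_section j w (a + (0 +i* th))).
Proof.
move=> wW; apply: ccon_ex => th _.
have [|A dA] := @cder_log_section2 j w (a + (0 +i* th)).
  by move: wW => /worm_cexp2 h; apply/worm_cexp2; rewrite cReD /= addr0.
by eexists; exact: (@der_comp _ _ _ (log_section j w) (fun y => a + (0 +i* y)) th _ _ (cint_vertical_der a th) dA).
Qed.

Lemma log_section_period j w ze :
  log_section j w (ze + (0 +i* (- pi))) = log_section j w (ze + (0 +i* pi)).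
Proof.
rewrite /log_section cexp_period -!mulNr; congr (_ * _).
by rewrite -!mulrNz !cexpMz cexp_period.
Qed.

Lemma fourier_coef_indep j w a a' :
  `|2 * complex.Re a| < mu -> adm 0 w (2 * complex.Re a) ->
  `|2 * complex.Re a'| < mu -> adm 0 w (2 * complex.Re a') ->
  fourier_coef j w a = fourier_coef j w a'.
Proof.
move=> ha ada ha' ada'.
have p0 := pi_gt0 R.
pose phi (x y : R) := a + x%:C * (a' - a) + (0 +i* y).
have inW x y : 0 <= x <= 1 -> W (cexp w, cexp (phi x y)).
  move=> hx; have E : 2 * complex.Re (phi x y) = (1 - x) * (2 * complex.Re a) + x * (2 * complex.Re a').
    by rewrite /phi !cReD cReM cReB /=; ring.
  by apply: adm_worm_cexp; rewrite E; [exact: ltr_norm_convex|exact: adm_between].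
have n1 : normc ('i : R[i]) = 1 by rewrite /= expr0n /= add0r expr1n sqrtr1.
have H := @goursat R (log_section j w) phi (fun _ _ => a' - a) (fun _ _ => 'i) 0 1 (- pi) pi
  (normc (a' - a) + 1).
have {H} : cint 0 1 (fun x : R => log_section j w (phi x (- pi)) * (a' - a)) +
   cint (- pi) pi (fun y : R => log_section j w (phi 1 y) * 'i%C) =
   cint 0 1 (fun x : R => log_section j w (phi x pi) * (a' - a)) +
   cint (- pi) pi (fun y : R => log_section j w (phi 0 y) * 'i%C).
  apply: H.
  - move=> x y _ _; rewrite -[X in der _ _ _ X]addr0; apply: derD; last exact: der_cst.
    rewrite -[X in der _ _ _ X]add0r; apply: derD; first exact: der_cst.
    have := derM (rder_id x) (der_cst (real_complex R) (a' - a) x).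
    by rewrite mul1r mulr0 addr0.
  - by move=> x y _ _; exact: cint_vertical_der.
  - by move=> y _ x _; exact: cnt_cst.
  - by move=> y _ x _; exact: cnt_cst.
  - by move=> x y _ _; rewrite lerDl.
  - by move=> x y _ _; rewrite n1 lerDr normc_ge0.
  - by move=> x y hx _; apply: cder_log_section2; exact: inW.
  - exact: ler01.
  - by rewrite ge0_cp// ltW.
rewrite (@eq_cint _ _ _ (fun x => log_section j w (phi x (- pi)) * (a' - a))
   (fun x : R => log_section j w (phi x pi) * (a' - a))); last first.
  by move=> x _; rewrite /phi log_section_period.
move=> /addrI E.
have c1 := log_section_ccon j (adm_worm_cexp ha' ada').
have c0 := log_section_ccon j (adm_worm_cexp ha ada).
have i0 : ('i : R[i]) != 0 by rewrite -normc_gt0 n1.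
apply: (mulfI i0); rewrite /fourier_coef -(cintZ _ c1) -(cintZ _ c0); symmetry.
rewrite (@eq_cint _ _ _ _ (fun y => log_section j w (phi 1 y) * 'i)); last first.
  by move=> y _; rewrite mulrC /phi mul1r addrCA subrr addr0.
rewrite E; apply: eq_cint => y _.
by rewrite mulrC /phi mul0r addr0.
Qed.

Lemma polysquare_worm w ze (d r : R) : 0 < d -> d <= 1 ->
  expR (complex.Re w) <= 2 -> `|2 * complex.Re ze| + d <= mu ->
  expR (complex.Re w) + 8 * d <= 2 * cos (complex.Im w - 2 * complex.Re ze) ->
  28 * r < d * expR (complex.Re w) -> 28 * r < d * expR (complex.Re ze) ->
  polysquare (cexp w, cexp ze) r `<=` W.
Proof.
move=> d0 d1 x2 hs hc r1 r2.
(* A point of the square is within 2 r < (d / 14) |e^u| of e^u, and [clog1D] costs a factor 6: the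
   logarithm moves by less than 6 d / 14 < d / 2. *)
have step (v u : R[i]) : 28 * r < d * expR (complex.Re u) -> csquare (cexp u) r v ->
    exists2 h, v = cexp (u + h) & normc h < d / 2.
  move=> ru [/andP[h1 h2] /andP[h3 h4]].
  have n0 : 0 < expR (complex.Re u) by exact: expR_gt0.
  have hv : normc (v - cexp u) <= 2 * r.
    apply: (le_trans (normc_le_ReIm _)); rewrite cReB cImB.
    have : `|complex.Re v - complex.Re (cexp u)| <= r by rewrite ler_norml; apply/andP; split; clear -h1 h2; rlra.
    have : `|complex.Im v - complex.Im (cexp u)| <= r by rewrite ler_norml; apply/andP; split; clear -h3 h4; rlra.
    rlra.
  pose k := v / cexp u - 1.
  have kE : normc k * expR (complex.Re u) = normc (v - cexp u).
    by rewrite -normc_cexp -normcM /k mulrBl mul1r divfK ?cexp_neq0.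
  have k1 : normc k < d / 14.
    by rewrite -(ltr_pM2r n0) kE; rlra.
  have k4 : normc k <= 4^-1 by (clear -d1 k1; rlra).
  have vE : v / cexp u = 1 + k by rewrite /k addrC subrK.
  have vn : 1 + k != 0.
    by apply: slit_neq0; left; rewrite cReD /=; have := le_Re_normc k; rewrite ler_norml; clear -d1 k1; rlra.
  exists (clog (1 + k)); last by apply: (le_lt_trans (clog1D k4)); clear -d0 k1; rlra.
  by rewrite cexpD cexp_clog// -vE mulrC divfK ?cexp_neq0.
case=> v1 v2 [/= /(step _ _ r1)[h hE hd] /(step _ _ r2)[k kE kd]]; rewrite hE kE.
apply/worm_cexp2; rewrite !cReD cImD.
have := le_Re_normc h; have := le_Im_normc h; have := le_Re_normc k.
set x := complex.Re w in x2 hc *; set y := complex.Im w in hc *; set s := complex.Re ze in hs hc *.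
move: (complex.Re h) (complex.Im h) (complex.Re k) => hx hy ks k1 k2 k3.
split.
  rewrite mulrDr; have := ler_normD (2 * s) (2 * ks).
  by rewrite (normrM 2 ks) (ger0_norm (ler0n _ 2)); clear -kd hs k1; rlra.
(* The margin 8 d pays at most 4 d for the exponential, as e^x <= 2, and 3 d for twice the cosine,
   whose argument moves by at most d / 2 + 2 (d / 2). *)
have c1 := cos_lipschitz (y + hy - 2 * (s + ks)) (y - 2 * s).
have c2 : `|y + hy - 2 * (s + ks) - (y - 2 * s)| <= `|hy| + 2 * `|ks|.
  rewrite (_ : _ - _ = hy - 2 * ks); last by ring.
  by apply: (le_trans (ler_normB _ _)); rewrite (normrM 2 ks) (ger0_norm (ler0n _ 2)).
have c3 := ler_norm (cos (y - 2 * s) - cos (y + hy - 2 * (s + ks))); rewrite distrC in c3.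
have e1 : expR hx <= 1 + 2 * d.
  have hxd : hx <= d / 2 by have := ler_norm hx; clear -hd k3; rlra.
  apply: (@le_trans _ _ (expR (d / 2))); first by rewrite ler_expR.
  have d2 : d / 2 <= 2^-1 by rlra.
  have := expR_taylor1 d2; have := ler_norm (expR (d / 2) - 1 - d / 2); rnra.
have e2 : expR x * expR hx <= expR x * (1 + 2 * d) by rewrite ler_wpM2l ?expR_ge0.
have e3 : expR x * d <= 2 * d by rewrite ler_wpM2r// ltW.
rewrite expRD; clear -d0 hd kd hc k1 k2 c1 c2 c3 e2 e3; rlra.
Qed.

(** The polysquare of half-side r = c d e^{Re w} lies in the domain. With c = e^{-mu} / 60 it is
    small against d |z_1| and, because |z_1| <= 2 and |z_2| >= e^{-mu}, also against d |z_2|. *)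
Lemma bergman_growth : exists2 K : R, 0 <= K & forall w ze (d : R), 0 < d -> d <= 1 ->
  expR (complex.Re w) <= 2 -> `|2 * complex.Re ze| + d <= mu ->
  expR (complex.Re w) + 8 * d <= 2 * cos (complex.Im w - 2 * complex.Re ze) ->
  normc (f (cexp w, cexp ze)) <= K / (d * expR (complex.Re w)) ^+ 4.
Proof.
have [K K0 HK] := bergman_polysquare_bound (@dopen_worm _ mu) (worm_finite mu0) hf.
pose c := expR (- mu) / 60.
have c0 : 0 < c by rewrite divr_gt0// expR_gt0.
exists (K / c ^+ 4); first by rewrite divr_ge0// exprn_ge0// ltW.
move=> w ze d d0 d1 x2 hs hc.
have e0 := expR_gt0 (complex.Re w).
pose r := c * (d * expR (complex.Re w)).
have de0 : 0 < d * expR (complex.Re w) by rewrite mulr_gt0.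
have r0 : 0 < r by rewrite /r mulr_gt0.
have -> : K / c ^+ 4 / (d * expR (complex.Re w)) ^+ 4 = K / r ^+ 4.
  have gen (A B D : R) : A / B / D = A / (B * D) by rewrite invfM mulrA.
  by rewrite gen -exprMn.
apply: HK => //; apply: (polysquare_worm d0 d1 x2 hs hc).
  have : c < 60^-1 by rewrite /c ltr_pdivrMr// mulVf// expR_lt1 oppr_lt0.
  by rewrite /r -(ltr_pM2r de0); rlra.
have sz : - mu <= complex.Re ze.
  have : `|2 * complex.Re ze| <= mu by lra.
  rewrite ler_norml; have := mu0; lra.
have ez : expR (- mu) <= expR (complex.Re ze) by rewrite ler_expR.
have h1 : d * expR (complex.Re w) <= 2 * d by rewrite mulrC ler_wpM2r// ltW.
have h2 : 28 * r <= 56 / 60 * (d * expR (- mu)).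
  have : c * (d * expR (complex.Re w)) <= c * (2 * d) by rewrite ler_wpM2l// ltW.
  by rewrite /r /c; rlra.
have h3 : 0 < d * expR (- mu) by rewrite mulr_gt0// expR_gt0.
have h4 : d * expR (- mu) <= d * expR (complex.Re ze) by rewrite ler_wpM2l// ltW.
rlra.
Qed.

(* Any admissible height will do, by [fourier_coef_indep]. *)
Definition slice w : R := xget 0 [set s | `|s| < mu /\ adm 0 w s].

Lemma sliceP w : Om mu 0 w -> `|slice w| < mu /\ adm 0 w (slice w).
Proof.
case=> s hs ha; rewrite /slice.
by apply: (@xgetPex _ 0 [set s | `|s| < mu /\ adm 0 w s]); exists s.
Qed.

Definition coef j w : R[i] := fourier_coef j w ((slice w / 2)%:C).

Lemma two_half (s : R) : 2 * complex.Re ((s / 2)%:C) = s.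
Proof. by rewrite /=; field. Qed.

Lemma coefE j w a : `|2 * complex.Re a| < mu -> adm 0 w (2 * complex.Re a) ->
  coef j w = fourier_coef j w a.
Proof.
move=> ha ada; have [h1 h2] : `|slice w| < mu /\ adm 0 w (slice w) by apply: sliceP; exists (2 * complex.Re a).
by apply: fourier_coef_indep; rewrite ?two_half.
Qed.

Lemma adm_mono tau tau' w s : tau <= tau' -> adm tau w s -> adm tau' w s.
Proof.
by move=> h [h1 h2]; split=> //; apply: le_lt_trans h2; rewrite ler_expR; lra.
Qed.

Lemma adm_slack tau w s : 0 <= tau -> adm (- tau) w s ->
  expR (complex.Re w) + tau * expR (complex.Re w) <= 2 * cos (complex.Im w - s).
Proof.
move=> t0 [_ h]; apply: le_trans (ltW h); rewrite opprK expRD.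
by rewrite -[X in X + _]mulr1 [tau * _]mulrC -mulrDr ler_wpM2l ?expR_ge0// expR_ge1Dx.
Qed.

Lemma normc_log_section j w ze (B : R) : normc (f (cexp w, cexp ze)) <= B ->
  `|2 * complex.Re ze| <= mu -> normc (log_section j w ze) <= B * expR (`|j%:~R| * mu).
Proof.
move=> hB hz; have B0 := le_trans (normc_ge0 _) hB.
rewrite normcM ler_pM ?normc_ge0// normc_cexp ler_expR cReN cReM.
have -> : (j%:~R : R[i]) = (j%:~R : R)%:C by rewrite rmorph_int.
rewrite /= mul0r subr0; apply: (le_trans (ler_norm _)); rewrite normrN normrM ler_wpM2l//.
apply: le_trans hz; rewrite normrM (ger0_norm (ler0n _ 2)); have := normr_ge0 (complex.Re ze); lra.
Qed.

Lemma Re_circle a (th : R) : complex.Re (a + (0 +i* th)) = complex.Re a.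
Proof. by rewrite cReD addr0. Qed.

(** A height admissible at [w] remains so nearby; by independence of the height, [coef] is locally
    an integral over one fixed segment, and [param_holo] applies with the bound of
    [bergman_growth]. *)
Lemma cder_coef j w : Om mu 0 w -> exists A, cder (coef j) w A.
Proof.
move=> /sliceP[]; set s := slice w => hs ha.
have [e e0 He] := adm_open hs ha.
have [K K0 HK] := bergman_growth.
pose a := (s / 2)%:C : R[i].
have aE : 2 * complex.Re a = s by exact: two_half.
(* Room in the direction of Re w gives [adm (- tau)], a quantitative slack that persists near
   [w]. *)
pose tau := e / 2; have tau0 : 0 < tau by rewrite divr_gt0.
have hat : adm (- tau) w s.
  have [|||_ []] := He (w + tau%:C) s; rewrite ?subrr ?normr0//.
  - by rewrite cReD addrAC subrr add0r /= gtr0_norm// /tau; lra.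
  - by rewrite cImD addrAC subrr add0r /= normr0.
  by rewrite cReD cImD /= !addr0 subr0 => h1 h2; split=> //; rewrite opprK.
have [e' e'0 He'] := adm_open hs hat.
pose r := Num.min (e' / 2) 1; have r0 : 0 < r by rewrite lt_min divr_gt0/=.
have [r1 r2] : r <= e' / 2 /\ r <= 1 by rewrite !ge_min !lexx orbT.
pose x0 := complex.Re w - 1.
pose d := Num.min 2^-1 (Num.min ((mu - `|s|) / 2) (tau * expR x0 / 8)).
have d0 : 0 < d by rewrite !lt_min invr_gt0 ltr0n /= !divr_gt0 ?subr_gt0 ?mulr_gt0 ?expR_gt0.
have [d1 d2 d3] : [/\ d <= 2^-1, d <= (mu - `|s|) / 2 & d <= tau * expR x0 / 8].
  by split; rewrite !ge_min lexx ?orbT.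
have near z : csquare w r z -> [/\ adm (- tau) z s & x0 <= complex.Re z].
  move=> [/andP[h1 h2] /andP[h3 h4]]; split; last by rewrite /x0; rlra.
  apply (He' z s); rewrite ?subrr ?normr0//.
    by apply: (@le_lt_trans _ _ r); [rewrite ler_norml; apply/andP; split; (clear -h1 h2; rlra)|(clear -e'0 r1; rlra)].
  by apply: (@le_lt_trans _ _ r); [rewrite ler_norml; apply/andP; split; (clear -h3 h4; rlra)|(clear -e'0 r1; rlra)].
have adm0 z : csquare w r z -> adm 0 z s.
  by move=> /near[h _]; apply: adm_mono h; rewrite oppr_le0 ltW.
have inW z th : csquare w r z -> W (cexp z, cexp (a + (0 +i* th))).
  by move=> zw; apply: adm_worm_cexp; rewrite Re_circle aE//; exact: adm0.
pose B := K / (d * expR x0) ^+ 4 * expR (`|j%:~R| * mu).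
have [A dA] : exists A, cder (fun u => cint (- pi) pi (fun th => log_section j u (a + (0 +i* th)))) w A.
  apply: (@param_holo R (- pi) pi (fun th u => log_section j u (a + (0 +i* th))) w r B) => //.
  - by rewrite ge0_cp// pi_ge0.
  - move=> th z _ zw; split; first exact: cder_log_section1 (inW z th zw).
    have [h1 h2] := near z zw; have [_ h3] := adm0 z zw; rewrite subr0 in h3.
    apply: normc_log_section; last by rewrite Re_circle aE ltW.
    have x2 : expR (complex.Re z) <= 2 by have := cos_le1 (complex.Im z - s); clear -h3; rlra.
    have ex : expR x0 <= expR (complex.Re z) by rewrite ler_expR.
    apply: (le_trans (HK z _ d d0 _ x2 _ _)); rewrite ?Re_circle ?aE; [(clear -d1; rlra)|(clear -hs d2; rlra)| |].
      have := adm_slack (ltW tau0) h1; have := ler_wpM2l (ltW tau0) ex; clear -d3; rlra.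
    apply: ler_wpM2l => //; rewrite lef_pV2 ?posrE ?exprn_gt0 ?mulr_gt0 ?expR_gt0//.
    by apply: lerXn2r; rewrite ?nnegrE ?mulr_ge0 ?expR_ge0 ?(ltW d0)// ler_wpM2l// ltW.
  - by move=> z zw; apply: log_section_ccon; have := inW z 0 zw; rewrite addr0.
exists A; apply: (@der_near _ _ id _ (coef j) w A dA); exists r; first exact: r0.
move=> z; rewrite /dio => zw.
have zs : csquare w r z by have := @csquareP R w r (z - w) (ltW zw); rewrite addrC subrK.
by rewrite -/(fourier_coef j z a) (@coefE j z a)// aE//; exact: adm0.
Qed.

Lemma cos_gt0_lt (x : R) : `|x| <= pi -> 0 < cos x -> `|x| < pi / 2.
Proof.
move=> xp c0; have p0 := pi_gt0 R.
rewrite -ltr_cos ?in_itv/= ?normr_ge0//=; first by rewrite cos_pihalf cos_norm.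
by apply/andP; split; lra.
Qed.

(** On [Om mu (- tau)] the slack is at least tau e^{Re w}, so the margin d may be a multiple of
    e^{Re w}, and (d e^{Re w})^4 is a multiple of e^{8 Re w}. The height s is first contracted to (1
    - k) s to leave the same margin below mu. *)
Lemma coef_growth j (tau : R) : 0 < tau -> exists2 C : R, 0 <= C &
  forall w, Om mu (- tau) w -> normc (coef j w) <= C * expR (- (8 * complex.Re w)).
Proof.
move=> tau0; have [K K0 HK] := bergman_growth; have p0 := pi_gt0 R.
(* Of the slack 10 ga e^{Re w}, 8 parts are the margin asked for by [bergman_growth] and 2 pay for
   moving the height. *)
pose ga := Num.min tau 1 / 10.
have ga0 : 0 < ga by rewrite divr_gt0// lt_min tau0/=.
have ga1 : ga <= 10^-1 by rewrite /ga ler_pdivrMr// mulVf// ge_min lexx orbT.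
have gat : 10 * ga <= tau by rewrite /ga mulrC divfK// ge_min lexx.
exists (2 * (K / ga ^+ 4 * expR (`|j%:~R| * mu)) * (2 * pi)).
  by rewrite !mulr_ge0 ?expR_ge0 ?invr_ge0 ?exprn_ge0 ?pi_ge0// ltW.
move=> w [s hs ha]; have [ha1 ha2] := ha.
set E := expR (complex.Re w).
have E0 : 0 < E by exact: expR_gt0.
have sl := adm_slack (ltW tau0) ha; rewrite -/E in sl.
have E2 : E <= 2.
  by have := cos_le1 (complex.Im w - s); have := mulr_ge0 (ltW tau0) (ltW E0); rlra.
pose d := ga * E; have d0 : 0 < d by rewrite mulr_gt0.
have d5 : d <= 5^-1.
  have := ler_pM (ltW ga0) (ltW E0) ga1 E2; rewrite /d; rlra.
pose k := d / mu; have k0 : 0 < k by rewrite divr_gt0.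
have kmu : k * mu = d by rewrite divfK// gt_eqF.
have k1 : k <= 1 by rewrite ler_pdivrMr// mul1r; have := mu1; rlra.
pose s' := (1 - k) * s; pose a := (s' / 2)%:C : R[i].
have aE : 2 * complex.Re a = s' by exact: two_half.
have ks : k * `|s| <= d by rewrite -kmu ler_wpM2l ?ltW.
have hs' : `|s'| + d <= mu.
  rewrite normrM ger0_norm; last (clear -k1; rlra).
  have : (1 - k) * `|s| <= (1 - k) * mu by rewrite ler_wpM2l ?subr_ge0// ltW.
  by rewrite [(1 - k) * mu]mulrBl mul1r kmu; clear; lra.
have ss : `|(complex.Im w - s') - (complex.Im w - s)| <= d.
  by rewrite (_ : _ - (_ - s) = k * s); [rewrite normrM (gtr0_norm k0)|rewrite /s'; ring].
have cl := cos_lipschitz (complex.Im w - s) (complex.Im w - s').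
rewrite distrC in ss; have cn := ler_norm (cos (complex.Im w - s) - cos (complex.Im w - s')).
have slk : E + 8 * d <= 2 * cos (complex.Im w - s').
  by have := ler_wpM2r (ltW E0) gat; rewrite /d in ss *; clear -sl cl cn ss; rlra.
have ad' : adm 0 w s'.
  split; last by rewrite subr0 -/E; clear -d0 slk; rlra.
  apply: cos_gt0_lt; last (clear -E0 d0 slk; rlra).
  have := ler_normD (complex.Im w - s) (- ((complex.Im w - s) - (complex.Im w - s'))).
  rewrite normrN (_ : _ - s - _ = complex.Im w - s'); last by ring.
  have := pi_ge2 R; clear -ha1 d5 ss; rlra.
have hs2 : `|s'| < mu by (clear -d0 hs'; rlra).
rewrite (@coefE j w a) ?aE// /fourier_coef.
have wW : W (cexp w, cexp a) by apply: adm_worm_cexp; rewrite aE.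
pose B := K / ga ^+ 4 * expR (`|j%:~R| * mu) * expR (- (8 * complex.Re w)).
apply: (@le_trans _ _ (2 * B * (pi - - pi))); last first.
  by rewrite /B le_eqVlt; apply/orP; left; apply/eqP; ring.
apply: cint_le; [by rewrite ge0_cp// pi_ge0|exact: log_section_ccon|].
move=> th _; have := @normc_log_section j w (a + (0 +i* th)) (K / (d * E) ^+ 4).
rewrite Re_circle aE => H; have {}H := H _ (ltW hs2).
have dE : (d * E) ^+ 4 = ga ^+ 4 * expR (8 * complex.Re w).
  by rewrite /d -mulrA exprMn; congr (_ * _); rewrite -expr2 -exprM -expRM_natl.
apply: (le_trans (H _)).
  by apply: HK; rewrite ?Re_circle ?aE//; clear -d5; rlra.
by rewrite dE /B expRN invfM le_eqVlt; apply/orP; left; apply/eqP; ring.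
Qed.

End fourier_coefficients.

(** * Damping and Fourier modes *)

Section damping.
Context {R : realType}.
Variables (mu : R).
Hypothesis mu0 : 0 < mu.
Implicit Types (w : R[i]) (e : R).
Let M := mu + pi / 2.
Let A := pi / (2 * M).
Let M0 : 0 < M. Proof. by rewrite addr_gt0// divr_gt0// pi_gt0. Qed.
Let A0 : 0 < A. Proof. by rewrite divr_gt0 ?pi_gt0// mulr_gt0. Qed.

Definition damp_rate := A.

(** The rate A = pi / (2 M) makes xi = e^{A w} send the strip |Im w| < M into the right half-plane.
    There xi / (xi + e) is bounded by 1, tends to 1 as e -> 0, and is at most |xi| / e, hence decays
    at the left end. *)
Definition damp e w : R[i] := cexp (A%:C * w) / (cexp (A%:C * w) + e%:C).

Lemma Re_cexp_strip w : `|complex.Im w| < M -> 0 < complex.Re (cexp (A%:C * w)).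
Proof.
move=> h; rewrite [complex.Re _]/= mulr_gt0 ?expR_gt0// cos_gt0_pihalf// -ltr_norml.
have -> : complex.Im (A%:C * w) = A * complex.Im w by rewrite cImM /= mul0r addr0.
rewrite normrM (gtr0_norm A0).
have -> : pi / 2 = A * M by rewrite /A; field; rewrite gt_eqF.
by rewrite ltr_pM2l.
Qed.

Lemma damp_den w e : 0 < e -> `|complex.Im w| < M ->
  normc (cexp (A%:C * w)) <= normc (cexp (A%:C * w) + e%:C) /\ e <= normc (cexp (A%:C * w) + e%:C).
Proof.
move=> e0 /Re_cexp_strip; move: (cexp _) => xi x0; split; last first.
  apply: le_trans (le_Re_normc _); rewrite cReD /=; have := ler_norm (complex.Re xi + e); lra.
rewrite -(@ler_pXn2r _ 2)// ?nnegrE ?normc_ge0// !normcE cReD cImD /= addr0.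
have := mulr_ge0 (ltW x0) (ltW e0); have := sqr_ge0 e; nra.
Qed.

Lemma damp_le1 w e : 0 < e -> `|complex.Im w| < M -> normc (damp e w) <= 1.
Proof.
move=> e0 h; have [h1 h2] := damp_den e0 h.
by rewrite normcM normcV ler_pdivrMr ?mul1r// (lt_le_trans e0).
Qed.

Lemma damp_le_exp w e : 0 < e -> `|complex.Im w| < M ->
  normc (damp e w) <= expR (A * complex.Re w) / e.
Proof.
move=> e0 h; have [h1 h2] := damp_den e0 h.
rewrite normcM normcV normc_cexp cReM /= mul0r subr0 ler_wpM2l ?expR_ge0//.
by rewrite lef_pV2 ?posrE// (lt_le_trans e0).
Qed.

Lemma cder_damp w e : 0 < e -> `|complex.Im w| < M -> exists a, cder (damp e) w a.
Proof.
move=> e0 h; have [_ h2] := damp_den e0 h.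
have d := @der_comp _ _ id cexp (fun u => A%:C * u) w _ _ (derZ A%:C (der_io id w)) (cder_cexp _).
eexists; apply: derM; first exact: d.
apply: derV; first by rewrite -normc_gt0 (lt_le_trans e0).
by apply: derD; [exact: d|exact: der_cst].
Qed.

Lemma damp_lim w k (r : R) : `|complex.Im w| < M -> 0 < r -> exists N, forall n, (N <= n)%N ->
  normc (damp n.+1%:R^-1 w ^+ k - 1) < r.
Proof.
move=> h r0.
have xn : cexp (A%:C * w) != 0 := cexp_neq0 _.
have cc : cnt (@dR R) setT (fun e : R => (cexp (A%:C * w) / (cexp (A%:C * w) + e%:C)) ^+ k) 0.
  apply: cntX; apply: cntM; first exact: cnt_cst.
  apply: cntV; first by rewrite addr0.
  apply: cntD; first exact: cnt_cst.
  by have := der_cnt (rder_id (0 : R)); rewrite dio_real.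
have [d d0 Hd] := cc _ r0.
exists (Num.bound d^-1) => n Nn.
have dn : `|n.+1%:R^-1 - 0 : R| < d.
  rewrite subr0 gtr0_norm ?invr_gt0// invf_plt ?posrE//.
  apply: (lt_le_trans (archi_boundP _)); first by rewrite invr_ge0 ltW.
  by rewrite ler_nat (leq_trans Nn).
by have := Hd _ I dn; rewrite addr0 divff// expr1n.
Qed.

End damping.

Section modes.
Context {R : realType}.
Local Notation C2 := (R[i]^o * R[i]^o)%type.
Variables (mu c0 : R) (f : C2 -> R[i]^o).
Hypotheses (hmu : pi / 2 < mu) (hc0 : -1 < c0) (hf : bergman (truncated_worm mu) f).
Local Notation W := (@truncated_worm R mu).
Implicit Types (z : C2) (t e : R) (j : int) (k : nat).

Let mu1 : 1 < mu. Proof. by have := pi_ge2 R; have := hmu; lra. Qed.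
Let mu0 : 0 < mu. Proof. by apply: lt_trans mu1; exact: ltr01. Qed.

(** A translation by - 2 t in the logarithmic coordinate. It takes [Om mu (t + t / 2)], where F must
    be defined, into [Om mu (- (t / 2))], where the coefficients are under control. *)
Definition dilate t z : C2 := (cexp (- (2 * t))%:C * z.1, z.2).
Definition damped t e k z : R[i]^o := f (dilate t z) * damp mu e (worm_L z) ^+ k.
Definition rotate (th : R) z : C2 := (z.1, cexp (0 +i* th) * z.2).
Definition mode (g : C2 -> R[i]^o) j z : R[i]^o :=
  cint (- pi) pi (fun th => g (rotate th z) * cexp (- (j%:~R * (0 +i* th)))).

Lemma adm_shift tau t w s : adm tau w s -> adm (tau - 2 * t) (w + (- (2 * t))%:C) s.
Proof.
case=> h1 h2; split; rewrite cImD /= addr0//.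
rewrite cReD /=; apply: le_lt_trans h2; rewrite ler_expR; lra.
Qed.

Lemma Om_shift tau t w : Om mu tau w -> Om mu (tau - 2 * t) (w + (- (2 * t))%:C).
Proof. by case=> s hs ha; exists s => //; exact: adm_shift. Qed.

Lemma dilateE t z : W z -> dilate t z = (cexp (worm_L z + (- (2 * t))%:C), z.2).
Proof. by move=> /worm_LP[E _]; rewrite /dilate cexpD E mulrC. Qed.

Lemma adm_worm_L t z : 0 <= t -> W z -> adm 0 (worm_L z + (- (2 * t))%:C) (log_sqnorm z.2).
Proof.
move=> t0 /worm_LP[_ /(adm_shift t) h]; apply: adm_mono h; lra.
Qed.

Lemma dilate_worm t z : 0 <= t -> W z -> W (dilate t z).
Proof.
move=> t0 zW; have [z2 _ hs] := zW; rewrite dilateE//.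
by apply: adm_worm => //; exact: adm_worm_L.
Qed.

Lemma log_sqnorm_rotate th z : z.2 != 0 -> log_sqnorm (rotate th z).2 = log_sqnorm z.2.
Proof.
by move=> z2; rewrite /= log_sqnormM ?cexp_neq0// log_sqnorm_cexp mulr0 add0r.
Qed.

Lemma worm_L_rotate th z : z.2 != 0 -> worm_L (rotate th z) = worm_L z.
Proof. by move=> z2; rewrite /worm_L log_sqnorm_rotate. Qed.

Lemma rotate_worm th z : W z -> W (rotate th z).
Proof.
move=> zW; have [z2 _ hs] := zW; have [E ad] := worm_LP zW.
have -> : rotate th z = (cexp (worm_L z), cexp (0 +i* th) * z.2) by rewrite E.
have ls := log_sqnorm_rotate th z2; rewrite /= in ls.
by apply: adm_worm; rewrite ?ls// mulf_neq0// cexp_neq0.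
Qed.

(** Damping to the power k gives decay at rate k A; the coefficient loses 8 and
    [approximable_worm_fun] asks for c0 + 2, whence c0 + 10. The factor e^{16 t} in [C'] comes from
    evaluating e^{- 8 Re w} at the translated point. *)
Lemma approximable_coef t e k j : 0 < t -> 0 < e -> c0 + 10 <= k%:R * damp_rate mu ->
  approximable W (worm_system mu c0)
    (fun z => coef mu f j (worm_L z + (- (2 * t))%:C) * damp mu e (worm_L z) ^+ k * z.2 ^ j : R[i]^o).
Proof.
move=> t0 e0 hk; set A := damp_rate mu in hk.
have t20 : 0 < t / 2 by rewrite divr_gt0.
have [C C0 HC] := coef_growth mu1 hf j t20.
have sh w : Om mu (t + t / 2) w -> Om mu (- (t / 2)) (w + (- (2 * t))%:C).
  by move=> /(Om_shift t); rewrite (_ : _ - 2 * t = - (t / 2)); [|field].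
pose F w := coef mu f j (w + (- (2 * t))%:C) * damp mu e w ^+ k.
pose C' := C * expR (16 * t) / e ^+ k.
have C'0 : 0 <= C' by rewrite !mulr_ge0 ?expR_ge0 ?invr_ge0 ?exprn_ge0// ltW.
apply: (@approximable_worm_fun R mu c0 hmu hc0 t C' (k%:R * A - 8) j F) => //; first lra.
- move=> w ww; have iw := Om_Im ww.
  have [|a da] := @cder_coef R mu f mu1 hf j (w + (- (2 * t))%:C).
    by apply: Om_mono (sh w ww); lra.
  have [b db] := cder_damp mu0 e0 iw; have [b' db'] := derX k db.
  eexists; apply: derM; last exact: db'.
  apply: (@der_comp _ _ id (coef mu f j) (fun w => w + (- (2 * t))%:C) w _ _ _ da).
  by apply: derD; [exact: der_io|exact: der_cst].
move=> w ww; have iw := Om_Im ww.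
have h1 := HC _ (sh w ww); have h2 := damp_le_exp mu0 e0 iw.
rewrite normcM normcX.
have h3 : normc (damp mu e w) ^+ k <= (expR (A * complex.Re w) / e) ^+ k.
  by apply: lerXn2r; rewrite ?nnegrE ?normc_ge0 ?divr_ge0 ?expR_ge0// ltW.
apply: (le_trans (ler_pM (normc_ge0 _) (exprn_ge0 _ (normc_ge0 _)) h1 h3)).
rewrite cReD /= exprMn exprVn -expRM_natl le_eqVlt; apply/orP; left; apply/eqP.
rewrite /C' mulrBl expRD mulrDr opprD expRD.
have -> : k%:R * (A * complex.Re w) = k%:R * A * complex.Re w by ring.
have -> : - (8 * - (2 * t)) = 16 * t by ring.
by ring.
Qed.

(** With z_2 = e^a, integrating over rotations is integrating [log_section] along the vertical
    segment through a, up to e^{j a} = z_2^j. The damping factor comes out because [worm_L] involves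
    z_2 only through |z_2|. *)
Lemma modeE t e k j z : 0 < t -> W z ->
  mode (damped t e k) j z =
  coef mu f j (worm_L z + (- (2 * t))%:C) * damp mu e (worm_L z) ^+ k * z.2 ^ j.
Proof.
move=> t0 zW; have [z2 _ hs] := zW.
pose a := clog z.2; have ca : cexp a = z.2 by exact: cexp_clog.
have aE : 2 * complex.Re a = log_sqnorm z.2 by rewrite log_sqnorm_clog.
set w := worm_L z + _.
have adw : adm 0 w (log_sqnorm z.2) by apply: adm_worm_L => //; exact: ltW.
rewrite (@coefE R mu f hf j w a) ?aE// /fourier_coef mulrAC -[RHS]mulrA.
have wW : W (cexp w, cexp a) by apply: adm_worm_cexp; rewrite aE.
rewrite [RHS]mulrC -cintZ; last exact: (log_section_ccon hf j wW).
apply: eq_cint => th _.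
rewrite /damped worm_L_rotate// dilateE; last exact: rotate_worm.
rewrite worm_L_rotate// -/w /log_section [(rotate th z).2]/= [cexp (a + _)]cexpD ca.
have -> : z.2 ^ j = cexp (j%:~R * a) by rewrite cexpMz ca.
have -> : cexp (- (j%:~R * (a + (0 +i* th)))) = (cexp (j%:~R * a))^-1 * cexp (- (j%:~R * (0 +i* th))).
  by rewrite -cexpN -cexpD; congr cexp; ring.
rewrite [z.2 * _]mulrC; field; exact: cexp_neq0.
Qed.

Lemma approximable_mode t e k j : 0 < t -> 0 < e -> c0 + 10 <= k%:R * damp_rate mu ->
  approximable W (worm_system mu c0) (mode (damped t e k) j).
Proof.
move=> t0 e0 hk; apply: eq_approximable (approximable_coef j t0 e0 hk) => z zW.
by rewrite modeE.
Qed.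

End modes.

(** * Averaging kernels *)

Section real_integrals.
Context {R : realType}.
Implicit Types (a b x : R) (g h : R -> R[i]).
Local Notation mu := (@lebesgue_measure R).

Lemma Re_cint_ge0 a b g : (forall x, a <= x <= b -> 0 <= complex.Re (g x)) ->
  0 <= complex.Re (cint a b g).
Proof. by move=> H; apply: Rintegral_ge0 => x /=; rewrite in_itv/=; exact: H. Qed.

Lemma Re_cint_le a b g h : ccon a b g -> ccon a b h ->
  (forall x, a <= x <= b -> complex.Re (g x) <= complex.Re (h x)) ->
  complex.Re (cint a b g) <= complex.Re (cint a b h).
Proof.
move=> cg ch H; rewrite -subr_ge0 -cReB -cintB//; apply: Re_cint_ge0 => x /H.
by rewrite cReB subr_ge0.
Qed.

Lemma cint_conj a b g : ccon a b g -> cint a b (fun x => conjc (g x)) = conjc (cint a b g).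
Proof.
move=> cg; have [g1 g2] := ccon_integrable cg.
apply: complex_eqP; first by apply: eq_Rintegral => x _; case: (g x).
rewrite [RHS]/= -[RHS]mulN1r -RintegralZl//.
by apply: eq_Rintegral => x _; rewrite mulN1r; case: (g x).
Qed.

Lemma ccon_conj a b g : ccon a b g -> ccon a b (fun x => conjc (g x)).
Proof.
move=> cg x xab e /(cg _ xab)[d d0 H]; exists d => // y yab yx.
by rewrite -rmorphB normcJ; exact: H.
Qed.

Lemma ccon_normcC a b g : ccon a b g -> ccon a b (fun x => (normc (g x))%:C).
Proof.
move=> cg x xab e /(cg _ xab)[d d0 H]; exists d => // y yab yx.
by rewrite -rmorphB normc_real (le_lt_trans (le_dist_normc _ _))// H.
Qed.

(* Jensen's inequality for the square of the modulus, from
   [0 <= \int K |g - m|^2] with [m = \int K g]. *)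
Lemma cint_jensen a b (K : R -> R) g : ccon a b (fun x => (K x)%:C) ->
  (forall x, a <= x <= b -> 0 <= K x) -> cint a b (fun x => (K x)%:C) = 1 -> ccon a b g ->
  normc (cint a b (fun x => (K x)%:C * g x)) ^+ 2 <=
  complex.Re (cint a b (fun x => (K x * normc (g x) ^+ 2)%:C)).
Proof.
move=> cK K0 K1 cg; set m := cint a b _.
have cKg : ccon a b (fun x => (K x)%:C * g x) by exact: cconM.
have cgb := ccon_conj cg.
have cKgb : ccon a b (fun x => (K x)%:C * conjc (g x)) by exact: cconM.
have cKgg : ccon a b (fun x => (K x)%:C * g x * conjc (g x)) by exact: cconM.
have mb : cint a b (fun x => (K x)%:C * conjc (g x)) = conjc m.
  rewrite /m -cint_conj//; apply: eq_cint => x _.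
  by rewrite rmorphM /=; congr (_ * _); rewrite /= oppr0.
have E : cint a b (fun x => (K x)%:C * (g x - m) * conjc (g x - m)) =
    cint a b (fun x => (K x)%:C * g x * conjc (g x)) - m * conjc m.
  rewrite (@eq_cint _ _ _ _ (fun x => ((K x)%:C * g x * conjc (g x) - conjc m * ((K x)%:C * g x)) -
     (m * ((K x)%:C * conjc (g x)) - (m * conjc m) * (K x)%:C))); last first.
    by move=> x _; rewrite rmorphB /=; ring.
  have c1 := cconZ (conjc m) cKg; have c2 := cconZ m cKgb; have c3 := cconZ (m * conjc m) cK.
  rewrite cintB//; [|exact: cconB|exact: cconB].
  rewrite cintB// cintB// !cintZ// K1 mb -/m; ring.
have P : 0 <= complex.Re (cint a b (fun x => (K x)%:C * (g x - m) * conjc (g x - m))).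
  apply: Re_cint_ge0 => x xab; rewrite -mulrA conjcM_normc -rmorphM /=.
  by rewrite mulr_ge0 ?K0// sqr_ge0.
rewrite (@eq_cint _ _ _ (fun x => (K x * normc (g x) ^+ 2)%:C) (fun x => (K x)%:C * g x * conjc (g x))).
  by move: P; rewrite E cReB conjcM_normc subr_ge0.
by move=> x _; rewrite -mulrA conjcM_normc -rmorphM.
Qed.

Lemma cint_normc_le a b g h : ccon a b g -> ccon a b h ->
  (forall x, a <= x <= b -> normc (g x) <= complex.Re (h x)) ->
  normc (cint a b g) <= 2 * complex.Re (cint a b h).
Proof.
move=> cg ch H; apply: (le_trans (cint_le_norm cg)); rewrite ler_pM2l//.
exact: (Re_cint_le (ccon_normcC cg) ch H).
Qed.

End real_integrals.

Section kernel.
Context {R : realType}.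
Implicit Types (th d : R) (N : nat).

Let pp : - pi <= pi :> R. Proof. by rewrite ge0_cp// pi_ge0. Qed.

Lemma ccon_cos a b : @ccon R a b (fun th => (cos th)%:C).
Proof. by apply: ccon_ex => x _; eexists; exact: (is_derive_rder (is_derive_cos x)). Qed.

(** The de la Vallee Poussin kernel, not yet normalized: nonnegative, concentrated at 0, and a
    trigonometric polynomial with explicit coefficients. *)
Definition bump N th : R := (1 + cos th) ^+ N.

Lemma ccon_bump N a b : ccon a b (fun th => (bump N th)%:C).
Proof.
have -> : (fun th => (bump N th)%:C) = (fun th => (1 + (cos th)%:C) ^+ N).
  by apply/funext => th; rewrite /bump rmorphXn rmorphD.
move=> x xab; apply: cntX; apply: cntD; [exact: cnt_cst|exact: ccon_cos].
Qed.

Lemma bump_ge0 N th : 0 <= bump N th.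
Proof. by rewrite exprn_ge0//; have := cos_geN1 th; lra. Qed.

Definition bump_mass N : R := complex.Re (cint (- pi) pi (fun th => (bump N th)%:C)).

Lemma bump_mono N d th : 0 <= d -> `|th| <= d -> d <= pi -> bump N d <= bump N th.
Proof.
move=> d0 hd dp; have c : cos d <= cos th.
  rewrite -(cos_norm th) leNgt ltr_cos ?in_itv/= ?normr_ge0 ?d0//=; first by rewrite -leNgt.
  exact: le_trans dp.
apply: lerXn2r; rewrite ?nnegrE; [have := cos_geN1 d; lra|have := cos_geN1 th; lra|lra].
Qed.

Lemma bump_mass_ge N d : 0 <= d -> d <= pi -> 2 * d * bump N d <= bump_mass N.
Proof.
move=> d0 dp; have cb a b := @ccon_bump N a b.
have pos a b : 0 <= complex.Re (cint a b (fun th => (bump N th)%:C)).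
  by apply: Re_cint_ge0 => x _ /=; exact: bump_ge0.
rewrite /bump_mass (@cint_cat _ _ (- d))//; last by apply/andP; split; lra.
rewrite (@cint_cat _ (- d) d pi)//; last by apply/andP; split; lra.
rewrite !cReD; have h1 := pos (- pi) (- d); have h2 := pos d pi.
suff : 2 * d * bump N d <= complex.Re (cint (- d) d (fun th => (bump N th)%:C)) by (clear -h1 h2; rlra).
have -> : 2 * d * bump N d = complex.Re (cint (- d) d (fun=> (bump N d)%:C)).
  rewrite cint_cst; last lra.
  by rewrite -rmorphM /=; ring.
apply: Re_cint_le => //; first by move=> x _; exact: cnt_cst.
by move=> x hx /=; apply: bump_mono => //; rewrite ler_norml.
Qed.

Lemma bump_mass_gt0 N : 0 < bump_mass N.
Proof.
have p0 := pi_gt0 R; apply: lt_le_trans (@bump_mass_ge N (pi / 4) _ _); [|lra|lra].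
rewrite mulr_gt0 ?mulr_gt0 ?divr_gt0// exprn_gt0// addr_gt0// cos_gt0_pihalf//.
by apply/andP; split; lra.
Qed.

Definition avg_kernel N th : R := bump N th / bump_mass N.

Lemma avg_kernel_ge0 N th : 0 <= avg_kernel N th.
Proof. by rewrite divr_ge0 ?bump_ge0// ltW// bump_mass_gt0. Qed.

Lemma ccon_avg_kernel N a b : ccon a b (fun th => (avg_kernel N th)%:C).
Proof.
have -> : (fun th => (avg_kernel N th)%:C) = (fun th => (bump_mass N)^-1%:C * (bump N th)%:C).
  by apply/funext => th; rewrite -rmorphM /avg_kernel mulrC.
apply: cconZ; exact: ccon_bump.
Qed.

Lemma cint_real a b (h : R -> R) : ccon a b (fun x => (h x)%:C) ->
  cint a b (fun x => (h x)%:C) = (complex.Re (cint a b (fun x => (h x)%:C)))%:C.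
Proof.
move=> ch; apply: complex_eqP => //=.
by rewrite (@eq_Rintegral _ _ _ _ _ (fun=> 0))// Rintegral_cst// mul0r.
Qed.

Lemma avg_kernel_mass N : cint (- pi) pi (fun th => (avg_kernel N th)%:C) = 1.
Proof.
have -> : (fun th => (avg_kernel N th)%:C) = (fun th => (bump_mass N)^-1%:C * (bump N th)%:C).
  by apply/funext => th; rewrite -rmorphM /avg_kernel mulrC.
rewrite cintZ; last exact: ccon_bump.
rewrite cint_real; last exact: ccon_bump.
by rewrite -rmorphM -/(bump_mass N) mulVf ?gt_eqF ?bump_mass_gt0.
Qed.

(* The kernel concentrates at 0: off [-d, d] it is at most [C r^N] with [r < 1]. *)
Lemma avg_kernel_tail d : 0 < d -> d <= pi -> exists C r : R, [/\ 0 <= C, 0 <= r < 1 &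
  forall N th, d <= `|th| <= pi -> avg_kernel N th <= C * r ^+ N].
Proof.
move=> d0 dp; have p0 := pi_gt0 R.
have cd : cos d < cos (d / 2).
  by rewrite ltr_cos ?in_itv/=; [lra|apply/andP; split; lra|apply/andP; split; lra].
have c1 := cos_geN1 d.
have den : 0 < 1 + cos (d / 2) by lra.
(* Off [-d, d] the bump is at most (1 + cos d)^N, while its mass is at least d (1 + cos (d / 2))^N,
   already carried by [-d / 2, d / 2]. *)
exists d^-1, ((1 + cos d) / (1 + cos (d / 2))); split.
- by rewrite invr_ge0 ltW.
- by rewrite divr_ge0 ?ltr_pdivrMr ?mul1r//=; lra.
move=> N th /andP[h1 h2].
have b1 : bump N th <= bump N d.
  rewrite /bump; apply: lerXn2r; rewrite ?nnegrE; [have := cos_geN1 th; lra|lra|].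
  rewrite lerD2l -(cos_norm th) leNgt ltr_cos ?in_itv/=; first by rewrite -leNgt.
  - by apply/andP; split; lra.
  - by apply/andP; split=> //; lra.
have b2 : d * bump N (d / 2) <= bump_mass N.
  by have := @bump_mass_ge N (d / 2) ltac:(rlra) ltac:(rlra); rewrite (_ : 2 * (d / 2) = d); [|field].
have b3 : 0 < d * bump N (d / 2) by rewrite mulr_gt0// exprn_gt0.
rewrite /avg_kernel ler_pdivrMr ?bump_mass_gt0//.
have r0 : 0 <= d^-1 * ((1 + cos d) / (1 + cos (d / 2))) ^+ N.
  by rewrite mulr_ge0 ?invr_ge0 ?(ltW d0)// exprn_ge0// divr_ge0 ?(ltW den)//; lra.
apply: (le_trans b1); apply: le_trans (ler_wpM2l r0 b2).
rewrite /bump expr_div_n le_eqVlt; apply/orP; left; apply/eqP.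
by field; rewrite expf_neq0 ?gt_eqF.
Qed.

Lemma avg_kernel_lim (g : R -> R[i]) : ccon (- pi) pi g -> forall e : R, 0 < e ->
  exists N0, forall N, (N0 <= N)%N ->
    normc (cint (- pi) pi (fun th => (avg_kernel N th)%:C * g th) - g 0) < e.
Proof.
move=> cg e e0; have p0 := pi_gt0 R.
have [B B0 HB] := ccon_bounded pp cg.
have in0 : - pi <= (0 : R) <= pi by apply/andP; split; lra.
have e4 : 0 < e / 4 by rewrite divr_gt0.
have [d' d'0 Hd'] := cg 0 in0 _ e4.
pose d := Num.min (d' / 2) pi.
have d0 : 0 < d by rewrite lt_min divr_gt0.
have [d1 d2] : d <= d' / 2 /\ d <= pi by rewrite !ge_min !lexx orbT.
have [C [r [C0 /andP[r0 r1] Hr]]] := avg_kernel_tail d0 d2.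
pose T := 2 * (2 * B * C * (2 * pi)).
have T0 : 0 <= T by rewrite /T !mulr_ge0// ltW.
have [N0 HN0] : exists N0, forall N, (N0 <= N)%N -> T * r ^+ N < e / 2.
  have : (fun n => r ^+ n) @ \oo --> (0 : R) by apply: cvg_expr; rewrite ger0_norm.
  move=> /cvgrPdist_lt/(_ (e / 2 / (T + 1))); rewrite !divr_gt0 ?ltr_wpDl// => /(_ isT).
  case=> N0 _ H; exists N0 => N /H; rewrite /= sub0r normrN ger0_norm ?exprn_ge0//.
  rewrite ltr_pdivlMr ?ltr_wpDl// => h.
  have : 0 <= r ^+ N by rewrite exprn_ge0.
  rlra.
exists N0 => N /HN0 hN.
have cK := @ccon_avg_kernel N (- pi) pi.
have cd : ccon (- pi) pi (fun th => g th - g 0) by apply: cconB => // x _; exact: cnt_cst.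
have -> : cint (- pi) pi (fun th => (avg_kernel N th)%:C * g th) - g 0 =
    cint (- pi) pi (fun th => (avg_kernel N th)%:C * (g th - g 0)).
  rewrite (@eq_cint _ _ _ (fun th => (avg_kernel N th)%:C * (g th - g 0))
    (fun th => (avg_kernel N th)%:C * g th - g 0 * (avg_kernel N th)%:C)); last by move=> x _; ring.
  by rewrite cintB ?cintZ ?avg_kernel_mass ?mulr1//; [exact: cconM|exact: cconZ].
(* A single majorant for two regimes: the oscillation of [g] near 0, weighted by a kernel of mass 1,
   and the tail bound elsewhere. *)
pose h th : R[i] := (e / 4)%:C * (avg_kernel N th)%:C + (2 * B * (C * r ^+ N))%:C.
have ch : ccon (- pi) pi h.
  by apply: cconD; [exact: cconZ|move=> x _; exact: cnt_cst].
have cKd : ccon (- pi) pi (fun th => (avg_kernel N th)%:C * (g th - g 0)) by exact: cconM.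
apply: (le_lt_trans (@cint_normc_le _ _ _ _ h cKd ch _)).
  move=> th hth; rewrite normcM normc_real ger0_norm ?avg_kernel_ge0//.
  rewrite /h -rmorphM -rmorphD /=.
  have k0 := avg_kernel_ge0 N th; have rN : 0 <= C * r ^+ N by rewrite mulr_ge0// exprn_ge0.
  have g2 : normc (g th - g 0) <= 2 * B.
    by have := le_normcB (g th) (g 0); have := HB _ hth; have := HB _ in0; rlra.
  have [hd|hd] := ltP `|th| d'.
    have : normc (g th - g 0) <= e / 4 by apply/ltW/Hd' => //; rewrite /dR subr0.
    move=> /(ler_wpM2l k0) k1; have : 0 <= 2 * B * (C * r ^+ N).
      by apply: mulr_ge0 => //; apply: mulr_ge0 => //; exact: ltW.

    clear -k1; rlra.
  have kt : avg_kernel N th <= C * r ^+ N.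
    by apply: Hr; rewrite ler_norml hth andbT; clear -d'0 d1 hd; rlra.
  have := ler_pM k0 (normc_ge0 (g th - g 0)) kt g2.
  have := mulr_ge0 (ltW e4) k0; clear; lra.
have cKe : ccon (- pi) pi (fun th => (e / 4)%:C * (avg_kernel N th)%:C) by exact: cconZ.
have cc : ccon (- pi) pi (fun _ : R => (2 * B * (C * r ^+ N))%:C : R[i]) by move=> x _; exact: cnt_cst.
rewrite /h cintD// cintZ// avg_kernel_mass cint_cst; last rlra.
rewrite mulr1 -rmorphM -rmorphD /=; rewrite /T in hN.
have -> : pi - - pi = 2 * pi :> R by ring.
rlra.
Qed.

(* [(1 + cos th)^N = 2^-N e^{-iN th} (1 + e^{i th})^{2N}]. *)
Lemma avg_kernel_trig N th : (avg_kernel N th)%:C =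
  \sum_(k < (N + N).+1) ((2 ^- N / bump_mass N) *+ 'C(N + N, k))%:C *
     cexp (- ((N%:Z - k%:Z)%:~R * (0 +i* th))).
Proof.
pose E : R[i] := cexp (0 +i* th).
have E0 : E != 0 := cexp_neq0 _.
have H : (1 + cos th)%:C = 2^-1 * (E^-1 * (1 + E) ^+ 2) :> R[i].
  have -> : E^-1 * (1 + E) ^+ 2 = 2 + (E + E^-1) by field.
  have -> : E + E^-1 = (2 * cos th)%:C.
    rewrite /E -cexpN; apply: complex_eqP; rewrite ?cReD ?cImD /= ?oppr0 ?expR0 ?cosN ?sinN; ring.
  by rewrite rmorphM rmorphD rmorph1 (rmorph_nat (real_complex R) 2); field.
have HN : (bump N th)%:C = (2^-1)^+ N * (E^-1 ^+ N * (1 + E) ^+ (N + N)).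
  have -> : (bump N th)%:C = (1 + cos th)%:C ^+ N by rewrite /bump rmorphXn.
  by rewrite H exprMn (exprMn N E^-1) -exprM mul2n addnn.
have c2 : ((2 ^- N : R)%:C) = (2^-1 : R[i]) ^+ N.
  by rewrite fmorphV rmorphXn (rmorph_nat (real_complex R) 2) exprVn.
have -> : (avg_kernel N th)%:C = (2 ^- N / bump_mass N)%:C * (E^-1 ^+ N * (1 + E) ^+ (N + N)).
  by rewrite /avg_kernel !rmorphM /= HN c2; ring.
rewrite (exprDn 1 E) !mulr_sumr; apply: eq_bigr => k _.
have -> : cexp (- ((N%:Z - k%:Z)%:~R * (0 +i* th))) = E^-1 ^+ N * E ^+ k.
  rewrite (_ : - _ = k%:R * (0 +i* th) - N%:R * (0 +i* th)); last first.
    by rewrite rmorphB /= -!pmulrn; ring.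
  by rewrite cexpB !cexpMn exprVn mulrC.
by rewrite expr1n mul1r rmorphMn /= !mulrnAr mulrnAl.
Qed.

End kernel.

(** * Averages over rotations *)

Section rotation_average.
Context {R : realType}.
Local Notation C2 := (R[i]^o * R[i]^o)%type.
Local Notation mR := (measurableTypeR R).
Local Notation mR2 := (mR * mR)%type.
Local Notation mR4 := (@mR4 R).
Local Notation leb := (@lebesgue_measure R).
Variables (mu : R).
Local Notation W := (@truncated_worm R mu).
Implicit Types (g : C2 -> R[i]^o) (th : R).

Definition rotation_average N g (z : C2) : R[i]^o :=
  cint (- pi) pi (fun th => (avg_kernel N th)%:C * g (rotate th z)).

Definition rot_R4 (p : mR4) (th : mR) : mR4 := (p.1, rot2 (cos th) (sin th) p.2).

Lemma toC2_rot p th : toC2 (rot_R4 p th) = rotate th (toC2 p).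
Proof.
case: p => p1 [x y]; rewrite /toC2 /rotate /rot_R4 /=; congr (_, _).
by apply: complex_eqP; rewrite ?cReM ?cImM /= expR0 ?mul1r; ring.
Qed.

Lemma rotateK th (z : C2) : rotate (- th) (rotate th z) = z.
Proof.
case: z => z1 z2; rewrite /rotate /=; congr (_, _).
rewrite mulrA -cexpD (_ : _ + _ = 0) ?cexp0 ?mul1r//.
by apply: complex_eqP; rewrite ?cReD ?cImD /= ?addr0 ?addNr.
Qed.

Lemma rotate_wormE th (z : C2) : W (rotate th z) <-> W z.
Proof. by split; [move=> /(rotate_worm (- th)); rewrite rotateK|exact: rotate_worm]. Qed.

Lemma measurable_rot_R4 : measurable_fun setT (fun q : mR4 * mR => rot_R4 q.1 q.2).
Proof.
have m2 : measurable_fun setT (fun q : mR4 * mR => q.2) by exact: measurable_snd.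
have m11 : measurable_fun setT (fun q : mR4 * mR => q.1.1).
  by apply: (measurableT_comp measurable_fst); exact: measurable_fst.
have m12 : measurable_fun setT (fun q : mR4 * mR => q.1.2).
  by apply: (measurableT_comp measurable_snd); exact: measurable_fst.
have mx : measurable_fun setT (fun q : mR4 * mR => q.1.2.1) by exact: (measurableT_comp measurable_fst m12).
have my : measurable_fun setT (fun q : mR4 * mR => q.1.2.2) by exact: (measurableT_comp measurable_snd m12).
have mc : measurable_fun setT (fun q : mR4 * mR => cos q.2 : mR).
  by apply: measurableT_comp m2; apply: continuous_measurable_fun; exact: continuous_cos.
have ms : measurable_fun setT (fun q : mR4 * mR => sin q.2 : mR).
  by apply: measurableT_comp m2; apply: continuous_measurable_fun; exact: continuous_sin.
apply: measurable_fun_pair => //; apply: measurable_fun_pair.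
  by apply: measurable_funB; apply: measurable_funM.
by apply: measurable_funD; apply: measurable_funM.
Qed.

Let kern N (th : mR) : \bar R := ((fun th => (avg_kernel N th)%:E) \_ `[(- pi)%R, pi%R]) th.

Let kern_ge0 N th : (0 <= kern N th)%E.
Proof. by rewrite /kern patchE; case: ifP => // _; rewrite lee_fin avg_kernel_ge0. Qed.

Let cont_avg N : {within `[- pi, pi : R], continuous (@avg_kernel R N)}.
Proof. exact: (ccon_Re (@ccon_avg_kernel R N (- pi) pi)). Qed.

Let measurable_kern N : measurable_fun setT (kern N).
Proof.
have mI : measurable (`[- pi, pi : R] : set mR) by exact: measurable_itv.
apply/(measurable_restrictT _ mI)/measurable_EFinP.
by apply: subspace_continuous_measurable_fun => //; exact: cont_avg.
Qed.

Let kern_mass N : (\int[leb]_th kern N th = 1)%E.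
Proof.
rewrite /kern -integral_mkcond.
have fi := within_integrable (@cont_avg N).
have E := avg_kernel_mass (R := R) N.
have : (\int[leb]_(th in `[- pi, pi]) avg_kernel N th)%R = 1 :> R.
  by have := congr1 (@complex.Re R) E.
rewrite /Rintegral => H; rewrite -[LHS]fineK; first by congr EFin.
by apply: integrable_fin_num => //.
Qed.

(** Jensen's inequality bounds |average|^2 pointwise by the average of the rotated |g|^2. Tonelli's
    theorem then exchanges the integrals, and each rotation of z_2 preserves both the domain and
    Lebesgue measure. *)
Lemma N2_rotation_average N g : cmeas W g -> cmeas W (rotation_average N g) ->
  (forall z, W z -> ccon (- pi) pi (fun th => g (rotate th z))) ->
  (N2 W (rotation_average N g) <= N2 W g)%E.
Proof.
move=> mg ms cg; have oW := @dopen_worm R mu; have mE := measurable_toC2 oW.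
pose phi : mR4 -> \bar R := (fun p : mR4 => (normc (g (toC2 p)) ^+ 2)%:E) \_ (toC2 @^-1` W).
have mphi : measurable_fun setT phi by apply/(measurable_restrictT _ mE); exact: cmeas_normc2.
have phi0 p : (0 <= phi p)%E by rewrite /phi patchE; case: ifP => // _; rewrite lee_fin sqr_ge0.
have N2E : N2 W g = (\int[lebesgueC2]_p phi p)%E by rewrite /phi -integral_mkcond.
pose h (q : mR4 * mR) : \bar R := (kern N q.2 * phi (rot_R4 q.1 q.2))%E.
have mh : measurable_fun setT h.
  apply: emeasurable_funM; first exact: (measurableT_comp (@measurable_kern N) measurable_snd).
  exact: (measurableT_comp mphi measurable_rot_R4).
have h0 q : (0 <= h q)%E by rewrite /h mule_ge0.
pose Psi (p : mR4) : \bar R := (\int[leb]_th h (p, th))%E.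
have mPsi : measurable_fun setT Psi.
  exact: (@measurable_fun_fubini_tonelli_F _ _ _ _ R leb h mh h0).
have Psi0 p : (0 <= Psi p)%E by exact: integral_ge0.
have bound p : (toC2 @^-1` W) p -> ((normc (rotation_average N g (toC2 p)) ^+ 2)%:E <= Psi p)%E.
  move=> Ep; have cgp := cg _ Ep; have cK := @ccon_avg_kernel R N (- pi) pi.
  have J := cint_jensen cK (fun th _ => avg_kernel_ge0 N th) (avg_kernel_mass N) cgp.
  have cn : ccon (- pi) pi (fun th => (avg_kernel N th * normc (g (rotate th (toC2 p))) ^+ 2)%:C).
    have -> : (fun th => (avg_kernel N th * normc (g (rotate th (toC2 p))) ^+ 2)%:C) =
      (fun th => (avg_kernel N th)%:C * (normc (g (rotate th (toC2 p))))%:C ^+ 2).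
      by apply/funext => th; rewrite rmorphM rmorphXn.
    apply: cconM => // th hth; apply: cntX; exact: (ccon_normcC cgp).
  have [fi _] := ccon_integrable cn.
  apply: (@le_trans _ _ (complex.Re (cint (- pi) pi (fun th => (avg_kernel N th * normc (g (rotate th (toC2 p))) ^+ 2)%:C)))%:E).
    by rewrite lee_fin.
  rewrite /cint /= /Rintegral fineK; last by apply: integrable_fin_num => //.
  rewrite /Psi integral_mkcond le_eqVlt; apply/orP; left; apply/eqP.
  apply: eq_integral => th _; rewrite /h /kern /= !patchE; case: ifP => _; last by rewrite mul0e.
  rewrite /phi patchE ifT; first by rewrite toC2_rot -EFinM.
  by rewrite inE /= toC2_rot; exact/rotate_wormE.
apply: (@le_trans _ _ (\int[lebesgueC2]_(p in toC2 @^-1` W) Psi p)%E).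
  by apply: (N2_le oW ms) => //; exact: measurable_funS mPsi.
apply: (@le_trans _ _ (\int[lebesgueC2]_p Psi p)%E); first exact: ge0_subset_integral.
rewrite N2E le_eqVlt; apply/orP; left; apply/eqP.
rewrite (@fubini_tonelli1 _ _ _ _ _ (@lebesgue2 R) (@lebesgue2 R) Psi mPsi Psi0).
rewrite (@fubini_tonelli1 _ _ _ _ _ (@lebesgue2 R) (@lebesgue2 R) phi mphi phi0).
apply: eq_integral => p1 _; rewrite /fubini_F.
pose h1 (q : mR2 * mR) : \bar R := h ((p1, q.1), q.2).
have mpair : measurable_fun setT (fun q : mR2 * mR => ((p1, q.1), q.2) : mR4 * mR).
  apply: measurable_fun_pair; last exact: measurable_snd.
  by apply: measurable_fun_pair; [exact: measurable_cst|exact: measurable_fst].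
have mh1 : measurable_fun setT h1 by exact: (measurableT_comp mh mpair).
have h10 q : (0 <= h1 q)%E by exact: h0.
have := @fubini_tonelli _ _ _ _ R (@lebesgue2 R) leb h1 mh1 h10.
rewrite -[X in X = _ -> _]/(\int[lebesgue2]_p2 Psi (p1, p2))%E => ->.
have mphi1 : measurable_fun setT (fun p2 : mR2 => phi (p1, p2)) by exact: measurable_fun_pair2.
pose c : \bar R := (\int[lebesgue2]_p2 phi (p1, p2))%E.
rewrite -[RHS]/c; transitivity (\int[leb]_th (kern N th * c))%E; last first.
  by rewrite ge0_integralZr ?kern_mass ?mul1e// integral_ge0.
apply: eq_integral => th _; rewrite /h1 /h /=.
rewrite ge0_integralZl//; last first.
  by apply: (measurableT_comp mphi1); exact: measurable_rot2.
congr (_ * _)%E; rewrite /c.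
apply: (@ge0_integral_rot2 R (cos th) (sin th) (fun p2 => phi (p1, p2))) => //.
exact: cos2Dsin2.
Qed.

End rotation_average.

(** * Completeness *)

Lemma ccon_sum (R : realType) (a b : R) n (F : 'I_n -> R -> R[i]) :
  (forall k, ccon a b (F k)) -> ccon a b (fun x => \sum_(k < n) F k x).
Proof.
elim: n F => [|n IH] F cF.
  by rewrite (_ : (fun x => _) = fun=> 0); [move=> x _; exact: cnt_cst|apply/funext => x; rewrite big_ord0].
rewrite (_ : (fun x => _) = fun x => \sum_(k < n) F (widen_ord (leqnSn n) k) x + F ord_max x).
  by apply: cconD => //; exact: IH.
by apply/funext => x; rewrite big_ord_recr.
Qed.

Lemma cint_sum (R : realType) (a b : R) n (F : 'I_n -> R -> R[i]) : a <= b ->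
  (forall k, ccon a b (F k)) ->
  cint a b (fun x => \sum_(k < n) F k x) = \sum_(k < n) cint a b (F k).
Proof.
move=> ab; elim: n F => [|n IH] F cF.
  rewrite big_ord0 (@eq_cint _ _ _ _ (fun=> 0)); last by move=> x _; rewrite big_ord0.
  by rewrite cint_cst// mul0r.
rewrite (@eq_cint _ _ _ _ (fun x => \sum_(k < n) F (widen_ord (leqnSn n) k) x + F ord_max x)); last first.
  by move=> x _; rewrite big_ord_recr.
rewrite cintD//; last by apply: ccon_sum.
by rewrite IH// big_ord_recr.
Qed.

Section completeness.
Context {R : realType}.
Local Notation C2 := (R[i]^o * R[i]^o)%type.
Variables (mu c0 : R) (f : C2 -> R[i]^o).
Hypotheses (hmu : pi / 2 < mu) (hc0 : -1 < c0) (hf : bergman (truncated_worm mu) f).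
Local Notation W := (@truncated_worm R mu).
Local Notation S := (worm_system mu c0).
Implicit Types (z : C2) (t e : R) (j : int) (k : nat).

Let oW : dopen W := @dopen_worm R mu.
Let mS := @worm_system_cmeas R mu c0 hmu hc0.
Let mu0 : 0 < mu. Proof. by apply: lt_trans hmu; rewrite divr_gt0// pi_gt0. Qed.

Lemma bergman_N2_lty : (N2 W f < +oo)%E.
Proof.
case: hf => _ /integrableP[_]; rewrite /N2; under eq_integral do rewrite gee0_abs ?lee_fin ?sqr_ge0//.
by [].
Qed.

Lemma dilate_cnt t z : 0 <= t -> W z -> cnt dC2 W (fun y => f (dilate t y)) z.
Proof.
case: hf => hol _ t0 zW e e0.
have [d d0 H] := differentiable_cnt (hol _ (dilate_worm t0 zW)) e0.
exists d => // y _ /dC2_lt[h1 h2]; apply: H => //; apply/dC2_lt; split => //=.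
rewrite -mulrBr normcM normc_cexp /=; apply: le_lt_trans h1.
rewrite ler_piMl ?normc_ge0// -[leRHS]expR0 ler_expR; lra.
Qed.

Lemma cmeas_dilate t : 0 <= t -> cmeas W (fun y => f (dilate t y)).
Proof. by move=> t0; apply: (cnt_cmeas oW) => z; exact: dilate_cnt. Qed.

(** The dilation maps the domain into itself and multiplies the area in z_1 by e^{-4 t}. That the
    constant e^{4 t} tends to 1 as t -> 0 is the point: [L2_fatou] relies on it. *)
Lemma N2_dilate t : 0 <= t -> (N2 W (fun y => f (dilate t y) : R[i]^o) <= (expR (4 * t))%:E * N2 W f)%E.
Proof.
move=> t0; have mE := measurable_toC2 oW; set E := toC2 @^-1` W in mE.
pose kk : R := expR (- (2 * t)); have k0 : 0 < kk by exact: expR_gt0.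
have cf : cmeas W f by case: hf => /(holomorphic_cmeas oW).
pose h : mR4 -> \bar R := (fun p : mR4 => (normc (f (toC2 p)) ^+ 2)%:E) \_ E.
have mh : measurable_fun setT h by apply/(measurable_restrictT _ mE); exact: cmeas_normc2.
have h0 p : (0 <= h p)%E by rewrite /h patchE; case: ifP => // _; rewrite lee_fin sqr_ge0.
have H := ge0_integral_C2_scale k0 mh h0.
rewrite -integral_mkcond -/(N2 W f) in H.
have dE (p : mR4) : toC2 ((kk * p.1.1, kk * p.1.2), p.2) = dilate t (toC2 p).
  case: p => [[x y] p2]; rewrite /toC2 /dilate /=; congr (_, _).
  by apply: complex_eqP; rewrite ?cReM ?cImM /= ?oppr0 ?cos0 ?sin0 /kk; ring.
pose hk (p : mR4) := h ((kk * p.1.1, kk * p.1.2), p.2).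
have mk : measurable_fun setT hk.
  apply: (measurableT_comp mh); apply: measurable_fun_pair => //.
  by apply: measurable_fun_pair; apply: measurable_funM => //; apply: measurableT_comp.
have le1 : (N2 W (fun y => f (dilate t y) : R[i]^o) <= \int[lebesgueC2]_p hk p)%E.
  apply: (@le_trans _ _ (\int[lebesgueC2]_(p in E) hk p)%E).
    apply: (N2_le oW); [exact: cmeas_dilate|exact: measurable_funS mk|].
    move=> p pE; rewrite /hk /h patchE ifT; first by rewrite dE.
    by rewrite inE /E /= dE; exact: dilate_worm.
  by apply: ge0_subset_integral; [exact: mE|exact: measurableT|exact: mk|move=> p _; exact: h0|].
rewrite H muleA -EFinM (_ : expR _ * _ = 1) ?mul1e//.
by rewrite /kk -expRM_natl -expRD (_ : _ + _ = 0) ?expR0//; ring.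
Qed.

Lemma N2_dilate_lty t : 0 <= t -> (N2 W (fun y => f (dilate t y) : R[i]^o) < +oo)%E.
Proof.
move=> t0; apply: (le_lt_trans (N2_dilate t0)); have := bergman_N2_lty; have := N2_ge0 W f.
by case: (N2 W f) => //= r _ _; rewrite -EFinM ltry.
Qed.

Lemma cmeas_damped t e k : 0 <= t -> 0 < e -> cmeas W (damped mu f t e k).
Proof.
move=> t0 e0; apply: cmeasM; first exact: cmeas_dilate.
apply: (@eq_cmeas _ _ (fun z => damp mu e (worm_L z) ^+ k * z.2 ^ (0 : int))).
  by move=> z _; rewrite expr0z mulr1.
apply: (holomorphic_cmeas oW); apply: (@worm_holomorphic R mu (fun w => damp mu e w ^+ k) 0) => w /Om_Im iw.
by have [a da] := cder_damp mu0 e0 iw; have [b db] := derX k da; exists b.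
Qed.

Lemma normc_damped_le t e k z : 0 < e -> W z -> normc (damped mu f t e k z) <= normc (f (dilate t z)).
Proof.
move=> e0 /worm_Im_L iw; rewrite normcM normcX ler_piMr ?normc_ge0//.
by rewrite exprn_ile1 ?normc_ge0// damp_le1.
Qed.

Lemma N2_damped_lty t e k : 0 <= t -> 0 < e -> (N2 W (damped mu f t e k) < +oo)%E.
Proof.
move=> t0 e0; apply: (@le_lt_trans _ _ (N2 W (fun y => f (dilate t y) : R[i]^o))%E).
  apply: (N2_le oW); first exact: cmeas_damped.
    exact: (cmeas_normc2 (cmeas_dilate t0)).
  move=> p pW; rewrite lee_fin; apply: lerXn2r; rewrite ?nnegrE ?normc_ge0//.
  exact: normc_damped_le.
exact: N2_dilate_lty.
Qed.

(** Along an orbit of the rotations [worm_L] is constant, so the function is a multiple of the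
    section with j = 0 along a vertical segment. *)
Lemma ccon_damped_rotate t e k z : 0 <= t -> W z ->
  ccon (- pi) pi (fun th => damped mu f t e k (rotate th z)).
Proof.
move=> t0 zW; have [z2 _ hs] := zW.
pose a := clog z.2; have ca : cexp a = z.2 by exact: cexp_clog.
have aE : 2 * complex.Re a = log_sqnorm z.2 by rewrite log_sqnorm_clog.
set w := worm_L z + (- (2 * t))%:C.
have adw : adm 0 w (log_sqnorm z.2) by exact: (adm_worm_L t0 zW).
have wW : W (cexp w, cexp a) by apply: adm_worm_cexp; rewrite aE.
have -> : (fun th => damped mu f t e k (rotate th z)) =
    (fun th => damp mu e (worm_L z) ^+ k * log_section f 0 w (a + (0 +i* th))).
  apply/funext => th; rewrite /damped worm_L_rotate// (@dilateE _ mu); last exact: rotate_worm.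
  rewrite worm_L_rotate// -/w /log_section [(rotate th z).2]/= [cexp (a + _)]cexpD ca.
  by rewrite mul0r oppr0 cexp0 mulr1 mulrC [z.2 * _]mulrC.
by apply: cconZ; exact: (log_section_ccon hf 0 wW).
Qed.

Lemma ccon_cexp_mul j a b : @ccon R a b (fun th => cexp (- (j%:~R * (0 +i* th)))).
Proof.
apply: ccon_ex => th _; eexists.
apply: (@der_comp _ _ _ cexp (fun y => - (j%:~R * (0 +i* y))) th _ _ _ (cder_cexp _)).
apply: derN; apply: derZ; have d := cint_vertical_der (0 : R[i]) th.
have E : (fun y : R => 0 + (0 +i* y)) = (fun y : R => 0 +i* y) :> (R -> R[i]).
  by apply/funext => y; rewrite add0r.
by rewrite E in d; exact: d.
Qed.

(** The kernel being a trigonometric polynomial, the average is a finite combination of modes. *)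
Lemma approximable_rotation_average t e k N : 0 < t -> 0 < e ->
  c0 + 10 <= k%:R * damp_rate mu -> approximable W S (rotation_average N (damped mu f t e k)).
Proof.
move=> t0 e0 hk; set g := damped mu f t e k.
pose c (m : 'I_(N + N).+1) : R[i] := ((2 ^- N / bump_mass N) *+ 'C(N + N, m))%:C.
apply: (@eq_approximable _ _ _ (\sum_(m < (N + N).+1) c m *: mode g (N%:Z - m%:Z))); last first.
  apply: (approximable_sum oW mS) => m; apply: (approximableZ oW mS).
  exact: (approximable_mode hmu hc0 hf).
move=> z zW; have cg := @ccon_damped_rotate t e k z (ltW t0) zW; rewrite -/g in cg.
have cm j : ccon (- pi) pi (fun th => g (rotate th z) * cexp (- (j%:~R * (0 +i* th)))).
  by apply: cconM => //; exact: ccon_cexp_mul.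
rewrite /rotation_average.
rewrite (@eq_cint _ _ _ _ (fun th => \sum_(m < (N + N).+1)
    c m * (g (rotate th z) * cexp (- ((N%:Z - m%:Z)%:~R * (0 +i* th)))))); last first.
  by move=> th _; rewrite avg_kernel_trig mulr_suml; apply: eq_bigr => m _; rewrite -/(c m); ring.
rewrite cint_sum; [|by rewrite ge0_cp// pi_ge0|by move=> m; exact: cconZ].
rewrite fct_sumE; apply: eq_bigr => m _.
by rewrite cintZ.
Qed.

(** The averages converge pointwise and do not increase the norm, so [L2_fatou] applies with
    constant 1. *)
Lemma approximable_damped t e k : 0 < t -> 0 < e -> c0 + 10 <= k%:R * damp_rate mu ->
  approximable W S (damped mu f t e k).
Proof.
move=> t0 e0 hk; set g := damped mu f t e k.
have ag N := @approximable_rotation_average t e k N t0 e0 hk; rewrite -/g in ag.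
have mg : cmeas W g by apply: cmeas_damped => //; exact: ltW.
apply: (approximable_lim oW mS mg) => d d0.
have [N HN] : exists N, (N2 W (g - rotation_average N g)%R < d%:E)%E.
  apply: (@L2_fatou _ _ oW (fun N => rotation_average N g) g (fun=> 1) _ mg _ _ _ _ _ d d0).
  - by move=> N; case: (ag N).
  - move=> z zW r r0.
    have [N0 HN] := avg_kernel_lim (@ccon_damped_rotate t e k z (ltW t0) zW) r0.
    exists N0 => N /HN; rewrite -/g (_ : rotate 0 z = z)//.
    by case: (z) => z1 z2; rewrite /rotate cexp0 mul1r.
  - by apply: N2_damped_lty => //; exact: ltW.
  - by move=> _; exact: ler01.
  - exact: cvg_cst.
  move=> N; rewrite mul1e; apply: (N2_rotation_average mg); first by case: (ag N).
  by move=> z zW; apply: ccon_damped_rotate => //; exact: ltW.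
by exists (rotation_average N g).
Qed.

Lemma damp_rate_gt0 : 0 < damp_rate mu.
Proof. by rewrite /damp_rate divr_gt0 ?pi_gt0// mulr_gt0// addr_gt0// divr_gt0// pi_gt0. Qed.

(** The power k is fixed once for all by c0 and mu; only e tends to 0. Since the damping factor is
    at most 1 in modulus, the dilated function itself is the majorant. *)
Lemma approximable_dilate t : 0 < t -> approximable W S (fun z => f (dilate t z)).
Proof.
move=> t0; have t0' := ltW t0.
pose k := Num.bound ((c0 + 10) / damp_rate mu).
have hk : c0 + 10 <= k%:R * damp_rate mu.
  rewrite -ler_pdivrMr ?damp_rate_gt0// ltW// archi_boundP// divr_ge0 ?ltW ?damp_rate_gt0//.
  have := hc0; lra.
have e0 n : 0 < n.+1%:R^-1 :> R by rewrite invr_gt0.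
have mF : cmeas W (fun z => f (dilate t z)) by exact: cmeas_dilate.
apply: (approximable_lim oW mS mF) => d d0.
have [|||||n Hn] := @L2_dominated _ _ oW (fun n => damped mu f t n.+1%:R^-1 k)
  (fun z => f (dilate t z)) (fun p => normc (f (dilate t (toC2 p))) ^+ 2) _ _ _ _ _ d d0.
- by move=> n; exact: cmeas_damped.
- exact: mF.
- move=> z zW r r0; have iw := worm_Im_L zW.
  have K0 : 0 < normc (f (dilate t z)) + 1 by have := normc_ge0 (f (dilate t z)); lra.
  have [N HN] := damp_lim k iw (divr_gt0 r0 K0).
  exists N => n /HN; rewrite ltr_pdivlMr// => h.
  rewrite /damped -{2}[f (dilate t z)]mulr1 -mulrBr normcM.
  apply: le_lt_trans h; rewrite mulrC ler_wpM2l ?normc_ge0//; lra.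
- exact: (N2_square_integrable mF (N2_dilate_lty t0')).
- move=> n p pW; apply: lerXn2r; rewrite ?nnegrE ?normc_ge0//; exact: normc_damped_le.
by exists (damped mu f t n.+1%:R^-1 k); [exact: approximable_damped|exact: Hn].
Qed.

(** As t -> 0 the dilated functions converge pointwise by continuity of [f], and their squared norms
    exceed that of [f] by a factor at most e^{4 t}, so [L2_fatou] turns this into convergence in
    L^2. *)
Lemma approximable_bergman : approximable W S f.
Proof.
have t0 n : 0 < n.+1%:R^-1 :> R by rewrite invr_gt0.
have mf : cmeas W f by case: hf => /(holomorphic_cmeas oW).
apply: (approximable_lim oW mS mf) => d d0.
have [||||||n Hn] := @L2_fatou _ _ oW (fun n z => f (dilate n.+1%:R^-1 z)) f
  (fun n => expR (4 * n.+1%:R^-1)) _ mf _ _ _ _ _ d d0.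
- by move=> n; apply: cmeas_dilate; exact: ltW.
- move=> z zW r r0; case: hf => hol _.
  have [q q0 Hq] := differentiable_cnt (hol _ zW) r0.
  have cc : cnt (@dR R) setT (fun t : R => cexp (- 2 * t%:C) * z.1) 0.
    apply: cntM; last exact: cnt_cst.
    have := der_cnt (@der_comp _ _ _ cexp (fun t : R => - 2 * t%:C) 0 _ _
      (derZ (- 2) (rder_id 0)) (cder_cexp _)).
    by rewrite dio_real.
  have [s s0 Hs] := cc _ q0.
  exists (Num.bound s^-1) => n Nn; apply: Hq => //; apply/dC2_lt.
  have ns : dR n.+1%:R^-1 (0 : R) < s.
    rewrite /dR subr0 gtr0_norm ?invr_gt0// invf_plt ?posrE//.
    apply: (lt_le_trans (archi_boundP _)); first by rewrite invr_ge0 ltW.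
    by rewrite ler_nat (leq_trans Nn).
  have := Hs _ I ns; rewrite mulr0 cexp0 mul1r /= subrr normc0 => h; split => //.
  suff -> : (- (2 * n.+1%:R^-1))%:C = - 2 * (n.+1%:R^-1)%:C :> R[i] by [].
  by rewrite rmorphN rmorphM (rmorph_nat (real_complex R) 2) mulNr.
- exact: bergman_N2_lty.
- by move=> n; exact: expR_ge0.
- have C : (fun n => 4 * n.+1%:R^-1 : R) @ \oo --> (0 : R).
    by rewrite -[X in _ --> X](mulr0 4); apply: cvgM; [exact: cvg_cst|exact: cvg_harmonic].
  by rewrite -[X in _ --> X]expR0; exact: (continuous_cvg _ (@continuous_expR R 0) C).
- by move=> n; apply: N2_dilate; exact: ltW.
by exists (fun z => f (dilate n.+1%:R^-1 z)); [exact: approximable_dilate|exact: Hn].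
Qed.

Lemma L2norm_lt (g : C2 -> R[i]^o) (r : R) : 0 < r -> cmeas W g -> (N2 W g < (r ^+ 2)%:E)%E ->
  L2norm W g < r.
Proof.
move=> r0 mg h; rewrite /L2norm.
have E : complex.Re (L2inner W g g) = fine (N2 W g).
  rewrite /L2inner /= /N2 /Rintegral; congr fine; apply: eq_integral => p _; congr EFin.
  by rewrite conjcM_normc.
have N0 := N2_ge0 W g.
rewrite E -[ltRHS](gtr0_norm r0) -sqrtr_sqr ltr_sqrt ?exprn_gt0//.
by rewrite -lte_fin fineK// ge0_fin_numE// (lt_trans h) ?ltry.
Qed.

End completeness.

Theorem theorem3p1 (R : realType) (mu c0 nu : R)
    (hmu : pi / 2 < mu) (hc0 : -1 < c0) (hnu : nu = pi / (2 * mu)) :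
  complete_in_bergman (truncated_worm mu)
    [set f : R[i]^o * R[i]^o -> R[i]^o |
      exists (l : nat) (j : int), f = worm_H c0 nu l j].
Proof.
subst nu; split; first exact: (worm_system_bergman hmu hc0).
move=> f hf eps e0.
have [mf af] := approximable_bergman hmu hc0 hf.
have [g Sg fg] := af _ (exprn_gt0 2 e0); exists g => //.
apply: (L2norm_lt e0 _ fg); apply: (cmeasB mf).
exact: (lin_span_cmeas (worm_system_cmeas hmu hc0)).
Qed.
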